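(* Let $H$ be a generalised Hénon map. Then for every $c>0$, every holomorphic automorphism of $\Omega_c$ is the restriction to $\Omega_c$ of an affine map of $\mathbb{C}^2$ that preserves the escaping set $U^+$ of $H$ (equivalently, the non-escaping set $K^+$), and ${\rm Aut}(\Omega_c)$ is a finite cyclic group of order at most $d_0(d-1)$.
   Context: A generalised Hénon map is $H=H_m\circ\cdots\circ H_1$, $m\ge1$, with $H_i(x,y)=(y,p_i(y)-a_ix)$, $p_i$ a complex polynomial in one variable of degree $d_i\ge2$ and $a_i\ne0$. Put $d=d_m\cdots d_1$ and $d'=d_{m-1}\cdots d_1$ ($d'=1$ if $m=1$). $K^{+}=\{z\in\mathbb{C}^2:(H^{n}(z))_{n\ge0}\text{ is bounded}\}$, $U^+=\mathbb{C}^2\setminus K^+$, $G_H^+(z)=\lim_{n\to\infty}d^{-n}\log^+\|H^n(z)\|$, $\Omega_c=\{z\in\mathbb{C}^2:G_H^+(z)<c\}$, and ${\rm Aut}(\Omega_c)$ is its group of holomorphic automorphisms. If $\mathbf{p}_1,\dots,\mathbf{p}_l$ are the distinct primes dividing $d$, then $d_0$ is the smallest positive integer of the form $(d+d')\,\mathbf{p}_1^{-n_1}\cdots\mathbf{p}_l^{-n_l}$ with integers $n_i\ge0$. *)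

(* Defs.v *)
From HB Require Import structures.
From mathcomp Require Import all_boot all_order all_algebra.
From mathcomp Require Import all_classical all_reals all_analysis.
From mathcomp.real_closed Require Export complex.

Set Implicit Arguments.
Unset Strict Implicit.
Unset Printing Implicit Defensive.

Import Order.TTheory GRing.Theory Num.Theory.
Import numFieldNormedType.Exports.

Local Open Scope classical_set_scope.
Local Open Scope complex_scope.
Local Open Scope ring_scope.

(* C^2 as a normed space over C (with the max norm): R[i] is only a field, the
   normed space over itself is R[i]^o. *)
Notation C2 R := (R[i]^o * R[i]^o)%type.

Section Henon.
Context {R : realType}.
Implicit Types (p : nat -> {poly R[i]}) (a : nat -> R[i]) (z : C2 R).

Definition henon (q : {poly R[i]}) (b : R[i]) z : C2 R :=
  (z.2, q.[z.2] - b * z.1).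

(* H_m \o ... \o H_1; only the indices 1, ..., m are used. *)
Fixpoint gen_henon p a (m : nat) : C2 R -> C2 R :=
  if m is k.+1 then henon (p m) (a m) \o gen_henon p a k else id.

(* The product d_m * ... * d_1; at m.-1 it is d', equal to 1 when m = 1. *)
Definition henon_degree p (m : nat) : nat :=
  \prod_(1 <= i < m.+1) (size (p i)).-1.

(* The library norm takes its (nonnegative real) values in R[i]. *)
Definition rnorm z : R := complex.Re `|z|.

(* log^+; note that logp 0 = 0 since ln 0 = 0 in the library. *)
Definition logp (x : R) : R := Num.max 0 (ln x).

Definition nonescaping (H : C2 R -> C2 R) : set (C2 R) :=
  [set z | bounded_fun (fun n : nat => iter n H z)].

Definition escaping (H : C2 R -> C2 R) : set (C2 R) := ~` nonescaping H.

Definition green (H : C2 R -> C2 R) (d : nat) z : R :=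
  limn (fun n : nat => d%:R ^- n * logp (rnorm (iter n H z))).

Definition sublevel (H : C2 R -> C2 R) (d : nat) (c : R) : set (C2 R) :=
  [set z | green H d z < c].

Definition is_affine (A : C2 R -> C2 R) : Prop :=
  exists (L : {linear C2 R -> C2 R}) (b : C2 R), forall z, A z = L z + b.

End Henon.

Section D0.
Local Open Scope nat_scope.

Definition d0_form (d d' k : nat) : Prop :=
  exists n : nat -> nat,
    (k%:R = (d + d')%:R / \prod_(q <- primes d) q%:R ^+ n q :> rat)%R.

Definition is_d0 (d d' k : nat) : Prop :=
  [/\ 0 < k, d0_form d d' k &
      forall j, 0 < j -> d0_form d d' j -> k <= j].

Definition d0 (d d' : nat) : nat := xget 0 [set k | is_d0 d d' k].

Lemma d0P (d d' : nat) : 0 < d + d' -> is_d0 d d' (d0 d d').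
Proof.
move=> dd'_gt0.
have ex : exists k, (0 < k) && `[< d0_form d d' k >].
  exists (d + d'); rewrite dd'_gt0; apply/asboolP; exists (fun=> 0).
  by rewrite big1 ?divr1// => q _; rewrite expr0.
case: (ex_minnP ex) => k /andP[k_gt0 /asboolP kf] kmin.
rewrite /d0; case: xgetP => [_ _ //|/(_ k)] [].
by split=> // j j_gt0 jf; apply: kmin; rewrite j_gt0; apply/asboolP.
Qed.

End D0.

(* Holomorphic automorphisms of a domain W of C^2.  A self-map of (the subtype
   of points of) W is holomorphic when some extension of it to C^2 is
   C-differentiable at all points of W; for open W the choice of the extension
   does not matter. *)
Section HolomorphicAutomorphisms.
Context {R : realType}.
Variable W : set (C2 R).

Definition holomorphic (f : W -> W) : Prop :=
  exists g : C2 R -> C2 R, (forall w : W, g (val w) = val (f w)) /\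
    (forall z : C2 R, W z -> differentiable g z).

Definition is_holo_aut (f : W -> W) : Prop :=
  holomorphic f /\
  exists h : W -> W, [/\ cancel f h, cancel h f & holomorphic h].

Record holo_aut := HoloAut {
  aut_map :> W -> W;
  aut_mapP : is_holo_aut aut_map }.

Lemma holo_autE (f g : holo_aut) : aut_map f =1 aut_map g -> f = g.
Proof.
case: f g => f fP [g gP] /= /funext fg; case: _ / fg gP => gP.
by congr HoloAut; exact: Prop_irrelevance.
Qed.

Lemma holomorphic_id : holomorphic id.
Proof. by exists id; split. Qed.

Lemma holomorphic_comp (f g : W -> W) :
  holomorphic f -> holomorphic g -> holomorphic (f \o g).
Proof.
move=> [f' [f'E f'd]] [g' [g'E g'd]]; exists (f' \o g'); split.
  by move=> w /=; rewrite g'E f'E.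
move=> z Wz; apply: differentiable_comp; first exact: g'd.
apply: f'd; have := g'E (SigSub (mem_set Wz)).
by rewrite /= => ->; exact: set_valP.
Qed.

Lemma is_holo_aut_id : is_holo_aut id.
Proof.
by split; [exact: holomorphic_id|exists id; split=> //; exact: holomorphic_id].
Qed.

Lemma is_holo_aut_comp (f g : W -> W) :
  is_holo_aut f -> is_holo_aut g -> is_holo_aut (f \o g).
Proof.
move=> [fh [f' [ff' f'f f'h]]] [gh [g' [gg' g'g g'h]]].
split; first exact: holomorphic_comp.
by exists (g' \o f'); split;
  [exact: can_comp|exact: can_comp|exact: holomorphic_comp].
Qed.

Definition aut_invmap (f : holo_aut) : W -> W := sval (cid (aut_mapP f).2).

Lemma is_holo_aut_inv (f : holo_aut) : is_holo_aut (aut_invmap f).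
Proof.
rewrite /aut_invmap; case: cid => h /= [fh hf hh].
by split=> //; exists f; split=> //; case: (aut_mapP f).
Qed.

Definition aut_one : holo_aut := HoloAut is_holo_aut_id.
Definition aut_mul (f g : holo_aut) : holo_aut :=
  HoloAut (is_holo_aut_comp (aut_mapP f) (aut_mapP g)).
Definition aut_inv (f : holo_aut) : holo_aut := HoloAut (is_holo_aut_inv f).

Lemma aut_mulA : associative aut_mul.
Proof. by move=> f g h; exact: holo_autE. Qed.

Lemma aut_mul1 : left_id aut_one aut_mul.
Proof. by move=> f; exact: holo_autE. Qed.

Lemma aut_mulr1 : right_id aut_one aut_mul.
Proof. by move=> f; exact: holo_autE. Qed.

Lemma aut_mulV : left_inverse aut_one aut_inv aut_mul.
Proof.
move=> f; apply: holo_autE => w /=.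
by rewrite /aut_invmap; case: cid => h /= [fh _ _]; rewrite fh.
Qed.

Lemma aut_mulrV : right_inverse aut_one aut_inv aut_mul.
Proof.
move=> f; apply: holo_autE => w /=.
by rewrite /aut_invmap; case: cid => h /= [_ hf _]; rewrite hf.
Qed.

HB.instance Definition _ := gen_eqMixin holo_aut.
HB.instance Definition _ := gen_choiceMixin holo_aut.
HB.instance Definition _ := isGroup.Build holo_aut
  aut_mulA aut_mul1 aut_mulr1 aut_mulV aut_mulrV.

End HolomorphicAutomorphisms.

Definition is_cyclic (G : groupType) : Prop :=
  exists g : G, forall x : G, exists n : nat, (x = g ^+ n \/ x = g ^- n)%g.

(* Main.v *)
Require Import Defs.
From HB Require Import structures.
From mathcomp Require Import all_boot all_order all_algebra.
From mathcomp Require Import finmap cyclic.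
From mathcomp Require Import all_classical all_reals all_analysis.
From mathcomp.real_closed Require Import complex.
From mathcomp Require Import ring lra zify.

Set Implicit Arguments.
Unset Strict Implicit.
Unset Printing Implicit Defensive.

Import Order.TTheory GRing.Theory Num.Theory.
Import numFieldNormedType.Exports.

Local Open Scope classical_set_scope.
Local Open Scope complex_scope.
Local Open Scope card_scope.
Local Open Scope ring_scope.

(** Write the scalar orbit of a point as [x_(k+2) = p_k(x_(k+1)) - a_k x_k], with
    periodic [p_k], [a_k], and let [G] be its Green function.

    Invariance.  On the complex line through the images [F_n z], [F_n w] of a point
    [z] and a point [w] with [G w = 0], pulled back by [F_n], the set [G < c]
    contains a disc of radius about [exp (D_n (c - G z))]; three circles
    give [G (f z) <= G (f w) + (c - G (f w)) G z / c].  So [G o f] is constant on the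
    set [G = 0], and the constant is [0]: otherwise [G] would be constant near some
    point where it is positive, which the contraction of nearby orbits forbids.
    Hence [G o f = G].

    Leaves.  Two orbits in the escaping region that stay at bounded distance satisfy
    [e_(k+1) ~ (a_k / p_k'(x_(k+1))) e_k], so the leaves of the level sets of [G] carry
    an affine coordinate [lim e_k / tau_k] and contain discs [x_n = b_n + t] of radius
    about [|b_(n+1)|].  Liouville's theorem on these discs shows that [f] is affine
    along leaves, and comparing with a compact transversal bounds
    [f_n = F_n o f o F_n^-1] by [4 S] on bidiscs of radii about [S] for a range of
    [S].  Taylor's formula then makes [f_n] nearly affine and diagonal,
    with coefficients that satisfy approximately [p_n(E_(n+1) + A_(n+1) y) - a_n (E_n + A_n x)
    = E_(n+2) + A_(n+2) (p_n(y) - a_n x)]; they converge along periods to exact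
    solutions [M_n], and [f = M_0] because the error is superexponentially small
    against the Lipschitz constants of [F_n^-1].  Small [c] are reached by conjugating with
    iterates of the map.

    Group.  Comparing coefficients gives [A_(n+2) = A_n] and [A_(n+1)^(d_n) = A_n], and
    [A_1] determines [A] and [E].  So [f |-> A_1] embeds the group into the roots of
    unity of order dividing [(d + d') (d - 1)] whose order is prime to [d]. *)

(** No pluripotential theory and no Boettcher coordinate enter. Statements about [G] are read off
    the holomorphic functions [F_n o g] on one-dimensional discs, with errors that are bounded or
    linear in [n]; dividing by the degree [D_n], which is at least [2^n], makes them vanish. The
    data are sequences of maps with one constant [C] for all indices, so that a lemma at level 0
    holds at every level for the shifted data.

    The obstacle in passing from leaves to all of [f_n] is that the constants on a leaf depend on
    the leaf. Sliding each leaf down to the transversal [{0} x C], where the relevant points form a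
    compact annulus, removes this dependence. The annulus must lie in [G < c], while the radii [S]
    have to range from [exp (D_n g1)] to [exp (D_n g2)] with [g2] above a fixed multiple of [g1]: a
    power of the lower end, which bounds Lipschitz constants of the polynomials, has to be beaten by
    the upper end. This is why large [c] come first. That [f_n] and [f_(n+1)] share a coordinate is
    what kills the off-diagonal coefficients. *)

Section Modulus.
Context {R : realType}.
Implicit Types (z w p : R[i]) (x : R).

(** Real-valued, whereas the norm of [R[i]] takes complex values: all estimates then live in the
    real field, where [lra] applies. *)
Definition cabs z : R := Num.sqrt ((complex.Re z) ^+ 2 + (complex.Im z) ^+ 2).

Lemma cabsE z : `|z| = (cabs z)%:C. Proof. exact: normc_def. Qed.

Lemma cabs_normc z : cabs z = Normc.normc z. Proof. by case: z. Qed.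

Lemma cabs_ge0 z : 0 <= cabs z. Proof. exact: sqrtr_ge0. Qed.
#[local] Hint Extern 0 (is_true (0 <= cabs _)) => exact: cabs_ge0 : core.

Lemma cabsM z w : cabs (z * w) = cabs z * cabs w.
Proof. by rewrite !cabs_normc Normc.normcM. Qed.

Lemma cabsD z w : cabs (z + w) <= cabs z + cabs w.
Proof. by rewrite !cabs_normc le_normcD. Qed.

Lemma cabsN z : cabs (- z) = cabs z.
Proof. by rewrite !cabs_normc normcN. Qed.

Lemma cabsB z w : cabs (z - w) <= cabs z + cabs w.
Proof. by rewrite -(cabsN w) cabsD. Qed.

Lemma cabsC z w : cabs (z - w) = cabs (w - z).
Proof. by rewrite -cabsN opprB. Qed.

Lemma cabs0 : cabs 0 = 0.
Proof. by rewrite cabs_normc Normc.normc0. Qed.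

Lemma cabs1 : cabs 1 = 1.
Proof. by rewrite cabs_normc Normc.normc1. Qed.

Lemma cabs_eq0 z : (cabs z == 0) = (z == 0).
Proof.
apply/eqP/eqP => [|->]; last exact: cabs0.
by rewrite cabs_normc => /Normc.eq0_normc.
Qed.

Lemma cabs_gt0 z : (0 < cabs z) = (z != 0).
Proof. by rewrite lt_def cabs_eq0 cabs_ge0 andbT. Qed.

Lemma cabsV z : cabs z^-1 = (cabs z)^-1.
Proof. by rewrite !cabs_normc Normc.normcV. Qed.

Lemma cabsf z w : cabs (z / w) = cabs z / cabs w.
Proof. by rewrite cabsM cabsV. Qed.

Lemma cabsX z n : cabs (z ^+ n) = cabs z ^+ n.
Proof. by elim: n => [|n ih]; rewrite ?expr0 ?cabs1// !exprS cabsM ih. Qed.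

Lemma cabsR x : cabs x%:C = `|x|.
Proof. by rewrite /cabs /= expr0n addr0 sqrtr_sqr. Qed.

Lemma cabs_nat n : cabs (n%:R) = n%:R.
Proof. by rewrite -[n%:R in LHS](rmorph_nat (real_complex R)) cabsR normr_nat. Qed.

Lemma cabs_dist z w : cabs z - cabs w <= cabs (z - w).
Proof. by have := cabsD (z - w) w; rewrite subrK lerBlDr. Qed.

Lemma cabs_triB z w p : cabs (z - p) <= cabs (z - w) + cabs (w - p).
Proof. by have := cabsD (z - w) (w - p); rewrite addrA subrK. Qed.

Lemma Re_le_cabs z : `|complex.Re z| <= cabs z.
Proof. by rewrite /cabs -sqrtr_sqr ler_wsqrtr // lerDl sqr_ge0. Qed.

Lemma Im_le_cabs z : `|complex.Im z| <= cabs z.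
Proof. by rewrite /cabs -sqrtr_sqr ler_wsqrtr // lerDr sqr_ge0. Qed.

Lemma cabs_le_ReIm z : cabs z <= `|complex.Re z| + `|complex.Im z|.
Proof.
rewrite [in leLHS](complexE z) (le_trans (cabsD _ _))// cabsM !cabsR lerD2l.
by rewrite -[leRHS]mul1r ler_wpM2r// /cabs /= expr0n add0r expr1n sqrtr1.
Qed.

End Modulus.
#[global] Hint Extern 0 (is_true (0 <= cabs _)) => exact: cabs_ge0 : core.

(** * Complex differentiation and Cauchy theory *)

Section Limits.
Context {R : realType}.
Implicit Types (p : R[i]) (e : R).

(** One notion of limit for the three filters in use: [cnb p] at complex points, [nbhs x] for real
    parameters and [\oo] for sequences. *)
Definition clim (T : Type) (F : set_system T) (f : T -> R[i]) (l : R[i]) :=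
  forall e, 0 < e -> \forall s \near F, cabs (f s - l) < e.

Section Algebra.
Context {T : Type} {F : set_system T} {FF : Filter F}.

Lemma clim_cst l : clim F (fun=> l) l.
Proof. by move=> e e0; apply: nearW => s; rewrite subrr cabs0. Qed.

Lemma climD f g l k : clim F f l -> clim F g k -> clim F (fun s => f s + g s) (l + k).
Proof.
move=> fl gk e e0; have e2 : 0 < e / 2 by rewrite divr_gt0.
move: (fl _ e2) (gk _ e2); apply: filterS2 => s h1 h2.
rewrite opprD addrACA (le_lt_trans (cabsD _ _))//.
by rewrite (splitr e) ltrD.
Qed.

Lemma climN f l : clim F f l -> clim F (fun s => - f s) (- l).
Proof.
move=> fl e e0; move: (fl _ e0); apply: filterS => s.
by rewrite -opprD cabsN.
Qed.

Lemma climB f g l k : clim F f l -> clim F g k -> clim F (fun s => f s - g s) (l - k).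
Proof. by move=> fl gk; apply: climD => //; exact: climN. Qed.

Lemma clim_bounded f l : clim F f l -> \forall s \near F, cabs (f s) < cabs l + 1.
Proof.
move=> /(_ 1 ltr01); apply: filterS => s h.
have := cabs_dist (f s) l; lra.
Qed.

Lemma clim0M f g (B : R) : clim F f 0 -> (\forall s \near F, cabs (g s) <= B) ->
  clim F (fun s => f s * g s) 0.
Proof.
move=> f0 gB e e0; have B0 : 0 < `|B| + 1 by rewrite ltr_wpDl.
move: (f0 (e / (`|B| + 1)) (divr_gt0 e0 B0)) gB; apply: filterS2 => s.
rewrite !subr0 cabsM ltr_pdivlMr// => h1 h2.
apply: le_lt_trans h1; rewrite ler_wpM2l//.
by rewrite (le_trans h2)// (le_trans (ler_norm _))// lerDl.
Qed.

Lemma climM f g l k : clim F f l -> clim F g k -> clim F (fun s => f s * g s) (l * k).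
Proof.
move=> fl gk.
have h1 : clim F (fun s => (f s - l) * g s) 0.
  apply: (@clim0M _ _ (cabs k + 1)).
    by rewrite -(subrr l); apply: climB => //; exact: clim_cst.
  by move: (clim_bounded gk); apply: filterS => s; exact: ltW.
have h2 : clim F (fun s => (g s - k) * l) 0.
  apply: (@clim0M _ _ (cabs l)).
    by rewrite -(subrr k); apply: climB => //; exact: clim_cst.
  by apply: nearW.
move=> e /(climD h1 h2); apply: filterS => s.
by rewrite addr0 subr0; congr (cabs _ < e); ring.
Qed.

Lemma clim_neq0 f l : clim F f l -> l != 0 -> \forall s \near F, cabs l / 2 < cabs (f s).
Proof.
move=> fl l0; have l2 : 0 < cabs l / 2 by rewrite divr_gt0 ?cabs_gt0.
move: (fl _ l2); apply: filterS => s; rewrite cabsC => h.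
have := cabs_dist l (f s); lra.
Qed.

Lemma climV f l : clim F f l -> l != 0 -> clim F (fun s => (f s)^-1) (l^-1).
Proof.
move=> fl l0; have l2 : 0 < cabs l / 2 by rewrite divr_gt0 ?cabs_gt0.
have h : clim F (fun s => (f s - l) * (- ((f s)^-1 * l^-1))) 0.
  apply: (@clim0M _ _ ((cabs l / 2)^-1 * (cabs l)^-1)).
    by rewrite -(subrr l); apply: climB => //; exact: clim_cst.
  move: (clim_neq0 fl l0); apply: filterS => s h.
  rewrite cabsN cabsM !cabsV ler_wpM2r ?invr_ge0// lef_pV2 ?posrE ?ltW//.
  exact: lt_trans h.
move=> e e0; move: (h _ e0) (clim_neq0 fl l0); apply: filterS2 => s + h2.
have fs0 : f s != 0 by rewrite -cabs_gt0 (lt_trans _ h2).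
rewrite subr0; congr (cabs _ < e); field.
by rewrite fs0 l0.
Qed.

Lemma clim_near_eq f g l : (\forall s \near F, f s = g s) -> clim F f l -> clim F g l.
Proof. by move=> fg fl e /fl; move: fg; apply: filterS2 => s ->. Qed.

End Algebra.

Definition cnb p : set_system R[i] := nbhs (p : R[i]^o).

Global Instance cnb_filter p : ProperFilter (cnb p).
Proof. exact: (nbhs_pfilter (p : R[i]^o)). Qed.

Lemma cnbP p (A : set R[i]) :
  cnb p A <-> exists2 e, 0 < e & forall s, cabs (s - p) < e -> A s.
Proof.
split.
- move=> /nbhs_ballP[e /= e0 h].
  have e0' : 0 < complex.Re e by move: e0; rewrite ltcE => /andP[].
  exists (complex.Re e) => // s hs; apply: h => /=.
  rewrite -ball_normE /= distrC cabsE; move: e0 hs; rewrite !ltcE /=.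
  by move=> /andP[/eqP -> _] ->; rewrite eqxx.
- move=> [e e0 h]; apply/nbhs_ballP; exists (e%:C) => /=; first by rewrite ltcR.
  move=> s; rewrite -ball_normE /= distrC cabsE ltcR; exact: h.
Qed.

Lemma cnb_clim p : clim (cnb p) (fun s => s) p.
Proof. by move=> e e0; apply/cnbP; exists e. Qed.

Lemma cnb_comp (T : Type) (F : set_system T) {FF : Filter F} (f : T -> R[i]) l (P : set R[i]) :
  clim F f l -> cnb l P -> \forall s \near F, P (f s).
Proof. by move=> fl /cnbP[e e0 h]; move: (fl _ e0); apply: filterS => s /h. Qed.

Lemma clim_comp (T : Type) (F : set_system T) {FF : Filter F} (f : T -> R[i]) g l k :
  clim F f l -> clim (cnb l) g k -> clim F (fun s => g (f s)) k.
Proof. by move=> fl gk e /gk; exact: cnb_comp. Qed.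

Lemma cnb_ball p e : 0 < e -> \forall s \near cnb p, cabs (s - p) < e.
Proof. by move=> e0; apply/cnbP; exists e. Qed.

Lemma cnb_self p (P : set R[i]) : (\forall s \near cnb p, P s) -> P p.
Proof. by move=> /cnbP[e e0]; apply; rewrite subrr cabs0. Qed.

Definition ccont (f : R[i] -> R[i]) p := clim (cnb p) f (f p).

(** Caratheodory's form of the derivative: the continuous slope function [phi] turns the sum,
    product, quotient and chain rules into algebra with [clim]. *)
Definition cder (f : R[i] -> R[i]) p l := exists phi : R[i] -> R[i],
  [/\ phi p = l, ccont phi p & \forall s \near cnb p, f s = f p + phi s * (s - p)].

Definition cdiff f p := exists l, cder f p l.

Lemma cdiff_ccont f p : cdiff f p -> ccont f p.
Proof.
move=> [l [phi [_ phic h]]].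
have : clim (cnb p) (fun s => f p + phi s * (s - p)) (f p + phi p * (p - p)).
  apply: climD; first exact: clim_cst.
  by apply: climM => //; apply: climB; [exact: cnb_clim|exact: clim_cst].
rewrite subrr mulr0 addr0 => h'; apply: clim_near_eq h'.
by move: h; apply: filterS => s ->.
Qed.

Lemma cdiff_near f g p : (\forall s \near cnb p, f s = g s) -> cdiff f p -> cdiff g p.
Proof.
move=> fg [l [phi [pl pc h]]]; exists l; exists phi; split => //.
have e := cnb_self fg; move: fg h; apply: filterS2 => s <- ->; by rewrite e.
Qed.

Lemma cdiff_cst c p : cdiff (fun=> c) p.
Proof.
exists 0; exists (fun=> 0); split => //; first exact: clim_cst.
by apply: nearW => s; rewrite mul0r addr0.
Qed.

Lemma cdiff_id p : cdiff (fun s => s) p.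
Proof.
exists 1; exists (fun=> 1); split => //; first exact: clim_cst.
by apply: nearW => s; rewrite mul1r addrC subrK.
Qed.

Lemma cdiffD f g p : cdiff f p -> cdiff g p -> cdiff (fun s => f s + g s) p.
Proof.
move=> [l [phi [pl pc h]]] [k [psi [qk qc h']]].
exists (l + k); exists (fun s => phi s + psi s); split.
- by rewrite pl qk.
- exact: climD.
- by move: h h'; apply: filterS2 => s -> ->; ring.
Qed.

Lemma cdiffM f g p : cdiff f p -> cdiff g p -> cdiff (fun s => f s * g s) p.
Proof.
move=> df dg; have gc := cdiff_ccont dg.
move: df dg => [l [phi [pl pc h]]] [k [psi [qk qc h']]].
exists (phi p * g p + f p * psi p); exists (fun s => phi s * g s + f p * psi s); split => //.
- apply: climD; first exact: climM.
  by apply: climM => //; exact: clim_cst.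
- by move: h h'; apply: filterS2 => s -> ->; ring.
Qed.

Lemma cdiffZ c f p : cdiff f p -> cdiff (fun s => c * f s) p.
Proof. by move=> df; apply: cdiffM => //; exact: cdiff_cst. Qed.

Lemma cdiffN f p : cdiff f p -> cdiff (fun s => - f s) p.
Proof.
by move=> /(cdiffZ (-1)); under eq_fun do rewrite mulN1r.
Qed.

Lemma cdiffB f g p : cdiff f p -> cdiff g p -> cdiff (fun s => f s - g s) p.
Proof. by move=> df dg; apply: cdiffD => //; exact: cdiffN. Qed.

Lemma cdiffV f p : f p != 0 -> cdiff f p -> cdiff (fun s => (f s)^-1) p.
Proof.
move=> f0 df; have fc := cdiff_ccont df.
move: df => [l [phi [pl pc h]]].
exists (- (phi p * (f p)^-1 * (f p)^-1)).
exists (fun s => - (phi s * (f s)^-1 * (f p)^-1)); split => //.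
- apply: climN; apply: climM; last exact: clim_cst.
  by apply: climM => //; exact: climV.
- have hn : \forall s \near cnb p, cabs (f p) / 2 < cabs (f s) by exact: clim_neq0.
  move: h hn; apply: filterS2 => s h1 h2.
  have fs0 : f s != 0.
    by rewrite -cabs_gt0 (lt_trans _ h2)// divr_gt0// cabs_gt0.
  have -> : - (phi s / f s / f p) * (s - p) = - ((phi s * (s - p)) / f s / f p) by ring.
  have -> : phi s * (s - p) = f s - f p by rewrite h1; ring.
  by field; rewrite fs0 f0.
Qed.

Lemma cdiff_div f g p : g p != 0 -> cdiff f p -> cdiff g p -> cdiff (fun s => f s / g s) p.
Proof. by move=> g0 df dg; apply: cdiffM => //; exact: cdiffV. Qed.

Lemma cdiffX n f p : cdiff f p -> cdiff (fun s => f s ^+ n) p.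
Proof.
move=> df; elim: n => [|n ih].
  by under eq_fun do rewrite expr0; exact: cdiff_cst.
by under eq_fun do rewrite exprS; exact: cdiffM.
Qed.

Lemma cdiff_comp f g p : cdiff f p -> cdiff g (f p) -> cdiff (fun s => g (f s)) p.
Proof.
move=> df dg; have fc := cdiff_ccont df.
move: df dg => [l [phi [pl pc h]]] [k [psi [qk qc h']]].
exists (psi (f p) * phi p); exists (fun s => psi (f s) * phi s); split => //.
- by apply: climM => //; exact: (clim_comp fc).
- have h2 : \forall s \near cnb p, g (f s) = g (f p) + psi (f s) * (f s - f p).
    exact: (cnb_comp fc h').
  move: h h2; apply: filterS2 => s h1 ->.
  have -> : f s - f p = phi s * (s - p) by rewrite h1; ring.
  by rewrite mulrA.
Qed.

Lemma cdiff_horner (q : {poly R[i]}) f p : cdiff f p -> cdiff (fun s => q.[f s]) p.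
Proof.
move=> df; elim/poly_ind: q => [|q c ih].
  by under eq_fun do rewrite horner0; exact: cdiff_cst.
under eq_fun do rewrite hornerMXaddC.
by apply: cdiffD; [exact: cdiffM|exact: cdiff_cst].
Qed.

End Limits.

(** * Integrals of complex functions over segments *)

Section Integral.
Context {R : realType}.
Notation mu := (@lebesgue_measure R).
Implicit Types (g h : R -> R[i]) (a b x y e M : R).

Definition rcont g x := clim (nbhs x) g (g x).

Definition cint g a b : R[i] :=
  (\int[mu]_(x in `[a, b]) complex.Re (g x))%R +i* (\int[mu]_(x in `[a, b]) complex.Im (g x))%R.

Lemma rcont_ReIm g x : rcont g x ->
  {for x, continuous (fun t => complex.Re (g t) : R^o)} /\
  {for x, continuous (fun t => complex.Im (g t) : R^o)}.
Proof.
move=> gx; split; apply/cvgrPdist_lt => e e0; move: (gx _ e0); apply: filterS => t;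
  rewrite cabsC; apply: le_lt_trans.
- by rewrite (le_trans _ (Re_le_cabs _))//; case: (g x) (g t) => ? ? [].
- by rewrite (le_trans _ (Im_le_cabs _))//; case: (g x) (g t) => ? ? [].
Qed.

Lemma rcont_integrable g a b : (forall x, a <= x <= b -> rcont g x) ->
  mu.-integrable `[a, b] (EFin \o (fun t => complex.Re (g t))) /\
  mu.-integrable `[a, b] (EFin \o (fun t => complex.Im (g t))).
Proof.
move=> gc; split; apply: continuous_compact_integrable; try exact: segment_compact;
  apply: continuous_in_subspaceT => x; rewrite inE /= in_itv /= => /gc /rcont_ReIm[] //.
Qed.

Lemma cintD g h a b : (forall x, a <= x <= b -> rcont g x) ->
  (forall x, a <= x <= b -> rcont h x) ->
  cint (fun x => g x + h x) a b = cint g a b + cint h a b.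
Proof.
move=> /rcont_integrable[g1 g2] /rcont_integrable[h1 h2].
rewrite /cint /= [in RHS]/GRing.add /=.
by congr (_ +i* _); rewrite -RintegralD//; apply: eq_Rintegral => x _;
  case: (g x) (h x) => ? ? [].
Qed.

Lemma cintZ c g a b : (forall x, a <= x <= b -> rcont g x) ->
  cint (fun x => c * g x) a b = c * cint g a b.
Proof.
move=> /rcont_integrable[g1 g2]; case: c => u v.
rewrite /cint /= [in RHS]/GRing.mul /=.
have Zl w (k : R -> R) : mu.-integrable `[a, b] (EFin \o k) ->
    mu.-integrable `[a, b] (EFin \o (fun t => w * k t)).
  move=> ki; have : mu.-integrable `[a, b] (fun t => (w%:E * (k t)%:E)%E).
    exact: integrableZl.
  by [].
congr (_ +i* _); rewrite -!RintegralZl// -?RintegralB// -?RintegralD//;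
  try exact: Zl; by apply: eq_Rintegral => x _; case: (g x).
Qed.

Lemma cint_split g a b x : (forall x, a <= x <= b -> rcont g x) -> a <= x <= b ->
  cint g a b = cint g a x + cint g x b.
Proof.
move=> /rcont_integrable[g1 g2] /andP[ax xb].
rewrite /cint [in RHS]/GRing.add /=.
have hs (k : R -> R) : mu.-integrable `[a, b] (EFin \o k) ->
  (\int[mu]_(t in `[a, b]) k t = \int[mu]_(t in `[a, x]) k t + \int[mu]_(t in `[x, b]) k t)%R.
  move=> ki; apply/eqP; rewrite addrC -subr_eq; apply/eqP.
  rewrite Rintegral_itvB// ?bnd_simp//; last by rewrite Rintegral_itv_obnd_cbnd//;
    apply: integrableS ki => //; apply: subset_itvr; rewrite bnd_simp.
by congr (_ +i* _); exact: hs.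
Qed.

Lemma eq_cint g h a b : (forall x, a <= x <= b -> g x = h x) -> cint g a b = cint h a b.
Proof.
by move=> gh; rewrite /cint; congr (_ +i* _); apply: eq_Rintegral => x;
  rewrite inE /= in_itv /= => /gh ->.
Qed.

(** The factor 2 comes from bounding real and imaginary parts separately. It is harmless: it is
    absorbed in constants, or removed by taking powers ([le_of_powers]). *)
Lemma cint_bound g a b M : a <= b -> (forall x, a <= x <= b -> rcont g x) ->
  (forall x, a <= x <= b -> cabs (g x) <= M) -> cabs (cint g a b) <= 2 * M * (b - a).
Proof.
move=> ab /rcont_integrable[g1 g2] gM.
have hs (k : R -> R) : mu.-integrable `[a, b] (EFin \o k) ->
    (forall x, a <= x <= b -> `|k x| <= M) ->
    `|(\int[mu]_(t in `[a, b]) k t)%R| <= M * (b - a).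
  move=> ki kM; rewrite (le_trans (le_normr_Rintegral _ _))//.
  have -> : M * (b - a) = (\int[mu]_(t in `[a, b]) M)%R.
    rewrite Rintegral_cst//= lebesgue_measure_itv /= lte_fin.
    case: ltP => [_|ba]; first by rewrite -EFinB.
    by rewrite /= (_ : b - a = 0)//; lra.
  have i1 : mu.-integrable `[a, b] (EFin \o (fun t => `|k t|)) by exact: integrable_norm.
  have i2 : mu.-integrable `[a, b] (EFin \o (fun=> M)).
    by apply: continuous_compact_integrable; [exact: segment_compact|];
      apply: continuous_subspaceT => x; exact: cvg_cst.
  by apply: (le_Rintegral _ i1 i2) => // x xab; apply: kM; move: xab; rewrite /= in_itv.
have h1 := hs _ g1 (fun x xab => le_trans (Re_le_cabs _) (gM x xab)).
have h2 := hs _ g2 (fun x xab => le_trans (Im_le_cabs _) (gM x xab)).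
apply: (le_trans (cabs_le_ReIm _)); rewrite -mulrA mulr_natl mulr2n.
exact: lerD h1 h2.
Qed.

Lemma rcont_comp (f : R[i] -> R[i]) g x : rcont g x -> ccont f (g x) -> rcont (fun t => f (g t)) x.
Proof. by move=> gx fg; exact: (clim_comp gx). Qed.

Lemma rcontD g h x : rcont g x -> rcont h x -> rcont (fun t => g t + h t) x.
Proof. exact: climD. Qed.
Lemma rcontB g h x : rcont g x -> rcont h x -> rcont (fun t => g t - h t) x.
Proof. exact: climB. Qed.
Lemma rcontM g h x : rcont g x -> rcont h x -> rcont (fun t => g t * h t) x.
Proof. exact: climM. Qed.
Lemma rcont_cst c x : rcont (fun=> c) x.
Proof. exact: clim_cst. Qed.

Lemma rcont_hline y x : rcont (fun t => t +i* y) x.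
Proof.
move=> e e0; near=> t.
rewrite (_ : _ - _ = (t - x)%:C); last by apply/eqP; rewrite eq_complex /= subrr !eqxx.
rewrite cabsR; near: t.
by apply/nbhs_ballP; exists e => //= t; rewrite /ball /= distrC.
Unshelve. all: by end_near. Qed.

Lemma rcont_vline y x : rcont (fun t => y +i* t) x.
Proof.
move=> e e0; near=> t.
rewrite (_ : _ - _ = 0 +i* (t - x)); last by apply/eqP; rewrite eq_complex /= subrr !eqxx.
rewrite (le_lt_trans (cabs_le_ReIm _))//= normr0 add0r; near: t.
by apply/nbhs_ballP; exists e => //= t; rewrite /ball /= distrC.
Unshelve. all: by end_near. Qed.

End Integral.

(** * Goursat's theorem for rectangles *)

Section Goursat.
Context {R : realType}.
Implicit Types (f : R[i] -> R[i]) (a b x y e M : R).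

Definition in_rect x y a b (s : R[i]) :=
  x <= complex.Re s <= x + a /\ y <= complex.Im s <= y + b.

(** The integral of [f] along the boundary of the rectangle with lower left corner [x +i* y] and
    sides [a], [b]. Opposite sides are paired, so that the orientation appears as differences. *)
Definition rect_int f x y a b : R[i] :=
  cint (fun u => f (u +i* y) - f (u +i* (y + b))) x (x + a) +
  (0 +i* 1) * cint (fun v => f ((x + a) +i* v) - f (x +i* v)) y (y + b).

Lemma rcont_hdiff f y y' u : ccont f (u +i* y) -> ccont f (u +i* y') ->
  rcont (fun u => f (u +i* y) - f (u +i* y')) u.
Proof.
by move=> h1 h2; apply: rcontB; apply: rcont_comp => //; exact: rcont_hline.
Qed.

Lemma rcont_vdiff f y y' u : ccont f (y +i* u) -> ccont f (y' +i* u) ->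
  rcont (fun u => f (y +i* u) - f (y' +i* u)) u.
Proof.
by move=> h1 h2; apply: rcontB; apply: rcont_comp => //; exact: rcont_vline.
Qed.

Lemma rect_int_hsplit f x y a1 a2 b : 0 <= a1 -> 0 <= a2 -> 0 <= b ->
  (forall s, in_rect x y (a1 + a2) b s -> ccont f s) ->
  rect_int f x y (a1 + a2) b = rect_int f x y a1 b + rect_int f (x + a1) y a2 b.
Proof.
move=> a10 a20 b0 fc; rewrite /rect_int addrA.
rewrite (cint_split (x := x + a1)); last 2 first.
- by move=> u ?; apply: rcont_hdiff; apply: fc; split => /=; lra.
- lra.
have -> : cint (fun v => f ((x + a1 + a2) +i* v) - f (x +i* v)) y (y + b) =
   cint (fun v => f ((x + a1) +i* v) - f (x +i* v)) y (y + b) +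
   cint (fun v => f ((x + a1 + a2) +i* v) - f ((x + a1) +i* v)) y (y + b).
  rewrite -cintD.
  - by apply: eq_cint => v _; ring.
  - by move=> u ?; apply: rcont_vdiff; apply: fc; split => /=; lra.
  - by move=> u ?; apply: rcont_vdiff; apply: fc; split => /=; lra.
ring.
Qed.

Lemma rect_int_vsplit f x y a b1 b2 : 0 <= a -> 0 <= b1 -> 0 <= b2 ->
  (forall s, in_rect x y a (b1 + b2) s -> ccont f s) ->
  rect_int f x y a (b1 + b2) = rect_int f x y a b1 + rect_int f x (y + b1) a b2.
Proof.
move=> a0 b10 b20 fc; rewrite /rect_int addrA.
rewrite [cint _ y _](cint_split (x := y + b1)); last 2 first.
- by move=> u ?; apply: rcont_vdiff; apply: fc; split => /=; lra.
- lra.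
have -> : cint (fun v => f (v +i* y) - f (v +i* (y + b1 + b2))) x (x + a) =
   cint (fun v => f (v +i* y) - f (v +i* (y + b1))) x (x + a) +
   cint (fun v => f (v +i* (y + b1)) - f (v +i* (y + b1 + b2))) x (x + a).
  rewrite -cintD.
  - by apply: eq_cint => v _; ring.
  - by move=> u ?; apply: rcont_hdiff; apply: fc; split => /=; lra.
  - by move=> u ?; apply: rcont_hdiff; apply: fc; split => /=; lra.
ring.
Qed.

Lemma rect_int_quarter f x y a b : 0 <= a -> 0 <= b ->
  (forall s, in_rect x y (a + a) (b + b) s -> ccont f s) ->
  rect_int f x y (a + a) (b + b) =
  rect_int f x y a b + rect_int f x (y + b) a b
  + (rect_int f (x + a) y a b + rect_int f (x + a) (y + b) a b).
Proof.
move=> a0 b0 fc; rewrite rect_int_hsplit ?rect_int_vsplit//; last lra.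
- by move=> s [h1 h2]; apply: fc; split; lra.
- by move=> s [h1 h2]; apply: fc; split; lra.
Qed.

(* The integral of an affine function vanishes, so only its distance to f matters. *)
Lemma rect_int_bound f x y a b (c l : R[i]) M : 0 <= a -> 0 <= b ->
  (forall s, in_rect x y a b s -> ccont f s) ->
  (forall s, in_rect x y a b s -> cabs (f s - (c + l * s)) <= M) ->
  cabs (rect_int f x y a b) <= 4 * M * (a + b).
Proof.
move=> a0 b0 fc fM.
have Cl s : ccont (fun s => c + l * s) s.
  by apply: climD; [exact: clim_cst|apply: climM; [exact: clim_cst|exact: cnb_clim]].
pose g s := f s - (c + l * s).
have gc s : in_rect x y a b s -> ccont g s.
  by move=> /fc h; apply: climB => //; exact: Cl.
have cstE (k : R[i]) p q (pq : p <= q) : cint (fun=> k) p q = k * (q - p)%:C.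
  rewrite /cint /= !Rintegral_cst//= lebesgue_measure_itv /= lte_fin.
  case: ltP => [_|ba].
    by rewrite -EFinB /=; case: k => u v /=; apply/eqP; rewrite eq_complex /=; apply/andP; split; apply/eqP; ring.
  have -> : q = p by lra.
  by rewrite subrr /=; case: k => u v /=; apply/eqP; rewrite eq_complex /=; apply/andP; split; apply/eqP; ring.
have -> : rect_int f x y a b = rect_int g x y a b.
  rewrite /rect_int.
  have -> : cint (fun u => f (u +i* y) - f (u +i* (y + b))) x (x + a) =
     cint (fun u => g (u +i* y) - g (u +i* (y + b))) x (x + a)
     + cint (fun=> - (l * (0 +i* b))) x (x + a).
    rewrite -cintD.
    - apply: eq_cint => u _; rewrite /g.
      have -> : u +i* (y + b) = u +i* y + 0 +i* b.
        by apply/eqP; rewrite eq_complex /= addr0 !eqxx.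
      ring.
    - by move=> u ?; apply: rcont_hdiff; apply: gc; split => /=; lra.
    - by move=> *; exact: rcont_cst.
  have -> : cint (fun v => f ((x + a) +i* v) - f (x +i* v)) y (y + b) =
     cint (fun v => g ((x + a) +i* v) - g (x +i* v)) y (y + b)
     + cint (fun=> l * (a +i* 0)) y (y + b).
    rewrite -cintD.
    - apply: eq_cint => u _; rewrite /g.
      have -> : (x + a) +i* u = x +i* u + a +i* 0.
        by apply/eqP; rewrite eq_complex /= addr0 !eqxx.
      ring.
    - by move=> u ?; apply: rcont_vdiff; apply: gc; split => /=; lra.
    - by move=> *; exact: rcont_cst.
  rewrite !cstE ?lerDl// (_ : x + a - x = a) 1?(_ : y + b - y = b); try ring.
  suff h k : - (k * (0 +i* b)) * a%:C + (0 +i* 1) * (k * (a +i* 0) * b%:C) = 0.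
    by rewrite mulrDr addrACA h addr0.
  case: k => u v; apply/eqP; rewrite eq_complex /=; apply/andP; split; apply/eqP; ring.
rewrite /rect_int (le_trans (cabsD _ _))// cabsM.
have -> : cabs (0 +i* 1 : R[i]) = 1 by rewrite /cabs /= expr0n expr1n add0r sqrtr1.
have -> : 4 * M * (a + b) = 2 * (M + M) * (x + a - x) + 1 * (2 * (M + M) * (y + b - y)) by ring.
apply: lerD; rewrite ?mul1r; apply: cint_bound; rewrite ?lerDl//.
- by move=> u ?; apply: rcont_hdiff; apply: gc; split => /=; lra.
- by move=> u ?; rewrite (le_trans (cabsB _ _))// lerD// fM//; split => /=; lra.
- by move=> u ?; apply: rcont_vdiff; apply: gc; split => /=; lra.
- by move=> u ?; rewrite (le_trans (cabsB _ _))// lerD// fM//; split => /=; lra.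
Qed.

Lemma nested_intervals (u : nat -> R) (w : nat -> R) :
  (forall n, u n <= u n.+1 /\ u n.+1 + w n.+1 <= u n + w n) -> (forall n, 0 <= w n) ->
  exists t, forall n, u n <= t <= u n + w n.
Proof.
move=> uw w0.
have nest k n : u n <= u (n + k)%N /\ u (n + k)%N + w (n + k)%N <= u n + w n.
  elim: k => [|k [ih1 ih2]]; first by rewrite addn0 lexx.
  rewrite addnS; have [h1 h2] := uw (n + k)%N; split; lra.
have ub n m : u m <= u n + w n.
  have [mn|nm] := leqP m n.
    by have [] := nest (n - m)%N m; rewrite subnKC// => h _; have := w0 n; lra.
  have [_] := nest (m - n)%N n; rewrite subnKC// 1?ltnW// => h.
  have := w0 m; lra.
exists (sup (range u)) => n; apply/andP; split.
  apply: ub_le_sup; last by exists n.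
  by exists (u 0%N + w 0%N) => _ [m _ <-].
by apply: ge_sup; [exists (u 0%N), 0%N|move=> _ [m _ <-]].
Qed.

(** If the integral were nonzero, repeated quartering would leave nested rectangles on which it
    exceeds [e (A + B)^2]. At their common point [f] is affine up to a small multiple of the
    distance, and [rect_int_bound] gives a contradiction. *)
Lemma goursat f x y a b : 0 <= a -> 0 <= b ->
  (forall s, in_rect x y a b s -> cdiff f s) -> rect_int f x y a b = 0.
Proof.
move=> a0 b0 fd.
have fc s : in_rect x y a b s -> ccont f s by move=> /fd /cdiff_ccont.
apply/eqP; apply/negPn/negP; rewrite -cabs_gt0 => I0.
(* Chosen so that the initial rectangle satisfies the strict inequality in [good]. *)
pose e := cabs (rect_int f x y a b) / ((a + b) ^+ 2 + 1).
have e0 : 0 < e by rewrite divr_gt0// ltr_wpDl// sqr_ge0.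
pose A n := a / 2 ^+ n; pose B n := b / 2 ^+ n.
have two n : 0 < 2 ^+ n :> R by rewrite exprn_gt0.
have A0 n : 0 <= A n by rewrite divr_ge0// ltW.
have B0 n : 0 <= B n by rewrite divr_ge0// ltW.
have halfA n : A n = A n.+1 + A n.+1.
  by rewrite /A exprS; field; rewrite gt_eqF.
have halfB n : B n = B n.+1 + B n.+1.
  by rewrite /B exprS; field; rewrite gt_eqF.
have AZ : A 0%N = a by rewrite /A expr0 divr1.
have BZ : B 0%N = b by rewrite /B expr0 divr1.
have small d : 0 < d -> exists n, A n + B n < d.
  move=> d0; have ab0 : 0 <= (a + b) / d by rewrite divr_ge0 ?addr_ge0// ltW.
  exists (Num.bound ((a + b) / d)).
  rewrite /A /B -mulrDl ltr_pdivrMr// -ltr_pdivrMl// mulrC.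
  rewrite (lt_le_trans (archi_boundP ab0))//.
  by rewrite -natrX ler_nat ltnW// ltn_expl.
clearbody A B; clear two.
pose good (q : nat * R * R) :=
  e * (A q.1.1 + B q.1.1) ^+ 2 < cabs (rect_int f q.1.2 q.2 (A q.1.1) (B q.1.1)) /\
  (forall s, in_rect q.1.2 q.2 (A q.1.1) (B q.1.1) s -> in_rect x y a b s).
(* Goodness of the next rectangle is only an implication, so that [rel] is total and dependent
   choice applies to arbitrary triples. *)
pose rel (q q' : nat * R * R) := [/\ q'.1.1 = q.1.1.+1, good q -> good q',
  q.1.2 <= q'.1.2 /\ q'.1.2 + A q'.1.1 <= q.1.2 + A q.1.1 &
  q.2 <= q'.2 /\ q'.2 + B q'.1.1 <= q.2 + B q.1.1].
have step q : exists q', rel q q'.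
  case: q => [[n u] v].
  have [[/= bad inc]|ng] := pselect (good (n, u, v)); last first.
    have hA := halfA n; have hB := halfB n.
    have hA' := A0 n.+1; have hB' := B0 n.+1.
    by exists (n.+1, u, v); split; [by []|by move=> /ng|by split=> /=; (clear - hA' hA; lra)|by split=> /=; (clear - hB' hB; lra)].
  rewrite (halfA n) (halfB n) in bad inc.
  have := A0 n.+1; have := B0 n.+1; set a' := A n.+1; set b' := B n.+1 => b'0 a'0.
  move: bad inc; rewrite -/a' -/b' => bad inc.
  have quarter u' v' : (u' = u \/ u' = u + a') -> (v' = v \/ v' = v + b') ->
      e * (a' + b') ^+ 2 < cabs (rect_int f u' v' a' b') -> exists q', rel (n, u, v) q'.
    move=> hu hv h; exists (n.+1, u', v'); split => //=.
    - move=> _; split => //= s [h1 h2]; apply: inc.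
      move: h1 h2; rewrite -/a' -/b'.
      by case: hu hv => -> [] -> h1 h2; split; (clear - h1 h2; lra).
    - by rewrite (halfA n) -/a'; case: hu => ->; split; (clear - a'0; lra).
    - by rewrite (halfB n) -/b'; case: hv => ->; split; (clear - b'0; lra).
  apply: contrapT => nq.
  have {}quarter u' v' : (u' = u \/ u' = u + a') -> (v' = v \/ v' = v + b') ->
      cabs (rect_int f u' v' a' b') <= e * (a' + b') ^+ 2.
    by move=> hu hv; rewrite leNgt; apply/negP => /(quarter _ _ hu hv).
  have q1 := quarter u v (or_introl erefl) (or_introl erefl).
  have q2 := quarter u (v + b') (or_introl erefl) (or_intror erefl).
  have q3 := quarter (u + a') v (or_intror erefl) (or_introl erefl).
  have q4 := quarter (u + a') (v + b') (or_intror erefl) (or_intror erefl).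
  move: bad; rewrite rect_int_quarter//; last by move=> s /inc /fc.
  apply/negP; rewrite -leNgt.
  have -> : e * (a' + a' + (b' + b')) ^+ 2 = (e * (a' + b') ^+ 2 + e * (a' + b') ^+ 2)
    + (e * (a' + b') ^+ 2 + e * (a' + b') ^+ 2) by ring.
  by apply: (le_trans (cabsD _ _)); apply: lerD; apply: (le_trans (cabsD _ _)); apply: lerD.
have [F [F0 Frel]] := dependent_choice (fun q => cid (step q)) (0%N, x, y).
have Fn n : (F n).1.1 = n.
  by elim: n => [|n ih]; [rewrite F0|have [-> _ _ _] := Frel n; rewrite ih].
have Fgood n : good (F n).
  elim: n => [|n ih]; last by have [_ h _ _] := Frel n; exact: h.
  rewrite F0; split => /=; rewrite AZ BZ //.
  by rewrite /e mulrAC ltr_pdivrMr ?ltr_wpDl ?sqr_ge0// mulrDr mulr1 ltrDl.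
have [X hX] : exists t, forall n, (F n).1.2 <= t <= (F n).1.2 + A n.
  apply: (nested_intervals (u := fun n => (F n).1.2)) => // n.
  by have [_ _ + _] := Frel n; rewrite !Fn.
have [Y hY] : exists t, forall n, (F n).2 <= t <= (F n).2 + B n.
  apply: (nested_intervals (u := fun n => (F n).2)) => // n.
  by have [_ _ _] := Frel n; rewrite !Fn.
pose t := X +i* Y.
have tin n : in_rect (F n).1.2 (F n).2 (A n) (B n) t by split; [exact: hX|exact: hY].
have tR : in_rect x y a b t.
  by have [_ h] := Fgood 0%N; apply: h; rewrite Fn; exact: tin.
have [l [phi [phil phic /cnbP[d d0 hd]]]] := fd _ tR.
(* With the tolerance [e / 8] the bound [4 M (A + B)] of [rect_int_bound] becomes half of
   [e (A + B)^2]. *)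
have e8 : 0 < e / 8 by rewrite divr_gt0.
have /cnbP[d' d'0 hd'] := phic _ e8.
have m0 : 0 < Num.min d d' by rewrite lt_min d0.
have [n hn] := small _ m0.
have [bad inc] := Fgood n; rewrite !Fn in bad inc.
move: bad; apply/negP; rewrite -leNgt.
have := @rect_int_bound f (F n).1.2 (F n).2 (A n) (B n) (f t - l * t) l (e / 8 * (A n + B n)).
move=> /(_ (A0 n) (B0 n) (fun s h => fc s (inc s h))) hb.
rewrite (le_trans (hb _))//; last first.
  have -> : 4 * (e / 8 * (A n + B n)) * (A n + B n) = e * (A n + B n) ^+ 2 / 2 by field.
  by have := mulr_ge0 (ltW e0) (sqr_ge0 (A n + B n)); (clear; lra).
move=> s hs.
have hst : cabs (s - t) <= A n + B n.
  rewrite (le_trans (cabs_le_ReIm _))//.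
  have [hs1 hs2] := hs; have [ht1 ht2] := tin n.
  have -> : complex.Re (s - t) = complex.Re s - complex.Re t by case: (s) (t) => ? ? [].
  have -> : complex.Im (s - t) = complex.Im s - complex.Im t by case: (s) (t) => ? ? [].
  by apply: lerD; rewrite ler_norml; (clear - ht1 hs1 ht2 hs2; lra).
move: hn; rewrite lt_min => /andP[hn1 hn2].
rewrite hd ?(le_lt_trans hst)//.
have -> : f t + phi s * (s - t) - (f t - l * t + l * s) = (phi s - l) * (s - t) by ring.
rewrite cabsM ler_pM// -phil ltW// hd'// (le_lt_trans hst)//.
Qed.

End Goursat.

(** * The complex exponential *)

Section ComplexExp.
Context {R : realType}.
Implicit Types (w p : R[i]) (x y e : R).

Definition cexp w : R[i] :=
  (expR (complex.Re w) * cos (complex.Im w)) +i* (expR (complex.Re w) * sin (complex.Im w)).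

Lemma cexpD w p : cexp (w + p) = cexp w * cexp p.
Proof.
case: w p => a b [c d]; apply/eqP; rewrite eq_complex /cexp /= expRD sinD cosD.
by apply/andP; split; apply/eqP; ring.
Qed.

Lemma cabs_cexp w : cabs (cexp w) = expR (complex.Re w).
Proof.
rewrite /cabs /cexp /= !exprMn -mulrDr cos2Dsin2 mulr1 sqrtr_sqr.
by rewrite ger0_norm ?expR_ge0.
Qed.

Lemma cexp_neq0 w : cexp w != 0.
Proof. by rewrite -cabs_gt0 cabs_cexp expR_gt0. Qed.

Lemma cexp_periodic x y : cexp (x +i* (y + pi *+ 2)) = cexp (x +i* y).
Proof. by rewrite /cexp /= cosD2pi sinD2pi. Qed.

Lemma cexp_ReIm x y : cexp (x +i* y) = (expR x)%:C * cexp (0 +i* y).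
Proof.
apply/eqP; rewrite eq_complex /cexp /= expR0 !mul0r; apply/andP; split; apply/eqP; ring.
Qed.

Lemma is_derive_small (f : R -> R) x l : is_derive x 1 f l -> forall e, 0 < e ->
  exists2 d, 0 < d & forall h, `|h| < d -> `|f (x + h) - f x - l * h| <= e * `|h|.
Proof.
move=> [df dfl] e e0; have := df; rewrite /derivable => /cvg_ex[l' hl'].
have l'E : l' = l by rewrite -dfl /derive; apply/esym/cvg_lim.
rewrite {}l'E in hl'.
move/cvgrPdist_le : hl' => /(_ _ e0).
move=> /nbhs_ballP[d /= d0 hd]; exists d => // h hh.
have [->|h0] := eqVneq h 0; first by rewrite addr0 subrr mulr0 subrr normr0 mulr0.
have := hd h; rewrite -ball_normE /= sub0r normrN => /(_ hh h0).
rewrite /GRing.scale /= mulr1 [h + x]addrC => hk.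
have -> : f (x + h) - f x - l * h = - (l - h^-1 * (f (x + h) - f x)) * h.
  by field.
by rewrite normrM normrN ler_wpM2r.
Qed.

(** The derivative at 0, from those of [expR], [cos] and [sin]; the functional equation [cexpD] then
    gives it everywhere. *)
Lemma cexp_small e : 0 < e ->
  exists2 d, 0 < d & forall w, cabs w < d -> cabs (cexp w - 1 - w) <= e * cabs w.
Proof.
move=> e0; have e8 : 0 < Num.min (e / 8) 1 by rewrite lt_min ltr01 divr_gt0.
have [d1 d10 h1] := is_derive_small (is_derive_expR 0) e8.
have [d2 d20 h2] := is_derive_small (is_derive_cos 0) e8.
have [d3 d30 h3] := is_derive_small (is_derive_sin 0) e8.
exists (Num.min (Num.min d1 d2) (Num.min d3 (Num.min 1 (e / 8)))).
  by rewrite !lt_min d10 d20 d30 ltr01 divr_gt0//.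
move=> w; rewrite !lt_min => /andP[/andP[w1 w2] /andP[w3 /andP[w4 w5]]].
have rw := Re_le_cabs w; have iw := Im_le_cabs w.
have {}h1 := h1 _ (le_lt_trans rw w1).
have {}h2 := h2 _ (le_lt_trans iw w2).
have {}h3 := h3 _ (le_lt_trans iw w3).
move: h1 h2 h3; rewrite !add0r expR0 cos0 sin0 oppr0 ?mul0r ?subr0 ?addr0 ?mul1r.
set x := complex.Re w in rw *; set y := complex.Im w in iw *.
have m1 : Num.min (e / 8) 1 <= e / 8 by rewrite ge_min lexx.
have m2 : Num.min (e / 8) 1 <= 1 by rewrite ge_min lexx orbT.
set m := Num.min _ _ in m1 m2 *; move=> h1 h2 h3.
have Wge := cabs_ge0 w.
set W := cabs w in rw iw w4 w5 Wge *.
have m0 : 0 <= m by rewrite ltW.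
have k1 : `|expR x - 1 - x| <= m * W by rewrite (le_trans h1)// ler_wpM2l.
have k2 : `|cos y - 1| <= m * W by rewrite (le_trans h2)// ler_wpM2l.
have k3 : `|sin y - y| <= m * W by rewrite (le_trans h3)// ler_wpM2l.
have mW : m * W <= e / 8 * W by rewrite ler_wpM2r.
have mW1 : m * W <= W by rewrite ler_piMl.
have ex : `|expR x - 1| <= 2 * W.
  have -> : expR x - 1 = (expR x - 1 - x) + x by ring.
  rewrite (le_trans (ler_normD _ _))//; lra.
have ex3 : `|expR x| <= 3.
  have -> : expR x = (expR x - 1) + 1 by ring.
  rewrite (le_trans (ler_normD _ _))// normr1; lra.
rewrite (le_trans (cabs_le_ReIm _))//.
have -> : complex.Re (cexp w - 1 - w) = (expR x - 1 - x) * cos y + (1 + x) * (cos y - 1).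
  by rewrite /x /y /cexp; case: (w) => ? ? /=; ring.
have -> : complex.Im (cexp w - 1 - w) = expR x * (sin y - y) + (expR x - 1) * y.
  by rewrite /x /y /cexp; case: (w) => ? ? /=; ring.
have b1 : `|(expR x - 1 - x) * cos y| <= e / 8 * W.
  rewrite normrM -[leRHS]mulr1 ler_pM//; first exact: le_trans mW.
  by rewrite ler_norml cos_geN1 cos_le1.
have b2 : `|(1 + x) * (cos y - 1)| <= 2 * (e / 8 * W).
  rewrite normrM ler_pM//; last exact: le_trans mW.
  by rewrite (le_trans (ler_normD _ _))// normr1; lra.
have b3 : `|expR x * (sin y - y)| <= 3 * (e / 8 * W).
  by rewrite normrM ler_pM//; exact: le_trans mW.
have b4 : `|(expR x - 1) * y| <= 2 * (e / 8 * W).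
  have q : W * W <= e / 8 * W by rewrite ler_wpM2r// ltW.
  by rewrite normrM; have := ler_pM (normr_ge0 _) (normr_ge0 _) ex iw; lra.
have := ler_normD ((expR x - 1 - x) * cos y) ((1 + x) * (cos y - 1)).
have := ler_normD (expR x * (sin y - y)) ((expR x - 1) * y).
lra.
Qed.

Lemma cdiff_cexp p : cdiff cexp p.
Proof.
exists (cexp p); exists (fun s => if s == p then cexp p else (cexp s - cexp p) / (s - p)).
split; first by rewrite eqxx.
- move=> e e0; rewrite eqxx; have p0 : 0 < cabs (cexp p) by rewrite cabs_gt0 cexp_neq0.
  have [d d0 hd] := cexp_small (divr_gt0 (divr_gt0 e0 p0) (ltr0Sn R 1)).
  apply/cnbP; exists d => // s sp; case: eqVneq => [_|nsp]; first by rewrite subrr cabs0.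
  have sp0 : s - p != 0 by rewrite subr_eq0.
  have {1}-> : s = p + (s - p) by ring.
  rewrite cexpD.
  have -> : (cexp p * cexp (s - p) - cexp p) / (s - p) - cexp p =
     cexp p * ((cexp (s - p) - 1 - (s - p)) / (s - p)) by field.
  rewrite cabsM cabsf -ltr_pdivlMl// [_^-1 * e]mulrC.
  rewrite (le_lt_trans (y := e / cabs (cexp p) / 2))//.
    by rewrite ler_pdivrMr ?cabs_gt0// hd.
  by rewrite ltr_pdivrMr// ltr_pMr ?divr_gt0// ltr1n.
- apply: nearW => s; case: eqVneq => [->|nsp]; first by rewrite subrr mulr0 addr0.
  by field; rewrite subr_eq0.
Qed.

End ComplexExp.

(** * Circle integrals and compactness in the plane *)

Section Cauchy.
Context {R : realType}.
Implicit Types (g k : R[i] -> R[i]) (s : R[i]) (r x y e M T : R).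

Definition ccirc r y : R[i] := r%:C * cexp (0 +i* y).

Lemma cabs_ccirc r y : 0 <= r -> cabs (ccirc r y) = r.
Proof. by move=> r0; rewrite cabsM cabsR cabs_cexp expR0 mulr1 ger0_norm. Qed.

Lemma rcont_ccirc r y : rcont (ccirc r) y.
Proof.
apply: rcontM; first exact: rcont_cst.
apply: rcont_comp; first exact: rcont_vline.
exact/cdiff_ccont/cdiff_cexp.
Qed.

(** Not divided by the length [pi *+ 2], hence the factor [(pi *+ 2)%:C] in the Cauchy formulas
    below. *)
Definition cmean g r : R[i] := cint (fun y => g (ccirc r y)) 0 (pi *+ 2).

Lemma twopi_gt0 : 0 < pi *+ 2 :> R.
Proof. by rewrite pmulrn_lgt0// pi_gt0. Qed.

Lemma rcont_circ g r y : 0 <= r -> (forall s, cabs s = r -> ccont g s) ->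
  rcont (fun y => g (ccirc r y)) y.
Proof. by move=> r0 gc; apply: rcont_comp (rcont_ccirc _ _) _; apply: gc; exact: cabs_ccirc. Qed.

Lemma cmeanD g k r : 0 <= r -> (forall s, cabs s = r -> ccont g s) ->
  (forall s, cabs s = r -> ccont k s) ->
  cmean (fun s => g s + k s) r = cmean g r + cmean k r.
Proof. by move=> r0 gc kc; apply: cintD => y _; exact: rcont_circ. Qed.

Lemma cmeanZ c g r : 0 <= r -> (forall s, cabs s = r -> ccont g s) ->
  cmean (fun s => c * g s) r = c * cmean g r.
Proof. by move=> r0 gc; apply: cintZ => y _; exact: rcont_circ. Qed.

Lemma eq_cmean g k r : 0 <= r -> (forall s, cabs s = r -> g s = k s) -> cmean g r = cmean k r.
Proof. by move=> r0 gk; apply: eq_cint => y _; rewrite gk// cabs_ccirc. Qed.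

Lemma cmean_bound g r M : 0 <= r -> (forall s, cabs s = r -> ccont g s) ->
  (forall s, cabs s = r -> cabs (g s) <= M) -> cabs (cmean g r) <= 2 * M * (pi *+ 2).
Proof.
move=> r0 gc gM; rewrite -[X in _ * X](subr0 (pi *+ 2)).
apply: cint_bound; first exact/ltW/twopi_gt0.
- by move=> y _; exact: rcont_circ.
- by move=> y _; apply: gM; exact: cabs_ccirc.
Qed.

Lemma cmean_cst c r : cmean (fun=> c) r = (pi *+ 2)%:C * c.
Proof.
rewrite /cmean /cint !Rintegral_cst//= lebesgue_measure_itv /= lte_fin twopi_gt0.
rewrite -EFinB /= subr0; case: c => u v /=.
by apply/eqP; rewrite eq_complex /=; apply/andP; split; apply/eqP; ring.
Qed.

(** The exponential maps a rectangle of height [pi *+ 2] onto the annulus. Goursat applies to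
    [g o cexp]: the horizontal sides cancel by periodicity and the vertical ones are the two circle
    integrals. *)
Lemma cmean_const g r1 r2 : 0 < r1 -> r1 <= r2 ->
  (forall s, r1 <= cabs s <= r2 -> cdiff g s) -> cmean g r1 = cmean g r2.
Proof.
move=> r10 r12 gd; have r20 : 0 < r2 := lt_le_trans r10 r12.
have lnr : ln r1 <= ln r2 by rewrite ler_ln ?posrE.
pose f w := g (cexp w).
have fd w : in_rect (ln r1) 0 (ln r2 - ln r1) (pi *+ 2) w -> cdiff f w.
  move=> [h _]; apply: cdiff_comp; first exact: cdiff_cexp.
  apply: gd; rewrite cabs_cexp.
  by rewrite -[X in X <= _ <= _](lnK r10) -[X in _ <= _ <= X](lnK r20) !ler_expR; lra.
have := goursat (f := f) _ (ltW twopi_gt0) fd; rewrite subr_ge0 => /(_ lnr).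
rewrite /rect_int [cint _ (ln r1) _](_ : _ = 0); last first.
  rewrite -[RHS](mul0r (cint (fun=> 0) (ln r1) (ln r1 + (ln r2 - ln r1)))).
  rewrite -cintZ; last by move=> *; exact: rcont_cst.
  by apply: eq_cint => u _; rewrite mulr0 /f cexp_periodic subrr.
have h1 : ln r1 + (ln r2 - ln r1) = ln r2 by ring.
rewrite h1 !add0r => /eqP; rewrite mulf_eq0 => /orP[/eqP[/eqP]|/eqP h]; first by rewrite oner_eq0.
have circE r y : 0 < r -> f (ln r +i* y) = g (ccirc r y).
  by move=> r0; rewrite /f /ccirc cexp_ReIm lnK.
have e2 : cint (fun v => f (ln r2 +i* v) - f (ln r1 +i* v)) 0 (pi *+ 2) = cmean (fun s => g s + (-1) * g s) r2 + (cmean g r2 - cmean g r1).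
  have gc1 s : cabs s = r1 -> ccont g s by move=> sr; apply/cdiff_ccont/gd; lra.
  have gc2 s : cabs s = r2 -> ccont g s by move=> sr; apply/cdiff_ccont/gd; lra.
  rewrite (@eq_cint _ _ (fun v => g (ccirc r2 v) + (-1) * g (ccirc r1 v))); last first.
    by move=> v _; rewrite !circE// mulN1r.
  rewrite cintD ?cintZ.
  - rewrite cmeanD ?cmeanZ// ?ltW//; first by rewrite /cmean; ring.
    by move=> s h'; apply: climM; [exact: clim_cst|exact: gc2].
  - by move=> y _; apply: rcont_circ => //; exact: ltW.
  - by move=> y _; apply: rcont_circ => //; exact: ltW.
  - by move=> y _; apply: rcontM; [exact: rcont_cst|apply: rcont_circ => //; exact: ltW].
have gc2 s : cabs s = r2 -> ccont g s by move=> sr; apply/cdiff_ccont/gd; lra.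
move: e2; rewrite h cmeanD ?cmeanZ ?ltW//.
  by move=> /esym/eqP; rewrite mulN1r subrr add0r subr_eq0 => /eqP.
by move=> s h'; apply: climM; [exact: clim_cst|exact: gc2].
Qed.

(** Compactness in filter form: what holds locally from some rank on holds uniformly from some rank
    on. The local hypothesis ranges over the whole plane, so that closedness of [A] is handled by
    the callers, at the points outside [A]. *)
Lemma ccover (A : set R[i]) T (P : nat -> R[i] -> Prop) :
  (forall s, A s -> cabs s <= T) ->
  (forall s, exists e N, 0 < e /\ forall n s', (N <= n)%N -> cabs (s' - s) < e -> A s' -> P n s') ->
  exists N, forall n s, (N <= n)%N -> A s -> P n s.
Proof.
move=> AT loc.
have cpt : compact (`[-T, T]%classic `*` `[-T, T]%classic : set (R * R)).
  by apply: compact_setX; exact: segment_compact.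
have := (compact_near_coveringP _).1 cpt nat \oo
  (fun n q => A (q.1 +i* q.2) -> P n (q.1 +i* q.2)) _.
case.
  move=> [x y] _; have [e [N [e0 h]]] := loc (x +i* y).
  exists ([set q : R * R | ball x (e / 2) q.1 /\ ball y (e / 2) q.2], [set n | (N <= n)%N]).
    split => /=; last by exists N.
    exists (ball x (e / 2), ball y (e / 2)) => /=; last by case=> u v [].
    by split; apply: nbhsx_ballx; rewrite divr_gt0.
  case=> [[u v] n] /= [[h1 h2] Nn]; apply: h => //.
  have -> : u +i* v - (x +i* y) = (u - x) +i* (v - y) by [].
  rewrite (le_lt_trans (cabs_le_ReIm _))//= (splitr e) ltrD// distrC//.
move=> N _ hN; exists N => n [u v] Nn Auv.
apply: (hN n Nn (u, v)) => //=; have := AT _ Auv => hT.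
have := le_trans (Re_le_cabs _) hT; have := le_trans (Im_le_cabs _) hT => /=.
by rewrite !ler_norml => h1 h2; split; rewrite /= in_itv.
Qed.

Lemma cabs_open_lt s r : cabs s < r -> exists2 e, 0 < e & forall s', cabs (s' - s) < e -> cabs s' < r.
Proof.
move=> sr; exists (r - cabs s); first by rewrite subr_gt0.
by move=> s' h; have := cabs_dist s' s; lra.
Qed.

Lemma cabs_open_gt s r : r < cabs s -> exists2 e, 0 < e & forall s', cabs (s' - s) < e -> r < cabs s'.
Proof.
move=> sr; exists (cabs s - r); first by rewrite subr_gt0.
by move=> s' h; have := cabs_dist s s'; rewrite cabsC; lra.
Qed.

Lemma ccover_annulus r1 r2 (P : nat -> R[i] -> Prop) :
  (forall s, r1 <= cabs s <= r2 -> exists e N, 0 < e /\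
     forall n s', (N <= n)%N -> cabs (s' - s) < e -> r1 <= cabs s' <= r2 -> P n s') ->
  exists N, forall n s, (N <= n)%N -> r1 <= cabs s <= r2 -> P n s.
Proof.
move=> loc; apply: (ccover (A := [set s | r1 <= cabs s <= r2]) (T := r2)) => [s /= /andP[]//|s].
have [h1|h1] := leP r1 (cabs s); last first.
  have [e e0 he] := cabs_open_lt h1; exists e, 0%N; split => // n s' _ /he /=.
  by rewrite ltNge => /negbTE -> .
have [h2|h2] := leP (cabs s) r2; first by apply: loc; rewrite h1.
have [e e0 he] := cabs_open_gt h2; exists e, 0%N; split => // n s' _ /he /=.
by rewrite andbC ltNge => /negbTE -> .
Qed.

Lemma cbounded_annulus r1 r2 g : (forall s, r1 <= cabs s <= r2 -> ccont g s) ->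
  exists2 M, 0 < M & forall s, r1 <= cabs s <= r2 -> cabs (g s) <= M.
Proof.
move=> gc.
have [N hN] : exists N, forall n s, (N <= n)%N -> r1 <= cabs s <= r2 -> cabs (g s) <= n%:R.
  apply: ccover_annulus => s /gc /(_ 1 ltr01) /cnbP[e e0 he].
  exists e, (Num.bound (cabs (g s) + 1)); split => // n s' Nn /he h _.
  have : cabs (g s) + 1 < (Num.bound (cabs (g s) + 1))%:R.
    by apply: archi_boundP; rewrite addr_ge0.
  have := cabs_dist (g s') (g s).
  have : (Num.bound (cabs (g s) + 1))%:R <= n%:R :> R by rewrite ler_nat.
  lra.
exists (N%:R + 1); first by rewrite ltr_wpDl.
by move=> s hs; rewrite (le_trans (hN N s _ hs))// lerDl.
Qed.

End Cauchy.

(** * Cauchy's formula in an annulus *)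

Section CauchyFormula.
Context {R : realType}.
Implicit Types (g : R[i] -> R[i]) (s p : R[i]) (r y e M : R).

(** On a circle about 0, [ds / (s - p)] is [i] times [s / (s - p)] times the angle element: this is
    the Cauchy kernel for [cmean]. *)
Definition ckernel p s : R[i] := s / (s - p).

Lemma csub_neq0 s p : cabs s != cabs p -> s - p != 0.
Proof. by apply: contraNneq => /subr0_eq ->. Qed.

Lemma cabs_kernel p s r : cabs s = r -> 0 < r -> cabs p != r ->
  cabs (ckernel p s) <= r / `|r - cabs p|.
Proof.
move=> sr r0 pr; rewrite /ckernel cabsf sr; apply: (ler_wpM2l (ltW r0)); rewrite lef_pV2 ?posrE.
- by rewrite ler_norml; have := cabs_dist s p; have := cabs_dist p s; rewrite cabsC sr; lra.
- by rewrite cabs_gt0 csub_neq0// sr eq_sym.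
- by rewrite normr_gt0 subr_eq0 eq_sym.
Qed.

Lemma cdiff_kernel p s : s != p -> cdiff (ckernel p) s.
Proof.
move=> sp; apply: cdiff_div; [by rewrite subr_eq0|exact: cdiff_id|].
by apply: cdiffB; [exact: cdiff_id|exact: cdiff_cst].
Qed.

Lemma eps_eq0 (c : R[i]) : (forall e, 0 < e -> cabs c <= e) -> c = 0.
Proof.
move=> h; apply/eqP; rewrite -cabs_eq0 eq_le cabs_ge0 andbT leNgt; apply/negP => c0.
have := h (cabs c / 2) (divr_gt0 c0 (ltr0Sn R 1)); lra.
Qed.

Lemma archi_inv e : 0 < e -> exists N, forall n, (N <= n)%N -> n.+1%:R^-1 < e.
Proof.
move=> e0; exists (Num.bound e^-1) => n Nn.
rewrite invf_plt ?posrE ?ltr0n// (lt_le_trans (archi_boundP _))//.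
  by rewrite invr_ge0 ltW.
by rewrite ler_nat (leq_trans Nn).
Qed.

(** The circle may be shrunk towards 0, where the kernel tends to 0. *)
Lemma kernel_mean_in p r : 0 < r -> r < cabs p -> cmean (ckernel p) r = 0.
Proof.
move=> r0 rp; apply: eps_eq0 => e e0.
have P0 := @twopi_gt0 R; set P := pi *+ 2 in P0.
pose r' := Num.min r (Num.min (cabs p / 2) (e * cabs p / (4 * P))).
have p0 : 0 < cabs p by lra.
have r'0 : 0 < r' by rewrite !lt_min r0 !divr_gt0 ?mulr_gt0.
have r'r : r' <= r by rewrite ge_min lexx.
have r'p : r' <= cabs p / 2 by rewrite !ge_min lexx orbT.
have r'e : r' <= e * cabs p / (4 * P) by rewrite !ge_min lexx !orbT.
rewrite -(cmean_const r'0 r'r); last first.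
  by move=> s hs; apply: cdiff_kernel; apply: contraTneq rp => <-; rewrite -leNgt; lra.
have hne s : cabs s = r' -> s != p by move=> sr; apply/eqP => sp; move: sr; rewrite sp; lra.
have := @cmean_bound R (ckernel p) r' (r' / `|r' - cabs p|) (ltW r'0).
move=> /(_ (fun s sr => cdiff_ccont (cdiff_kernel (hne s sr)))) h.
apply: le_trans (h _) _ => [s sr|]; first by apply: cabs_kernel => //; rewrite gt_eqF//; lra.
have -> : `|r' - cabs p| = cabs p - r' by rewrite distrC ger0_norm//; lra.
rewrite -/P mulrAC mulrA ler_pdivrMr; last lra.
move: r'e; rewrite ler_pdivlMr ?mulr_gt0// => r'e.
have : e * (cabs p / 2) <= e * (cabs p - r') by rewrite ler_pM2l//; lra.
lra.
Qed.

(** The circle may be enlarged, and the kernel tends to 1 at infinity; [r'] makes [|p| / (r' - |p|)]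
    small. *)
Lemma kernel_mean_out p r : cabs p < r -> cmean (ckernel p) r = (pi *+ 2)%:C.
Proof.
move=> pr; have r0 : 0 < r := le_lt_trans (cabs_ge0 p) pr.
apply/eqP; rewrite -subr_eq0; apply/eqP; apply: eps_eq0 => e e0.
have P0 := @twopi_gt0 R.
have p0 := cabs_ge0 p.
pose r' := r + cabs p + 2 * (pi *+ 2) * cabs p / e.
have q0 : 0 <= 2 * (pi *+ 2) * cabs p / e by rewrite !mulr_ge0 ?invr_ge0 ?(ltW e0) ?(ltW P0).
have rr' : r <= r' by rewrite /r'; lra.
have r'0 : 0 < r' by lra.
rewrite (cmean_const r0 rr'); last first.
  by move=> s hs; apply: cdiff_kernel; apply: contraTneq pr => <-; rewrite -leNgt; lra.
have hne s : cabs s = r' -> s != p by move=> sr; apply/eqP => sp; move: sr; rewrite sp; lra.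
have hc s : cabs s = r' -> ccont (ckernel p) s.
  by move=> sr; apply/cdiff_ccont/cdiff_kernel/hne.
have -> : cmean (ckernel p) r' - (pi *+ 2)%:C = cmean (fun s => ckernel p s + -1) r'.
  rewrite cmeanD ?cmean_cst ?ltW//; first by rewrite mulrN1.
  by move=> *; exact: clim_cst.
have r'p : 0 < r' - cabs p by rewrite /r'; lra.
apply: le_trans (cmean_bound (M := cabs p / (r' - cabs p)) _ _ _) _.
- exact: ltW.
- by move=> s sr; apply: climD; [exact: hc|exact: clim_cst].
- move=> s sr; have sp : s - p != 0 by rewrite subr_eq0 hne.
  have -> : ckernel p s + -1 = p / (s - p) by rewrite /ckernel; field.
  rewrite cabsf ler_wpM2l// lef_pV2 ?posrE ?cabs_gt0//.
  by have := cabs_dist s p; rewrite sr.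
- rewrite mulrAC mulrA ler_pdivrMr//.
  have : 2 * (pi *+ 2) * cabs p / e <= r' - cabs p by rewrite /r'; lra.
  by rewrite ler_pdivrMr//; lra.
Qed.

(** The function [K], which is [s] times the difference quotient of [g] at [p], is continuous at [p]
    and differentiable elsewhere. Its circle integrals are constant on either side of the circle
    through [p], and the two constants agree by uniform continuity near that circle; this takes the
    place of a removable singularity theorem. *)
Lemma cauchy_annulus g r1 r2 p : 0 < r1 -> r1 < cabs p -> cabs p < r2 ->
  (forall s, r1 <= cabs s <= r2 -> cdiff g s) ->
  (pi *+ 2)%:C * g p = cmean (fun s => g s * ckernel p s) r2 - cmean (fun s => g s * ckernel p s) r1.
Proof.
move=> r10 r1p pr2 gd; have P0 := @twopi_gt0 R.
have gc s : r1 <= cabs s <= r2 -> ccont g s by move=> /gd/cdiff_ccont.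
have pin : r1 <= cabs p <= r2 by rewrite !ltW.
have [l [phi [phil phic hphi]]] := gd p pin.
pose K s := if s == p then p * phi p else (g s + - g p) * ckernel p s.
have Kd s : r1 <= cabs s <= r2 -> s != p -> cdiff K s.
  move=> hs sp; apply: (cdiff_near (f := fun s => (g s + - g p) * ckernel p s)).
    have sp0 : 0 < cabs (s - p) by rewrite cabs_gt0 subr_eq0.
    apply/cnbP; exists (cabs (s - p)) => // s' hs'; rewrite /K; case: eqVneq => // s'p.
    by move: hs'; rewrite s'p cabsC ltxx.
  apply: cdiffM; last exact: cdiff_kernel.
  by apply: cdiffD; [exact: gd|exact: cdiff_cst].
have Kp : ccont K p.
  have h : clim (cnb p) (fun s => s * phi s) (p * phi p) by apply: climM => //; exact: cnb_clim.
  rewrite /ccont {2}/K eqxx; apply: clim_near_eq h.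
  move: hphi; apply: filterS => s hs; rewrite /K; case: eqVneq => [->//|sp].
  by rewrite hs /ckernel; field; rewrite subr_eq0.
have Kc s : r1 <= cabs s <= r2 -> ccont K s.
  by move=> hs; have [->|sp] := eqVneq s p; [|apply/cdiff_ccont/Kd].
have meanK r : r1 <= r <= r2 -> r != cabs p ->
    cmean K r = cmean (fun s => g s * ckernel p s) r - g p * cmean (ckernel p) r.
  move=> hr rp; have r0 : 0 < r by lra.
  have hne s : cabs s = r -> s != p by move=> sr; apply: contraNneq rp => <-; rewrite sr.
  have kc s : cabs s = r -> ccont (ckernel p) s by move=> /hne sp; apply/cdiff_ccont/cdiff_kernel.
  have gc' s : cabs s = r -> ccont g s by move=> sr; apply: gc; rewrite sr.
  rewrite -mulNr -cmeanZ ?ltW// -cmeanD ?ltW//.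
  - apply: eq_cmean; first exact: ltW.
    by move=> s /hne sp; rewrite /K (negbTE sp) mulrDl.
  - by move=> s sr; apply: climM; [exact: gc'|exact: kc].
  - by move=> s sr; apply: climM; [exact: clim_cst|exact: kc].
have KE : cmean K r1 = cmean K r2.
  clear meanK Kp hphi phic; clearbody K.
  apply/eqP; rewrite -subr_eq0; apply/eqP; apply: eps_eq0 => e e0.
  pose e' := e / (2 * (pi *+ 2)).
  have e'0 : 0 < e' by rewrite divr_gt0 ?mulr_gt0.
  have p0 : 0 < cabs p by lra.
  (* Uniform continuity of [K] under radial perturbations of the circle [|s| = |p|], by compactness.
     The circles compared below have radii [|p| (1 - u)] and [|p| (1 + u)]. *)
  have [N hN] : exists N, forall n s, (N <= n)%N -> cabs p <= cabs s <= cabs p ->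
      forall t : R, `|t| <= n.+1%:R^-1 -> cabs (K (s * (1 + t)%:C) - K s) < e' / 2.
    apply: ccover_annulus => s hs.
    have sp : cabs s = cabs p by lra.
    have hs12 : r1 <= cabs s <= r2 by lra.
    have /cnbP[d d0 hd] := Kc s hs12 (e' / 4) (divr_gt0 e'0 (ltr0Sn _ 3)).
    have [N hN] := archi_inv (divr_gt0 (divr_gt0 d0 p0) (ltr0Sn R 1)).
    exists (d / 2), N; split; first by rewrite divr_gt0.
    move=> n s' Nn hs' hs'p t ht.
    have s'p : cabs s' = cabs p by lra.
    have h1 : cabs (s' - s) < d by lra.
    have h2 : cabs (s' * (1 + t)%:C - s) < d.
      have -> : s' * (1 + t)%:C - s = (s' - s) + s' * t%:C.
        by rewrite rmorphD /=; ring.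
      rewrite (le_lt_trans (cabsD _ _))// cabsM cabsR s'p.
      have := hN n Nn; rewrite ltr_pdivlMr// ltr_pdivlMr// => h3.
      have : cabs p * `|t| <= cabs p * n.+1%:R^-1 by rewrite ler_wpM2l.
      move: h3 hs'; set u := n.+1%:R^-1; set v := `|t|; set w := cabs (s' - s).
      set P := cabs p; clear; lra.
    have -> : K (s' * (1 + t)%:C) - K s' = (K (s' * (1 + t)%:C) - K s) - (K s' - K s) by ring.
    rewrite (le_lt_trans (cabsB _ _))//.
    have := hd _ h1; have := hd _ h2; lra.
  have d10 : 0 < (cabs p - r1) / cabs p by rewrite divr_gt0// subr_gt0.
  have d20 : 0 < (r2 - cabs p) / cabs p by rewrite divr_gt0// subr_gt0.
  have [N1 hN1] := archi_inv d10; have [N2 hN2] := archi_inv d20.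
  pose n := maxn N (maxn N1 N2).
  have {}hN1 : n.+1%:R^-1 < (cabs p - r1) / cabs p by apply: hN1; rewrite !leq_max leqnn !orbT.
  have {}hN2 : n.+1%:R^-1 < (r2 - cabs p) / cabs p by apply: hN2; rewrite !leq_max leqnn !orbT.
  have {}hN := hN n _ (leq_maxl _ _).
  move: hN1 hN2 hN; rewrite !ltr_pdivlMr//; set u := n.+1%:R^-1 => hN1 hN2 hN.
  have u0 : 0 < u by rewrite invr_gt0 ltr0n.
  have up0 : 0 < u * cabs p by rewrite mulr_gt0.
  have E1 : cmean K r1 = cmean K (cabs p * (1 - u)).
    apply: cmean_const => //; first lra.
    move=> s hs; apply: Kd; first lra.
    by apply/eqP => sp; move: hs; rewrite sp; lra.
  have E2 : cmean K (cabs p * (1 + u)) = cmean K r2.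
    apply: cmean_const; [lra|lra|].
    move=> s hs; apply: Kd; first lra.
    by apply/eqP => sp; move: hs; rewrite sp; lra.
  rewrite E1 -E2.
  have circc v y : 0 <= cabs p * (1 + v) -> r1 <= cabs p * (1 + v) <= r2 ->
      rcont (fun y => K (ccirc (cabs p * (1 + v)) y)) y.
    by move=> v0 hv; apply: rcont_circ => // s sr; apply: Kc; rewrite sr.
  have -> : cmean K (cabs p * (1 - u)) - cmean K (cabs p * (1 + u)) =
      cint (fun y => K (ccirc (cabs p * (1 - u)) y) + -1 * K (ccirc (cabs p * (1 + u)) y)) 0 (pi *+ 2).
    rewrite cintD ?cintZ ?mulN1r//.
    - by move=> y _; apply: circc; lra.
    - by move=> y _; apply: (circc (- u)); lra.
    - by move=> y _; apply: rcontM; [exact: rcont_cst|apply: circc; lra].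
  have -> : e = 2 * e' * (pi *+ 2 - 0).
    by rewrite subr0 /e'; move: (pi *+ 2) P0 => P P0; field; rewrite gt_eqF.
  apply: cint_bound; first exact: ltW.
    move=> y _; apply: rcontD; first by apply: (circc (- u)); lra.
    by apply: rcontM; [exact: rcont_cst|apply: circc; lra].
  move=> y _; rewrite mulN1r.
  have cE v : ccirc (cabs p * (1 + v)) y = ccirc (cabs p) y * (1 + v)%:C.
    by rewrite /ccirc rmorphM /=; ring.
  have hp : cabs p <= cabs (ccirc (cabs p) y) <= cabs p by rewrite cabs_ccirc ?lexx.
  rewrite (cE u) (cE (- u)).
  have h1 := hN _ hp u; have h2 := hN _ hp (- u).
  rewrite normrN ger0_norm ?lexx ?ltW// in h1 h2.
  have {}h1 := h1 isT; have {}h2 := h2 isT.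
  set S := ccirc _ y in h1 h2 *.
  have -> : K (S * (1 - u)%:C) - K (S * (1 + u)%:C) =
     (K (S * (1 - u)%:C) - K S) - (K (S * (1 + u)%:C) - K S) by ring.
  rewrite (le_trans (cabsB _ _))//; lra.
have m1 : cmean K r1 = cmean (fun s => g s * ckernel p s) r1.
  by rewrite meanK ?kernel_mean_in ?mulr0 ?subr0 ?lt_eqF// lexx /=; (clear - pin; lra).
have m2 : cmean K r2 = cmean (fun s => g s * ckernel p s) r2 - g p * (pi *+ 2)%:C.
  by rewrite meanK ?kernel_mean_out ?gt_eqF// lexx andbT; (clear - pin; lra).
by move: KE; rewrite m1 m2 => ->; ring.
Qed.

End CauchyFormula.

(** * Maximum principle, three circles, Liouville and Taylor bounds *)

Section CauchyConsequences.
Context {R : realType}.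
Implicit Types (g k : R[i] -> R[i]) (s p l : R[i]) (r x y e M T : R).

Lemma bernoulli_le x n : 0 <= x -> 1 + n%:R * x <= (1 + x) ^+ n.
Proof.
move=> x0; elim: n => [|n ih]; first by rewrite mul0r addr0 expr0.
rewrite exprS (le_trans _ (ler_wpM2l _ ih))//; last lra.
have : 0 <= n%:R * (x * x) by rewrite !mulr_ge0.
rewrite -natr1; lra.
Qed.

(** A constant in front of an estimate valid for all powers disappears. Applied to [g ^+ n], this
    turns the lossy Cauchy bounds into the sharp maximum principle. *)
Lemma le_of_powers x y C : 0 <= x -> 0 <= y -> (forall n, x ^+ n <= C * y ^+ n) -> x <= y.
Proof.
move=> x0 y0 h; rewrite leNgt; apply/negP => yx.
have [y00|yn0] := eqVneq y 0.
  by have := h 1%N; rewrite !expr1 y00 mulr0; lra.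
have {}y0 : 0 < y by rewrite lt_def yn0.
pose t := x / y - 1.
have t0 : 0 < t by rewrite subr_gt0 ltr_pdivlMr// mul1r.
have {}h n : 1 + n%:R * t <= C.
  rewrite (le_trans (bernoulli_le n (ltW t0)))// /t addrC subrK expr_div_n.
  by rewrite ler_pdivrMr ?exprn_gt0.
have C0 : 0 <= C by have := h 0%N; rewrite mul0r addr0; lra.
have := archi_boundP (divr_ge0 C0 (ltW t0)); rewrite ltr_pdivrMr//.
have := h (Num.bound (C / t)); lra.
Qed.

Lemma twopi_cancel (c : R[i]) B : cabs ((pi *+ 2)%:C * c) <= 2 * B * (pi *+ 2) -> cabs c <= 2 * B.
Proof.
have P0 := @twopi_gt0 R.
by rewrite cabsM cabsR (ger0_norm (ltW P0)) mulrC ler_pM2r.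
Qed.

Lemma cont_kernel_mul g p r s : cabs s = r -> cabs p != r -> ccont g s ->
  ccont (fun s => g s * ckernel p s) s.
Proof.
move=> sr pr gc; apply: climM => //; apply/cdiff_ccont/cdiff_kernel.
by apply: contraNneq pr => <-; rewrite sr.
Qed.

Lemma kernel_mul_bound g p r M s : cabs s = r -> 0 < r -> cabs p != r -> cabs (g s) <= M ->
  cabs (g s * ckernel p s) <= M * (r / `|r - cabs p|).
Proof. by move=> sr r0 pr gM; rewrite cabsM ler_pM// cabs_kernel. Qed.

Lemma mp_annulus g r1 r2 p M : 0 < r1 -> r1 < cabs p -> cabs p < r2 ->
  (forall s, r1 <= cabs s <= r2 -> cdiff g s) ->
  (forall s, cabs s = r1 -> cabs (g s) <= M) ->
  (forall s, cabs s = r2 -> cabs (g s) <= M) -> cabs (g p) <= M.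
Proof.
move=> r10 r1p pr2 gd g1 g2.
have M0 : 0 <= M by apply: le_trans (g1 r1%:C _) => //; rewrite cabsR ger0_norm ?ltW.
have r20 : 0 < r2 by lra.
apply: (@le_of_powers _ _ (2 * (r2 / `|r2 - cabs p| + r1 / `|r1 - cabs p|))) => // n.
rewrite -cabsX -[leRHS]mulrA; apply: twopi_cancel.
rewrite (@cauchy_annulus R (fun s => g s ^+ n) r1 r2)//; last first.
  by move=> s hs; apply: cdiffX; exact: gd.
have q2 : cabs p != r2 by rewrite lt_eqF.
have q1 : cabs p != r1 by rewrite gt_eqF.
have hb r : 0 < r -> cabs p != r -> (forall s, cabs s = r -> cabs (g s) <= M) ->
   r1 <= r <= r2 ->
   cabs (cmean (fun s => g s ^+ n * ckernel p s) r) <= 2 * (M ^+ n * (r / `|r - cabs p|)) * (pi *+ 2).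
  move=> r0 pr gM hr; apply: cmean_bound; first exact: ltW.
  - move=> s sr; apply: (cont_kernel_mul sr) => //.
    by apply/cdiff_ccont/cdiffX/gd; rewrite sr.
  - move=> s sr; apply: (@kernel_mul_bound (fun s => g s ^+ n) p r) => //.
    by rewrite cabsX lerXn2r ?nnegrE// gM.
rewrite (le_trans (cabsB _ _))//.
have c1 : r1 <= r1 <= r2 by lra.
have c2 : r1 <= r2 <= r2 by lra.
apply: le_trans (lerD (hb r2 r20 q2 g2 c2) (hb r1 r10 q1 g1 c1)) _.
by rewrite le_eqVlt; apply/orP; left; apply/eqP; ring.
Qed.

(** The maximum principle for [g s / s ^+ n]. Integral exponents suffice for the Green function:
    rounding the optimal exponent costs a bounded amount, against degrees that tend to infinity. *)
Lemma hadamard g r1 r2 s M1 M2 n : 0 < r1 -> r1 < cabs s -> cabs s < r2 ->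
  (forall s, r1 <= cabs s <= r2 -> cdiff g s) ->
  (forall s, cabs s = r1 -> cabs (g s) <= M1) ->
  (forall s, cabs s = r2 -> cabs (g s) <= M2) ->
  cabs (g s) <= cabs s ^+ n * Num.max (M1 / r1 ^+ n) (M2 / r2 ^+ n).
Proof.
move=> r10 r1s sr2 gd g1 g2.
have s0 : 0 < cabs s by lra.
rewrite mulrC -ler_pdivrMr ?exprn_gt0// -cabsX -cabsf.
have cX r t : cabs t = r -> cabs (t ^+ n) = r ^+ n by move=> <-; rewrite cabsX.
apply: (@mp_annulus (fun s => g s / s ^+ n) r1 r2) => //.
- move=> t ht; apply: cdiff_div; [|exact: gd|apply: cdiffX; exact: cdiff_id].
  by rewrite expf_neq0// -cabs_gt0; lra.
- move=> t tr; rewrite cabsf (cX _ _ tr) le_max; apply/orP; left.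
  by apply: ler_wpM2r; [rewrite invr_ge0 exprn_ge0// ltW|exact: g1].
- move=> t tr; rewrite cabsf (cX _ _ tr) le_max; apply/orP; right.
  by apply: ler_wpM2r; [rewrite invr_ge0 exprn_ge0//; lra|exact: g2].
Qed.

(** The inner circle of [cauchy_annulus] shrinks to 0, where [s * g s] tends to 0. Singularities of
    this kind arise from differences of reciprocals of two functions with simple zeros at 0. *)
Lemma cauchy_punctured g p T : 0 < cabs p -> cabs p < T ->
  (forall s, 0 < cabs s <= T -> cdiff g s) ->
  (forall e, 0 < e -> exists2 d, 0 < d & forall s, 0 < cabs s < d -> cabs (s * g s) <= e) ->
  (pi *+ 2)%:C * g p = cmean (fun s => g s * ckernel p s) T.
Proof.
move=> p0 pT gd g0; have P0 := @twopi_gt0 R.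
apply/eqP; rewrite -subr_eq0; apply/eqP; apply: eps_eq0 => e e0.
have T0 : 0 < T by lra.
pose e' := e * cabs p / (4 * (pi *+ 2)).
have e'0 : 0 < e' by rewrite divr_gt0 ?mulr_gt0.
have [d d0 hd] := g0 _ e'0.
pose r := Num.min (d / 2) (cabs p / 2).
have r0 : 0 < r by rewrite lt_min !divr_gt0.
have rd : r <= d / 2 by rewrite ge_min lexx.
have rp : r <= cabs p / 2 by rewrite ge_min lexx orbT.
have rp' : r < cabs p by lra.
rewrite (@cauchy_annulus R g r T)//; last by move=> s hs; apply: gd; lra.
rewrite addrAC subrr add0r cabsN.
have pr : cabs p != r by rewrite gt_eqF.
apply: le_trans (cmean_bound (M := e' * (2 / cabs p)) _ _ _) _; first exact: ltW.
- move=> s sr; apply: (cont_kernel_mul sr) => //.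
  by apply/cdiff_ccont/gd; rewrite sr; lra.
- move=> s sr; have sp : 0 < cabs (s - p).
    by rewrite cabs_gt0 csub_neq0// sr eq_sym.
  have -> : g s * ckernel p s = (s * g s) / (s - p) by rewrite /ckernel; ring.
  rewrite cabsf; apply: ler_pM => //; first by rewrite invr_ge0.
    by apply: hd; rewrite sr; lra.
  rewrite -[leRHS]invf_div lef_pV2 ?posrE ?divr_gt0//.
  by have := cabs_dist p s; rewrite cabsC sr; lra.
- rewrite /e' le_eqVlt; apply/orP; left; apply/eqP.
  move: (pi *+ 2) P0 => P P0; field.
  by rewrite !gt_eqF.
Qed.

Lemma cdiff_small g : cdiff g 0 ->
  forall e, 0 < e -> exists2 d, 0 < d & forall s, 0 < cabs s < d -> cabs (s * g s) <= e.
Proof.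
move=> /cdiff_ccont g0 e e0.
have h : clim (cnb 0) (fun s => s * g s) (0 * g 0) by apply: climM => //; exact: cnb_clim.
have /cnbP[d d0 hd] := h _ e0; exists d => // s /andP[_ sd].
by have := hd s; rewrite !subr0 mul0r subr0 => /(_ sd)/ltW.
Qed.

Lemma cauchy_disc g p T : cabs p < T -> (forall s, cabs s <= T -> cdiff g s) ->
  (pi *+ 2)%:C * g p = cmean (fun s => g s * ckernel p s) T.
Proof.
move=> pT gd; have p0 := cabs_ge0 p.
(* The punctured formula excludes [p = 0]; there the kernel is 1 and the integral over small circles
   tends to [(pi *+ 2) g 0]. *)
have [->|pn0] := eqVneq p 0; last first.
  apply: cauchy_punctured; rewrite ?cabs_gt0//; last by apply/cdiff_small/gd; rewrite cabs0; lra.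
  by move=> s /andP[_ ?]; exact: gd.
have T0 : 0 < T by lra.
have P0 := @twopi_gt0 R.
have kE r : 0 < r -> cmean (fun s => g s * ckernel 0 s) r = cmean g r.
  move=> r0; apply: eq_cmean; first exact: ltW.
  by move=> s sr; rewrite /ckernel subr0 divff ?mulr1// -cabs_gt0 sr.
rewrite kE//.
apply/eqP; rewrite -subr_eq0; apply/eqP; apply: eps_eq0 => e e0.
have g0c : ccont g 0 by apply/cdiff_ccont/gd; rewrite cabs0 ltW.
have e'0 : 0 < e / (2 * (pi *+ 2)) by rewrite divr_gt0 ?mulr_gt0.
have /cnbP[d d0 hd] := g0c _ e'0.
pose r := Num.min T (d / 2).
have r0 : 0 < r by rewrite lt_min T0 divr_gt0.
have rT : r <= T by rewrite ge_min lexx.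
have rd : r <= d / 2 by rewrite ge_min lexx orbT.
rewrite -(cmean_const r0 rT); last by move=> s /andP[_ ?]; apply: gd.
have gc s : cabs s = r -> ccont g s by move=> sr; apply/cdiff_ccont/gd; rewrite sr.
rewrite -cabsN opprB -mulrN -(cmean_cst _ r) -cmeanD ?(ltW r0)//; last by move=> *; exact: clim_cst.
apply: le_trans (cmean_bound (M := e / (2 * (pi *+ 2))) _ _ _) _; first exact: ltW.
- by move=> s sr; apply: climD; [exact: gc|exact: clim_cst].
- by move=> s sr; rewrite ltW// hd// subr0 sr; lra.
- rewrite le_eqVlt; apply/orP; left; apply/eqP.
  move: (pi *+ 2) P0 => P P0'; field.
  by rewrite !gt_eqF.
Qed.

Lemma mp_disc g p T M : cabs p < T -> (forall s, cabs s <= T -> cdiff g s) ->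
  (forall s, cabs s = T -> cabs (g s) <= M) -> cabs (g p) <= M.
Proof.
move=> pT gd gM; have p0 := cabs_ge0 p; have T0 : 0 < T by lra.
have M0 : 0 <= M by apply: le_trans (gM T%:C _) => //; rewrite cabsR ger0_norm ?ltW.
apply: (@le_of_powers _ _ (2 * (T / `|T - cabs p|))) => // n.
rewrite -cabsX -[leRHS]mulrA; apply: twopi_cancel.
rewrite (@cauchy_disc (fun s => g s ^+ n) p T)//; last by move=> s /gd; exact: cdiffX.
have q : cabs p != T by rewrite lt_eqF.
have -> : 2 * (T / `|T - cabs p| * M ^+ n) * (pi *+ 2) = 2 * (M ^+ n * (T / `|T - cabs p|)) * (pi *+ 2) by ring.
apply: cmean_bound; first exact: ltW.
- by move=> s sr; apply: (cont_kernel_mul sr) => //; apply/cdiff_ccont/cdiffX/gd; rewrite sr.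
- move=> s sr; apply: (@kernel_mul_bound (fun s => g s ^+ n) p T) => //.
  by rewrite cabsX lerXn2r ?nnegrE// gM.
Qed.

Lemma kernel_diff g p1 p2 T M : 0 < T -> cabs p1 <= T / 2 -> cabs p2 <= T / 2 ->
  (forall s, cabs s = T -> ccont g s) ->
  (forall s, cabs s = T -> cabs (g s) <= M) ->
  cabs (cmean (fun s => g s * ckernel p1 s) T - cmean (fun s => g s * ckernel p2 s) T)
    <= 2 * (M * (4 * cabs (p1 - p2) / T)) * (pi *+ 2).
Proof.
move=> T0 p1T p2T gc gM.
have q p s : cabs p <= T / 2 -> cabs s = T -> s - p != 0.
  by move=> pT sT; apply: csub_neq0; rewrite sT; apply/eqP; lra.
have kc p s : cabs p <= T / 2 -> cabs s = T -> ccont (fun s => g s * ckernel p s) s.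
  move=> pT sT; apply: (cont_kernel_mul sT); [by apply/eqP; lra|exact: gc].
rewrite -mulN1r -cmeanZ ?(ltW T0)//; last by move=> s; exact: kc.
rewrite -cmeanD ?(ltW T0)//; last 2 first.
- by move=> s; exact: kc.
- by move=> s sT; apply: climM; [exact: clim_cst|exact: kc].
apply: cmean_bound; first exact: ltW.
- by move=> s sT; apply: climD; [exact: kc|apply: climM; [exact: clim_cst|exact: kc]].
- move=> s sT.
  have -> : g s * ckernel p1 s + -1 * (g s * ckernel p2 s) =
     g s * (s * (p1 - p2) / ((s - p1) * (s - p2))).
    by rewrite /ckernel; field; rewrite !q.
  rewrite cabsM ler_pM ?gM// cabsf !cabsM sT.
  have hs p : cabs p <= T / 2 -> T / 2 <= cabs (s - p).
    by move=> pT; have := cabs_dist s p; rewrite sT; lra.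
  have h1 := hs _ p1T; have h2 := hs _ p2T.
  have h : (T / 2) * (T / 2) <= cabs (s - p1) * cabs (s - p2).
    by apply: ler_pM => //; rewrite divr_ge0 ?ltW.
  have TT0 : 0 < T / 2 * (T / 2) by rewrite !mulr_gt0 ?invr_gt0.
  rewrite ler_pdivrMr; last exact: lt_le_trans h.
  have -> : T * cabs (p1 - p2) = 4 * cabs (p1 - p2) / T * (T / 2 * (T / 2)).
    by field; rewrite gt_eqF.
  by rewrite ler_wpM2l// !mulr_ge0 ?invr_ge0// ltW.
Qed.

Lemma liouville_punctured g p1 p2 T M : 0 < cabs p1 <= T / 2 -> 0 < cabs p2 <= T / 2 ->
  (forall s, 0 < cabs s <= T -> cdiff g s) ->
  (forall e, 0 < e -> exists2 d, 0 < d & forall s, 0 < cabs s < d -> cabs (s * g s) <= e) ->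
  (forall s, cabs s = T -> cabs (g s) <= M) ->
  cabs (g p1 - g p2) <= 8 * M * cabs (p1 - p2) / T.
Proof.
move=> /andP[p10 p1T] /andP[p20 p2T] gd g0 gM; have T0 : 0 < T by lra.
have -> : 8 * M * cabs (p1 - p2) / T = 2 * (M * (4 * cabs (p1 - p2) / T)) by field; rewrite gt_eqF.
apply: twopi_cancel; rewrite mulrBr !(@cauchy_punctured g _ T)//; try lra.
apply: kernel_diff => // s sT; apply/cdiff_ccont/gd; rewrite sT; lra.
Qed.

(** A Lipschitz bound on the half disc, from the difference of two Cauchy kernels; with [T] growing
    it is Liouville's theorem. *)
Lemma schwarz g p1 p2 T M : cabs p1 <= T / 2 -> cabs p2 <= T / 2 -> 0 < T ->
  (forall s, cabs s <= T -> cdiff g s) ->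
  (forall s, cabs s = T -> cabs (g s) <= M) ->
  cabs (g p1 - g p2) <= 8 * M * cabs (p1 - p2) / T.
Proof.
move=> p1T p2T T0 gd gM.
have -> : 8 * M * cabs (p1 - p2) / T = 2 * (M * (4 * cabs (p1 - p2) / T)) by field; rewrite gt_eqF.
apply: twopi_cancel; rewrite mulrBr !(@cauchy_disc g _ T)//; try lra.
by apply: kernel_diff => // s sT; apply/cdiff_ccont/gd; rewrite sT.
Qed.

(** The linear coefficient is Cauchy's circle integral, and the remainder has the kernel
    [p^2 / (s (s - p))]. *)
Lemma taylor2 g T M : 0 < T ->
  (forall s, cabs s <= T -> cdiff g s) ->
  (forall s, cabs s = T -> cabs (g s) <= M) ->
  exists l, cabs l <= 2 * M / T /\
    forall p, cabs p <= T / 2 -> cabs (g p - g 0 - l * p) <= 4 * M * cabs p ^+ 2 / T ^+ 2.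
Proof.
move=> T0 gd gM; have P0 := @twopi_gt0 R.
have gc s : cabs s = T -> ccont g s by move=> sT; apply/cdiff_ccont/gd; rewrite sT.
have sn0 s : cabs s = T -> s != 0 by move=> sT; rewrite -cabs_gt0 sT.
have vc s : cabs s = T -> ccont (fun s => g s * s^-1) s.
  by move=> sT; apply: climM; [exact: gc|apply: climV; [exact: cnb_clim|exact: sn0]].
pose l := ((pi *+ 2)%:C)^-1 * cmean (fun s => g s * s^-1) T.
have Pn0 : (pi *+ 2)%:C != 0 :> R[i].
  by rewrite -cabs_gt0 cabsR normr_gt0 gt_eqF.
have lE : (pi *+ 2)%:C * l = cmean (fun s => g s * s^-1) T by rewrite /l mulrA divff// mul1r.
exists l; split.
  rewrite -mulrA; apply: twopi_cancel; rewrite lE; apply: cmean_bound => //; first exact: ltW.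
  by move=> s sT; rewrite cabsM cabsV sT; apply: ler_wpM2r; [rewrite invr_ge0 ltW|exact: gM].
move=> p pT.
have -> : 4 * M * cabs p ^+ 2 / T ^+ 2 = 2 * (M * (2 * cabs p ^+ 2 / T ^+ 2)) by field; rewrite gt_eqF.
apply: twopi_cancel.
have -> : (pi *+ 2)%:C * (g p - g 0 - l * p) = (pi *+ 2)%:C * g p - (pi *+ 2)%:C * g 0 - p * ((pi *+ 2)%:C * l) by ring.
have p0 := cabs_ge0 p.
rewrite lE !(@cauchy_disc g _ T)//; [|by rewrite cabs0|lra].
have q s : cabs s = T -> s - p != 0 by move=> sT; apply: csub_neq0; rewrite sT; apply/eqP; lra.
have kc p' s : cabs p' <= T / 2 -> cabs s = T -> ccont (fun s => g s * ckernel p' s) s.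
  by move=> p'T sT; apply: (cont_kernel_mul sT); [apply/eqP; lra|exact: gc].
have k0 : cabs 0 <= T / 2 by rewrite cabs0 divr_ge0 ?ltW.
have c1 s : cabs s = T -> ccont (fun s => -1 * (g s * ckernel 0 s)) s.
  by move=> sT; apply: climM; [exact: clim_cst|exact: kc].
have c2 s : cabs s = T -> ccont (fun s => - p * (g s * s^-1)) s.
  by move=> sT; apply: climM; [exact: clim_cst|exact: vc].
have e1 : cmean (fun s => -1 * (g s * ckernel 0 s)) T = - cmean (fun s => g s * ckernel 0 s) T.
  by rewrite cmeanZ ?mulN1r ?(ltW T0)// => s; exact: kc.
have e2 : cmean (fun s => - p * (g s * s^-1)) T = - (p * cmean (fun s => g s * s^-1) T).
  by rewrite cmeanZ ?mulNr ?(ltW T0)// => s; exact: vc.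
rewrite -e1 -e2 -cmeanD ?(ltW T0)//; last by move=> s; exact: kc.
rewrite -cmeanD ?(ltW T0)//; last by move=> s sT; apply: climD; [exact: kc|exact: c1].
apply: cmean_bound; first exact: ltW.
- by move=> s sT; apply: climD; [apply: climD; [exact: kc|exact: c1]|exact: c2].
- move=> s sT.
  have -> : g s * ckernel p s + -1 * (g s * ckernel 0 s) + - p * (g s / s) =
    g s * (p ^+ 2 / (s * (s - p))).
    by rewrite /ckernel subr0; field; rewrite q// sn0.
  rewrite cabsM ler_pM ?gM// cabsf cabsX cabsM sT.
  have h : T * (T / 2) <= T * cabs (s - p).
    by rewrite ler_pM2l//; have := cabs_dist s p; rewrite sT; lra.
  have TT0 : 0 < T * (T / 2) by rewrite !mulr_gt0 ?invr_gt0.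
  rewrite ler_pdivrMr; last exact: lt_le_trans h.
  rewrite [leLHS](_ : _ = 2 * cabs p ^+ 2 / T ^+ 2 * (T * (T / 2))); last first.
    by field; rewrite gt_eqF.
  by rewrite ler_wpM2l// !mulr_ge0 ?invr_ge0 ?exprn_ge0// ltW.
Qed.

(** Without a zero, [1 / g] would violate the maximum principle at 0. Points with prescribed
    coordinates are found this way below. *)
Lemma exists_zero g T M : 0 < T -> (forall s, cabs s <= T -> cdiff g s) ->
  cabs (g 0) < M -> (forall s, cabs s = T -> M <= cabs (g s)) ->
  exists2 s, cabs s < T & g s = 0.
Proof.
move=> T0 gd g0 gM; apply: contrapT => nz.
have M0 : 0 < M by apply: le_lt_trans g0.
have gn0 s : cabs s <= T -> g s != 0.
  rewrite le_eqVlt => /orP[/eqP sT|sT]; first by rewrite -cabs_gt0 (lt_le_trans M0)// gM.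
  by apply/eqP => gs; apply: nz; exists s.
have : cabs ((g 0)^-1) <= M^-1.
  apply: (@mp_disc (fun s => (g s)^-1) 0 T); first by rewrite cabs0.
    by move=> s sT; apply: cdiffV; [exact: gn0|exact: gd].
  by move=> s sT; rewrite cabsV lef_pV2 ?posrE ?cabs_gt0 ?gM// gn0// sT.
by rewrite cabsV lef_pV2 ?posrE ?cabs_gt0 ?gn0 ?cabs0 ?(ltW T0)// leNgt g0.
Qed.

(* Borel--Caratheodory, through the map q |-> q / (2 A - q) of the half plane into the disc. *)
Lemma borel_caratheodory g T A s : 0 < A -> 0 < T -> (forall s, cabs s <= T -> cdiff g s) ->
  g 0 = 0 -> (forall s, cabs s <= T -> complex.Re (g s) <= A) ->
  cabs s <= T / 16 -> cabs (g s) <= 32 * A * cabs s / T.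
Proof.
move=> A0 T0 gd g00 gA sT.
pose D s := (2 * A)%:C - g s.
have Dre s' : complex.Re (D s') = 2 * A - complex.Re (g s') by rewrite /D; case: (g s').
have D0 s' : cabs s' <= T -> D s' != 0.
  move=> /gA h; apply/eqP => /(congr1 (@complex.Re _)); rewrite Dre /=; lra.
have hd s' : cabs s' <= T -> cdiff (fun s => g s / D s) s'.
  move=> h; apply: cdiff_div; [exact: D0|exact: gd|].
  by apply: cdiffB; [exact: cdiff_cst|exact: gd].
have h1 s' : cabs s' = T -> cabs (g s' / D s') <= 1.
  move=> s'T; have s'T' : cabs s' <= T by rewrite s'T.
  rewrite cabsf ler_pdivrMr ?cabs_gt0 ?D0// mul1r /cabs ler_wsqrtr//.
  rewrite Dre (_ : complex.Im (D s') = - complex.Im (g s')); last by rewrite /D; case: (g s') => ? ? /=; rewrite sub0r.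
  rewrite sqrrN lerD2r.
  have := gA _ s'T'; set u := complex.Re (g s') => uA.
  have : 0 <= A * (A - u) by rewrite mulr_ge0// ?subr_ge0// ltW.
  lra.
have := @schwarz (fun s => g s / D s) s 0 T 1 _ _ T0 hd h1.
rewrite g00 mul0r !subr0 cabs0 mulr1 => h.
have {}h : cabs (g s / D s) <= 8 * cabs s / T by apply: h; lra.
set q := g s / D s in h.
have q2 : cabs q <= 1 / 2.
  rewrite (le_trans h)// ler_pdivrMr//; lra.
have Ds : D s != 0 by apply: D0; lra.
have gE : g s * (1 + q) = (2 * A)%:C * q.
  have -> : (2 * A)%:C = D s + g s by rewrite /D subrK.
  by rewrite /q; field.
have q1 : 1 / 2 <= cabs (1 + q).
  have := cabs_dist 1 (- q); rewrite opprK cabsN cabs1; lra.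
have : cabs (g s) * (1 / 2) <= 2 * A * (8 * cabs s / T).
  have A2 : 0 <= 2 * A by lra.
  rewrite (le_trans (y := cabs (g s) * cabs (1 + q)))//; first exact: ler_wpM2l.
  by rewrite -cabsM gE cabsM cabsR ger0_norm// ler_wpM2l.
have -> : 32 * A * cabs s / T = 2 * A * (8 * cabs s / T) * 2 by field; rewrite gt_eqF.
lra.
Qed.

End CauchyConsequences.

(** * Uniform limits of holomorphic functions, and the logarithm near 1 *)

Section Limits2.
Context {R : realType}.
Implicit Types (g k : R[i] -> R[i]) (s p w h : R[i]) (x e M T : R).

Lemma rcauchy (u : nat -> R) :
  (forall e, 0 < e -> exists N, forall m n, (N <= m)%N -> (N <= n)%N -> `|u m - u n| < e) ->
  exists l, forall e, 0 < e -> exists N, forall n, (N <= n)%N -> `|u n - l| < e.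
Proof.
move=> hu; have : cvg (u @ \oo).
  apply: cauchy_cvg; apply: cauchy_exP => e e0.
  have [N hN] := hu _ e0; exists (u N); exists N => // n /= Nn.
  by rewrite /ball /=; apply: hN.
move=> /cvg_ex[l /cvgrPdist_lt hl]; exists l => e e0.
have [N _ hN] := hl _ e0; exists N => n Nn; rewrite distrC; exact: hN.
Qed.

Lemma ccauchy (u : nat -> R[i]) :
  (forall e, 0 < e -> exists N, forall m n, (N <= m)%N -> (N <= n)%N -> cabs (u m - u n) < e) ->
  exists l, forall e, 0 < e -> exists N, forall n, (N <= n)%N -> cabs (u n - l) < e.
Proof.
move=> hu.
have ReB w w' : complex.Re w - complex.Re w' = complex.Re (w - w') by case: w w' => ? ? [].
have ImB w w' : complex.Im w - complex.Im w' = complex.Im (w - w') by case: w w' => ? ? [].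
have [a ha] : exists l, forall e, 0 < e -> exists N, forall n, (N <= n)%N -> `|complex.Re (u n) - l| < e.
  apply: rcauchy => e /hu[N hN]; exists N => m n Nm Nn.
  by rewrite ReB (le_lt_trans (Re_le_cabs _))// hN.
have [b hb] : exists l, forall e, 0 < e -> exists N, forall n, (N <= n)%N -> `|complex.Im (u n) - l| < e.
  apply: rcauchy => e /hu[N hN]; exists N => m n Nm Nn.
  by rewrite ImB (le_lt_trans (Im_le_cabs _))// hN.
exists (a +i* b) => e e0; have e2 : 0 < e / 2 by rewrite divr_gt0.
have [N hN] := ha _ e2; have [N' hN'] := hb _ e2.
exists (maxn N N') => n; rewrite geq_max => /andP[/hN h1 /hN' h2].
rewrite (le_lt_trans (cabs_le_ReIm _))// -ReB -ImB /=; lra.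
Qed.

Lemma cdiff_quadratic k p l C d : 0 < d ->
  (forall h, cabs h <= d -> cabs (k (p + h) - k p - l * h) <= C * cabs h ^+ 2) -> cdiff k p.
Proof.
move=> d0 hk.
have C0 : 0 <= C.
  have := hk d%:C; rewrite cabsR ger0_norm ?(ltW d0)// lexx => /(_ isT).
  move=> /(le_trans (cabs_ge0 _)); rewrite pmulr_lge0// exprn_gt0//.
exists l; exists (fun s => if s == p then l else (k s - k p) / (s - p)).
split; first by rewrite eqxx.
- move=> e e0; rewrite eqxx; apply/cnbP.
  exists (Num.min d (e / (C + 1))); first by rewrite lt_min d0 divr_gt0// ltr_wpDl.
  move=> s; rewrite lt_min => /andP[sd se]; case: eqVneq => [_|sp]; first by rewrite subrr cabs0.
  have sp0 : s - p != 0 by rewrite subr_eq0.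
  have := hk (s - p) (ltW sd); rewrite [p + (s - p)]addrC subrK => h1.
  have -> : (k s - k p) / (s - p) - l = (k s - k p - l * (s - p)) / (s - p) by field.
  rewrite cabsf ltr_pdivrMr ?cabs_gt0// (le_lt_trans h1)// expr2 mulrA.
  rewrite ltr_pM2r ?cabs_gt0//.
  move: se; rewrite ltr_pdivlMr ?ltr_wpDl//.
  have : 0 < cabs (s - p) by rewrite cabs_gt0.
  lra.
- apply: nearW => s; case: eqVneq => [->|sp]; first by rewrite subrr mulr0 addr0.
  by field; rewrite subr_eq0.
Qed.

Lemma cdiff_shift k p h : cdiff k (p + h) -> cdiff (fun s => k (p + s)) h.
Proof.
by move=> kd; apply: cdiff_comp => //; apply: cdiffD; [exact: cdiff_cst|exact: cdiff_id].
Qed.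

Lemma cbounded_disc g T : (forall s, cabs s <= T -> ccont g s) ->
  exists2 M, 0 < M & forall s, cabs s <= T -> cabs (g s) <= M.
Proof.
move=> gc; have [M M0 hM] := @cbounded_annulus R 0 T g (fun s sT => gc s (proj2 (andP sT))).
by exists M => // s sT; apply: hM; rewrite cabs_ge0.
Qed.

(** The approximants have second order Taylor bounds with a common constant. Their linear
    coefficients form a Cauchy sequence, and the bound passes to the limit [k], which is therefore
    differentiable. *)
Lemma weierstrass (g : nat -> R[i] -> R[i]) k T :
  (forall j s, cabs s <= T -> cdiff (g j) s) ->
  (forall e, 0 < e -> exists N, forall j, (N <= j)%N -> forall s, cabs s <= T -> cabs (g j s - k s) <= e) ->
  forall p, cabs p < T -> cdiff k p.
Proof.
move=> gd gk p pT.
have [N0 hN0] := gk 1 ltr01.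
have [M0 M00 hM0] := cbounded_disc (fun s sT => cdiff_ccont (gd N0 s sT)).
pose M := M0 + 2; have M0' : 0 < M by rewrite /M; lra.
have gM j s : (N0 <= j)%N -> cabs s <= T -> cabs (g j s) <= M.
  move=> N0j sT; have h1 := hN0 j N0j s sT; have h2 := hN0 N0 (leqnn _) s sT; have h3 := hM0 s sT.
  have := cabs_dist (g j s) (k s); have := cabs_dist (k s) (g N0 s).
  rewrite (cabsC (k s)) /M; lra.
pose d := T - cabs p; have d0 : 0 < d by rewrite subr_gt0.
have inT h : cabs h <= d -> cabs (p + h) <= T.
  by move=> hd; rewrite (le_trans (cabsD _ _))//; move: hd; rewrite /d; lra.
pose C := 4 * M / d ^+ 2.
have C0 : 0 < C by rewrite divr_gt0 ?exprn_gt0// mulr_gt0.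
have /choice[l hl] : forall j, exists l : R[i], (N0 <= j)%N -> forall h, cabs h <= d / 2 ->
    cabs (g j (p + h) - g j p - l * h) <= C * cabs h ^+ 2.
  move=> j; have [N0j|_] := leqP N0 j; last by exists 0.
  have [||l [_ hl]] := @taylor2 R (fun s => g j (p + s)) d M d0.
  - by move=> s sd; apply: cdiff_shift; apply: gd; exact: inT.
  - by move=> s sd; apply: gM => //; apply: inT; rewrite sd.
  exists l => _ h /hl; rewrite addr0 /C; congr (_ <= _); ring.
clearbody C.
have [L hL] : exists L, forall e, 0 < e -> exists N, forall n, (N <= n)%N -> cabs (l n - L) < e.
  apply: ccauchy => e e0.
  (* At distance [t] the two quadratic remainders contribute at most [e t / 4], and so do the four
     uniform errors [e t / 16]; division by [t] leaves [e / 2]. *)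
  pose t := Num.min (d / 2) (e / (8 * C)).
  have t0 : 0 < t.
    by rewrite lt_min; apply/andP; split; apply: divr_gt0 => //; apply: mulr_gt0.
  have td : t <= d / 2 by rewrite ge_min lexx.
  have te : t <= e / (8 * C) by rewrite ge_min lexx orbT.
  clearbody t.
  have et : 0 < e * t / 16 by rewrite divr_gt0 ?mulr_gt0.
  have [N hN] := gk _ et; exists (maxn N N0) => m n; rewrite !geq_max => /andP[Nm N0m] /andP[Nn N0n].
  have tt : cabs (t%:C) = t :> R by rewrite cabsR ger0_norm// ltW.
  have ttd : cabs t%:C <= d / 2 by rewrite tt.
  have h1 := hl m N0m _ ttd; have h2 := hl n N0n _ ttd.
  have a1 := hN m Nm (p + t%:C) (inT _ _); have a2 := hN n Nn (p + t%:C) (inT _ _).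
  have b1 := hN m Nm p (ltW pT); have b2 := hN n Nn p (ltW pT).
  have {}a1 : cabs (g m (p + t%:C) - k (p + t%:C)) <= e * t / 16 by apply: a1; lra.
  have {}a2 : cabs (g n (p + t%:C) - k (p + t%:C)) <= e * t / 16 by apply: a2; lra.
  have hE : (l m - l n) * t%:C =
     (g n (p + t%:C) - g n p - l n * t%:C) - (g m (p + t%:C) - g m p - l m * t%:C)
     + ((g m (p + t%:C) - k (p + t%:C)) - (g n (p + t%:C) - k (p + t%:C)) - ((g m p - k p) - (g n p - k p))).
    by ring.
  have : cabs (l m - l n) * t <= 2 * (C * t ^+ 2) + 4 * (e * t / 16).
    rewrite -{1}tt -cabsM hE.
    move: h1 h2 a1 a2 b1 b2; rewrite tt.
    set A1 := g m (p + t%:C) - g m p - _; set A2 := g n (p + t%:C) - g n p - _.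
    set B1 := g m (p + t%:C) - k _; set B2 := g n (p + t%:C) - k _.
    set B3 := g m p - k p; set B4 := g n p - k p => h1 h2 a1 a2 b1 b2.
    have := cabsD (A2 - A1) (B1 - B2 - (B3 - B4)).
    have := cabsB A2 A1; have := cabsB (B1 - B2) (B3 - B4); have := cabsB B1 B2; have := cabsB B3 B4.
    lra.
  move=> h3; rewrite -(ltr_pM2r t0) (le_lt_trans h3)//.
  have h4 : C * t ^+ 2 <= e / 8 * t.
    rewrite expr2 mulrA ler_pM2r//.
    have : t * (8 * C) <= e by rewrite -ler_pdivlMr ?mulr_gt0.
    lra.
  have : 0 < e * t by rewrite mulr_gt0.
  lra.
have d20 : 0 < d / 2 by rewrite divr_gt0.
apply: (@cdiff_quadratic k p L C (d / 2) d20) => h hd.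
apply/ler_addgt0Pr => e e0.
have e4 : 0 < e / 4 by rewrite divr_gt0.
have [N hN] := gk _ e4.
have eh : 0 < e / (4 * (cabs h + 1)) by rewrite divr_gt0 ?mulr_gt0// ltr_wpDl.
have [N' hN'] := hL _ eh.
pose j := maxn N0 (maxn N N').
have j0 : (N0 <= j)%N by rewrite leq_maxl.
have jN : (N <= j)%N by rewrite !leq_max leqnn orbT.
have jN' : (N' <= j)%N by rewrite !leq_max leqnn !orbT.
have h1 := hl j j0 h hd.
have hin : cabs (p + h) <= T by apply: inT; lra.
have a1 := hN j jN _ hin; have a2 := hN j jN p (ltW pT).
have a3 := hN' j jN'.
have hE : k (p + h) - k p - L * h = (g j (p + h) - g j p - l j * h)
   + ((g j p - k p) - (g j (p + h) - k (p + h))) + (l j - L) * h by ring.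
have a4 : cabs ((l j - L) * h) <= e / 4.
  rewrite cabsM.
  have : cabs (l j - L) * cabs h <= e / (4 * (cabs h + 1)) * (cabs h + 1).
    by apply: ler_pM => //; [exact: ltW|lra].
  move/le_trans; apply; rewrite le_eqVlt; apply/orP; left; apply/eqP; field.
  by rewrite gt_eqF// ltr_wpDl.
rewrite hE.
have := cabsD (g j (p + h) - g j p - l j * h + ((g j p - k p) - (g j (p + h) - k (p + h)))) ((l j - L) * h).
have := cabsD (g j (p + h) - g j p - l j * h) ((g j p - k p) - (g j (p + h) - k (p + h))).
have := cabsB (g j p - k p) (g j (p + h) - k (p + h)).
lra.
Qed.

Lemma ln_le_sub1 x : 0 < x -> ln x <= x - 1.
Proof.
move=> x0; rewrite -ler_expR lnK ?posrE//.
by have := expR_ge1Dx (x - 1); lra.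
Qed.

Lemma cabs_sqr1D w : cabs (1 + w) ^+ 2 = 1 + (2 * complex.Re w + cabs w ^+ 2).
Proof.
rewrite /cabs !sqr_sqrtr ?addr_ge0 ?sqr_ge0//.
by case: w => a b /=; ring.
Qed.

Lemma ln_cabs1D_le w : 1 + w != 0 -> ln (cabs (1 + w)) <= complex.Re w + cabs w ^+ 2.
Proof.
move=> w0; have w0' : 0 < cabs (1 + w) by rewrite cabs_gt0.
have : ln (cabs (1 + w) ^+ 2) <= 2 * complex.Re w + cabs w ^+ 2.
  by rewrite (le_trans (ln_le_sub1 _)) ?exprn_gt0// cabs_sqr1D; lra.
rewrite lnXn// mulr2n; have := sqr_ge0 (cabs w); lra.
Qed.

Lemma ln_cabs1D w : cabs w <= 1 / 2 -> `|ln (cabs (1 + w)) - complex.Re w| <= 8 * cabs w ^+ 2.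
Proof.
move=> w2.
have w1 : 1 / 2 <= cabs (1 + w).
  by have := cabs_dist 1 (- w); rewrite opprK cabsN cabs1; lra.
have w10 : 0 < cabs (1 + w) by lra.
have wn0 : 1 + w != 0 by rewrite -cabs_gt0.
have h1 := ln_cabs1D_le wn0.
(* Since [1 + v] is the inverse of [1 + w], the upper bound [ln_cabs1D_le] for [v] is a lower bound
   for [w]. *)
pose v := - w / (1 + w).
have v1 : 1 + v = (1 + w)^-1 by rewrite /v; field.
have h2 := @ln_cabs1D_le v; rewrite v1 cabsV in h2.
have {}h2 : ln ((cabs (1 + w))^-1) <= complex.Re v + cabs v ^+ 2 by apply: h2; rewrite invr_neq0.
have vE : v = - w + w ^+ 2 / (1 + w) by rewrite /v; field.
have q : cabs (w ^+ 2 / (1 + w)) <= 2 * cabs w ^+ 2.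
  rewrite cabsf cabsX ler_pdivrMr//.
  have := sqr_ge0 (cabs w); nra.
have vw : cabs v <= 2 * cabs w.
  by rewrite /v cabsf cabsN ler_pdivrMr//; have := cabs_ge0 w; nra.
have v2 : cabs v ^+ 2 <= 4 * cabs w ^+ 2.
  have -> : 4 * cabs w ^+ 2 = (2 * cabs w) ^+ 2 by ring.
  by rewrite lerXn2r// ?nnegrE// mulr_ge0.
have rev : complex.Re v <= - complex.Re w + 2 * cabs w ^+ 2.
  rewrite vE; have -> : complex.Re (- w + w ^+ 2 / (1 + w)) = - complex.Re w + complex.Re (w ^+ 2 / (1 + w)).
    by case: (w) (w ^+ 2 / _) => ? ? [].
  rewrite lerD2l; exact: le_trans (ler_norm _) (le_trans (Re_le_cabs _) q).
rewrite lnV ?posrE// in h2.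
have := sqr_ge0 (cabs w).
rewrite ler_norml; lra.
Qed.

End Limits2.

(** * A Harnack inequality for the logarithm of the modulus *)

Section Harnack.
Context {R : realType}.
Implicit Types (k : R[i] -> R[i]) (s w h : R[i]) (r e T L : R).

(* Logarithms are replaced by the telescoping sums of k(t_{j+1} s)/k(t_j s) - 1 over a fine
   subdivision of [0, 1], whose real parts tend to ln|k s| - ln|k 0|. *)
Lemma harnack_log k T L s : 0 < T -> 0 <= L -> (forall s, cabs s <= T -> cdiff k s) ->
  (forall s, cabs s <= T -> k s != 0 /\ `|ln (cabs (k s))| <= L) ->
  cabs s <= T / 32 ->
  `|ln (cabs (k s)) - ln (cabs (k 0))| <= 64 * (2 * L + 1) * cabs s / T.
Proof.
move=> T0 L0 kd kL sT.
have kn0 s' : cabs s' <= T -> k s' != 0 by move=> /kL[].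
have k0 s' : cabs s' <= T -> 0 < cabs (k s') by move=> /kn0; rewrite cabs_gt0.
pose E := expR L; have E0 : 0 < E := expR_gt0 _.
have kE s' : cabs s' <= T -> E^-1 <= cabs (k s') <= E.
  move=> h; have [_] := kL _ h; rewrite ler_norml => /andP[h1 h2].
  by rewrite /E -expRN -(lnK (k0 _ h)) !ler_expR h1.
pose B := 4 * E ^+ 2; have B0 : 0 < B by rewrite mulr_gt0// exprn_gt0.
pose t n j : R := j%:R / n%:R.
pose w n j s' := k ((t n j.+1)%:C * s') / k ((t n j)%:C * s') - 1.
pose q n s' := \sum_(0 <= j < n) w n j s'.
have t01 n j : (j <= n)%N -> (0 < n)%N -> 0 <= t n j <= 1.
  by move=> jn n0; rewrite /t divr_ge0//= ler_pdivrMr ?ltr0n// mul1r ler_nat.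
have tin n j s' r : (j <= n)%N -> (0 < n)%N -> cabs s' <= r -> cabs ((t n j)%:C * s') <= r.
  move=> jn n0 h; have /andP[a b] := t01 n j jn n0.
  by rewrite cabsM cabsR ger0_norm// (le_trans _ h)// ler_piMl.
(* [schwarz] bounds an increment of [k] by [O(1 / n)] and [E] bounds the reciprocal of [k]. So each
   [w n j] is [O(1 / n)], and the [n] quadratic errors of [ln_cabs1D] add up to [O(1 / n)]. *)
have wB n j s' : (j < n)%N -> cabs s' <= T / 2 -> cabs (w n j s') <= B / n%:R.
  move=> jn hs; have n0 : (0 < n)%N by apply: leq_ltn_trans jn.
  have i1 := tin n j.+1 s' _ jn n0 hs; have i2 := tin n j s' _ (ltnW jn) n0 hs.
  have i2' : cabs ((t n j)%:C * s') <= T by lra.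
  have -> : w n j s' = (k ((t n j.+1)%:C * s') - k ((t n j)%:C * s')) / k ((t n j)%:C * s').
    by rewrite /w; field; apply: kn0.
  have hE s1 : cabs s1 = T -> cabs (k s1) <= E by move=> h; have /andP[] : E^-1 <= cabs (k s1) <= E by apply: kE; rewrite h.
  have := schwarz i1 i2 T0 kd hE.
  have -> : (t n j.+1)%:C * s' - (t n j)%:C * s' = (n%:R^-1)%:C * s'.
    by rewrite -mulrBl -rmorphB /= /t -mulrBl -natrB// subSnn mul1r.
  rewrite cabsM cabsR ger0_norm ?invr_ge0// => h.
  have /andP[kl _] := kE _ i2'.
  have kV : (cabs (k ((t n j)%:C * s')))^-1 <= E.
    by rewrite -[E]invrK lef_pV2 ?posrE ?invr_gt0// k0.
  rewrite cabsf; apply: le_trans (ler_pM _ _ h kV) _ => //; first by rewrite invr_ge0.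
  have -> : B / n%:R = 8 * E * (n%:R^-1 * (T / 2)) / T * E by rewrite /B; field; rewrite !gt_eqF ?ltr0n.
  have n0' : 0 <= n%:R^-1 :> R by rewrite invr_ge0.
  apply: ler_wpM2r; first exact: ltW.
  apply: ler_wpM2r; first by rewrite invr_ge0 ltW.
  apply: ler_wpM2l; first by rewrite mulr_ge0// ltW.
  exact: ler_wpM2l.
have qlog n s' : (0 < n)%N -> B / n%:R <= 1 / 2 -> cabs s' <= T / 2 ->
    `|complex.Re (q n s') - (ln (cabs (k s')) - ln (cabs (k 0)))| <= 8 * B ^+ 2 / n%:R.
  move=> n0 Bn hs.
  have sumRe (m : nat) (u : nat -> R[i]) : complex.Re (\sum_(0 <= j < m) u j) = \sum_(0 <= j < m) complex.Re (u j).
    elim: m => [|m ih]; first by rewrite !big_nil.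
    by rewrite !big_nat_recr//= -ih; case: (\sum_(0 <= j < m) u j) (u m) => ? ? [].
  pose f j := ln (cabs (k ((t n j)%:C * s'))).
  have -> : ln (cabs (k s')) - ln (cabs (k 0)) = \sum_(0 <= j < n) (f j.+1 - f j).
    rewrite telescope_sumr// /f /t mul0r mul0r divff ?mul1r// pnatr_eq0 -lt0n//.
  rewrite sumRe -sumrB (le_trans (ler_norm_sum _ _ _))//.
  have -> : 8 * B ^+ 2 / n%:R = \sum_(0 <= j < n) (8 * (B / n%:R) ^+ 2).
    rewrite sumr_const_nat subn0 -mulr_natl; field.
    by rewrite pnatr_eq0 -lt0n.
  apply: ler_sum_nat => j /andP[_ jn].
  have hw := wB n j s' jn hs.
  have i2 : cabs ((t n j)%:C * s') <= T by apply: tin; [exact: ltnW| |lra].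
  have i1 : cabs ((t n j.+1)%:C * s') <= T by apply: tin => //; lra.
  have -> : f j.+1 - f j = ln (cabs (1 + w n j s')).
    have -> : 1 + w n j s' = k ((t n j.+1)%:C * s') / k ((t n j)%:C * s') by rewrite /w; ring.
    by rewrite cabsf lnM ?lnV ?posrE ?invr_gt0 ?k0.
  rewrite distrC (le_trans (ln_cabs1D _))//; first exact: le_trans Bn.
  by rewrite ler_wpM2l// lerXn2r ?nnegrE// ltW// divr_gt0 ?ltr0n.
(* Borel-Caratheodory for the holomorphic sum [q n] on the disc of radius [T / 2]. The last term is
   the discretisation error, removed at the end by taking [n] large. *)
have key n : (0 < n)%N -> B / n%:R <= 1 / 2 -> 8 * B ^+ 2 / n%:R <= 1 ->
   `|ln (cabs (k s)) - ln (cabs (k 0))| <= 64 * (2 * L + 1) * cabs s / T + 8 * B ^+ 2 / n%:R.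
  move=> n0 Bn Bn1.
  have T20 : 0 < T / 2 by rewrite divr_gt0.
  have A0 : 0 < 2 * L + 1 by lra.
  have qd s' : cabs s' <= T / 2 -> cdiff (q n) s'.
    move=> hs; have -> : q n = fun s' => \sum_(0 <= j < n) w n j s' by [].
    have : cdiff (fun s' => \sum_(j <- [seq i <- index_iota 0 n | (i < n)%N]) w n j s') s'.
      elim: (index_iota 0 n) => [|j l ih] /=.
        by under eq_fun do rewrite big_nil; exact: cdiff_cst.
      case: ifP => // jn; under eq_fun do rewrite big_cons.
      apply: cdiffD => //; apply: cdiffB; last exact: cdiff_cst.
      have lin j' : cdiff (fun s => (t n j')%:C * s) s' by apply: cdiffZ; exact: cdiff_id.
      apply: cdiff_div.
      - by apply: kn0; apply: tin; [exact: ltnW| |lra].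
      - by apply: cdiff_comp (lin _) _; apply: kd; apply: tin => //; lra.
      - by apply: cdiff_comp (lin _) _; apply: kd; apply: tin; [exact: ltnW| |lra].
    rewrite (_ : [seq i <- index_iota 0 n | (i < n)%N] = index_iota 0 n)//.
    by apply/all_filterP/allP => j; rewrite mem_index_iota.
  have q0 : q n 0 = 0.
    rewrite /q big1// => j _; rewrite /w !mulr0 divff ?subrr//.
    by apply: kn0; rewrite cabs0 ltW.
  have qA s' : cabs s' <= T / 2 -> complex.Re (q n s') <= 2 * L + 1.
    move=> hs; have := qlog n s' n0 Bn hs.
    have sT' : cabs s' <= T by lra.
    have c0 : cabs 0 <= T by rewrite cabs0 ltW.
    have [_] := kL _ sT'; have [_] := kL _ c0.
    rewrite !ler_norml; lra.
  have s2 : cabs s <= T / 2 by have := cabs_ge0 s; lra.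
  have s16 : cabs s <= T / 2 / 16 by lra.
  have h1 := borel_caratheodory A0 T20 qd q0 qA s16.
  have h2 := qlog n s n0 Bn s2.
  have h3 := le_trans (Re_le_cabs (q n s)) h1.
  move: h3; have -> : 32 * (2 * L + 1) * cabs s / (T / 2) = 64 * (2 * L + 1) * cabs s / T.
    by field; rewrite gt_eqF.
  move: h2; rewrite !ler_norml; lra.
pose C := 2 * B + 8 * B ^+ 2.
have C0 : 0 < C by rewrite addr_gt0 ?mulr_gt0 ?exprn_gt0.
apply/ler_addgt0Pr => e e0.
have m0 : 0 < Num.min 1 e / C by rewrite divr_gt0// lt_min ltr01.
have [N hN] := archi_inv m0.
have := hN N (leqnn _); rewrite ltr_pdivlMr// => h.
have n0 : 0 < N.+1%:R^-1 :> R by rewrite invr_gt0 ltr0n.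
have m1 : Num.min 1 e <= 1 by rewrite ge_min lexx.
have me : Num.min 1 e <= e by rewrite ge_min lexx orbT.
have b2 : 0 <= N.+1%:R^-1 * (8 * B ^+ 2) by rewrite !mulr_ge0 ?exprn_ge0// ltW.
have b1 : 0 <= N.+1%:R^-1 * (2 * B) by rewrite !mulr_ge0// ltW.
have hC : N.+1%:R^-1 * C = N.+1%:R^-1 * (2 * B) + N.+1%:R^-1 * (8 * B ^+ 2) by rewrite mulrDr.
rewrite hC in h.
have h8 : 8 * B ^+ 2 / N.+1%:R = N.+1%:R^-1 * (8 * B ^+ 2) by rewrite mulrC.
have hB : B / N.+1%:R = N.+1%:R^-1 * (2 * B) / 2 by move: (N.+1%:R^-1) => u; field.
have := key N.+1 isT; rewrite hB h8.
move: b1 b2 h; set X := _ * (2 * B); set Y := _ * (8 * B ^+ 2); set Z := 64 * _ * _ / T.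
move=> b1 b2 h; have a1 : X / 2 <= 1 / 2 by lra.
have a2 : Y <= 1 by lra.
by move=> /(_ a1 a2); lra.
Qed.

End Harnack.

(** * Estimates for one Henon map *)

Section PolynomialEstimates.
Context {R : realType}.
Implicit Types (q : {poly R[i]}) (y z e : R[i]) (K r : R).

(** Horner's scheme: in the induction along [q * 'X + c] the bounds on increments need those on the
    value and the derivative, hence the joint statement. Powers of [|y|] stand on the left to avoid
    divisions. *)
Lemma poly_estimates n q : (size q <= n.+1)%N -> exists K, 0 <= K /\ forall y, 1 <= cabs y ->
  [/\ cabs q.[y] <= K * cabs y ^+ n,
      cabs q^`().[y] * cabs y <= K * cabs y ^+ n,
      forall e, cabs e <= cabs y -> cabs (q.[y + e] - q.[y]) * cabs y <= K * cabs e * cabs y ^+ n &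
      forall e e' r, cabs e <= r -> cabs e' <= r -> r <= cabs y ->
        cabs (q.[y + e] - q.[y + e'] - q^`().[y] * (e - e')) * cabs y ^+ 2
          <= K * r * cabs (e - e') * cabs y ^+ n].
Proof.
elim: n q => [|n ih] q.
  move=> /size1_polyC ->; exists (cabs q`_0); split => // y y1.
  rewrite derivC hornerC expr0 mulr1 horner0 cabs0 mul0r; split => //.
  - by move=> e _; rewrite !hornerC subrr cabs0 mul0r !mulr_ge0.
  - move=> e e' r er _ _; rewrite !hornerC subrr mul0r subr0 cabs0 mul0r.
    by rewrite !mulr_ge0//; exact: le_trans er.
elim/poly_ind: q => [|q c _] szq.
  exists 0; split => // y y1; rewrite deriv0 !horner0 cabs0 !mul0r; split => //.
  - by move=> e _; rewrite !horner0 subrr cabs0 !mul0r.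
  - by move=> *; rewrite !horner0 ?mul0r !subr0 cabs0 !mul0r.
have szq' : (size q <= n.+1)%N.
  by move: szq; rewrite size_MXaddC; case: eqP => [->|//]; rewrite size_poly0.
have [K [K0 hK]] := ih q szq'.
exists (4 * K + cabs c); split; first by rewrite addr_ge0// mulr_ge0.
move=> y y1; have [h1 h2 h3 h4] := hK y y1.
have [Y YE] : exists Y, cabs y = Y by exists (cabs y).
rewrite YE in y1 h1 h2 h3 h4 *.
have Y0 : 0 < Y by lra.
have Yn : 1 <= Y ^+ n by rewrite exprn_ege1.
have c0 := cabs_ge0 c.
have dE : (q * 'X + c%:P)^`() = q + q^`() * 'X.
  by rewrite derivD derivM derivX derivC addr0 mulr1 addrC.
rewrite exprS; split.
- rewrite hornerMXaddC (le_trans (cabsD _ _))// cabsM YE.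
  have : cabs q.[y] * Y <= K * Y ^+ n * Y by rewrite ler_wpM2r// ltW.
  have : cabs c * 1 <= cabs c * (Y * Y ^+ n) by rewrite ler_wpM2l// mulr_ege1.
  have : 0 <= K * (Y * Y ^+ n) by rewrite !mulr_ge0 ?exprn_ge0// ltW.
  lra.
- rewrite dE hornerD hornerMX.
  have : cabs (q.[y] + q^`().[y] * y) * Y <= (cabs q.[y] + cabs q^`().[y] * Y) * Y.
    by apply: ler_wpM2r; [exact: ltW|rewrite (le_trans (cabsD _ _))// cabsM YE].
  have : (cabs q.[y] + cabs q^`().[y] * Y) * Y <= (K * Y ^+ n + K * Y ^+ n) * Y.
    by apply: ler_wpM2r; [exact: ltW|exact: lerD].
  have : 0 <= K * (Y * Y ^+ n) by rewrite !mulr_ge0 ?exprn_ge0// ltW.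
  have : 0 <= cabs c * (Y * Y ^+ n) by rewrite !mulr_ge0 ?exprn_ge0// ltW.
  lra.
- move=> e eY; rewrite !hornerMXaddC.
  have -> : q.[y + e] * (y + e) + c - (q.[y] * y + c) = (q.[y + e] - q.[y]) * (y + e) + q.[y] * e by ring.
  have hh := h3 e eY.
  have ye : cabs (y + e) <= 2 * Y by rewrite (le_trans (cabsD _ _))// YE; lra.
  have : cabs ((q.[y + e] - q.[y]) * (y + e) + q.[y] * e) * Y <=
    (cabs (q.[y + e] - q.[y]) * (2 * Y) + K * Y ^+ n * cabs e) * Y.
    apply: ler_wpM2r; [exact: ltW|rewrite (le_trans (cabsD _ _))// !cabsM].
    by apply: lerD; [exact: ler_wpM2l|exact: ler_wpM2r].
  have : cabs (q.[y + e] - q.[y]) * Y * (2 * Y) <= K * cabs e * Y ^+ n * (2 * Y).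
    by apply: ler_wpM2r => //; rewrite mulr_ge0// ltW.
  have : 0 <= K * cabs e * (Y * Y ^+ n) by rewrite !mulr_ge0 ?exprn_ge0// ltW.
  have : 0 <= cabs c * cabs e * (Y * Y ^+ n) by rewrite !mulr_ge0 ?exprn_ge0// ltW.
  lra.
- move=> e e' r er e'r rY; rewrite dE !hornerMXaddC hornerD hornerMX.
  have -> : q.[y + e] * (y + e) + c - (q.[y + e'] * (y + e') + c) - (q.[y] + q^`().[y] * y) * (e - e')
    = (q.[y + e] - q.[y + e'] - q^`().[y] * (e - e')) * (y + e) + q^`().[y] * (e * (e - e'))
      + (q.[y + e'] - q.[y]) * (e - e') by ring.
  have e'Y : cabs e' <= Y by lra.
  have hh := h3 e' e'Y; have h5 := h4 e e' r er e'r rY.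
  have ye : cabs (y + e) <= 2 * Y by rewrite (le_trans (cabsD _ _))// YE; lra.
  set T := q.[y + e] - q.[y + e'] - _ in h5 *.
  set D := q.[y + e'] - q.[y] in hh *.
  set E := e - e'.
  have r0 : 0 <= r := le_trans (cabs_ge0 _) er.
  have E0 := cabs_ge0 E; have P0 : 0 <= Y ^+ n by lra.
  have t1 : cabs (T * (y + e)) * Y ^+ 2 <= 2 * (K * r * cabs E * (Y * Y ^+ n)).
    rewrite cabsM mulrAC.
    have : cabs T * Y ^+ 2 * cabs (y + e) <= K * r * cabs E * Y ^+ n * (2 * Y).
      by apply: ler_pM => //; rewrite mulr_ge0 ?exprn_ge0 ?(ltW Y0).
    lra.
  have t2 : cabs (q^`().[y] * (e * E)) * Y ^+ 2 <= K * r * cabs E * (Y * Y ^+ n).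
    rewrite !cabsM.
    have : cabs q^`().[y] * Y * (cabs e * (cabs E * Y)) <= K * Y ^+ n * (r * (cabs E * Y)).
      apply: ler_pM => //; rewrite ?mulr_ge0// ?(ltW Y0)//.
      by apply: ler_wpM2r => //; rewrite mulr_ge0 ?(ltW Y0).
    rewrite expr2; lra.
  have t3 : cabs (D * E) * Y ^+ 2 <= K * r * cabs E * (Y * Y ^+ n).
    rewrite cabsM.
    have : cabs D * Y * (cabs E * Y) <= K * r * Y ^+ n * (cabs E * Y).
      apply: ler_wpM2r; first by rewrite mulr_ge0 ?(ltW Y0).
      apply: (le_trans hh); apply: ler_wpM2r => //; exact: ler_wpM2l.
    rewrite expr2; lra.
  have : cabs (T * (y + e) + q^`().[y] * (e * E) + D * E) * Y ^+ 2 <=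
     (cabs (T * (y + e)) + cabs (q^`().[y] * (e * E)) + cabs (D * E)) * Y ^+ 2.
    apply: ler_wpM2r; first by rewrite exprn_ge0// ltW.
    by rewrite (le_trans (cabsD _ _))// lerD2r cabsD.
  have : 0 <= cabs c * r * cabs E * (Y * Y ^+ n) by rewrite !mulr_ge0 ?exprn_ge0// ltW.
  lra.
Qed.

Lemma lead_estimate n q : (size q <= n.+2)%N -> exists K, 0 <= K /\ forall y, 1 <= cabs y ->
  cabs (q.[y] - q`_n.+1 * y ^+ n.+1) <= K * cabs y ^+ n.
Proof.
move=> szq.
have [|K [K0 hK]] := @poly_estimates n (q - q`_n.+1 *: 'X^(n.+1)).
  apply/leq_sizeP => j nj; rewrite coefB coefZ coefXn.
  have [->|jn] := eqVneq j n.+1; first by rewrite mulr1 subrr.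
  rewrite mulr0 subr0; apply: nth_default; rewrite (leq_trans szq)//.
  by rewrite ltn_neqAle eq_sym jn.
exists K; split => // y /hK[h _ _ _]; move: h.
by rewrite !hornerE.
Qed.

Lemma lip_estimate n q : (size q <= n.+1)%N -> exists K, 0 <= K /\ forall y z r, 1 <= r ->
  cabs y <= r -> cabs z <= r -> cabs (q.[y] - q.[z]) <= K * r ^+ n * cabs (y - z) /\
  cabs q.[y] <= K * r ^+ n.
Proof.
elim: n q => [|n ih] q.
  move=> /size1_polyC ->; exists (cabs q`_0); split => // y z r r1 _ _.
  by rewrite !hornerC subrr cabs0 expr0 mulr1; split => //; rewrite mulr_ge0.
elim/poly_ind: q => [|q c _] szq.
  by exists 0; split => // y z r *; rewrite !horner0 subrr cabs0 !mul0r.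
have szq' : (size q <= n.+1)%N.
  by move: szq; rewrite size_MXaddC; case: eqP => [->|//]; rewrite size_poly0.
have [K [K0 hK]] := ih q szq'.
exists (2 * K + cabs c); split; first by rewrite addr_ge0// mulr_ge0.
move=> y z r r1 yr zr; have [h1 h2] := hK y z r r1 yr zr.
have r0 : 0 <= r by lra.
have rn : 1 <= r ^+ n by rewrite exprn_ege1.
have c0 := cabs_ge0 c; rewrite !hornerMXaddC exprS; split.
- have -> : q.[y] * y + c - (q.[z] * z + c) = (q.[y] - q.[z]) * z + q.[y] * (y - z) by ring.
  rewrite (le_trans (cabsD _ _))// !cabsM.
  have : cabs (q.[y] - q.[z]) * cabs z <= K * r ^+ n * cabs (y - z) * r by exact: ler_pM.
  have : cabs q.[y] * cabs (y - z) <= K * r ^+ n * cabs (y - z) by exact: ler_wpM2r.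
  have : K * r ^+ n * cabs (y - z) * 1 <= K * r ^+ n * cabs (y - z) * r.
    by apply: ler_wpM2l => //; rewrite !mulr_ge0// exprn_ge0.
  have : 0 <= cabs c * (r * r ^+ n) * cabs (y - z) by rewrite !mulr_ge0 ?exprn_ge0.
  lra.
- rewrite (le_trans (cabsD _ _))// cabsM.
  have : cabs q.[y] * cabs y <= K * r ^+ n * r by exact: ler_pM.
  have : cabs c * 1 <= cabs c * (r * r ^+ n) by rewrite ler_wpM2l// mulr_ege1.
  have : 0 <= K * (r * r ^+ n) by rewrite !mulr_ge0 ?exprn_ge0.
  lra.
Qed.

Lemma ln_cabs1D_small (w : R[i]) : cabs w <= 1 / 2 -> `|ln (cabs (1 + w))| <= 5 * cabs w.
Proof.
move=> w2; have := ln_cabs1D w2.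
have := Re_le_cabs w; rewrite !ler_norml.
have : cabs w ^+ 2 <= 1 / 2 * cabs w by rewrite expr2 ler_wpM2r.
have := cabs_ge0 w; lra.
Qed.

End PolynomialEstimates.

(** * Uniform constants for one step of the dynamics *)

Section UniformBounds.
Context {R : realType}.
Implicit Types (q : {poly R[i]}) (a x y z e : R[i]) (C r : R).

Definition pdeg q : nat := (size q).-1.

(* All the estimates on [q.[y] - a * x] for large [y] that the dynamics needs, with one
   constant, which is then uniform for periodic data. *)
Record bnd q a C : Prop := Bnd {
  bC : 1 <= C;
  bdeg : (2 <= pdeg q)%N;
  bdegC : (pdeg q)%:R <= C;
  ba : cabs a <= C;
  baV : 1 <= C * cabs a;
  blead : `|ln (cabs (lead_coef q))| <= C;
  blog : forall x y, C <= cabs y -> cabs x <= cabs y ->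
    `|ln (cabs (q.[y] - a * x)) - ((pdeg q)%:R * ln (cabs y) + ln (cabs (lead_coef q)))| <= C / cabs y;
  bpos : forall x y, C <= cabs y -> cabs x <= cabs y -> 2 * cabs y <= cabs (q.[y] - a * x);
  bvm : forall x y, C <= cabs y -> cabs (q.[y] - a * x) <= cabs y -> cabs y ^+ 2 <= C * cabs x;
  bdlog : forall y, C <= cabs y ->
    `|ln (cabs q^`().[y]) - ((pdeg q).-1%:R * ln (cabs y) + ln (cabs (lead_coef q *+ pdeg q)))| <= C / cabs y;
  bdlow : forall y, C <= cabs y -> cabs y <= C * cabs q^`().[y];
  btay : forall y e e' r, C <= cabs y -> cabs e <= r -> cabs e' <= r -> r <= cabs y ->
    cabs (q.[y + e] - q.[y + e'] - q^`().[y] * (e - e')) * cabs y <= C * r * cabs q^`().[y] * cabs (e - e');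
  blip : forall y z r, 1 <= r -> cabs y <= r -> cabs z <= r ->
    cabs (q.[y] - q.[z]) <= C * r ^+ pdeg q * cabs (y - z);
  bup : forall y r, 1 <= r -> cabs y <= r -> cabs q.[y] <= C * r ^+ pdeg q }.

Lemma bnd_mono q a C C' : bnd q a C -> C <= C' -> bnd q a C'.
Proof.
move=> [h1 h2 h3 h4 h5 h6 h7 h8 h9 h10 h11 h12 h13 h14] CC'.
have C0 : 0 < C by lra.
have q' y : cabs y != 0 -> C / cabs y <= C' / cabs y by move=> y0; rewrite ler_wpM2r// invr_ge0.
have pos y : C' <= cabs y -> 0 < cabs y by lra.
split => //; try by apply: (le_trans _ CC').
- by apply: le_trans h5 _; exact: ler_wpM2r.
- move=> x y yC xy; apply: le_trans (h7 x y _ xy) _; first lra.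
  by apply: q'; rewrite gt_eqF// pos.
- by move=> x y yC xy; apply: h8 => //; lra.
- move=> x y yC xy; apply: le_trans (h9 x y _ xy) _; first lra.
  exact: ler_wpM2r.
- move=> y yC; apply: le_trans (h10 y _) _; first lra.
  by apply: q'; rewrite gt_eqF// pos.
- move=> y yC; apply: le_trans (h11 y _) _; first lra.
  exact: ler_wpM2r.
- move=> y e e' r yC er e'r ry; apply: le_trans (h12 y e e' r _ er e'r ry) _; first lra.
  by do 3 apply: ler_wpM2r => //; exact: le_trans er.
- move=> y z r r1 yr zr; apply: le_trans (h13 y z r r1 yr zr) _.
  by do 2 apply: ler_wpM2r => //; rewrite exprn_ge0//; lra.
- move=> y r r1 yr; apply: le_trans (h14 y r r1 yr) _.
  by apply: ler_wpM2r => //; rewrite exprn_ge0//; lra.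
Qed.

(* f y = l y^n (1 + O(1/|y|)) *)
Lemma ln_lead (l y u : R[i]) n (K : R) : l != 0 -> 0 <= K -> 10 * K <= cabs y -> 0 < cabs y ->
  cabs (u - l * y ^+ n) <= K * cabs l * cabs y ^+ n / cabs y ->
  cabs l * cabs y ^+ n / 2 <= cabs u /\
  `|ln (cabs u) - (n%:R * ln (cabs y) + ln (cabs l))| <= 5 * K / cabs y.
Proof.
move=> l0 K0 Ky y0 hu.
have yn0 : y != 0 by rewrite -cabs_gt0.
have l0' : 0 < cabs l by rewrite cabs_gt0.
have yn : 0 < cabs y ^+ n by rewrite exprn_gt0.
have ly : 0 < cabs l * cabs y ^+ n by rewrite mulr_gt0.
pose w := (u - l * y ^+ n) / (l * y ^+ n).
have wE : u = l * y ^+ n * (1 + w).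
  by rewrite /w; field; rewrite l0 expf_neq0.
have wK : cabs w <= K / cabs y.
  rewrite /w cabsf cabsM cabsX ler_pdivrMr// (le_trans hu)//.
  by rewrite le_eqVlt; apply/orP; left; apply/eqP; ring.
have w2 : cabs w <= 1 / 2.
  by rewrite (le_trans wK)// ler_pdivrMr//; lra.
have w1 : 1 / 2 <= cabs (1 + w).
  by have := cabs_dist 1 (- w); rewrite opprK cabsN cabs1; lra.
rewrite wE !cabsM cabsX; split.
  by rewrite ler_pM2l//; lra.
rewrite !lnM ?posrE ?mulr_gt0//; last lra.
rewrite lnXn// -[ln (cabs y) *+ n]mulr_natl.
have -> : ln (cabs l) + n%:R * ln (cabs y) + ln (cabs (1 + w)) - (n%:R * ln (cabs y) + ln (cabs l)) = ln (cabs (1 + w)) by ring.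
by rewrite (le_trans (ln_cabs1D_small w2))// -mulrA ler_wpM2l.
Qed.

Lemma bnd_exists q a : (2 <= pdeg q)%N -> a != 0 -> exists C, bnd q a C.
Proof.
move=> dq a0.
case dE : (pdeg q) dq => [|[|n]] // _.
have szq : size q = n.+3 by move: dE; rewrite /pdeg; case: (size q) => //= m ->.
pose l := lead_coef q.
have l0 : l != 0 by rewrite lead_coef_eq0 -size_poly_eq0 szq.
have lE : l = q`_n.+2 by rewrite /l lead_coefE szq.
have l0' : 0 < cabs l by rewrite cabs_gt0.
have [|K1 [K10 hK1]] := @lead_estimate R n.+1 q; first by rewrite szq.
have szq' : (size q^`() <= n.+2)%N.
  by rewrite -ltnS -szq lt_size_deriv// -size_poly_eq0 szq.
have [K3 [K30 hK3]] := @lead_estimate R n q^`() szq'.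
have l'E : q^`()`_n.+1 = l *+ n.+2 by rewrite coef_deriv lE.
have [|K4 [K40 hK4]] := @poly_estimates R n.+2 q; first by rewrite szq.
have [|K5 [K50 hK5]] := @lip_estimate R n.+2 q; first by rewrite szq.
have a0' : 0 < cabs a by rewrite cabs_gt0.
pose K2 := (K1 + cabs a) / cabs l.
have K20 : 0 <= K2 by rewrite divr_ge0// addr_ge0.
have ln0' : 0 < cabs (l *+ n.+2).
  by rewrite cabs_gt0 mulrn_eq0 negb_or.
pose K3' := K3 / cabs (l *+ n.+2).
have K30' : 0 <= K3' by rewrite divr_ge0// ltW.
have lV0 : 0 < (cabs l)^-1 by rewrite invr_gt0.
have aV0 : 0 < (cabs a)^-1 by rewrite invr_gt0.
pose K6 := K4 / cabs l; have K60 : 0 <= K6 by rewrite divr_ge0// ltW.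
pose K7 := 4 * cabs a / cabs l; have K70 : 0 <= K7 by rewrite divr_ge0 ?mulr_ge0// ltW.
have nn : 0 <= n.+2%:R :> R by [].
have ll := normr_ge0 (ln (cabs l)).
(* A sum of nonnegative requirements, so that each bound below is linear: [10 * K2] and [10 * K3']
   serve [ln_lead], [4 / |l|] the doubling [bpos], [K6] the Taylor remainder and [K7] the bound
   [bvm]. *)
pose C := 1 + n.+2%:R + cabs a + (cabs a)^-1 + `|ln (cabs l)| + 10 * K2 + 10 * K3' + 4 * (cabs l)^-1 + K6 + K7 + K5.
have [[c1 c2 c3 c4 c5] [[c6 c7 c8 c9 c10] c11]] :
  [/\ 1 <= C, n.+2%:R <= C, cabs a <= C, (cabs a)^-1 <= C & `|ln (cabs l)| <= C] /\
  ([/\ 10 * K2 <= C, 10 * K3' <= C, 4 * (cabs l)^-1 <= C, K6 <= C & K7 <= C] /\ K5 <= C).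
  by rewrite /C; repeat split; (clear - ll nn K70 K60 aV0 lV0 K30' K20 a0' K50; lra).
clearbody C.
have dln : cabs (l *+ n.+2) = n.+2%:R * cabs l.
  by rewrite -[l *+ _]mulr_natl cabsM cabs_nat.
have main x y : C <= cabs y -> cabs x <= cabs y ->
   cabs l * cabs y ^+ n.+2 / 2 <= cabs (q.[y] - a * x) /\
   `|ln (cabs (q.[y] - a * x)) - (n.+2%:R * ln (cabs y) + ln (cabs l))| <= 5 * K2 / cabs y.
  move=> yC xy; apply: ln_lead => //; [(clear - yC c6; lra)|(clear - yC c1; lra)|].
  have y1 := le_trans c1 yC.
  have h := hK1 y y1; rewrite -lE in h.
  have -> : q.[y] - a * x - l * y ^+ n.+2 = q.[y] - l * y ^+ n.+2 - a * x by ring.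
  rewrite (le_trans (cabsB _ _))// cabsM.
  have -> : K2 * cabs l * cabs y ^+ n.+2 / cabs y = K1 * cabs y ^+ n.+1 + cabs a * cabs y ^+ n.+1.
    rewrite /K2 exprS; field; rewrite !gt_eqF//; (clear - y1; lra).
  apply: lerD => //; apply: ler_wpM2l => //; rewrite (le_trans xy)//.
  by rewrite exprS ler_peMr// exprn_ege1.
have dmain y : C <= cabs y ->
   cabs (l *+ n.+2) * cabs y ^+ n.+1 / 2 <= cabs q^`().[y] /\
   `|ln (cabs q^`().[y]) - (n.+1%:R * ln (cabs y) + ln (cabs (l *+ n.+2)))| <= 5 * K3' / cabs y.
  move=> yC; apply: ln_lead => //; [by rewrite -cabs_gt0|(clear - yC c7; lra)|(clear - yC c1; lra)|].
  have y1 := le_trans c1 yC.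
  have h := hK3 y y1; rewrite l'E in h.
  have -> : K3' * cabs (l *+ n.+2) * cabs y ^+ n.+1 / cabs y = K3 * cabs y ^+ n.
    rewrite /K3' exprS; field; rewrite !gt_eqF//; (clear - y1; lra).
  exact: h.
have dlow y : C <= cabs y -> cabs l * cabs y ^+ n.+1 <= cabs q^`().[y].
  move=> yC; have [h _] := dmain y yC; apply: le_trans h.
  rewrite dln; have n2 : 2 <= n.+2%:R :> R by rewrite ler_nat.
  have : 2 * (cabs l * cabs y ^+ n.+1) <= n.+2%:R * (cabs l * cabs y ^+ n.+1).
    by apply: ler_wpM2r => //; rewrite mulr_ge0// exprn_ge0.
  (clear; lra).
have Cge K : 0 <= K -> K <= C -> forall y, C <= cabs y -> K / cabs y <= C / cabs y.
  by move=> K0 KC y yC; rewrite ler_wpM2r// invr_ge0.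
have [k20 k2C k30 k3C] : [/\ 0 <= 5 * K2, 5 * K2 <= C, 0 <= 5 * K3' & 5 * K3' <= C] by split; (clear - K20 c6 c1 K30' c7; lra).
clear K10 K30 hK1 hK3 c6 c7 K20 K30' nn ll ln0'.
exists C; split; rewrite ?dE -/l //.
- have : (cabs a)^-1 * cabs a <= C * cabs a by apply: ler_wpM2r => //; lra.
  by rewrite mulVf ?gt_eqF.
- move=> x y yC xy; have [_ h] := main x y yC xy; apply: le_trans h _.
  exact: Cge.
- move=> x y yC xy; have [h _] := main x y yC xy; apply: le_trans h.
  have y1 := le_trans c1 yC.
  have : 4 * (cabs l)^-1 <= cabs y by (clear - yC c8; lra).
  rewrite ler_pdivrMr// => h4.
  have yn : cabs y * cabs y <= cabs y ^+ n.+2.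
    by rewrite !exprS mulrA ler_peMr ?mulr_ge0// exprn_ege1.
  have : cabs l * (cabs y * cabs y) <= cabs l * cabs y ^+ n.+2 by rewrite ler_pM2l.
  have : 4 * cabs y <= cabs y * cabs l * cabs y by rewrite ler_wpM2r.
  (clear; lra).
(* If [q(y) - a x] is no larger than [y], then [a x] must compensate [q(y)], whose modulus is at
   least [|l| |y|^2 / 2]; so [|x|] is at least of order [|y|^2]. *)
- move=> x y yC hy.
  have y1 := le_trans c1 yC.
  have c00 : cabs (0 : R[i]) <= cabs y by rewrite cabs0.
  have [h _] := main 0 y yC c00.
  rewrite mulr0 subr0 in h.
  have yn : cabs y * cabs y <= cabs y ^+ n.+2.
    by rewrite !exprS mulrA ler_peMr ?mulr_ge0// exprn_ege1.
  have h1 : cabs l * (cabs y * cabs y) <= cabs l * cabs y ^+ n.+2 by rewrite ler_pM2l.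
  have : 4 * (cabs l)^-1 <= cabs y by (clear - yC c8; lra).
  rewrite ler_pdivrMr// => h4.
  have h5 : 4 * cabs y <= cabs y * cabs l * cabs y by rewrite ler_wpM2r.
  have h6 : cabs q.[y] <= cabs y + cabs a * cabs x.
    by have := cabs_dist q.[y] (a * x); rewrite cabsM; (clear - hy; lra).
  have h7 : cabs l * (cabs y * cabs y) <= 4 * (cabs a * cabs x) by (clear - h6 h5 h1 h; lra).
  have h8 : cabs y ^+ 2 <= K7 * cabs x.
    rewrite /K7 mulrAC ler_pdivlMr// expr2; (clear - h7; lra).
  apply: (le_trans h8); apply: ler_wpM2r => //; lra.
- move=> y yC; have [_ h] := dmain y yC; apply: le_trans h _.
  exact: Cge.
- move=> y yC; have h := dlow y yC.
  have y1 := le_trans c1 yC.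
  have h1 : cabs l * cabs y <= cabs l * cabs y ^+ n.+1.
    by rewrite ler_pM2l// exprS ler_peMr// exprn_ege1.
  have h2 : (cabs l)^-1 * (cabs l * cabs y) <= C * cabs q^`().[y].
    apply: ler_pM => //; rewrite ?mulr_ge0//; first exact: ltW.
      (clear - k3C k30 c8; lra).
    exact: le_trans h1 h.
  by move: h2; rewrite mulrA mulVf ?gt_eqF// mul1r.
- move=> y e e' r yC er e'r ry.
  have y1 := le_trans c1 yC.
  have y0 : 0 < cabs y by (clear - y1; lra).
  have [_ _ _ /(_ e e' r er e'r ry) h] := hK4 y y1.
  rewrite -(ler_pM2r y0) [leLHS](_ : _ = cabs (q.[y + e] - q.[y + e'] - q^`().[y] * (e - e')) * cabs y ^+ 2); last first.
    by rewrite expr2 mulrA.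
  apply: (le_trans h).
  have h1 := dlow y yC.
  have h2 : (cabs l)^-1 * (cabs l * cabs y ^+ n.+1) <= (cabs l)^-1 * cabs q^`().[y].
    by rewrite ler_pM2l.
  move: h2; rewrite mulrA mulVf ?gt_eqF// mul1r => h2.
  have r0 : 0 <= r := le_trans (cabs_ge0 _) er.
  have h3 : K4 * r * cabs (e - e') * cabs y * cabs y ^+ n.+1 <= K4 * r * cabs (e - e') * cabs y * ((cabs l)^-1 * cabs q^`().[y]).
    by apply: ler_wpM2l => //; rewrite !mulr_ge0.
  have h4 : K6 * (r * cabs q^`().[y] * cabs (e - e') * cabs y) <= C * (r * cabs q^`().[y] * cabs (e - e') * cabs y).
    by apply: ler_wpM2r; [rewrite !mulr_ge0|(clear - c9; lra)].
  have h5 : K6 * (r * cabs q^`().[y] * cabs (e - e') * cabs y) = K4 * r * cabs (e - e') * cabs y * ((cabs l)^-1 * cabs q^`().[y]).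
    by rewrite /K6; ring.
  rewrite exprS; (clear - h5 h4 h3; lra).
- move=> y z r r1 yr zr; have [h _] := hK5 y z r r1 yr zr.
  apply: (le_trans h); do 2 apply: ler_wpM2r => //.
    by rewrite exprn_ge0//; (clear - r1; lra).
- move=> y r r1 yr; have [_ h] := hK5 y y r r1 yr yr.
  apply: (le_trans h); apply: ler_wpM2r => //.
    by rewrite exprn_ge0//; (clear - r1; lra).
Qed.

Lemma bnd_periodic m (q : nat -> {poly R[i]}) (a : nat -> R[i]) :
  (0 < m)%N -> (forall k, q (k + m)%N = q k) -> (forall k, a (k + m)%N = a k) ->
  (forall k, (2 <= pdeg (q k))%N) -> (forall k, a k != 0) ->
  exists C, forall k, bnd (q k) (a k) C.
Proof.
move=> m0 qm am dq an0.
have fin n : exists C, forall k, (k < n)%N -> bnd (q k) (a k) C.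
  elim: n => [|n [C ih]]; first by exists 0.
  have [C' hC'] := bnd_exists (dq n) (an0 n).
  exists (Num.max C C') => k; rewrite ltnS leq_eqVlt => /orP[/eqP ->|kn].
    by apply: bnd_mono hC' _; rewrite le_max lexx orbT.
  by apply: bnd_mono (ih k kn) _; rewrite le_max lexx.
have [C hC] := fin m; exists C => k.
have per j i : q (i + j * m)%N = q i /\ a (i + j * m)%N = a i.
  by elim: j => [|j [h1 h2]]; rewrite ?addn0// mulSn addnCA addnC qm am.
have [h1 h2] := per (k %/ m)%N (k %% m)%N.
rewrite (divn_eq k m) addnC h1 h2; apply: hC; exact: ltn_pmod.
Qed.

End UniformBounds.

(** * Orbits and the Green function *)

Section Dynamics.
Context {R : realType}.
Implicit Types (z w : C2 R) (r x y e : R) (n k : nat).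

(** Shifting the data turns a statement at level 0 about the point [F_n z] into one about the orbit
    of [z] from level [n] on, with the same constant [C]. *)
Definition stail (T : Type) n (u : nat -> T) : nat -> T := fun k => u (n + k)%N.

Section Orbit.
Variables (q : nat -> {poly R[i]}) (a : nat -> R[i]).

Fixpoint hiter n z : C2 R := if n is k.+1 then henon (q k) (a k) (hiter k z) else z.

Definition hinv k w : C2 R := (((q k).[w.1] - w.2) / a k, w.1).

Fixpoint hiterV n z : C2 R := if n is k.+1 then hiterV k (hinv k z) else z.

Definition hdeg n : nat := \prod_(0 <= k < n) pdeg (q k).

Definition xorb z n : R[i] := (hiter n z).1.

Lemma xorbS z n : xorb z n.+1 = (hiter n z).2. Proof. by []. Qed.

Lemma xorb_rec z n : xorb z n.+2 = (q n).[xorb z n.+1] - a n * xorb z n.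
Proof. by []. Qed.

Lemma hdegS n : hdeg n.+1 = (hdeg n * pdeg (q n))%N.
Proof. by rewrite /hdeg big_nat_recr. Qed.

Lemma hdeg0 : hdeg 0 = 1%N. Proof. by rewrite /hdeg big_nil. Qed.

End Orbit.

Lemma hiterD q a n k z : hiter q a (n + k) z = hiter (stail n q) (stail n a) k (hiter q a n z).
Proof. by elim: k => [|k ih]; rewrite ?addn0// addnS /= ih. Qed.

Lemma hdegD q n k : hdeg q (n + k) = (hdeg q n * hdeg (stail n q) k)%N.
Proof.
elim: k => [|k ih]; first by rewrite addn0 hdeg0 muln1.
by rewrite addnS !hdegS ih mulnA.
Qed.

Definition nrm z : R := Num.max (cabs z.1) (cabs z.2).

Definition lg z : R := ln (Num.max 1 (nrm z)).

Lemma nrm_ge0 z : 0 <= nrm z. Proof. by rewrite le_max cabs_ge0. Qed.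

Lemma nrm1 z : cabs z.1 <= nrm z. Proof. by rewrite le_max lexx. Qed.
Lemma nrm2 z : cabs z.2 <= nrm z. Proof. by rewrite le_max lexx orbT. Qed.

Lemma nrm_le z r : (nrm z <= r) = (cabs z.1 <= r) && (cabs z.2 <= r).
Proof. by rewrite ge_max. Qed.

Lemma max1_gt0 z : 0 < Num.max 1 (nrm z).
Proof. by rewrite lt_max ltr01. Qed.

Lemma lg_ge0 z : 0 <= lg z.
Proof. by rewrite ln_ge0// le_max lexx. Qed.

Lemma lg_le z r : 1 <= r -> nrm z <= r -> lg z <= ln r.
Proof.
move=> r1 zr; rewrite ler_ln ?posrE ?max1_gt0//; last lra.
by rewrite ge_max r1.
Qed.

Lemma lg_ge z x : 0 < x -> x <= nrm z -> ln x <= lg z.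
Proof. by move=> x0 xz; rewrite ler_ln ?posrE ?max1_gt0// le_max xz orbT. Qed.

Lemma nrm_le_exp z : nrm z <= expR (lg z).
Proof. by rewrite lnK ?posrE ?max1_gt0// le_max lexx orbT. Qed.

(** The region [V+] of the usual filtration for Henon maps: forward invariant for [r] at least [C],
    with the second coordinate at least doubling. *)
Definition vplus r z := r <= cabs z.2 /\ cabs z.1 <= cabs z.2.

(** The complement of the region [V-] where the first coordinate dominates. On it a step multiplies
    [lg] by the degree up to an error bounded in both directions. *)
Definition good r z := cabs z.1 <= Num.max r (cabs z.2).

Lemma vplus_good r z : vplus r z -> good r z.
Proof. by move=> [_ h]; rewrite /good le_max h orbT. Qed.

Lemma goodP r z : good r z -> nrm z <= r \/ vplus r z.
Proof.
rewrite /good /vplus nrm_le le_max => h.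
have [h2|h2] := leP (cabs z.2) r; last by right; split; [exact: ltW|case/orP: h => // h; lra].
by case/orP: h => h; left; rewrite andbT; [|exact: le_trans h2].
Qed.

Lemma vplus_nrm r z : vplus r z -> nrm z = cabs z.2.
Proof. by move=> [_ h]; rewrite /nrm max_r. Qed.

Section Filtration.
Variables (q : nat -> {poly R[i]}) (a : nat -> R[i]) (C : R).
Hypothesis HB : forall k, bnd (q k) (a k) C.
Notation F := (hiter q a).
Notation D := (hdeg q).

Let C1 : 1 <= C := bC (HB 0).

Lemma bnd_aneq0 k : a k != 0.
Proof.
have c1 := C1.
apply/eqP => ak; have := baV (HB k); rewrite ak cabs0 mulr0; lra.
Qed.

Lemma henon_vplus r k z : C <= r -> vplus r z -> vplus (2 * r) (henon (q k) (a k) z) /\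
  2 * cabs z.2 <= cabs (henon (q k) (a k) z).2.
Proof.
move=> Cr [zr z12]; have h := bpos (HB k) (le_trans Cr zr) z12.
have := cabs_ge0 z.2; rewrite /vplus /henon /=; do 2 split => //; lra.
Qed.

Lemma hiter_vplus r n z : C <= r -> vplus r z -> vplus r (F n z) /\ 2 ^+ n * cabs z.2 <= cabs (F n z).2.
Proof.
move=> Cr zr; elim: n => [|n [ih1 ih2]]; first by rewrite expr0 mul1r.
have [h1 h2] := henon_vplus n Cr ih1; split; last by rewrite exprS -mulrA (le_trans _ h2)// ler_pM2l.
by case: h1 => h3 h4; split => //; apply: le_trans h3; have c1 := C1; lra.
Qed.

(** In [henon_ngood] a first coordinate that is not halved would force [|y| <= 2 C]; the factor 4
    excludes this. *)
Definition rgood : R := 4 * C.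

Lemma henon_good k z : good rgood z -> good rgood (henon (q k) (a k) z).
Proof.
have c1 := C1.
have Cr : C <= rgood by rewrite /rgood; lra.
move=> /goodP[|zV]; last first.
  apply: vplus_good; have [[h1 h2] _] := henon_vplus k Cr zV; split => //.
  by rewrite /rgood in h1 *; lra.
by rewrite nrm_le => /andP[_ h]; rewrite /good /henon /= le_max h.
Qed.

Lemma henon_ngood k z : ~ good rgood (henon (q k) (a k) z) -> cabs (henon (q k) (a k) z).1 <= cabs z.1 / 2.
Proof.
have c1 := C1.
rewrite /good /henon /= => /negP; rewrite -ltNge gt_max => /andP[h1 h2].
have Cz : C <= cabs z.2 by rewrite /rgood in h1; lra.
have h := bvm (HB k) Cz (ltW h2).
have z0 : 0 < cabs z.2 by lra.
rewrite leNgt; apply/negP => h3.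
have : cabs z.2 * cabs z.2 <= C * (2 * cabs z.2).
  rewrite -expr2 (le_trans h)// ler_wpM2l//; lra.
rewrite mulrA ler_pM2r//; rewrite /rgood in h1; lra.
Qed.

Lemma hiter_good n k z : good rgood (F n z) -> good rgood (F (n + k) z).
Proof. by move=> h; elim: k => [|k ih]; rewrite ?addn0// addnS /=; exact: henon_good. Qed.

(** Outside [good] the first coordinate is halved at each step although it must exceed [rgood]. The
    waiting time depends only on a bound for [z.1], and this makes the estimates on [G] locally
    uniform. *)
Lemma eventually_good r : exists N, forall n z, (N <= n)%N -> cabs z.1 <= r -> good rgood (F n z).
Proof.
have c1 := C1.
have step n z : cabs (F n z).1 <= cabs z.1 / 2 ^+ n \/ good rgood (F n z).
  elim: n => [|n [ih|ih]]; first by left; rewrite expr0 divr1.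
  - have [h|/henon_ngood h] := pselect (good rgood (F n.+1 z)); [by right|left].
    by rewrite exprSr invfM mulrA; apply: (le_trans h); apply: ler_wpM2r => //; rewrite invr_ge0.
  - by right; exact: henon_good.
have r0 : 0 < rgood by rewrite /rgood; lra.
exists (Num.bound (`|r| / rgood)) => n z Nn zr.
have [h|//] := step n z; rewrite /good le_max (le_trans h)//.
rewrite ler_pdivrMr ?exprn_gt0// mulrC -ler_pdivrMr//.
have := archi_boundP (divr_ge0 (normr_ge0 r) (ltW r0)) => h1.
apply: (@le_trans _ _ (`|r| / rgood)).
  by apply: ler_wpM2r; [rewrite invr_ge0 ltW|rewrite (le_trans zr)// ler_norm].
apply: le_trans (ltW h1) _.
by rewrite -natrX ler_nat (leq_trans Nn)// ltnW// ltn_expl.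
Qed.

Lemma hdeg_gt0 n : (0 < D n)%N.
Proof.
elim: n => [|n ih]; rewrite ?hdeg0// hdegS muln_gt0 ih /=.
by rewrite (leq_trans _ (bdeg (HB n))).
Qed.

Lemma hdeg_ge n : (2 ^ n <= D n)%N.
Proof.
elim: n => [|n ih]; rewrite ?hdeg0// hdegS expnSr leq_mul//; exact: bdeg (HB n).
Qed.

Lemma hdegR_gt0 n : 0 < (D n)%:R :> R. Proof. by rewrite ltr0n hdeg_gt0. Qed.

Lemma hdeg_large x : exists N, forall n, (N <= n)%N -> x < (D n)%:R.
Proof.
exists (Num.bound `|x|) => n Nn.
rewrite (le_lt_trans (ler_norm x))// (lt_le_trans (archi_boundP (normr_ge0 x)))//.
by rewrite ler_nat (leq_trans Nn)// (leq_trans _ (hdeg_ge n))// ltnW// ltn_expl.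
Qed.

(** Bounds the error of one step for [lg]. The summand [C * ln rgood] covers the bidisc of radius
    [rgood], whose points may be sent near 0. *)
Definition cgr : R := 2 * C + C * ln rgood + 1.

Lemma ln_rgood_ge0 : 0 <= ln rgood.
Proof. by have c1 := C1; rewrite ln_ge0// /rgood; lra. Qed.

Lemma cgr_gt0 : 0 < cgr.
Proof. by have c1 := C1; have := mulr_ge0 (le_trans ler01 C1) ln_rgood_ge0; rewrite /cgr; lra. Qed.

Lemma lg_henon_le k z : lg (henon (q k) (a k) z) <= (pdeg (q k))%:R * lg z + cgr.
Proof.
have c1 := C1.
pose r := Num.max 1 (nrm z).
have r1 : 1 <= r by rewrite le_max lexx.
have rz : nrm z <= r by rewrite le_max lexx orbT.
have r0 : 0 < r by lra.
have C0 : 0 <= C by lra.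
have rd : r <= r ^+ pdeg (q k).
  by rewrite -[leLHS]expr1 ler_weXn2l//; apply: leq_trans (bdeg (HB k)).
have y1 : cabs (q k).[z.2] <= C * r ^+ pdeg (q k).
  by apply: (bup (HB k)) => //; exact: le_trans (nrm2 z) rz.
have y2 : cabs (a k * z.1) <= C * r ^+ pdeg (q k).
  rewrite cabsM; apply: ler_pM => //; first exact: ba (HB k).
  exact: le_trans (nrm1 z) (le_trans rz rd).
have rd1 : 1 <= r ^+ pdeg (q k) by exact: le_trans rd.
have : nrm (henon (q k) (a k) z) <= 2 * C * r ^+ pdeg (q k).
  rewrite nrm_le /henon /=; apply/andP; split.
    have := le_trans (nrm2 z) (le_trans rz rd).
    have : 1 * r ^+ pdeg (q k) <= C * r ^+ pdeg (q k) by rewrite ler_wpM2r//; lra.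
    lra.
  have := cabsB (q k).[z.2] (a k * z.1); lra.
move=> /lg_le h; apply: le_trans (h _) _.
  by have := ler_pM ler01 ler01 C1 rd1; lra.
rewrite lnM ?posrE ?exprn_gt0//; last lra.
have -> : ln (r ^+ pdeg (q k)) = (pdeg (q k))%:R * lg z by rewrite lnXn// mulr_natl.
have : ln (2 * C) <= 2 * C - 1 by apply: ln_le_sub1; lra.
have := mulr_ge0 C0 ln_rgood_ge0; rewrite /cgr; lra.
Qed.

Lemma lg_henon_ge k z : good rgood z -> (pdeg (q k))%:R * lg z - cgr <= lg (henon (q k) (a k) z).
Proof.
have c1 := C1.
have C0 : 0 <= C by lra.
have cl := mulr_ge0 C0 ln_rgood_ge0.
move=> /goodP[zr|zV].
  have : lg z <= ln rgood by apply: lg_le => //; rewrite /rgood; lra.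
  move=> h; have := lg_ge0 (henon (q k) (a k) z).
  have : (pdeg (q k))%:R * lg z <= C * ln rgood.
    by apply: ler_pM => //; [exact: lg_ge0|exact: bdegC (HB k)].
  rewrite /cgr; lra.
have [zr z12] := zV; have Cz : C <= cabs z.2 by rewrite /rgood in zr; lra.
have lz : lg z = ln (cabs z.2).
  by rewrite /lg (vplus_nrm zV) max_r//; lra.
have := blog (HB k) Cz z12.
have := blead (HB k).
have q1 : C / cabs z.2 <= 1 by rewrite ler_pdivrMr; lra.
have y0 : 0 < cabs ((q k).[z.2] - a k * z.1) by have := bpos (HB k) Cz z12; lra.
have := @lg_ge (henon (q k) (a k) z) _ y0 (nrm2 (henon (q k) (a k) z)).
rewrite lz !ler_norml /cgr; lra.
Qed.

Lemma hiter_upper n z : lg (F n z) <= (D n)%:R * (lg z + cgr).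
Proof.
(* The weight [D n - 1] in place of [D n] closes the induction: a step multiplies the old error by a
   degree at least 2 and adds one [cgr]. *)
suff h : lg (F n z) <= (D n)%:R * lg z + ((D n)%:R - 1) * cgr.
  by have := cgr_gt0; lra.
elim: n => [|n ih]; first by rewrite hdeg0 mul1r subrr mul0r addr0.
apply: (le_trans (lg_henon_le _ _)); rewrite hdegS natrM.
have d2 : 2 <= (pdeg (q n))%:R :> R by rewrite ler_nat; exact: bdeg (HB n).
have := ler_wpM2l (le_trans (ler0n _ 2) d2) ih.
have : 1 * cgr <= ((pdeg (q n))%:R - 1) * cgr.
  by apply: ler_wpM2r; [exact/ltW/cgr_gt0|lra].
lra.
Qed.

Definition gseq n z : R := lg (F n z) / (D n)%:R.

Lemma gseq_step n z : good rgood (F n z) -> `|gseq n.+1 z - gseq n z| <= cgr / (D n.+1)%:R.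
Proof.
move=> h; have D0 := hdegR_gt0 n; have D1 := hdegR_gt0 n.+1.
have d0 : 0 < (pdeg (q n))%:R :> R by rewrite ltr0n (leq_trans _ (bdeg (HB n))).
have -> : gseq n.+1 z - gseq n z = (lg (F n.+1 z) - (pdeg (q n))%:R * lg (F n z)) / (D n.+1)%:R.
  by rewrite /gseq hdegS natrM; field; rewrite !gt_eqF.
rewrite normrM normfV (gtr0_norm D1) ler_pM2r ?invr_gt0//.
have := lg_henon_le n (F n z); have := lg_henon_ge n h.
by rewrite ler_norml /=; lra.
Qed.

(** Degrees at least double, so the step error [cgr / D_(k+1)] is at most
    [cgr (1 / D_k - 1 / D_(k+1))]; in this form the errors telescope. *)
Lemma gseq_cauchy n k z : good rgood (F n z) -> `|gseq (n + k) z - gseq n z| <= cgr * ((D n)%:R^-1 - (D (n + k))%:R^-1).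
Proof.
move=> h; elim: k => [|k ih]; first by rewrite addn0 !subrr normr0 mulr0.
rewrite addnS; have h1 := gseq_step (hiter_good k h).
have -> : gseq (n + k).+1 z - gseq n z = (gseq (n + k).+1 z - gseq (n + k) z) + (gseq (n + k) z - gseq n z) by ring.
apply: (le_trans (ler_normD _ _)); apply: (le_trans (lerD h1 ih)).
have D2 : (D (n + k).+1)%:R^-1 * 2 <= (D (n + k))%:R^-1 :> R.
  rewrite hdegS natrM invfM -mulrA ler_piMr ?invr_ge0//.
  by rewrite mulrC ler_pdivrMr ?mul1r ?ler_nat ?ltr0n ?(leq_trans _ (bdeg (HB _)))// bdeg.
have := ler_wpM2l (ltW cgr_gt0) D2; lra.
Qed.

(** Letting the later index of [gseq_cauchy] tend to infinity keeps the same constant [cgr] at every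
    good level. *)
Lemma gr_exists z : exists g : R, forall n, good rgood (F n z) -> `|lg (F n z) - (D n)%:R * g| <= cgr.
Proof.
have [N hN] := eventually_good (cabs z.1).
have {}hN n : (N <= n)%N -> good rgood (F n z) by move=> /hN; apply.
have [g hg] : exists l, forall e, 0 < e -> exists N, forall n, (N <= n)%N -> `|gseq n z - l| < e.
  apply: rcauchy => e e0; have e2 : 0 < e / 2 by rewrite divr_gt0.
  have [M hM] := hdeg_large (cgr / (e / 2)).
  pose K := maxn M N.
  have key m : (K <= m)%N -> `|gseq m z - gseq K z| < e / 2.
    move=> Km; rewrite -(subnKC Km); apply: le_lt_trans (gseq_cauchy _ (hN K (leq_maxr _ _))) _.
    have := hM K (leq_maxl _ _); rewrite ltr_pdivrMr// => h.
    have : 0 <= cgr * (D (K + (m - K)))%:R^-1 by rewrite mulr_ge0 ?invr_ge0// ltW ?cgr_gt0.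
    have : cgr * (D K)%:R^-1 < e / 2 by rewrite ltr_pdivrMr ?hdegR_gt0// mulrC.
    rewrite mulrBr; lra.
  exists K => m n /key h1 /key h2; have := ler_normB (gseq m z - gseq K z) (gseq n z - gseq K z).
  by rewrite opprB addrA subrK; lra.
exists g => n hn; have D0 := hdegR_gt0 n.
suff h : `|gseq n z - g| <= cgr / (D n)%:R.
  have -> : lg (F n z) - (D n)%:R * g = (gseq n z - g) * (D n)%:R by rewrite /gseq; field; rewrite gt_eqF.
  by rewrite normrM (ger0_norm (ltW D0)) -ler_pdivlMr.
apply/ler_addgt0Pr => e e0; have [M hM] := hg e e0.
have h1 := hM (n + M)%N (leq_addl _ _).
have h2 := gseq_cauchy M hn.
have h3 : 0 <= cgr * (D (n + M))%:R^-1 by rewrite mulr_ge0 ?invr_ge0// ltW ?cgr_gt0.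
have -> : gseq n z - g = (gseq (n + M) z - g) - (gseq (n + M) z - gseq n z) by ring.
apply: (le_trans (ler_normB _ _)); move: h1 h2; rewrite mulrBr; lra.
Qed.

End Filtration.
End Dynamics.

(** * The Green function: uniqueness, continuity and functional equation *)

Section Green.
Context {R : realType}.
Implicit Types (z w : C2 R) (r x y e : R) (n k : nat).

Definition dst z w : R := Num.max (cabs (z.1 - w.1)) (cabs (z.2 - w.2)).

Lemma dst1 z w : cabs (z.1 - w.1) <= dst z w. Proof. by rewrite le_max lexx. Qed.
Lemma dst2 z w : cabs (z.2 - w.2) <= dst z w. Proof. by rewrite le_max lexx orbT. Qed.
Lemma dst_le z w r : (dst z w <= r) = (cabs (z.1 - w.1) <= r) && (cabs (z.2 - w.2) <= r).
Proof. by rewrite ge_max. Qed.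
Lemma dst_lt z w r : (dst z w < r) = (cabs (z.1 - w.1) < r) && (cabs (z.2 - w.2) < r).
Proof. by rewrite gt_max. Qed.
Lemma dst_ge0 z w : 0 <= dst z w. Proof. by rewrite le_max cabs_ge0. Qed.
Lemma dstC z w : dst z w = dst w z. Proof. by rewrite /dst cabsC (cabsC z.2). Qed.
Lemma nrm_dst z w : nrm z <= nrm w + dst z w.
Proof.
rewrite nrm_le; have := cabs_dist z.1 w.1; have := cabs_dist z.2 w.2.
have := dst1 z w; have := dst2 z w; have := nrm1 w; have := nrm2 w.
by move=> *; apply/andP; split; lra.
Qed.

Lemma dst_nrm z w : dst z w <= nrm z + nrm w.
Proof.
rewrite dst_le; have := cabsB z.1 w.1; have := cabsB z.2 w.2.
have := nrm1 z; have := nrm2 z; have := nrm1 w; have := nrm2 w.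
by move=> *; apply/andP; split; lra.
Qed.

Lemma lg_dst z w : lg z - lg w <= dst z w.
Proof.
have h1 := max1_gt0 z; have h2 := max1_gt0 w; have h3 := nrm_dst z w; have h4 := dst_ge0 z w.
have w1 : 1 <= Num.max 1 (nrm w) by rewrite le_max lexx.
have zw : Num.max 1 (nrm z) <= Num.max 1 (nrm w) + dst z w.
  have h : nrm w <= Num.max 1 (nrm w) by rewrite le_max lexx orbT.
  by rewrite ge_max; apply/andP; split; lra.
rewrite /lg -ln_div ?posrE//; apply: le_trans (ln_le_sub1 _) _; first exact: divr_gt0.
rewrite lerBlDr ler_pdivrMr//.
have : dst z w * 1 <= dst z w * Num.max 1 (nrm w) by rewrite ler_wpM2l.
lra.
Qed.

Section Filtration.
Variables (q : nat -> {poly R[i]}) (a : nat -> R[i]) (C : R).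
Hypothesis HB : forall k, bnd (q k) (a k) C.
Notation F := (hiter q a).
Notation Fi := (hiterV q a).
Notation D := (hdeg q).
Notation rg := (rgood C).
Notation cg := (cgr C).

(* The unique [g] with [log+ |F_n z| = D_n g + O(1)], which exists by [gr_exists]. *)
Definition gr z : R := xget 0 [set g | forall n, good rg (F n z) -> `|lg (F n z) - (D n)%:R * g| <= cg].

Lemma grP n z : good rg (F n z) -> `|lg (F n z) - (D n)%:R * gr z| <= cg.
Proof.
rewrite /gr; case: xgetP => [x _ h|h]; first exact: h.
have [g hg] := gr_exists HB z; by case: (h g).
Qed.

Lemma eventually_good_pt z : exists N, forall n, (N <= n)%N -> good rg (F n z).
Proof. by have [N hN] := eventually_good HB (cabs z.1); exists N => n /hN; apply. Qed.

(** Division by the unbounded degrees removes additive constants: the device by which [O(1)]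
    estimates become exact inequalities. *)
Lemma hdeg_le x y K N : (forall n, (N <= n)%N -> (D n)%:R * x <= (D n)%:R * y + K) -> x <= y.
Proof.
move=> h; rewrite leNgt; apply/negP => yx.
have xy : 0 < x - y by rewrite subr_gt0.
have [M hM] := hdeg_large HB (K / (x - y)).
have := hM _ (leq_maxl M N); rewrite ltr_pdivrMr// => h1.
have := h _ (leq_maxr M N); lra.
Qed.

Lemma gr_uniq g K z N : (forall n, (N <= n)%N -> `|lg (F n z) - (D n)%:R * g| <= K) -> gr z = g.
Proof.
move=> h; have [M hM] := eventually_good_pt z.
have key n : (maxn M N <= n)%N -> (D n)%:R * gr z <= (D n)%:R * g + (K + cg) /\ (D n)%:R * g <= (D n)%:R * gr z + (K + cg).
  rewrite geq_max => /andP[Mn Nn]; have := h n Nn; have := grP (hM n Mn).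
  by rewrite !ler_norml => /andP[h1 h2] /andP[h3 h4]; split; lra.
by apply/eqP; rewrite eq_le; apply/andP; split; apply: (@hdeg_le _ _ (K + cg) (maxn M N)) => n /key[].
Qed.

Lemma gr_ge0 z : 0 <= gr z.
Proof.
have [M hM] := eventually_good_pt z.
apply: (@hdeg_le _ _ cg M) => n /hM/grP; have := lg_ge0 (F n z).
rewrite ler_norml mulr0; lra.
Qed.

Lemma gr_le z : gr z <= lg z + cg.
Proof.
have [M hM] := eventually_good_pt z.
apply: (@hdeg_le _ _ cg M) => n /hM/grP; have := hiter_upper HB n z.
rewrite ler_norml; lra.
Qed.

Lemma gr_good z : good rg z -> `|lg z - gr z| <= cg.
Proof. by move=> h; have := @grP 0 z h; rewrite /= hdeg0 mul1r. Qed.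

Lemma gr_vplus z : vplus rg z -> `|ln (cabs z.2) - gr z| <= cg.
Proof.
move=> zV; have := gr_good (vplus_good zV); rewrite /lg (vplus_nrm zV) max_r//.
case: zV => h _; have c1 := bC (HB 0); rewrite /rgood in h; lra.
Qed.

Lemma gr_vplus_gt0 r z : expR cg < r -> vplus r z -> vplus rg z -> 0 < gr z.
Proof.
move=> er [rz _] /gr_vplus; rewrite ler_norml => h.
have : cg < ln (cabs z.2) by rewrite -ltr_expR lnK ?posrE; have := expR_gt0 cg; lra.
lra.
Qed.

Lemma gr_gt0_vplus r z : 0 < gr z -> exists N, forall n, (N <= n)%N -> vplus r (F n z).
Proof.
move=> g0; have [M hM] := eventually_good_pt z.
have [N hN] := hdeg_large HB ((cg + ln (Num.max rg `|r|)) / gr z).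
have c1 := bC (HB 0).
have m0 : 0 < Num.max rg `|r| by rewrite lt_max /rgood; apply/orP; left; lra.
exists (maxn M N) => n; rewrite geq_max => /andP[/hM Mn /hN Nn].
have := grP Mn; rewrite ltr_pdivrMr// in Nn; rewrite ler_norml => h.
have lgF : ln (Num.max rg `|r|) < lg (F n z) by lra.
have nF : Num.max rg `|r| < nrm (F n z).
  move: lgF; rewrite /lg ltr_ln ?posrE ?max1_gt0// lt_max => /orP[|//].
  by rewrite gt_max /rgood => /andP[]; lra.
move: nF; rewrite gt_max => /andP[n1 n2].
have [|zV] := goodP Mn; first lra.
move: n2; rewrite (vplus_nrm zV) => n2; split; last by case: zV.
by rewrite (le_trans (ler_norm _))// ltW.
Qed.

Lemma gr0_bounded z : gr z = 0 -> exists B, forall n, nrm (F n z) <= B.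
Proof.
move=> g0; have [M hM] := eventually_good_pt z.
exists (\sum_(0 <= k < M) nrm (F k z) + expR cg) => n.
have s0 : 0 <= \sum_(0 <= k < M) nrm (F k z) by apply: sumr_ge0 => i _; exact: nrm_ge0.
have [/hM/grP|nM] := leqP M n.
  rewrite g0 mulr0 subr0 (ger0_norm (lg_ge0 _)) => h.
  have := nrm_le_exp (F n z); have : expR (lg (F n z)) <= expR cg by rewrite ler_expR.
  lra.
rewrite (big_cat_nat (n := n))//=; last exact: ltnW.
rewrite (big_ltn nM).
have : 0 <= \sum_(0 <= k < n) nrm (F k z) by apply: sumr_ge0 => i _; exact: nrm_ge0.
have : 0 <= \sum_(n.+1 <= k < M) nrm (F k z) by apply: sumr_ge0 => i _; exact: nrm_ge0.
have := expR_gt0 cg; lra.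
Qed.

Lemma bounded_gr0 B z : (forall n, nrm (F n z) <= B) -> gr z = 0.
Proof.
move=> h; apply/eqP; rewrite eq_le gr_ge0 andbT.
have [M hM] := eventually_good_pt z.
apply: (@hdeg_le _ _ (cg + ln (Num.max 1 B)) M) => n /hM/grP.
have : lg (F n z) <= ln (Num.max 1 B).
  by apply: lg_le; rewrite le_max ?lexx// h orbT.
by rewrite ler_norml mulr0; lra.
Qed.

Lemma henon_lip k r z w : 1 <= r -> nrm z <= r -> nrm w <= r ->
  dst (henon (q k) (a k) z) (henon (q k) (a k) w) <= 2 * C * r ^+ pdeg (q k) * dst z w.
Proof.
move=> r1 zr wr; have c1 := bC (HB 0).
have rd : 1 <= r ^+ pdeg (q k) by rewrite exprn_ege1.
have Cr : C <= C * r ^+ pdeg (q k) by rewrite ler_peMr//; lra.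
rewrite dst_le /henon /=.
have d0 := dst_ge0 z w.
apply/andP; split.
  apply: le_trans (dst2 z w) _; rewrite ler_peMl//; lra.
have -> : (q k).[z.2] - a k * z.1 - ((q k).[w.2] - a k * w.1) =
  ((q k).[z.2] - (q k).[w.2]) - a k * (z.1 - w.1) by ring.
apply: le_trans (cabsB _ _) _; rewrite cabsM.
have h1 : cabs ((q k).[z.2] - (q k).[w.2]) <= C * r ^+ pdeg (q k) * dst z w.
  apply: (le_trans (blip (HB k) r1 (le_trans (nrm2 z) zr) (le_trans (nrm2 w) wr))).
  by apply: ler_wpM2l; [lra|exact: dst2].
have h2 : cabs (a k) * cabs (z.1 - w.1) <= C * r ^+ pdeg (q k) * dst z w.
  apply: ler_pM => //; last exact: dst1.
  exact: le_trans (ba (HB k)) Cr.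
lra.
Qed.

Lemma hinv_lip k r z w : 1 <= r -> nrm z <= r -> nrm w <= r ->
  dst (hinv q a k z) (hinv q a k w) <= C * (C * r ^+ pdeg (q k) + 1) * dst z w.
Proof.
move=> r1 zr wr; have c1 := bC (HB 0).
have rd : 1 <= r ^+ pdeg (q k) by rewrite exprn_ege1.
have Cr : C <= C * r ^+ pdeg (q k) by rewrite ler_peMr//; lra.
rewrite dst_le /hinv /=.
have d0 := dst_ge0 z w.
have K1 : 1 <= C * r ^+ pdeg (q k) + 1 by lra.
have K2 : 1 <= C * (C * r ^+ pdeg (q k) + 1) by rewrite -[leLHS]mulr1 ler_pM//; lra.
apply/andP; split; last by apply: le_trans (dst1 z w) _; rewrite ler_peMl.
have -> : ((q k).[z.1] - z.2) / a k - ((q k).[w.1] - w.2) / a k =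
  (((q k).[z.1] - (q k).[w.1]) - (z.2 - w.2)) / a k.
  by rewrite -mulrBl; congr (_ / _); ring.
rewrite cabsf ler_pdivrMr ?cabs_gt0 ?(bnd_aneq0 HB)//.
apply: le_trans (cabsB _ _) _.
have h1 : cabs ((q k).[z.1] - (q k).[w.1]) <= C * r ^+ pdeg (q k) * dst z w.
  apply: (le_trans (blip (HB k) r1 (le_trans (nrm1 z) zr) (le_trans (nrm1 w) wr))).
  by apply: ler_wpM2l; [lra|exact: dst1].
have h2 := dst2 z w.
have h3 := baV (HB k).
have : 1 * ((C * r ^+ pdeg (q k) + 1) * dst z w) <= (C * cabs (a k)) * ((C * r ^+ pdeg (q k) + 1) * dst z w).
  by rewrite ler_wpM2r// mulr_ge0//; lra.
lra.
Qed.

Lemma henonK k : cancel (henon (q k) (a k)) (hinv q a k).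
Proof.
move=> [x y]; rewrite /henon /hinv /=; congr (_, _).
by rewrite opprB addrC subrK mulrC mulrA mulVf ?mul1r// (bnd_aneq0 HB).
Qed.

Lemma hinvK k : cancel (hinv q a k) (henon (q k) (a k)).
Proof.
move=> [x y]; rewrite /henon /hinv /=; congr (_, _).
by rewrite mulrCA mulfV ?mulr1 ?(bnd_aneq0 HB)//; ring.
Qed.

Lemma hiterK n : cancel (F n) (Fi n).
Proof. by elim: n => [|n ih] z //=; rewrite henonK ih. Qed.

Lemma hiterVK n : cancel (Fi n) (F n).
Proof. by elim: n => [|n ih] z //=; rewrite ih hinvK. Qed.

Lemma hiter_lip n r : exists2 L, 1 <= L & forall z w, nrm z <= r -> nrm w <= r -> dst (F n z) (F n w) <= L * dst z w.
Proof.
have c1 := bC (HB 0).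
suff [L [B [L1 B1 h]]] : exists L B, [/\ 1 <= L, 1 <= B & forall z w, nrm z <= r -> nrm w <= r ->
    [/\ nrm (F n z) <= B, nrm (F n w) <= B & dst (F n z) (F n w) <= L * dst z w]].
  by exists L => // z w zr wr; have [] := h z w zr wr.
elim: n => [|n [L [B [L1 B1 ih]]]].
  exists 1, (Num.max 1 r); split => //; first by rewrite le_max lexx.
  by move=> z w zr wr; split; rewrite ?mul1r//= le_max; apply/orP; right.
have Bd : 1 <= B ^+ pdeg (q n) by rewrite exprn_ege1.
have K1 : 1 <= 2 * C * B ^+ pdeg (q n) by rewrite -[leLHS]mulr1 ler_pM//; lra.
have h0 : nrm (henon (q n) (a n) (0, 0)) <= nrm (henon (q n) (a n) (0, 0)) by [].
have n0 := nrm_ge0 (henon (q n) (a n) (0, 0)).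
have nz : nrm ((0, 0) : C2 R) <= B by rewrite nrm_le /= cabs0; apply/andP; split; lra.
exists (2 * C * B ^+ pdeg (q n) * L), (nrm (henon (q n) (a n) (0, 0)) + 2 * C * B ^+ pdeg (q n) * B).
have K0 : 0 <= 2 * C * B ^+ pdeg (q n) by lra.
have bd z : nrm z <= B -> nrm (henon (q n) (a n) z) <= nrm (henon (q n) (a n) (0, 0)) + 2 * C * B ^+ pdeg (q n) * B.
  move=> zB; apply: le_trans (nrm_dst _ (henon (q n) (a n) (0, 0))) _; rewrite lerD2l.
  apply: le_trans (henon_lip _ B1 zB nz) _; apply: ler_wpM2l => //.
  by rewrite /dst /= !subr0.
split.
- by rewrite -[leLHS]mulr1 ler_pM.
- have : 1 * 1 <= 2 * C * B ^+ pdeg (q n) * B by apply: ler_pM.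
  lra.
- move=> z w zr wr; have [h1 h2 h3] := ih z w zr wr; split; [exact: bd|exact: bd|].
  apply: le_trans (henon_lip _ B1 h1 h2) _.
  by have := ler_wpM2l K0 h3; rewrite mulrA.
Qed.

(** Near [z] a common level [n] is good, and there [G] differs from the continuous function
    [lg (F_n z) / D_n] by at most [cgr / D_n]. *)
Lemma gr_cont z e : 0 < e -> exists2 d, 0 < d & forall w, dst w z < d -> `|gr w - gr z| < e.
Proof.
move=> e0.
have [N hN] := eventually_good HB (cabs z.1 + 1).
have [M hM] := hdeg_large HB ((2 * cg + 1) / e).
pose n := maxn N M.
have [L L1 hL] := hiter_lip n (nrm z + 1).
have L0 : 0 < L by lra.
exists (Num.min 1 (1 / L)); first by rewrite lt_min ltr01 divr_gt0.
move=> w; rewrite lt_min => /andP[w1 w2].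
have wz := nrm_dst w z.
have g1 : good rg (F n z) by apply: hN; [exact: leq_maxl|lra].
have g2 : good rg (F n w).
  apply: hN; first exact: leq_maxl.
  have := cabs_dist w.1 z.1; have := dst1 w z; lra.
have D1 : 2 * cg + 1 < (D n)%:R * e by rewrite -ltr_pdivrMr// hM// leq_maxr.
have D0 := hdegR_gt0 HB n.
have dF : dst (F n w) (F n z) < 1.
  apply: le_lt_trans (hL _ _ _ _) _; [lra|lra|].
  by rewrite mulrC -ltr_pdivlMr.
have := lg_dst (F n w) (F n z); have := lg_dst (F n z) (F n w); rewrite (dstC (F n z)).
move: (grP g1) (grP g2); rewrite !ler_norml => h1 h2 h3 h4.
rewrite -(ltr_pM2l D0) -{1}(ger0_norm (ltW D0)) -normrM mulrBr ltr_norml.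
by apply/andP; split; lra.
Qed.

Lemma gr_lt_open z c : gr z < c -> exists2 d, 0 < d & forall w, dst w z < d -> gr w < c.
Proof.
move=> zc; have [|d d0 h] := @gr_cont z (c - gr z); first by rewrite subr_gt0.
by exists d => // w /h; rewrite ltr_norml; lra.
Qed.

End Filtration.

Lemma stail_bnd q a (C : R) n : (forall k, bnd (q k) (a k) C) -> forall k, bnd (stail n q k) (stail n a k) C.
Proof. by move=> HB k; exact: HB. Qed.

Lemma gr_shift q a (C : R) n z : (forall k, bnd (q k) (a k) C) ->
  gr (stail n q) (stail n a) C (hiter q a n z) = (hdeg q n)%:R * gr q a C z.
Proof.
move=> HB; have [M hM] := eventually_good_pt HB z.
apply: (@gr_uniq (stail n q) (stail n a) C (stail_bnd n HB) _ (cgr C) _ M) => k Mk.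
rewrite -hiterD mulrA -natrM mulnC -hdegD; apply: (grP HB).
by apply: hM; rewrite (leq_trans Mk)// leq_addl.
Qed.

Lemma grV_shift q a (C : R) n z : (forall k, bnd (q k) (a k) C) ->
  gr (stail n q) (stail n a) C z = (hdeg q n)%:R * gr q a C (hiterV q a n z).
Proof. by move=> HB; rewrite -gr_shift// (hiterVK HB). Qed.

End Green.

(** * Holomorphic discs and the Green function *)

Section Curves.
Context {R : realType}.
Implicit Types (z w : C2 R) (r x y e c : R) (n k : nat) (g : R[i] -> C2 R) (s : R[i]).

Definition cdiff2 g s := cdiff (fun s => (g s).1) s /\ cdiff (fun s => (g s).2) s.

Lemma cdiff2_cont g s : cdiff2 g s ->
  forall e, 0 < e -> exists2 d, 0 < d & forall s', cabs (s' - s) < d -> dst (g s') (g s) < e.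
Proof.
move=> [/cdiff_ccont g1 /cdiff_ccont g2] e e0.
have : \forall s' \near cnb s, dst (g s') (g s) < e.
  by move: (g1 e e0) (g2 e e0); apply: filterS2 => s' h1 h2; rewrite dst_lt h1.
by move=> /cnbP.
Qed.

Definition line z w s : C2 R := (w.1 + s * (z.1 - w.1), w.2 + s * (z.2 - w.2)).

Lemma line0 z w : line z w 0 = w.
Proof. by rewrite /line !mul0r !addr0; case: w. Qed.

Lemma line1 z w : line z w 1 = z.
Proof.
rewrite /line !mul1r; case: z w => z1 z2 [w1 w2] /=.
by rewrite (addrC w1) (addrC w2) !subrK.
Qed.

Lemma cdiff2_line z w s : cdiff2 (line z w) s.
Proof.
by split; (apply: cdiffD; [exact: cdiff_cst|apply: cdiffM; [exact: cdiff_id|exact: cdiff_cst]]).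
Qed.

Lemma dst_line z w s : dst (line z w s) w = cabs s * dst z w.
Proof.
rewrite /dst /line /= ![_ + _ * _]addrC !addrK !cabsM.
have [h|h] := leP (cabs (z.1 - w.1)) (cabs (z.2 - w.2)).
  by rewrite max_r// ler_wpM2l.
by rewrite max_l// ler_wpM2l// ltW.
Qed.

Lemma cdiff2_hiter q a n g s : cdiff2 g s -> cdiff2 (fun s => hiter q a n (g s)) s.
Proof.
move=> gs; elim: n => [|n [ih1 ih2]] //; split => //=.
by apply: cdiffB; [exact: cdiff_horner|exact: cdiffZ].
Qed.

Lemma cdiff2_hiterV q a n g s : cdiff2 g s -> cdiff2 (fun s => hiterV q a n (g s)) s.
Proof.
elim: n g => [|n ih] g //= [g1 g2]; apply: (ih (fun s => hinv q a n (g s))); split => //=.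
apply: cdiffM; last exact: cdiff_cst.
by apply: cdiffB => //; exact: cdiff_horner.
Qed.

(** [ccover] in the second variable along each vertical slice, then in the first, as in the tube
    lemma. *)
Lemma ccover2 (A : set (C2 R)) T (P : nat -> C2 R -> Prop) :
  (forall z, A z -> nrm z <= T) ->
  (forall z, exists e N, 0 < e /\ forall n w, (N <= n)%N -> dst w z < e -> A w -> P n w) ->
  exists N, forall n w, (N <= n)%N -> A w -> P n w.
Proof.
move=> AT loc.
have tube (x : R[i]) : exists e N, 0 < e /\ forall n (x' : R[i]), (N <= n)%N -> cabs (x' - x) < e -> cabs x' <= T ->
    forall y : R[i], A (x', y) -> P n (x', y).
  have [M hM] : exists M, forall n (y : R[i]), (M <= n)%N -> cabs y <= T ->
      forall x' : R[i], cabs (x' - x) < n.+1%:R^-1 -> A (x', y) -> forall k, (n <= k)%N -> P k (x', y).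
    apply: (ccover (A := [set y | cabs y <= T]) (T := T)) => // y.
    have [e [N [e0 h]]] := loc (x, y).
    have [M hM] := archi_inv e0.
    exists e, (maxn M N); split => // n y'; rewrite geq_max => /andP[Mn Nn] yy _ x' xx Axy k nk.
    apply: h => //; first exact: leq_trans nk.
    rewrite dst_lt /= yy andbT (lt_trans xx)//.
    by have := hM n Mn.
  exists M.+1%:R^-1, M; split; first by rewrite invr_gt0.
  move=> n x' Mn xx _ y Axy; apply: (hM M y) => //.
  by have := AT _ Axy; rewrite nrm_le => /andP[].
have [N hN] := @ccover R [set x | cabs x <= T] T _ (fun _ h => h) tube.
exists N => n [x y] Nn Axy; apply: hN => //.
by have := AT _ Axy; rewrite nrm_le => /andP[].
Qed.

(** The two consequences of complex differentiability that the proof works with: holomorphy along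
    holomorphic discs and a pointwise Lipschitz bound. Both survive conjugation by [F_n]. *)
Record hol (W : set (C2 R)) (f : C2 R -> C2 R) : Prop := Hol {
  hol_curve : forall g s, cdiff2 g s -> W (g s) -> cdiff2 (fun s => f (g s)) s;
  hol_lip : forall z, W z -> exists K d, [/\ 0 < K, 0 < d &
    forall w, dst w z < d -> dst (f w) (f z) <= K * dst w z] }.

Lemma hol_cont W f z e : hol W f -> W z -> 0 < e ->
  exists2 d, 0 < d & forall w, dst w z < d -> dst (f w) (f z) < e.
Proof.
move=> fh Wz e0; have [K [d [K0 d0 h]]] := hol_lip fh Wz.
exists (Num.min d (e / K)); first by rewrite lt_min d0 divr_gt0.
move=> w; rewrite lt_min => /andP[/h h1 h2]; apply: le_lt_trans h1 _.
by rewrite mulrC -ltr_pdivlMr.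
Qed.

Section Filtration.
Variables (q : nat -> {poly R[i]}) (a : nat -> R[i]) (C : R).
Hypothesis HB : forall k, bnd (q k) (a k) C.
Notation F := (hiter q a).
Notation D := (hdeg q).
Notation rg := (rgood C).
Notation cg := (cgr C).
Notation G := (gr q a C).

(** As [hdeg_le], with an error linear in [n], which the exponential degrees still dominate. The
    contradiction is taken at an index [k + k], where [D] is at least [k * k]. *)
Lemma hdeg_lin x y K M N : (forall n, (N <= n)%N -> (D n)%:R * x <= (D n)%:R * y + K + M * n%:R) -> x <= y.
Proof.
move=> h; rewrite leNgt; apply/negP => yx.
have xy : 0 < x - y by rewrite subr_gt0.
pose B := `|K| + `|M| *+ 2.
have B0 : 0 <= B by rewrite addr_ge0// mulrn_wge0.
pose k := maxn N (Num.bound (B / (x - y))).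
have k1 : (0 < k)%N by rewrite (leq_trans _ (leq_maxr _ _)).
have kB : B < k%:R * (x - y).
  rewrite -ltr_pdivrMr//; apply: (lt_le_trans (archi_boundP _)); first by rewrite divr_ge0// ltW.
  by rewrite ler_nat leq_maxr.
have kN : (N <= k + k)%N by rewrite (leq_trans (leq_maxl N (Num.bound (B / (x - y)))))// leq_addr.
have kk : (k * k <= D (k + k))%N.
  by rewrite (leq_trans _ (hdeg_ge HB _))// expnD leq_mul// ltnW// ltn_expl.
have k0 : 1 <= k%:R :> R by rewrite ler1n.
have h1 : k%:R * k%:R * (x - y) <= (D (k + k))%:R * (x - y).
  by rewrite ler_wpM2r ?(ltW xy)// -natrM ler_nat.
have h2 := h _ kN.
have h3 : K + M * (k + k)%:R <= k%:R * B.
  rewrite natrD /B mulr2n.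
  have := ler_norm K; have := ler_norm M; have := normr_ge0 K.
  have : `|K| * 1 <= `|K| * k%:R by rewrite ler_wpM2l.
  have : M * k%:R <= `|M| * k%:R by rewrite ler_wpM2r ?ler_norm.
  lra.
have h4 : k%:R * B < k%:R * (k%:R * (x - y)) by rewrite ltr_pM2l//; lra.
lra.
Qed.

Lemma vplus_mono r r' z : r <= r' -> vplus r' z -> vplus r z.
Proof. by move=> rr [h1 h2]; split => //; exact: le_trans h1. Qed.

Lemma hiter_vplus_from r N n z : C <= r -> (N <= n)%N -> vplus r (F N z) -> vplus r (F n z).
Proof.
move=> Cr Nn zV; rewrite -(subnKC Nn) hiterD.
by have [] := hiter_vplus (stail_bnd N HB) (n - N) Cr zV.
Qed.

Lemma curve_vplus g T r : (forall s, cabs s <= T -> cdiff2 g s /\ 0 < G (g s)) ->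
  exists N, forall n s, (N <= n)%N -> cabs s <= T -> vplus r (F n (g s)).
Proof.
move=> gh.
have c1 := bC (HB 0).
pose r' := Num.max r rg.
have rr' : r <= r' by rewrite le_max lexx.
have Cr : C <= r' by rewrite le_max /rgood; apply/orP; right; lra.
have r0 : 0 < r' by lra.
apply: (ccover (A := [set s | cabs s <= T]) (T := T)) => // s.
have [sT|sT] := leP (cabs s) T; last first.
  have [e e0 he] := cabs_open_gt sT; exists e, 0%N; split => // n s' _ /he h /=.
  by rewrite leNgt h.
have [gd g0] := gh s sT.
have [N hN] := gr_gt0_vplus HB (2 * r') g0.
(* One more iterate makes the second coordinate at least twice the first, which leaves room for
   perturbations of size 1 in both. *)
have [e e0 he] := cdiff2_cont (cdiff2_hiter q a N.+1 gd) ltr01.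
have [v1 v2] := hN N (leqnn _).
have h3 := bpos (HB N) (le_trans (_ : C <= 2 * r') v1) v2.
exists e, N.+1; split => // n s' Nn /he es _; apply: (vplus_mono rr').
apply: (hiter_vplus_from Cr Nn).
have y1 : cabs (F N.+1 (g s)).1 = cabs (F N (g s)).2 by [].
have y2 : 2 * cabs (F N (g s)).2 <= cabs (F N.+1 (g s)).2 by apply: h3; lra.
have r4 : 4 <= r' by rewrite le_max /rgood; apply/orP; right; lra.
have := cabs_dist (F N.+1 (g s')).1 (F N.+1 (g s)).1.
have := cabs_dist (F N.+1 (g s)).2 (F N.+1 (g s')).2; rewrite (cabsC (F N.+1 (g s)).2).
have := dst1 (F N.+1 (g s')) (F N.+1 (g s)); have := dst2 (F N.+1 (g s')) (F N.+1 (g s)).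
clear he gh h3.
by move=> *; split; lra.
Qed.

Lemma ln_exprn x k : 0 < x -> ln (x ^+ k) = k%:R * ln x.
Proof. by move=> x0; rewrite lnXn// mulr_natl. Qed.

Lemma le_expR_ln x y : 0 < x -> ln x <= y -> x <= expR y.
Proof. by move=> x0 xy; rewrite -[x]lnK ?posrE// ler_expR. Qed.

(** Hadamard's inequality for the coordinates of [F_n o g], which on the two circles are at most
    [exp (D_n B)] and [exp (D_n A)] up to bounded factors. After division by [D_n] only the
    convexity in [ln |s|] remains. *)
Lemma circles g r T A B s : 0 < r -> r < cabs s -> cabs s < T -> B <= A ->
  (forall s, r <= cabs s <= T -> cdiff2 g s) ->
  (forall s, cabs s = r -> G (g s) <= B) ->
  (forall s, cabs s = T -> G (g s) <= A) ->
  G (g s) * (ln T - ln r) <= B * (ln T - ln r) + (A - B) * (ln (cabs s) - ln r).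
Proof.
move=> r0 rs sT BA gd hB hA.
have s0 : 0 < cabs s by lra.
have T0 : 0 < T by lra.
have B0 : 0 <= B.
  by rewrite (le_trans (gr_ge0 HB (g r%:C)))// hB// cabsR ger0_norm// ltW.
have l1 : ln r < ln (cabs s) by rewrite ltr_ln ?posrE.
have l2 : ln (cabs s) < ln T by rewrite ltr_ln ?posrE.
have [M1 M10 hM1] := cbounded_annulus (fun s h => cdiff_ccont (gd s h).1).
have [N hN] := eventually_good HB M1.
have {hM1 hN} gN n s' : (N <= n)%N -> r <= cabs s' <= T -> good rg (F n (g s')).
  by move=> Nn /hM1; exact: hN.
have cg0 := cgr_gt0 HB.
have l0 : 0 < ln T - ln r by lra.
have [X XE] : exists X, X = B + (A - B) / (ln T - ln r) * (ln (cabs s) - ln r) by eexists.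
have XB : B <= X by rewrite XE lerDl mulr_ge0// ?divr_ge0//; lra.
suff h : G (g s) <= X.
  have -> : B * (ln T - ln r) + (A - B) * (ln (cabs s) - ln r) = X * (ln T - ln r).
    by rewrite XE; field; rewrite gt_eqF.
  by rewrite ler_wpM2r// ltW.
apply: (@hdeg_le _ _ _ _ HB _ _ (2 * cg + (ln T - ln (cabs s))) N) => n Nn.
have D0 := hdegR_gt0 HB n.
have [v vE] : exists v, v = (D n)%:R * ((A - B) / (ln T - ln r)) by eexists.
have v0 : 0 <= v by rewrite vE !mulr_ge0 ?invr_ge0//; lra.
(* The exponent must be an integer; rounding [v] down costs at most [ln T - ln |s|], independently
   of [n]. *)
have [m m1 m2] : exists2 m : nat, m%:R <= v & v < m%:R + 1.
  by exists (Num.trunc v); have := truncn_itv v0; rewrite -natr1 => /andP[].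
have vX : (D n)%:R * X = (D n)%:R * B + v * (ln (cabs s) - ln r).
  by rewrite XE vE; ring.
have vA : (D n)%:R * A = (D n)%:R * B + v * (ln T - ln r).
  by rewrite vE; field; rewrite gt_eqF.
have [E EE] : exists E, E = (D n)%:R * X + cg + (ln T - ln (cabs s)) by eexists.
have lgG s' (K : R) : r <= cabs s' <= T -> G (g s') <= K -> nrm (F n (g s')) <= expR ((D n)%:R * K + cg).
  move=> hs' GK; apply: le_trans (nrm_le_exp _) _; rewrite ler_expR.
  have := grP HB (gN n s' Nn hs'); have := ler_wpM2l (ltW D0) GK.
  by rewrite ler_norml; lra.
have hb1 : cabs s ^+ m * (expR ((D n)%:R * B + cg) / r ^+ m) <= expR E.
  apply: le_expR_ln; first by do ?[apply: divr_gt0|apply: mulr_gt0|apply: exprn_gt0|apply: expR_gt0].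
  rewrite lnM ?posrE ?divr_gt0 ?exprn_gt0 ?expR_gt0//.
  rewrite ln_div ?posrE ?exprn_gt0 ?expR_gt0// expRK !ln_exprn// EE vX.
  have : m%:R * (ln (cabs s) - ln r) <= v * (ln (cabs s) - ln r) by rewrite ler_wpM2r//; lra.
  lra.
have hb2 : cabs s ^+ m * (expR ((D n)%:R * A + cg) / T ^+ m) <= expR E.
  apply: le_expR_ln; first by do ?[apply: divr_gt0|apply: mulr_gt0|apply: exprn_gt0|apply: expR_gt0].
  rewrite lnM ?posrE ?divr_gt0 ?exprn_gt0 ?expR_gt0//.
  rewrite ln_div ?posrE ?exprn_gt0 ?expR_gt0// expRK !ln_exprn// EE vX vA.
  have : v * (ln T - ln (cabs s)) <= (m%:R + 1) * (ln T - ln (cabs s)) by rewrite ler_wpM2r//; (clear - HB l2 m2; lra).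
  lra.
have sm0 : 0 <= cabs s ^+ m by rewrite exprn_ge0// ltW.
have Fd := fun s h => cdiff2_hiter q a n (gd s h).
have key : nrm (F n (g s)) <= expR E.
  rewrite nrm_le; apply/andP; split.
  - apply: le_trans (hadamard (M1 := expR ((D n)%:R * B + cg)) (M2 := expR ((D n)%:R * A + cg)) m r0 rs sT (fun s h => (Fd s h).1) _ _) _.
    + by move=> s' hs'; apply: le_trans (nrm1 _) (lgG _ _ _ (hB _ hs')); rewrite hs' lexx; lra.
    + by move=> s' hs'; apply: le_trans (nrm1 _) (lgG _ _ _ (hA _ hs')); rewrite hs' lexx; lra.
    + by rewrite maxr_pMr// ge_max hb1.
  - apply: le_trans (hadamard (M1 := expR ((D n)%:R * B + cg)) (M2 := expR ((D n)%:R * A + cg)) m r0 rs sT (fun s h => (Fd s h).2) _ _) _.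
    + by move=> s' hs'; apply: le_trans (nrm2 _) (lgG _ _ _ (hB _ hs')); rewrite hs' lexx; lra.
    + by move=> s' hs'; apply: le_trans (nrm2 _) (lgG _ _ _ (hA _ hs')); rewrite hs' lexx; lra.
    + by rewrite maxr_pMr// ge_max hb1.
have E0 : 0 <= E.
  have : 0 <= (D n)%:R * X by rewrite mulr_ge0//; lra.
  rewrite EE; lra.
have : lg (F n (g s)) <= E.
  by rewrite -[leRHS]expRK; apply: lg_le => //; rewrite -expR0 ler_expR.
have := grP HB (gN n s Nn (introT andP (conj (ltW rs) (ltW sT)))).
rewrite ler_norml EE; lra.
Qed.

End Filtration.
End Curves.

(** * Complex lines through the images of two points *)

Section Lines.
Context {R : realType}.
Implicit Types (z w : C2 R) (r x y e c : R) (n k : nat) (g : R[i] -> C2 R) (s : R[i]).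
Variables (q : nat -> {poly R[i]}) (a : nat -> R[i]) (C : R).
Hypothesis HB : forall k, bnd (q k) (a k) C.
Notation F := (hiter q a).
Notation Fi := (hiterV q a).
Notation D := (hdeg q).
Notation rg := (rgood C).
Notation cg := (cgr C).
Notation G := (gr q a C).

Lemma expR_ge1 x : 0 <= x -> 1 <= expR x.
Proof. by move=> x0; rewrite -[leLHS]expR0 ler_expR. Qed.

Lemma pdeg_bound k : (pdeg (q k) <= Num.bound C)%N.
Proof.
have c1 := bC (HB 0).
rewrite -(ler_nat R) (le_trans (bdegC (HB k)))// ltW// archi_boundP//; lra.
Qed.

(** Near a bounded orbit the inverse steps have a common Lipschitz constant [L]. The loss [L ^+ n]
    enters later only through [n * ln L], which is negligible against [D_n]. *)
Lemma hiterV_near B w : (forall k, nrm (F k w) <= B) -> exists2 L, 1 <= L &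
  forall n v, L ^+ n * dst v (F n w) <= 1 -> dst (Fi n v) w <= L ^+ n * dst v (F n w).
Proof.
move=> hB; have c1 := bC (HB 0).
have B0 : 0 <= B by apply: le_trans (hB 0%N); exact: nrm_ge0.
have [L LE] : exists L, L = C * (C * (B + 1) ^+ Num.bound C + 1) by eexists.
have B1 : 1 <= B + 1 by lra.
have e1 : 1 <= (B + 1) ^+ Num.bound C by rewrite exprn_ege1.
have L1 : 1 <= L.
  have h : 1 * 1 <= C * (B + 1) ^+ Num.bound C by apply: ler_pM.
  have : 1 * 1 <= C * (C * (B + 1) ^+ Num.bound C + 1) by apply: ler_pM => //; lra.
  by rewrite LE; lra.
exists L => //; elim=> [|n ih] v; first by rewrite expr0 mul1r.
move=> hv.
have Ln : 1 <= L ^+ n by rewrite exprn_ege1.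
have Ln1 : 1 <= L ^+ n.+1 by rewrite exprn_ege1.
have d0 := dst_ge0 v (F n.+1 w).
have dv : dst v (F n.+1 w) <= 1 by apply: le_trans hv; rewrite ler_peMl.
have h : dst (hinv q a n v) (F n w) <= L * dst v (F n.+1 w).
  rewrite -{1}(henonK HB n (F n w)).
  have nv : nrm v <= B + 1 by have := nrm_dst v (F n.+1 w); have := hB n.+1; lra.
  have nw : nrm (F n.+1 w) <= B + 1 by have := hB n.+1; lra.
  apply: le_trans (hinv_lip HB n B1 nv nw) _; apply: ler_wpM2r => //; rewrite LE.
  have C0 : 0 <= C by lra.
  apply: ler_wpM2l => //; rewrite lerD2r; apply: ler_wpM2l => //.
  by rewrite ler_weXn2l// pdeg_bound.
have h2 : L ^+ n * dst (hinv q a n v) (F n w) <= L ^+ n.+1 * dst v (F n.+1 w).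
  by rewrite exprSr -mulrA; apply: ler_wpM2l => //; lra.
exact: le_trans (ih _ (le_trans h2 hv)) h2.
Qed.

(** By [gr_le], a point of norm at most [exp (D_n c - cg - 1)] has shifted Green function below
    [D_n c]; on the line the norm is bounded by [B] plus [|s|] times a multiple of [exp (D_n G z)].
    The constant [K] collects the factors [B] and [exp cg]. *)
Lemma line_disc w z c : G w = 0 -> G z < c -> exists K N, 1 <= K /\ forall n, (N <= n)%N ->
  dst (F n z) (F n w) <= K * expR ((D n)%:R * G z) /\
  forall s, cabs s <= expR ((D n)%:R * (c - G z)) / K -> G (Fi n (line (F n z) (F n w) s)) < c.
Proof.
move=> /(gr0_bounded HB)[B0 hB0] zc.
have g0 := gr_ge0 HB z; have c0 : 0 < c by lra.
have cg0 := cgr_gt0 HB.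
have [B [B1 hB]] : exists B, 1 <= B /\ forall n, nrm (F n w) <= B.
  exists (Num.max 1 B0); split; first by rewrite le_max lexx.
  by move=> n; rewrite le_max hB0 orbT.
have [N1 hN1] := eventually_good_pt HB z.
have [N2 hN2] := hdeg_large HB ((ln (2 * B) + cg + 1) / c).
have [K KE] : exists K, K = 4 * B * expR (2 * cg + 1) by eexists.
have K1 : 1 <= K.
  have : 1 <= expR (2 * cg + 1) by rewrite expR_ge1; lra.
  by have B4 : 1 <= 4 * B by [lra]; move=> h; have := ler_pM ler01 ler01 B4 h; rewrite KE; lra.
have K0 : 0 < K by lra.
exists K, (maxn N1 N2); split => // n; rewrite geq_max => /andP[/hN1 gn /hN2 Dn].
have D0 := hdegR_gt0 HB n.
have Dg : 0 <= (D n)%:R * G z by rewrite mulr_ge0// ltW.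
rewrite ltr_pdivrMr// in Dn.
have zn : nrm (F n z) <= expR ((D n)%:R * G z + cg).
  apply: le_trans (nrm_le_exp _) _; rewrite ler_expR.
  by have := grP HB gn; rewrite ler_norml; lra.
have e1 : 1 <= expR ((D n)%:R * G z + cg) by rewrite expR_ge1; (clear - HB zn Dg cg0; lra).
have dn : dst (F n z) (F n w) <= 2 * B * expR ((D n)%:R * G z + cg).
  apply: le_trans (dst_nrm _ _) _.
  have := hB n; have : 1 * expR ((D n)%:R * G z + cg) <= B * expR ((D n)%:R * G z + cg).
    by rewrite ler_wpM2r//; lra.
  have : B * 1 <= B * expR ((D n)%:R * G z + cg) by rewrite ler_wpM2l//; lra.
  lra.
split.
  apply: le_trans dn _; rewrite KE expRD.
  have : expR cg <= expR (2 * cg + 1) by rewrite ler_expR; lra.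
  move=> h; have h2 : 2 * B * expR cg <= 4 * B * expR (2 * cg + 1).
    by apply: (ler_pM _ (expR_ge0 cg) _ h); (clear - HB B1; lra).
  rewrite (mulrC (expR _)) mulrA ler_wpM2r ?expR_ge0//.
move=> s sT.
have [P PE] : exists P, P = expR ((D n)%:R * c - cg - 1) by eexists.
have PB : 2 * B <= P by rewrite PE; apply: le_expR_ln; (clear - HB B1 Dn; lra).
have sP : cabs s * dst (F n z) (F n w) <= P / 2.
  have -> : P / 2 = expR ((D n)%:R * (c - G z)) / K * (2 * B * expR ((D n)%:R * G z + cg)).
    have -> : P = expR ((D n)%:R * (c - G z)) * expR ((D n)%:R * G z + cg) / expR (2 * cg + 1).
      by rewrite PE -expRN -!expRD; congr expR; ring.
    rewrite KE; field; rewrite !gt_eqF ?expR_gt0//; (clear - HB B1; lra).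
  by apply: ler_pM => //; exact: dst_ge0.
have nl : nrm (line (F n z) (F n w) s) <= P.
  apply: le_trans (nrm_dst _ (F n w)) _; rewrite dst_line.
  by have := hB n; (clear - HB sP PB; lra).
have P1 : 1 <= P by (clear - HB PB B1; lra).
have := gr_le (stail_bnd n HB) (line (F n z) (F n w) s).
rewrite (grV_shift _ _ HB) => h; have := lg_le P1 nl; rewrite PE expRK => h2.
by rewrite -(ltr_pM2l D0); (clear - HB h2 h; lra).
Qed.

(** [circles] on the pulled back line, with the parameter 1 at [z]: [f] is near [f w] on the circle
    of radius [r], and [G o f < c] on that of radius [T]. To leading order [ln T] and [- ln r] are
    [D_n (c - G z)] and [D_n G z], and their ratio gives the convex combination. *)
Lemma green_convex f c w z : hol [set z | G z < c] f -> (forall z, G z < c -> G (f z) < c) ->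
  0 < c -> G w = 0 -> G z < c -> (G (f z) - G (f w)) * c <= (c - G (f w)) * G z.
Proof.
move=> fh fc c0 w0 zc; have wc : G w < c by rewrite w0.
have uc := fc w wc.
have [K [N [K1 hN]]] := line_disc w0 zc.
have K0 : 0 < K by lra.
have [B hB] := gr0_bounded HB w0.
have [L L1 hL] := hiterV_near hB.
have g0 := gr_ge0 HB z.
apply/ler_addgt0Pr => e e0.
(* The slack [b] makes [G (f w) + b] an upper bound on a whole neighbourhood of [w]; it is paid for
   by [e]. *)
have [b [b0 bu be]] : exists b, [/\ 0 < b, b <= c - G (f w) & b * c <= e].
  exists (Num.min (c - G (f w)) (e / c)); split.
  - by rewrite lt_min divr_gt0// andbT subr_gt0.
  - by rewrite ge_min lexx.
  - by rewrite -ler_pdivlMr// ge_min lexx orbT.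
suff h : (G (f z) - (G (f w) + b)) * c <= (c - (G (f w) + b)) * G z.
  by have : 0 <= b * G z by [rewrite mulr_ge0// ltW]; (clear - HB h be; lra).
have [d1 d10 hd1] : exists2 d, 0 < d & forall v, dst v w < d -> G (f v) < G (f w) + b.
  have [|d2 d20 hd2] := @gr_lt_open _ _ _ _ HB (f w) (G (f w) + b); first lra.
  by have [d d0 hd] := hol_cont fh wc d20; exists d => // v /hd/hd2.
have [d [d0 dd d11]] : exists d, [/\ 0 < d, d < d1 & d < 1].
  exists (Num.min 1 d1 / 2); have : 0 < Num.min 1 d1 by rewrite lt_min ltr01.
  have : Num.min 1 d1 <= 1 by rewrite ge_min lexx.
  have : Num.min 1 d1 <= d1 by rewrite ge_min lexx orbT.
  by move=> *; split; lra.
have [N2 hN2] := hdeg_large HB (ln K / (c - G z)).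
have [N3 hN3] := hdeg_large HB (`|ln d - ln K| / c).
apply: (@hdeg_lin _ _ _ _ HB _ _ ((c - (G (f w) + b)) * (ln K - ln d) + (G (f z) - (G (f w) + b)) * ln d)
   (ln L * (c - G (f z))) (maxn N (maxn N2 N3))) => n.
rewrite !geq_max => /and3P[/hN[dn hT] /hN2 Dn /hN3 Dn3].
rewrite ltr_pdivrMr ?subr_gt0// in Dn; rewrite ltr_pdivrMr// in Dn3.
have D0 := hdegR_gt0 HB n.
have [T TE] : exists T, T = expR ((D n)%:R * (c - G z)) / K by eexists.
rewrite -TE in hT.
have T0 : 0 < T by rewrite TE divr_gt0 ?expR_gt0.
have lT : ln T = (D n)%:R * (c - G z) - ln K by rewrite TE ln_div ?posrE ?expR_gt0// expRK.
(* A radius whose disc on the line is sent by [hiterV_near] into the [d]-neighbourhood of [w]. *)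
have [r rE] : exists r, r = d / (L ^+ n * (K * expR ((D n)%:R * G z))) by eexists.
have L0 : 0 < L by (clear - HB L1; lra).
have Ln0 : 0 < L ^+ n by rewrite exprn_gt0.
have KE0 : 0 < K * expR ((D n)%:R * G z) by rewrite mulr_gt0 ?expR_gt0.
have LK0 : 0 < L ^+ n * (K * expR ((D n)%:R * G z)) by rewrite mulr_gt0.
have r0 : 0 < r by rewrite rE divr_gt0.
have lr : ln r = ln d - n%:R * ln L - ln K - (D n)%:R * G z.
  by rewrite rE ln_div ?posrE// lnM ?posrE// ln_exprn// lnM ?posrE ?expR_gt0// expRK; ring.
have lL : 0 <= n%:R * ln L by rewrite mulr_ge0// ln_ge0.
have T1 : 1 < T by rewrite -ltr_ln ?posrE// ln1 lT; (clear - HB Dn; lra).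
have ln10 : ln 1 = 0 :> R by exact: ln1.
have r1 : r < 1.
  rewrite rE ltr_pdivrMr// mul1r (lt_le_trans d11)//.
  have E1 : 1 <= expR ((D n)%:R * G z) by apply: expR_ge1; apply: mulr_ge0 => //; exact: ltW.
  have Ln1 : 1 <= L ^+ n by rewrite exprn_ege1.
  have m1 := ler_pM ler01 ler01 K1 E1; rewrite mulr1 in m1.
  by have m2 := ler_pM ler01 ler01 Ln1 m1; rewrite mulr1 in m2.
have gd s : cabs s <= T -> cdiff2 (fun s => f (Fi n (line (F n z) (F n w) s))) s.
  move=> sT; apply: (hol_curve fh); last exact: hT.
  by apply: cdiff2_hiterV; exact: cdiff2_line.
have := @circles _ _ _ _ HB (fun s => f (Fi n (line (F n z) (F n w) s))) r T c (G (f w) + b) 1 r0.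
rewrite cabs1 line1 (hiterK HB) ln10 => /(_ r1 T1) => h.
have {}h := h _ _ _ _.
have : (G (f z)) * (ln T - ln r) <= (G (f w) + b) * (ln T - ln r) + (c - (G (f w) + b)) * (0 - ln r).
  apply: h; first (clear - HB bu; lra).
  - by move=> s /andP[_ sT]; exact: gd.
  - move=> s sr; apply/ltW/hd1.
    have [_ [_ hv]] : True /\ True /\ dst (line (F n z) (F n w) s) (F n w) * L ^+ n <= d.
      do 2 split => //; rewrite dst_line sr rE.
      rewrite -mulrA mulrAC ler_pdivrMr// ler_pM2l//.
      by rewrite mulrC ler_pM2l//.
    rewrite mulrC in hv.
    apply: (le_lt_trans _ dd); apply: (le_trans _ hv); apply: hL.
    exact: le_trans hv (ltW d11).
  - by move=> s sT; apply/ltW/fc/hT; rewrite sT.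
rewrite lT lr; clear; lra.
Qed.

(** On the discs of [line_disc] the image keeps [G] positive and bounded, so from some level [k] on
    [(F_k (g s)).2] has no zeros, and its logarithm is [D_k G] up to [cgr]. [harnack_log] bounds the
    oscillation of [G o f] by [O(c / T)], and [T] is unbounded. *)
Lemma green_const f c c' w z : hol [set z | G z < c'] f ->
  (forall z, G z < c' -> 0 < G (f z) <= c) -> G w = 0 -> G z < c' -> G (f z) = G (f w).
Proof.
move=> fh fc w0 zc; have g0 := gr_ge0 HB z.
have c0 : 0 <= c by have /andP[] := fc z zc; lra.
have [K [N [K1 hN]]] := line_disc w0 zc.
have K0 : 0 < K by lra.
have cg0 := cgr_gt0 HB.
have k0 : 0 < c' - G z by lra.
suff h : `|G (f z) - G (f w)| <= 0 by apply/eqP; rewrite -subr_eq0 -normr_le0.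
have [N2 hN2] := hdeg_large HB (32 * K / (c' - G z)).
apply: (@hdeg_le _ _ _ _ HB _ _ (128 * c * K / (c' - G z)) (maxn N N2)) => n.
rewrite geq_max mulr0 add0r => /andP[/hN[_ hT] /hN2 Dn].
have D0 := hdegR_gt0 HB n; rewrite ltr_pdivrMr// in Dn.
have [T TE] : exists T, T = expR ((D n)%:R * (c' - G z)) / K by eexists.
rewrite -TE in hT.
have T0 : 0 < T by rewrite TE divr_gt0 ?expR_gt0.
have TD : (D n)%:R * (c' - G z) / K <= T.
  rewrite TE ler_pM2r ?invr_gt0//.
  by have := expR_ge1Dx ((D n)%:R * (c' - G z)); lra.
have T32 : 32 <= T by apply: le_trans TD; rewrite ler_pdivlMr//; lra.
suff h : `|G (f z) - G (f w)| <= 128 * c / T.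
  rewrite mulrC -ler_pdivlMr//; apply: le_trans h _.
  rewrite ler_pdivrMr//.
  have -> : 128 * c * K / (c' - G z) / (D n)%:R * T = 128 * c * (T / ((D n)%:R * (c' - G z) / K)).
    by field; rewrite !gt_eqF.
  rewrite ler_peMr//; first (clear - HB c0; lra).
  by rewrite ler_pdivlMr ?mul1r// divr_gt0// mulr_gt0.
pose g s := f (Fi n (line (F n z) (F n w) s)).
have gd s : cabs s <= T -> cdiff2 g s.
  move=> sT; apply: (hol_curve fh); last exact: hT.
  by apply: cdiff2_hiterV; exact: cdiff2_line.
have gc s : cabs s <= T -> 0 < G (g s) <= c by move=> /hT/fc.
have g1 : g 1 = f z by rewrite /g line1 (hiterK HB).
have gz : g 0 = f w by rewrite /g line0 (hiterK HB).
have [M hM] := @curve_vplus _ _ _ _ HB g T rg (fun s h => conj (gd s h) (proj1 (andP (gc s h)))).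
rewrite -g1 -gz; clearbody g.
apply: (@hdeg_le _ _ _ _ HB _ _ (64 * (2 * cg + 1) / T + 2 * cg) M) => k Mk.
have Dk := hdegR_gt0 HB k.
have c1 := bC (HB 0).
have lgk s : cabs s <= T -> 1 <= cabs (F k (g s)).2 /\ `|ln (cabs (F k (g s)).2) - (D k)%:R * G (g s)| <= cg.
  move=> sT; have sV := hM k s Mk sT.
  have y1 : 1 <= cabs (F k (g s)).2 by case: sV; rewrite /rgood; (clear - HB c1; lra).
  split => //; have := grP HB (vplus_good sV).
  by rewrite /lg (vplus_nrm sV) max_r.
have := @harnack_log _ (fun s => (F k (g s)).2) T ((D k)%:R * c + cg) 1 T0.
rewrite cabs1 => h.
have {}h : `|ln (cabs (F k (g 1)).2) - ln (cabs (F k (g 0)).2)| <= 64 * (2 * ((D k)%:R * c + cg) + 1) * 1 / T.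
  apply: h.
  - by have := mulr_ge0 (ltW Dk) c0; (clear - HB cg0; lra).
  - by move=> s sT; have [] := cdiff2_hiter q a k (gd s sT).
  - move=> s sT; have [y1 y2] := lgk s sT; split; first by rewrite -cabs_gt0; (clear - HB y1; lra).
    have /andP[_ u1] := gc s sT; have := ler_wpM2l (ltW Dk) u1.
    rewrite ger0_norm ?ln_ge0//; move: y2; rewrite ler_norml; (clear - HB; lra).
  - by rewrite ler_pdivlMr//; (clear - HB T32; lra).
have [|_ h1] := lgk 1; first by rewrite cabs1; lra.
have [|_ h0] := lgk 0; first by rewrite cabs0; lra.
rewrite -{1}(ger0_norm (ltW Dk)) -normrM mulrBr.
have -> : (D k)%:R * (128 * c / T) + (64 * (2 * cg + 1) / T + 2 * cg) =
  64 * (2 * ((D k)%:R * c + cg) + 1) * 1 / T + 2 * cg by ring.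
move: h h1 h0; rewrite !ler_norml => /andP[? ?] /andP[? ?] /andP[? ?].
apply/andP; split; lra.
Qed.

End Lines.

(** * Affine coordinates on leaves *)

Section Leaves.
Context {R : realType}.
Implicit Types (w P Q : C2 R) (r x : R) (n k : nat) (s t : R[i]).

Lemma clim_unique (T : Type) (F : set_system T) (FF : ProperFilter F) (f : T -> R[i]) (l l' : R[i]) :
  clim F f l -> clim F f l' -> l = l'.
Proof.
move=> fl fl'; apply/eqP; rewrite -subr_eq0 -cabs_eq0 eq_le cabs_ge0 andbT.
apply/ler_addgt0Pr => e e0; have e2 : 0 < e / 2 by rewrite divr_gt0.
have /filter_ex[s [h1 h2]] : \forall s \near F, cabs (f s - l) < e / 2 /\ cabs (f s - l') < e / 2.
  by move: (fl _ e2) (fl' _ e2); apply: filterS2.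
have := cabs_triB l (f s) l'; rewrite (cabsC l (f s)); lra.
Qed.

Lemma clim_ooP (f : nat -> R[i]) (l : R[i]) :
  clim \oo f l <-> forall e, 0 < e -> exists N, forall n, (N <= n)%N -> cabs (f n - l) < e.
Proof.
split=> h e e0; first by have [N _ hN] := h e e0; exists N => n; exact: hN.
by have [N hN] := h e e0; exists N => // n; exact: hN.
Qed.

Lemma clim_horner (T : Type) (F : set_system T) (FF : Filter F) (f : T -> R[i]) (l : R[i]) (q : {poly R[i]}) :
  clim F f l -> clim F (fun i => q.[f i]) q.[l].
Proof.
move=> fl; apply: (clim_comp fl).
exact: (cdiff_ccont (cdiff_horner q (cdiff_id l))).
Qed.

Lemma clim_le (T : Type) (F : set_system T) (FF : ProperFilter F) (f : T -> R[i]) (l : R[i]) x :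
  clim F f l -> (\forall s \near F, cabs (f s) <= x) -> cabs l <= x.
Proof.
move=> fl fx; apply/ler_addgt0Pr => e e0.
have /filter_ex[s [h1 h2]] : \forall s \near F, cabs (f s - l) < e /\ cabs (f s) <= x.
  by move: (fl _ e0) fx; apply: filterS2.
have := cabs_dist l (f s); rewrite cabsC; lra.
Qed.

Section Base.
Variables (q : nat -> {poly R[i]}) (a : nat -> R[i]) (C : R).
Hypothesis HB : forall k, bnd (q k) (a k) C.
Notation X := (xorb q a).

(** The separation allowed between orbits of one leaf. It exceeds [3 C^2] and [16 C], the bounds
    produced by [leaf_graph] and [leaf_disc]. *)
Definition rho : R := 40 * C ^+ 2.
(** Beyond this modulus, and for separations up to [rho], the Taylor remainder is at most the
    fraction [C rho / rr <= 1 / 50] of the linear term. *)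
Definition rr : R := (50 * 40) * C ^+ 5.

Lemma Cpow : [/\ 1 <= C, C <= C ^+ 2, C ^+ 2 <= C ^+ 3, C ^+ 3 <= C ^+ 4 & C ^+ 4 <= C ^+ 5].
Proof.
have c1 := bC (HB 0).
have p n : C ^+ n <= C ^+ n.+1 by rewrite exprS ler_peMl// exprn_ge0//; lra.
by split => //; have := p 1; rewrite expr1.
Qed.

Lemma rr_rgood : rgood C <= rr.
Proof. by have [*] := Cpow; rewrite /rr /rgood; lra. Qed.

Lemma rr_ge : C <= rr. Proof. by have [*] := Cpow; rewrite /rr; lra. Qed.

(** Indices start at 1: the term with index 0 serves as the parameter along the leaf and may vary on
    the scale of [|x_1|]. *)
Definition nearby P Q r := forall k, cabs (X P k.+1 - X Q k.+1) <= r.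

Definition wt Q k : R[i] := (q k)^`().[X Q k.+1].

(* The product of the factors by which bounded differences of orbits near that of [Q]
   are multiplied, to first order. *)
Definition tau Q n : R[i] := \prod_(0 <= k < n) (a k / wt Q k).

Section Far.
Variable Q : C2 R.
Hypothesis HQ : vplus rr Q.

Lemma far_growth k : 2 ^+ k * rr <= cabs (X Q k.+1).
Proof.
have [_ h] := hiter_vplus HB k rr_ge HQ.
rewrite xorbS; apply: le_trans h; rewrite ler_pM2l ?exprn_gt0//.
by case: HQ.
Qed.

Lemma far k : rr <= cabs (X Q k.+1).
Proof.
apply: le_trans (far_growth k); rewrite ler_peMl ?exprn_ege1 ?ler1n//.
by have := rr_ge; have := bC (HB 0); lra.
Qed.

Lemma wt_low k : cabs (X Q k.+1) <= C * cabs (wt Q k).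
Proof. by apply: (bdlow (HB k)); apply: le_trans (far k); exact: rr_ge. Qed.

Lemma wt_low2 k : (50 * 40) * C ^+ 4 <= cabs (wt Q k).
Proof.
have [c1 _ _ _ _] := Cpow; have := le_trans (far k) (wt_low k).
by rewrite /rr [C ^+ 5]exprS mulrCA ler_pM2l//; lra.
Qed.

Lemma wt_neq0 k : wt Q k != 0.
Proof. by have [*] := Cpow; rewrite -cabs_gt0; have := wt_low2 k; lra. Qed.

Lemma tauS k : tau Q k.+1 = tau Q k * (a k / wt Q k).
Proof. by rewrite /tau big_nat_recr. Qed.

Lemma tau_neq0 k : tau Q k != 0.
Proof.
elim: k => [|k ih]; first by rewrite /tau big_nil oner_neq0.
by rewrite tauS !mulf_neq0 ?invr_neq0 ?wt_neq0// (bnd_aneq0 HB).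
Qed.

Lemma leaf_rec P P' k r : r <= rho -> nearby P Q r -> nearby P' Q r -> exists N,
  X P k.+2 - X P' k.+2 = wt Q k * (X P k.+1 - X P' k.+1) + N - a k * (X P k - X P' k) /\
  cabs N * cabs (X Q k.+1) <= C * r * cabs (wt Q k) * cabs (X P k.+1 - X P' k.+1).
Proof.
move=> rrho nP nP'; have [*] := Cpow.
have rX : r <= cabs (X Q k.+1) by apply: le_trans (far k); rewrite /rho in rrho; rewrite /rr; lra.
have h := btay (HB k) (le_trans rr_ge (far k)) (nP k) (nP' k) rX.
exists ((q k).[X P k.+1] - (q k).[X P' k.+1] - wt Q k * (X P k.+1 - X P' k.+1)).
split; first by rewrite !xorb_rec; ring.
move: h; rewrite ![X Q k.+1 + (_ - _)]addrC !subrK.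
by have -> : X P k.+1 - X Q k.+1 - (X P' k.+1 - X Q k.+1) = X P k.+1 - X P' k.+1 by ring.
Qed.

(** A failure at one index propagates to all later ones, the difference doubling each time, against
    the bound [2 rho]. So differences of nearby orbits follow the contracted direction. *)
Lemma leaf_dich P P' k : nearby P Q rho -> nearby P' Q rho ->
  cabs (wt Q k) * cabs (X P k.+1 - X P' k.+1) <= 2 * cabs (a k) * cabs (X P k - X P' k).
Proof.
move=> nP nP'; have [c1 c2 c3 c4 c5] := Cpow.
pose e k := cabs (X P k - X P' k).
pose bad k := 2 * cabs (a k) * e k < cabs (wt Q k) * e k.+1.
rewrite leNgt; apply/negP => bk; change (is_true (bad k)) in bk.
have step j : bad j -> bad j.+1 /\ 2 * e j.+1 <= e j.+2.
  move=> bj; have [N [eN hN]] := leaf_rec j (lexx _) nP nP'.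
  have far0 := far j; have w0 := wt_low2 j; have w1 := wt_low2 j.+1.
  have ej : 0 < e j.+1.
    rewrite lt_neqAle cabs_ge0 andbT eq_sym; apply/eqP => ej0.
    have := mulr_ge0 (mulr_ge0 (ler0n R 2) (cabs_ge0 (a j))) (cabs_ge0 (X P j - X P' j)).
    by move: bj; rewrite /bad ej0 mulr0 ltNge => /negP.
  have X0 : 0 < cabs (X Q j.+1) by rewrite /rr in far0; lra.
  have N4 : cabs N <= cabs (wt Q j) * e j.+1 / 4.
    rewrite -(ler_pM2r X0); apply: le_trans hN _; rewrite -/(e j.+1).
    have -> : C * rho * cabs (wt Q j) * e j.+1 = cabs (wt Q j) * e j.+1 * (C * rho) by ring.
    have -> : cabs (wt Q j) * e j.+1 / 4 * cabs (X Q j.+1) = cabs (wt Q j) * e j.+1 * (cabs (X Q j.+1) / 4) by field.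
    rewrite ler_wpM2l ?mulr_ge0//; first exact: ltW.
    by rewrite /rr in far0; rewrite /rho; lra.
  have e2 : cabs (wt Q j) * e j.+1 / 4 <= e j.+2.
    rewrite /e eN -/(e j); have := cabs_dist (wt Q j * (X P j.+1 - X P' j.+1)) (- (N - a j * (X P j - X P' j))).
    rewrite opprK addrA !cabsM cabsN -/(e j.+1).
    have := cabsB N (a j * (X P j - X P' j)); rewrite cabsM -/(e j).
    move: bj; rewrite /bad; clear - N4; lra.
  have Ce : 0 <= C * e j.+1 by apply: mulr_ge0; [lra|exact: ltW].
  have e3 : 2 * C * e j.+1 <= e j.+2.
    apply: (le_trans _ e2).
    have : (50 * 40) * C ^+ 4 * e j.+1 <= cabs (wt Q j) * e j.+1 by rewrite ler_wpM2r// ltW.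
    have : C * e j.+1 <= C ^+ 4 * e j.+1 by rewrite ler_wpM2r; lra.
    lra.
  have e4 : 2 * 1 * e j.+1 <= 2 * C * e j.+1 by rewrite ler_wpM2r; lra.
  split; last lra.
  rewrite /bad; have : cabs (a j.+1) * e j.+1 <= C * e j.+1 by rewrite ler_wpM2r ?(ltW ej)// (ba (HB _)).
  have : 2 * e j.+2 <= cabs (wt Q j.+1) * e j.+2 by rewrite ler_wpM2r; lra.
  lra.
have grow i : bad (k + i)%N /\ 2 ^+ i * e k.+1 <= e (k + i).+1.
  elim: i => [|i [ih1 ih2]]; first by rewrite addn0 expr0 mul1r.
  have [h1 h2] := step _ ih1; rewrite addnS; split => //.
  by rewrite exprS -mulrA; lra.
have ek : 0 < e k.+1.
  rewrite lt_neqAle cabs_ge0 andbT eq_sym; apply/eqP => ej0.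
  have := mulr_ge0 (mulr_ge0 (ler0n R 2) (cabs_ge0 (a k))) (cabs_ge0 (X P k - X P' k)).
  by move: bk; rewrite /bad ej0 mulr0 ltNge => /negP.
have ub i : e (k + i).+1 <= 2 * rho.
  have := cabs_triB (X P (k + i).+1) (X Q (k + i).+1) (X P' (k + i).+1).
  have := nP (k + i)%N; have := nP' (k + i)%N; rewrite (cabsC (X P' _)) /e; lra.
have := archi_boundP (divr_ge0 (_ : 0 <= 2 * rho) (ltW ek)).
set n := Num.bound _ => h.
have {}h : 2 * rho / e k.+1 < n%:R by apply: h; rewrite /rho; lra.
rewrite ltr_pdivrMr// in h.
have [_ h1] := grow n; have h2 := ub n.
have : n%:R * e k.+1 <= 2 ^+ n * e k.+1.
  by rewrite ler_wpM2r ?(ltW ek)// -natrX ler_nat ltnW// ltn_expl.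
lra.
Qed.

Lemma leaf_small P P' k : nearby P Q rho -> nearby P' Q rho ->
  cabs (X P k.+1 - X P' k.+1) * cabs (X Q k.+1) <= 2 * C ^+ 2 * cabs (X P k - X P' k).
Proof.
move=> nP nP'; have h := leaf_dich k nP nP'; have [c1 *] := Cpow.
have := ler_wpM2r (cabs_ge0 (X P k.+1 - X P' k.+1)) (wt_low k).
have : C * (2 * cabs (a k) * cabs (X P k - X P' k)) <= 2 * C ^+ 2 * cabs (X P k - X P' k).
  have := ler_wpM2r (cabs_ge0 (X P k - X P' k)) (ba (HB k)).
  move=> h2; have := ler_wpM2l (_ : 0 <= C) h2; rewrite expr2; lra.
have := ler_wpM2l (_ : 0 <= C) h; lra.
Qed.

Lemma leaf_eq P P' : nearby P Q rho -> nearby P' Q rho -> P.1 = P'.1 -> P = P'.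
Proof.
move=> nP nP' e0; have := leaf_small 0 nP nP'.
have -> : X P 0 - X P' 0 = 0 by rewrite /xorb /= e0 subrr.
rewrite cabs0 mulr0 => h.
have f0 := far 0; have [*] := Cpow; rewrite /rr in f0.
have X0 : 0 < cabs (X Q 1) by lra.
move: h; rewrite pmulr_lle0// => h.
have : cabs (X P 1 - X P' 1) == 0 by rewrite eq_le h cabs_ge0.
rewrite cabs_eq0 subr_eq0 /xorb /= => /eqP e1.
by case: P P' e0 e1 {nP nP' h} => p1 p2 [p1' p2'] /= -> ->.
Qed.

Definition lratio P P' k := (X P k - X P' k) / tau Q k.

(** The change of the ratio is the difference with index [k + 2] minus the Taylor remainder, over
    [a_k tau_k]. Both are [O(1 / |x_(k+1)|)] relative to the ratio, and [far_growth] supplies the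
    summable factor [2^-k]. *)
Lemma ratio_step P P' k : nearby P Q rho -> nearby P' Q rho ->
  cabs (lratio P P' k.+1 - lratio P P' k) <= cabs (lratio P P' k) * (2^-1 ^+ k / 16).
Proof.
move=> nP nP'; have [c1 c2 c3 c4 c5] := Cpow.
have [N [eN hN]] := leaf_rec k (lexx _) nP nP'.
have s1 := leaf_dich k nP nP'; have s2 := leaf_small k.+1 nP nP'; have s3 := leaf_small k nP nP'.
have a0 : a k != 0 := bnd_aneq0 HB k.
have t0 := tau_neq0 k; have w0 := wt_neq0 k.
have -> : lratio P P' k.+1 - lratio P P' k = ((X P k.+2 - X P' k.+2) - N) / (a k * tau Q k).
  by rewrite /lratio eN tauS; field; rewrite a0 t0 w0.
have -> : cabs (lratio P P' k) = cabs (a k) * cabs (X P k - X P' k) / cabs (a k * tau Q k).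
  by rewrite /lratio cabsf cabsM -mulf_div divff ?mul1r// cabs_eq0.
rewrite cabsf mulrAC ler_pM2r ?invr_gt0 ?cabs_gt0 ?mulf_neq0//.
set e0 := cabs (X P k - X P' k) in s1 s3 *; set e1 := cabs (X P k.+1 - X P' k.+1) in s1 s2 s3 hN.
set e2 := cabs (X P k.+2 - X P' k.+2) in s2.
have e0p : 0 <= e0 by exact: cabs_ge0.
have f1 := far_growth k; have f2 := far k.+1; have a1 := baV (HB k).
have X0 : 0 < cabs (X Q k.+1) by have := far k; rewrite /rr; lra.
have X1 : 1 <= cabs (X Q k.+2) by move: f2; rewrite /rr; lra.
have ae : 0 <= cabs (a k) * e0 by rewrite mulr_ge0.
have hN2 : cabs N * cabs (X Q k.+1) <= 2 * C * rho * (cabs (a k) * e0).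
  apply: le_trans hN _.
  have := ler_wpM2l (_ : 0 <= C * rho) s1; rewrite /rho; lra.
have he2 : e2 * cabs (X Q k.+1) <= 4 * C ^+ 5 * (cabs (a k) * e0).
  have h1 : e2 <= 2 * C ^+ 2 * e1.
    apply: le_trans s2; rewrite ler_peMr//; exact: cabs_ge0.
  have h2 := ler_wpM2r (ltW X0) h1.
  have h3 := ler_wpM2l (_ : 0 <= 2 * C ^+ 2) s3.
  have h4 := ler_wpM2r e0p a1.
  have h5 := ler_wpM2l (_ : 0 <= 4 * C ^+ 4) h4.
  have q1 : 0 <= 2 * C ^+ 2 by lra.
  have q2 : 0 <= 4 * C ^+ 4 by lra.
  by move: h2 (h3 q1) (h5 q2); rewrite (exprS C 4); lra.
have tot : cabs (X P k.+2 - X P' k.+2 - N) * cabs (X Q k.+1) <= (84 * C ^+ 5) * (cabs (a k) * e0).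
  have := ler_wpM2r (ltW X0) (cabsB (X P k.+2 - X P' k.+2) N); rewrite -/e2.
  have : 2 * C * rho * (cabs (a k) * e0) <= 80 * C ^+ 5 * (cabs (a k) * e0).
    by rewrite ler_wpM2r// /rho; lra.
  lra.
rewrite -(ler_pM2r X0); apply: le_trans tot _.
suff hk : 84 * C ^+ 5 <= 2^-1 ^+ k / 16 * cabs (X Q k.+1).
  by have := ler_wpM2l ae hk; lra.
have h : 2^-1 ^+ k * 2 ^+ k = 1 :> R by rewrite -exprMn mulVf ?expr1n// pnatr_eq0.
have : 2^-1 ^+ k / 16 * (2 ^+ k * rr) <= 2^-1 ^+ k / 16 * cabs (X Q k.+1).
  by rewrite ler_wpM2l// divr_ge0// exprn_ge0.
have -> : 2^-1 ^+ k / 16 * (2 ^+ k * rr) = rr / 16 by move: h; move: (_ ^+ k) (2 ^+ k) => u v h; transitivity (u * v * (rr / 16)); [ring|rewrite h mul1r].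
by rewrite /rr; lra.
Qed.

Lemma ratio0 P P' : lratio P P' 0 = X P 0 - X P' 0.
Proof. by rewrite /lratio /tau big_nil divr1. Qed.

Lemma half_expn k : 0 < 2^-1 ^+ k :> R /\ 2^-1 ^+ k.+1 = 2^-1 ^+ k / 2 :> R.
Proof. by rewrite exprn_gt0 ?invr_gt0// exprSr. Qed.

Lemma ratio_bound P P' k : nearby P Q rho -> nearby P' Q rho ->
  cabs (lratio P P' k - (X P 0 - X P' 0)) <= cabs (X P 0 - X P' 0) / 4 * (1 - 2^-1 ^+ k).
Proof.
move=> nP nP'; elim: k => [|k ih]; first by rewrite ratio0 subrr cabs0 expr0 subrr mulr0.
have [h0 h1] := half_expn k; rewrite h1; have h := ratio_step k nP nP'.
have e0 := cabs_ge0 (X P 0 - X P' 0).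
have := cabs_triB (lratio P P' k.+1) (lratio P P' k) (X P 0 - X P' 0).
have E : cabs (lratio P P' k) <= 5 / 4 * cabs (X P 0 - X P' 0).
  have := cabs_dist (lratio P P' k) (X P 0 - X P' 0).
  have := mulr_ge0 e0 (ltW h0); lra.
have E2 : cabs (lratio P P' k) * (2^-1 ^+ k / 16) <= 5 / 4 * cabs (X P 0 - X P' 0) * (2^-1 ^+ k / 16).
  by rewrite ler_wpM2r//; lra.
have := mulr_ge0 e0 (ltW h0); lra.
Qed.

Lemma ratio_cauchy P P' k i : nearby P Q rho -> nearby P' Q rho ->
  cabs (lratio P P' (k + i) - lratio P P' k) <= cabs (X P 0 - X P' 0) / 4 * (2^-1 ^+ k - 2^-1 ^+ (k + i)).
Proof.
move=> nP nP'; have e0 := cabs_ge0 (X P 0 - X P' 0).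
elim: i => [|i ih]; first by rewrite addn0 !subrr cabs0 mulr0.
rewrite addnS; have [h0 h1] := half_expn (k + i); rewrite h1; have h := ratio_step (k + i) nP nP'.
have E : cabs (lratio P P' (k + i)) <= 5 / 4 * cabs (X P 0 - X P' 0).
  have := ratio_bound (k + i) nP nP'.
  have := cabs_dist (lratio P P' (k + i)) (X P 0 - X P' 0).
  have := mulr_ge0 e0 (ltW h0); lra.
have E2 : cabs (lratio P P' (k + i)) * (2^-1 ^+ (k + i) / 16) <= 5 / 4 * cabs (X P 0 - X P' 0) * (2^-1 ^+ (k + i) / 16).
  by rewrite ler_wpM2r//; lra.
have := cabs_triB (lratio P P' (k + i).+1) (lratio P P' (k + i)) (lratio P P' k).
have := mulr_ge0 e0 (ltW h0); lra.
Qed.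

(* The affine coordinate of [P] along the leaf of [Q]. *)
Definition dlt P : R[i] := xget 0 [set l | clim \oo (lratio P Q) l].

Lemma near_base r : 0 <= r -> nearby Q Q r.
Proof. by move=> r0 k; rewrite subrr cabs0. Qed.

Lemma rho_ge0 : 0 <= rho. Proof. by have [*] := Cpow; rewrite /rho; lra. Qed.

Lemma small_half e : 0 < e -> exists N, forall n, (N <= n)%N -> 2^-1 ^+ n < e :> R.
Proof.
move=> e0; have [N hN] := archi_inv e0; exists N => n /hN; apply: le_lt_trans.
rewrite exprVn lef_pV2 ?posrE ?exprn_gt0// -natrX ler_nat.
exact: ltn_expl.
Qed.

Lemma dlt_lim P : nearby P Q rho -> clim \oo (lratio P Q) (dlt P).
Proof.
move=> nP; have nQ := near_base rho_ge0.
rewrite /dlt; case: xgetP => [l _ //|h]; exfalso.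
have [l hl] : exists l, forall e, 0 < e -> exists N, forall n, (N <= n)%N -> cabs (lratio P Q n - l) < e.
  apply: ccauchy => e e0.
  have K0 : 0 < cabs (X P 0 - X Q 0) + 1 by rewrite ltr_wpDl.
  have [N hN] := small_half (divr_gt0 e0 K0).
  have key n : (N <= n)%N -> cabs (lratio P Q n - lratio P Q N) < e / 2.
    move=> Nn; rewrite -(subnKC Nn); apply: le_lt_trans (ratio_cauchy N (n - N) nP nQ) _.
    have := hN N (leqnn _); rewrite ltr_pdivlMr// => h1.
    have [h2 _] := half_expn (N + (n - N)); have [h3 _] := half_expn N.
    have := mulr_ge0 (cabs_ge0 (X P 0 - X Q 0)) (ltW h2).
    have := mulr_ge0 (cabs_ge0 (X P 0 - X Q 0)) (ltW h3).
    rewrite mulrBr; lra.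
  exists N => m n /key h1 /key h2.
  have := cabs_triB (lratio P Q m) (lratio P Q N) (lratio P Q n); rewrite (cabsC (lratio P Q N)); lra.
by apply: (h l); apply/clim_ooP.
Qed.

(** The corrections of [ratio_step] sum to at most a quarter, so the leaf coordinate is comparable
    to the first coordinate; with [leaf_eq] this makes it injective. *)
Lemma dlt_two P P' : nearby P Q rho -> nearby P' Q rho ->
  cabs (dlt P - dlt P' - (P.1 - P'.1)) <= cabs (P.1 - P'.1) / 4.
Proof.
move=> nP nP'.
have h : clim \oo (fun k => lratio P Q k - lratio P' Q k - (P.1 - P'.1)) (dlt P - dlt P' - (P.1 - P'.1)).
  by apply: climB; [apply: climB; exact: dlt_lim|exact: clim_cst].
apply: (clim_le _ h); apply: nearW => k.
have -> : lratio P Q k - lratio P' Q k = lratio P P' k by rewrite /lratio -mulrBl; congr (_ / _); ring.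
apply: le_trans (ratio_bound k nP nP') _; by rewrite ler_piMr ?divr_ge0//; have [h0 _] := half_expn k; lra.
Qed.

Lemma dlt_base : dlt Q = 0.
Proof.
have nQ := near_base rho_ge0; apply: (clim_unique _ (dlt_lim nQ)).
apply: (@clim_near_eq _ _ _ _ (fun=> 0)); last exact: clim_cst.
by apply: nearW => k; rewrite /lratio subrr mul0r.
Qed.

Lemma dlt_one P : nearby P Q rho -> cabs (dlt P - (P.1 - Q.1)) <= cabs (P.1 - Q.1) / 4.
Proof. by move=> nP; have := dlt_two nP (near_base rho_ge0); rewrite dlt_base subr0. Qed.

Lemma dlt_inj P P' : nearby P Q rho -> nearby P' Q rho -> dlt P = dlt P' -> P = P'.
Proof.
move=> nP nP' e; apply: leaf_eq => //; have := dlt_two nP nP'.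
rewrite e subrr add0r cabsN => h; apply/eqP; rewrite -subr_eq0 -cabs_eq0 eq_le cabs_ge0 andbT; lra.
Qed.

Lemma dlt_cdiff (g : R[i] -> C2 R) T : (forall s, cabs s <= T -> cdiff2 g s /\ nearby (g s) Q rho) ->
  forall s, cabs s < T -> cdiff (fun s => dlt (g s)) s.
Proof.
move=> gh; have [M M0 hM] := cbounded_disc (fun s h => cdiff_ccont (gh s h).1.1).
apply: (weierstrass (g := fun j s => lratio (g s) Q j)).
- move=> j s sT; apply: cdiffM; last exact: cdiff_cst.
  apply: cdiffB; last exact: cdiff_cst.
  by have [] := cdiff2_hiter q a j (gh s sT).1.
- move=> e e0; have K0 : 0 < M + cabs Q.1 + 1 by rewrite ltr_wpDl// addr_ge0// ltW.
  have [N hN] := small_half (divr_gt0 e0 K0).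
  exists N => j Nj s sT; have nP := (gh s sT).2; have nQ := near_base rho_ge0.
  have h : clim \oo (fun k => lratio (g s) Q j - lratio (g s) Q k) (lratio (g s) Q j - dlt (g s)).
    by apply: climB; [exact: clim_cst|exact: dlt_lim].
  apply: (clim_le _ h); exists j => // k /= jk; rewrite cabsC -(subnKC jk).
  apply: le_trans (ratio_cauchy j (k - j) nP nQ) _.
  have := hN j Nj; rewrite ltr_pdivlMr// => h1.
  have [h2 _] := half_expn (j + (k - j)); have [h3 _] := half_expn j.
  have x0 : cabs (X (g s) 0 - X Q 0) <= M + cabs Q.1 + 1.
    have := hM s sT; have := cabsB (g s).1 Q.1; rewrite /xorb /=; lra.
  have := mulr_ge0 (cabs_ge0 (X (g s) 0 - X Q 0)) (ltW h2).
  have := ler_wpM2l (ltW h3) x0.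
  have := mulr_ge0 (cabs_ge0 (X (g s) 0 - X Q 0)) (ltW h3).
  rewrite mulrBr; lra.
Qed.

End Far.
End Base.
End Leaves.

Section Leaves2.
Context {R : realType}.
Implicit Types (z w P Q : C2 R) (r x y : R) (n k j : nat) (s t : R[i]).
Variables (q : nat -> {poly R[i]}) (a : nat -> R[i]) (C : R).
Hypothesis HB : forall k, bnd (q k) (a k) C.
Notation F := (hiter q a).
Notation D := (hdeg q).
Notation cg := (cgr C).
Notation G := (gr q a C).
Notation X := (xorb q a).

Section Graph.
Variable Q : C2 R.
Hypothesis HQ : vplus (rr C) Q.
Notation w := (wt q a Q).

(** Picard iteration for the leaf: the recursion is solved for the difference with index [k + 1],
    which divides by the large derivative [w k]. The first argument counts iterations; the
    difference with index 0 is the free parameter [t], the others start from 0. *)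
Fixpoint git j k t : R[i] :=
  match k, j with
  | 0, _ => t
  | k'.+1, 0 => 0
  | k'.+1, j'.+1 => (a k' * git j' k' t + git j' k'.+2 t
      - ((q k').[X Q k'.+1 + git j' k'.+1 t] - (q k').[X Q k'.+1] - w k' * git j' k'.+1 t)) / w k'
  end.

Lemma git0 j t : git j 0 t = t. Proof. by case: j. Qed.

Lemma gitS j k t : git j.+1 k.+1 t = (a k * git j k t + git j k.+2 t
  - ((q k).[X Q k.+1 + git j k.+1 t] - (q k).[X Q k.+1] - w k * git j k.+1 t)) / w k.
Proof. by []. Qed.

Lemma git_err k r (e e' : R[i]) : r <= 3 * C ^+ 2 -> cabs e <= r -> cabs e' <= r ->
  cabs ((q k).[X Q k.+1 + e] - (q k).[X Q k.+1] - w k * e -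
        ((q k).[X Q k.+1 + e'] - (q k).[X Q k.+1] - w k * e')) <= cabs (w k) * (cabs (e - e') / (10 * 10)).
Proof.
move=> rC er er'; have [c1 c2 c3 c4 c5] := Cpow HB; have f := far HB HQ k.
have X0 : 0 < cabs (X Q k.+1) by rewrite /rr in f; lra.
have rX : r <= cabs (X Q k.+1) by rewrite /rr in f; lra.
have := btay (HB k) (le_trans (rr_ge HB) f) er er' rX.
have -> : (q k).[X Q k.+1 + e] - (q k).[X Q k.+1] - w k * e -
   ((q k).[X Q k.+1 + e'] - (q k).[X Q k.+1] - w k * e') =
   (q k).[X Q k.+1 + e] - (q k).[X Q k.+1 + e'] - (q k)^`().[X Q k.+1] * (e - e').
  by rewrite /wt; ring.
move=> h; rewrite -(ler_pM2r X0); apply: le_trans h _.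
have we : 0 <= cabs (w k) * cabs (e - e') by apply: mulr_ge0; exact: cabs_ge0.
have : C * r <= cabs (X Q k.+1) / (10 * 10).
  have := ler_wpM2l (_ : 0 <= C) rC; rewrite /rr in f; lra.
move=> /(ler_wpM2l we); rewrite -/(w k); lra.
Qed.

(** The parameter may be as large as [|x_1|], but [wt_low] still bounds [a_0 t / w_0] by [C^2]; the
    other terms are small because [w k] is large. *)
Lemma git_bound j k t : cabs t <= cabs Q.2 -> cabs (git j k.+1 t) <= 3 * C ^+ 2.
Proof.
move=> tQ; have [c1 c2 c3 c4 c5] := Cpow HB.
elim: j k => [|j ih] k; first by rewrite /= cabs0; lra.
have w1 := wt_low2 HB HQ k; have w2 := wt_low HB HQ k; have f := far HB HQ k.
have w0 : 0 < cabs (w k) by lra.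
rewrite /= cabsf ler_pdivrMr//.
have ek : cabs (git j k t) <= cabs (X Q k.+1).
  case: k f {w1 w2 w0} => [|k] f; first by rewrite git0.
  by apply: le_trans (ih k) _; rewrite /rr in f; lra.
have z0 : cabs (0 : R[i]) <= 3 * C ^+ 2 by rewrite cabs0; lra.
have := git_err k (lexx _) (ih k) z0; rewrite subr0 addr0 subrr mulr0 !subr0.
set N := _ - w k * _ => hN.
have h1 : cabs (a k * git j k t) <= C ^+ 2 * cabs (w k).
  rewrite cabsM; have := ler_pM (cabs_ge0 _) (cabs_ge0 _) (ba (HB k)) ek.
  have := ler_wpM2l (_ : 0 <= C) w2; rewrite expr2; lra.
have h2 := ih k.+1.
have h3 := ler_wpM2l (ltW w0) (ih k).
have p2 : 0 <= C ^+ 2 by lra.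
have p4 : 1 <= C ^+ 4 by lra.
have h5 := ler_wpM2r p2 w1.
have h6 := ler_wpM2l p2 p4.
have := cabsB (a k * git j k t + git j k.+2 t) N.
have := cabsD (a k * git j k t) (git j k.+2 t).
(clear - HB HQ h6 h5 p2 h3 h2 h1 hN; lra).
Qed.

Lemma git_step j k t : cabs t <= cabs Q.2 -> cabs (git j.+1 k t - git j k t) <= 3 * C ^+ 2 * 2^-1 ^+ j.
Proof.
move=> tQ; have [c1 c2 c3 c4 c5] := Cpow HB.
elim: j k => [|j ih] [|k].
- by rewrite !git0 subrr cabs0 mulr_ge0//; lra.
- by rewrite subr0 expr0 mulr1; exact: git_bound.
- by rewrite !git0 subrr cabs0 mulr_ge0 ?exprn_ge0//; lra.
have [h0 h1] := @half_expn R j; rewrite h1.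
have w1 := wt_low2 HB HQ k.
have w0 : 0 < cabs (w k) by lra.
have := git_err k (lexx _) (git_bound j.+1 k tQ) (git_bound j k tQ).
set N := (X in cabs X <= _) => hN.
have -> : git j.+2 k.+1 t - git j.+1 k.+1 t =
    (a k * (git j.+1 k t - git j k t) + (git j.+1 k.+2 t - git j k.+2 t) - N) / w k.
  by rewrite (gitS j.+1 k) [X in _ - X]gitS -mulrBl; congr (_ / _); rewrite /N; ring.
rewrite cabsf ler_pdivrMr//; clearbody N.
have i0 := ih k; have i1 := ih k.+1; have i2 := ih k.+2.
set d := 3 * C ^+ 2 * 2^-1 ^+ j in i0 i1 i2 *.
have d0 : 0 <= d by rewrite /d mulr_ge0 ?exprn_ge0//; lra.
have h2 := ler_wpM2l (ltW w0) i1.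
have h3 : cabs (a k * (git j.+1 k t - git j k t)) <= C * d.
  by rewrite cabsM; apply: ler_pM => //; exact: ba (HB k).
have h4 : (50 * 40) * C ^+ 4 * d <= cabs (w k) * d by rewrite ler_wpM2r.
have p4 : C <= C ^+ 4 by lra.
have h5 := ler_wpM2r d0 p4.
have h6 : 1 * d <= C * d by rewrite ler_wpM2r.
have := cabsB (a k * (git j.+1 k t - git j k t) + (git j.+1 k.+2 t - git j k.+2 t)) N.
have := cabsD (a k * (git j.+1 k t - git j k t)) (git j.+1 k.+2 t - git j k.+2 t).
move=> h7 h8.
rewrite (_ : 3 * C ^+ 2 * (2^-1 ^+ j / 2) = d / 2); last by rewrite /d; ring.
(clear - HB HQ h8 h7 h6 h5 h4 h3 h2 d0 i2 hN; lra).
Qed.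

Lemma git_cauchy j i k t : cabs t <= cabs Q.2 ->
  cabs (git (j + i) k t - git j k t) <= 6 * C ^+ 2 * (2^-1 ^+ j - 2^-1 ^+ (j + i)).
Proof.
move=> tQ; elim: i => [|i ih]; first by rewrite addn0 !subrr cabs0 mulr0.
rewrite addnS; have [h0 h1] := @half_expn R (j + i); rewrite h1.
have := git_step (j + i) k tQ.
have := cabs_triB (git (j + i).+1 k t) (git (j + i) k t) (git j k t); lra.
Qed.

Definition gam k t : R[i] := xget 0 [set l | clim \oo (fun j => git j k t) l].

Lemma gam_lim k t : cabs t <= cabs Q.2 -> clim \oo (fun j => git j k t) (gam k t).
Proof.
move=> tQ; rewrite /gam; case: xgetP => [l _ //|h]; exfalso.
have [c1 c2 c3 c4 c5] := Cpow HB.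
have [l hl] : exists l, forall e, 0 < e -> exists N, forall n, (N <= n)%N -> cabs (git n k t - l) < e.
  apply: ccauchy => e e0.
  have K0 : 0 < 12 * C ^+ 2 by lra.
  have [N hN] := small_half (divr_gt0 e0 K0).
  have key n : (N <= n)%N -> cabs (git n k t - git N k t) < e / 2.
    move=> Nn; rewrite -(subnKC Nn); apply: le_lt_trans (git_cauchy N (n - N) k tQ) _.
    have := hN N (leqnn _); rewrite ltr_pdivlMr// => h1.
    have [h2 _] := @half_expn R (N + (n - N)).
    have h3 : 0 <= C ^+ 2 * 2^-1 ^+ (N + (n - N)) by rewrite mulr_ge0 ?(ltW h2)//; lra.
    lra.
  exists N => m n /key h1 /key h2.
  have := cabs_triB (git m k t) (git N k t) (git n k t); rewrite (cabsC (git N k t)); lra.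
by apply: (h l); apply/clim_ooP.
Qed.

Lemma gam0 t : cabs t <= cabs Q.2 -> gam 0 t = t.
Proof.
move=> tQ; apply: (clim_unique _ (gam_lim 0 tQ)).
by apply: (@clim_near_eq _ _ _ _ (fun=> t)); [apply: nearW => j; rewrite git0|exact: clim_cst].
Qed.

Lemma gam_bound k t : cabs t <= cabs Q.2 -> cabs (gam k.+1 t) <= 3 * C ^+ 2.
Proof. by move=> tQ; apply: (clim_le _ (gam_lim _ tQ)); apply: nearW => j; exact: git_bound. Qed.

Lemma gam_cdiff k t : cabs t < cabs Q.2 -> cdiff (gam k) t.
Proof.
have [c1 c2 c3 c4 c5] := Cpow HB.
apply: (weierstrass (g := fun j s => git j k s)).
- move=> j s sT; elim: j k => [|j ih] [|k] /=; try exact: cdiff_id; try exact: cdiff_cst.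
  apply: cdiffM; last exact: cdiff_cst.
  apply: cdiffB; first by apply: cdiffD => //; exact: cdiffZ.
  apply: cdiffB; last exact: cdiffZ.
  apply: cdiffB; last exact: cdiff_cst.
  by apply: cdiff_horner; apply: cdiffD => //; exact: cdiff_cst.
- move=> e e0; have K0 : 0 < 6 * C ^+ 2 by lra.
  have [N hN] := small_half (divr_gt0 e0 K0).
  exists N => j Nj s sT.
  have h : clim \oo (fun i => git j k s - git i k s) (git j k s - gam k s).
    by apply: climB; [exact: clim_cst|exact: gam_lim].
  apply: (clim_le _ h); exists j => // i /= ji; rewrite cabsC -(subnKC ji).
  apply: le_trans (git_cauchy j (i - j) k sT) _.
  have := hN j Nj; rewrite ltr_pdivlMr// => h1.
  have [h2 _] := @half_expn R (j + (i - j)).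
  have h3 : 0 <= C ^+ 2 * 2^-1 ^+ (j + (i - j)) by rewrite mulr_ge0 ?(ltW h2)//; lra.
  lra.
Qed.

Lemma gam_rec k t : cabs t <= cabs Q.2 ->
  X Q k.+2 + gam k.+2 t = (q k).[X Q k.+1 + gam k.+1 t] - a k * (X Q k + gam k t).
Proof.
move=> tQ; have w0 := wt_neq0 HB HQ k.
have l1 : clim \oo (fun j => w k * git j.+1 k.+1 t) (w k * gam k.+1 t).
  apply: climM; first exact: clim_cst.
  apply/clim_ooP => e e0; have [N hN] := (clim_ooP _ _).1 (gam_lim k.+1 tQ) e e0.
  by exists N => n Nn; apply: hN; exact: leqW.
have l2 : clim \oo (fun j => w k * git j.+1 k.+1 t) (a k * gam k t + gam k.+2 t
      - ((q k).[X Q k.+1 + gam k.+1 t] - (q k).[X Q k.+1] - w k * gam k.+1 t)).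
  apply: (@clim_near_eq _ _ _ _ (fun j => a k * git j k t + git j k.+2 t
      - ((q k).[X Q k.+1 + git j k.+1 t] - (q k).[X Q k.+1] - w k * git j k.+1 t))).
    by apply: nearW => j /=; rewrite mulrCA mulfV ?mulr1.
  apply: climB.
    apply: climD; last exact: gam_lim.
    by apply: climM; [exact: clim_cst|exact: gam_lim].
  apply: climB; last by apply: climM; [exact: clim_cst|exact: gam_lim].
  apply: climB; last exact: clim_cst.
  by apply: clim_horner; apply: climD; [exact: clim_cst|exact: gam_lim].
have e : w k * gam k.+1 t = a k * gam k t + gam k.+2 t -
  ((q k).[X Q k.+1 + gam k.+1 t] - (q k).[X Q k.+1] - w k * gam k.+1 t).
  exact: (clim_unique _ l1 l2).
have {}e : gam k.+2 t = (q k).[X Q k.+1 + gam k.+1 t] - (q k).[X Q k.+1] - a k * gam k t.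
  have h (x y z v : R[i]) : v = x + y - (z - v) -> y = z - x.
    move=> h; have -> : y = (x + y - (z - v)) + (z - v) - x by ring.
    by rewrite -h; ring.
  exact: h e.
rewrite e {l1 l2}.
by rewrite xorb_rec; ring.
Qed.

(** By [gam_rec] the sequence [x_n + gam n t] is the orbit of the point formed by its first two
    terms. The length [|x_1|] of the parameter disc is unbounded along the orbit, as Liouville's
    theorem will require. *)
Lemma leaf_graph : exists g : R[i] -> C2 R,
  (forall t, cabs t <= cabs Q.2 -> (g t).1 = Q.1 + t /\ nearby q a (g t) Q (3 * C ^+ 2)) /\
  (forall t, cabs t < cabs Q.2 -> cdiff2 g t).
Proof.
exists (fun t => (Q.1 + gam 0 t, X Q 1 + gam 1 t)); split => [t tQ|t tQ]; last first.
  by split => /=; apply: cdiffD; try exact: cdiff_cst; exact: gam_cdiff.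
split => [|k]; first by rewrite /= gam0.
suff h : X (Q.1 + gam 0 t, X Q 1 + gam 1 t) k = X Q k + gam k t /\
    X (Q.1 + gam 0 t, X Q 1 + gam 1 t) k.+1 = X Q k.+1 + gam k.+1 t.
  by rewrite h.2 addrC addKr; exact: gam_bound.
elim: k => [|k [ih1 ih2]] //; split => //.
by rewrite xorb_rec ih1 ih2 -gam_rec.
Qed.

End Graph.

(** Read backwards: as [G P = G Q], the logarithms differ by at most [2 cgr] at every level, and
    each step back divides the difference by a degree at least 2, after an error of at most
    [2 C / m]. *)
Lemma leaf_ln P Q m : vplus (rr C) P -> vplus (rr C) Q -> G P = G Q -> 0 < m ->
  m <= cabs P.2 -> m <= cabs Q.2 -> `|ln (cabs P.2) - ln (cabs Q.2)| <= 2 * C / m.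
Proof.
move=> VP VQ GPQ m0 mP mQ; have [c1 *] := Cpow HB.
have cg0 := cgr_gt0 HB.
pose d k := ln (cabs (X P k.+1)) - ln (cabs (X Q k.+1)).
have orb Z : vplus (rr C) Z -> m <= cabs Z.2 -> forall k,
   [/\ `|ln (cabs (X Z k.+1)) - (D k)%:R * G Z| <= cg &
    `|ln (cabs (X Z k.+2)) - ((pdeg (q k))%:R * ln (cabs (X Z k.+1)) + ln (cabs (lead_coef (q k))))| <= C / m].
  move=> VZ mZ k; have [VF hF] := hiter_vplus HB k (rr_ge HB) VZ.
  split.
    have := gr_vplus (stail_bnd k HB) (vplus_mono (rr_rgood HB) VF).
    by rewrite gr_shift.
  have [V1 V2] := VF.
  have h := blog (HB k) (le_trans (rr_ge HB) V1) V2.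
  apply: le_trans h _; rewrite ler_wpM2l//; first lra.
  have X0 : 0 < cabs (F k Z).2 by have := rr_ge HB; lra.
  rewrite lef_pV2 ?posrE//; apply: le_trans hF.
  apply: le_trans mZ _; rewrite ler_peMl ?cabs_ge0//.
  by rewrite exprn_ege1// ler1n.
suff key i : forall k, `|d k| <= 2 * cg * 2^-1 ^+ i + 2 * C / m.
  apply/ler_addgt0Pr => e e0; have K0 : 0 < 2 * cg by lra.
  have [N hN] := small_half (divr_gt0 e0 K0).
  have := hN N (leqnn _); rewrite ltr_pdivlMr// => h1.
  by have := key N 0%N; rewrite /d /=; lra.
elim: i => [|i ih] k.
  have [h1 _] := orb P VP mP k; have [h2 _] := orb Q VQ mQ k.
  have : 0 <= 2 * C / m by rewrite divr_ge0 ?(ltW m0)//; lra.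
  rewrite expr0 mulr1; move: h1 h2; rewrite /d GPQ !ler_norml => /andP[? ?] /andP[? ?] ?.
  by apply/andP; split; lra.
have [_ h1] := orb P VP mP k; have [_ h2] := orb Q VQ mQ k.
have h3 := ih k.+1; have [h4 h5] := @half_expn R i; rewrite h5.
have d2 : 2 <= (pdeg (q k))%:R :> R by rewrite ler_nat; exact: bdeg (HB k).
have h6 : `|(pdeg (q k))%:R * d k| <= 2 * cg * 2^-1 ^+ i + 2 * C / m + 2 * C / m.
  have -> : (pdeg (q k))%:R * d k = d k.+1
    - (ln (cabs (X P k.+2)) - ((pdeg (q k))%:R * ln (cabs (X P k.+1)) + ln (cabs (lead_coef (q k)))))
    + (ln (cabs (X Q k.+2)) - ((pdeg (q k))%:R * ln (cabs (X Q k.+1)) + ln (cabs (lead_coef (q k))))).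
    by rewrite /d; ring.
  apply: le_trans (ler_normD _ _) _.
  have := ler_normB (d k.+1) (ln (cabs (X P k.+2)) - ((pdeg (q k))%:R * ln (cabs (X P k.+1)) + ln (cabs (lead_coef (q k))))).
  clear - h1 h2 h3; lra.
have : 2 * `|d k| <= `|(pdeg (q k))%:R * d k|.
  by rewrite normrM ger0_norm ?ler_wpM2r//; lra.
clear - h6; lra.
Qed.

(** In a level set of [G], [leaf_ln] confines the modulus of the second coordinate to a factor
    [1 + O(C / |y|)]. Borel-Caratheodory for its quotient by the value at 0 then bounds the
    displacement by [O(C)]. *)
Lemma leaf_disc1 g T s : 0 < T -> (forall s, cabs s <= T -> [/\ cdiff2 g s, vplus (rr C) (g s) & G (g s) = G (g 0)]) ->
  cabs s <= T / 16 -> cabs ((g s).2 - (g 0).2) <= 16 * C.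
Proof.
move=> T0 gh sT; have [c1 c2 c3 c4 c5] := Cpow HB.
have z0 : cabs (0 : R[i]) <= T by rewrite cabs0 ltW.
have [_ V0 _] := gh 0 z0; have [r0 _] := V0.
have Y0 : 0 < cabs (g 0).2 by rewrite /rr in r0; lra.
have [x [x0 xE x1]] : exists x, [/\ 0 < x, x = 4 * C / cabs (g 0).2 & x <= 1 / 2].
  exists (4 * C / cabs (g 0).2); split => //; first by rewrite divr_gt0//; lra.
  by rewrite ler_pdivrMr//; rewrite /rr in r0; lra.
have up s' : cabs s' <= T -> cabs (g s').2 <= (1 + 2 * x) * cabs (g 0).2.
  move=> s'T; have [_ Vs Gs] := gh s' s'T; have [rs _] := Vs.
  have Ys : 0 < cabs (g s').2 by rewrite /rr in rs; lra.
  have R0 : 0 < rr C by rewrite /rr; lra.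
  have l1 := leaf_ln Vs V0 Gs R0 rs r0.
  have r12 : 2 * C / rr C <= 1 / 2 by rewrite ler_pdivrMr// /rr; lra.
  (* A crude comparison with [m = rr] comes first; it allows [m = |y_0| / 2] in the sharp one. *)
  have half : cabs (g 0).2 / 2 <= cabs (g s').2.
    have e2 : expR (- (1 / 2)) * cabs (g 0).2 <= cabs (g s').2.
      have -> : cabs (g 0).2 = expR (ln (cabs (g 0).2)) by rewrite lnK.
      rewrite -expRD -[leRHS]lnK ?posrE// ler_expR; move: l1; rewrite ler_norml; (clear - HB r12; lra).
    have := expR_ge1Dx (- (1 / 2) : R) => e3.
    have : (1 / 2) * cabs (g 0).2 <= expR (- (1 / 2)) * cabs (g 0).2 by rewrite ler_wpM2r ?(ltW Y0)//; (clear - HB e3; lra).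
    (clear - HB e2; lra).
  have m0 : 0 < cabs (g 0).2 / 2 by lra.
  have m1 : cabs (g 0).2 / 2 <= cabs (g 0).2 by (clear - HB m0; lra).
  have := leaf_ln Vs V0 Gs m0 half m1.
  have -> : 2 * C / (cabs (g 0).2 / 2) = x by rewrite xE; field; rewrite gt_eqF.
  rewrite ler_norml => /andP[_ l2].
  have l3 : cabs (g s').2 <= expR x * cabs (g 0).2.
    have -> : cabs (g 0).2 = expR (ln (cabs (g 0).2)) by rewrite lnK.
    by rewrite -expRD -[leLHS]lnK ?posrE// ler_expR; (clear - HB l2; lra).
  have e1 : expR x <= 1 + 2 * x.
    have := expR_ge1Dx (- x); rewrite expRN => e2.
    have E0 := expR_gt0 x.
    have := ler_wpM2r (ltW E0) e2; rewrite mulVf ?gt_eqF// => e3.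
    have e4 : (1 + 2 * x) * ((1 - x) * expR x) <= 1 + 2 * x by have := ler_wpM2l (_ : 0 <= 1 + 2 * x) e3; rewrite mulr1; apply; (clear - HB x0; lra).
    have e5 : 0 <= expR x * (x * (1 - 2 * x)) by rewrite !mulr_ge0 ?(ltW E0) ?(ltW x0)//; (clear - HB x1; lra).
    (clear - HB e5 e4; lra).
  by apply: le_trans l3 _; rewrite ler_wpM2r// ltW.
have y0 : (g 0).2 != 0 by rewrite -cabs_gt0.
have h := @borel_caratheodory _ (fun s => (g s).2 / (g 0).2 - 1) T (2 * x) s.
have {}h : cabs ((g s).2 / (g 0).2 - 1) <= 32 * (2 * x) * cabs s / T.
  apply: h => //; first lra.
  - move=> s' s'T; have [[_ gd] _ _] := gh s' s'T.
    apply: cdiffB; last exact: cdiff_cst.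
    by apply: cdiffM => //; exact: cdiff_cst.
  - by rewrite mulfV ?subrr.
  - move=> s' s'T; have := up s' s'T.
    have := ler_norm (complex.Re ((g s').2 / (g 0).2)); have := Re_le_cabs ((g s').2 / (g 0).2).
    rewrite cabsf => h1 h2 h3.
    have h4 : cabs (g s').2 / cabs (g 0).2 <= 1 + 2 * x by rewrite ler_pdivrMr.
    rewrite raddfB /=; (clear - HB h4 h2 h1; lra).
have -> : (g s).2 - (g 0).2 = (g 0).2 * ((g s).2 / (g 0).2 - 1) by field.
rewrite cabsM.
have h2 : 32 * (2 * x) * cabs s / T <= 4 * x.
  rewrite ler_pdivrMr//; have := ler_wpM2l (ltW x0) sT; lra.
have -> : 16 * C = cabs (g 0).2 * (4 * x) by rewrite xE; field; rewrite gt_eqF.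
by rewrite ler_wpM2l ?(ltW Y0)//; apply: le_trans h h2.
Qed.

End Leaves2.

(** [leaf_disc1] at all levels: the images of the disc under [F_k] lie in level sets of the shifted
    Green functions. *)
Lemma leaf_disc (R : realType) (q : nat -> {poly R[i]}) a C (g : R[i] -> C2 R) T s : (forall k, bnd (q k) (a k) C) ->
  0 < T -> (forall s, cabs s <= T -> [/\ cdiff2 g s, vplus (rr C) (g s) & gr q a C (g s) = gr q a C (g 0)]) ->
  cabs s <= T / 16 -> nearby q a (g s) (g 0) (16 * C).
Proof.
move=> HB T0 gh sT k; rewrite !xorbS.
apply: (@leaf_disc1 _ _ _ _ (stail_bnd k HB) (fun s => hiter q a k (g s)) T) => // s' s'T.
have [gd gV gG] := gh s' s'T; split.
- exact: cdiff2_hiter.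
- by have [] := hiter_vplus HB k (rr_ge HB) gV.
- by rewrite !gr_shift// gG.
Qed.

(** * Proportionality of two injective coordinates on an exhausted leaf *)

Section Injective.
Context {R : realType}.
Implicit Types (x r e : R) (n N : nat) (s t : R[i]).

(* A pole-free comparison of [1/K] with [1/M]: Liouville's theorem on an exhaustion by discs. *)
Lemma leaf_linear (U : Type) (sg : nat -> R[i] -> U) (K M : U -> R[i]) (T : nat -> R) (B k0 : R) :
  (forall N, 2 <= T N /\ 2 * B <= T N) ->
  (forall x, exists N0, forall N, (N0 <= N)%N -> x <= T N) ->
  (forall N t, cabs t <= T N -> cdiff (fun t => K (sg N t)) t /\ cdiff (fun t => M (sg N t)) t) ->
  (forall N, K (sg N 0) = 0) -> (forall N, M (sg N 0) = 0) ->
  (forall N t t', cabs t <= T N -> cabs t' <= T N -> K (sg N t) = K (sg N t') -> sg N t = sg N t') ->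
  (forall N t, cabs t <= T N -> cabs t / 2 <= cabs (M (sg N t))) ->
  (forall t, cabs t <= T 0%N -> cabs (M (sg 0%N t)) <= 2 * cabs t) ->
  (forall N N' t, cabs t <= T N -> (N < N')%N -> exists2 t', cabs t' <= B & sg N t = sg N' t') ->
  (forall N e, 0 < e -> exists2 d, 0 < d & forall t, cabs t < d -> exists2 t0, cabs t0 < e & sg N t = sg 0%N t0) ->
  0 < k0 -> (exists2 d, 0 < d & forall t, cabs t < d -> k0 * cabs t <= cabs (K (sg 0%N t))) ->
  exists A, forall N t, cabs t <= T N -> K (sg N t) = A * M (sg N t).
Proof.
move=> T2 Tinf KM K0 M0 Kinj Mlow Mup nest loc k00 [dk dk0 Klow].
have z0 N : cabs (0 : R[i]) <= T N by rewrite cabs0; have [] := T2 N; lra.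
have Mn N t : cabs t <= T N -> t != 0 -> M (sg N t) != 0.
  by move=> /Mlow h; rewrite -!cabs_gt0; lra.
have Kn N t : cabs t <= T N -> t != 0 -> K (sg N t) != 0.
  move=> tT t0; apply/eqP => Kt; have := Mn N t tT t0.
  by rewrite (Kinj N t 0 tT (z0 N)) ?K0 ?M0 ?eqxx.
have [[lK [phi [_ phic hphi]]] [lM [psi [_ psic hpsi]]]] := KM 0%N 0 (z0 0%N).
have phiE : \forall t \near cnb 0, K (sg 0%N t) = phi t * t.
  by move: hphi; apply: filterS => t ->; rewrite K0 add0r subr0.
have psiE : \forall t \near cnb 0, M (sg 0%N t) = psi t * t.
  by move: hpsi; apply: filterS => t ->; rewrite M0 add0r subr0.
have nz t : t != 0 -> 0 < cabs t by rewrite cabs_gt0.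
have tsmall d : 0 < d -> exists t : R[i], t != 0 /\ cabs t < d.
  move=> d0; exists (d / 2)%:C; have d2 : 0 < d / 2 by lra.
  by rewrite -cabs_gt0 !cabsR gtr0_norm//; split => //; lra.
have phi0 : phi 0 != 0.
  apply/eqP => p0; have := phic _ k00; rewrite p0 => h.
  have [d d0 hd] := (cnbP _ _).1 (filterI h (filterI phiE (cnb_ball 0 dk0))).
  have [t [t0 td]] := tsmall d d0.
  have [] := hd t; first by rewrite subr0.
  rewrite subr0 => h1 [h2 h3]; rewrite subr0 in h3; have := Klow t h3.
  by rewrite h2 cabsM leNgt ltr_pM2r ?h1// nz.
have psi0 : psi 0 != 0.
  apply/eqP => p0; have e3 : 0 < 1 / 3 :> R by lra.
  have := psic _ e3; rewrite p0 => h.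
  have T0 : 0 < T 0%N by have [] := T2 0%N; lra.
  have [d d0 hd] := (cnbP _ _).1 (filterI h (filterI psiE (cnb_ball 0 T0))).
  have [t [t0 td]] := tsmall d d0.
  have [] := hd t; first by rewrite subr0.
  rewrite subr0 => h1 [h2 h3]; rewrite subr0 in h3; have := Mlow 0%N t (ltW h3); rewrite h2 cabsM.
  have := nz t t0 => t1; have : cabs (psi t) * cabs t < 1 / 3 * cabs t by rewrite ltr_pM2r.
  (clear - t1; lra).
pose A := phi 0 / psi 0.
have A0 : A != 0 by rewrite mulf_neq0// invr_neq0.
have lim0 e : 0 < e -> exists2 d, 0 < d & forall t, t != 0 -> cabs t < d ->
    cabs (M (sg 0%N t) / K (sg 0%N t) - A^-1) < e.
  move=> e0.
  have h : clim (cnb 0) (fun t => psi t / phi t) (psi 0 / phi 0).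
    by apply: climM => //; exact: climV.
  have [d d0 hd] := (cnbP _ _).1 (filterI (h e e0) (filterI phiE psiE)).
  exists d => // t t0 td; have [|h1 [h2 h3]] := hd t; first by rewrite subr0.
  by rewrite h2 h3 -mulf_div mulfV// mulr1 /A invf_div.

(* [K] is small only near the base point: a small value at [sg N t] with [|t| > 4] would, by
   [exists_zero], also be taken at some [|t0| < 1] in the disc of level 0, and injectivity
   contradicts the two bounds on [M]. *)
have [r r0 hr] : exists2 r, 0 < r & forall N t, 4 < cabs t <= T N -> r <= cabs (K (sg N t)).
  have T1 : 1 <= T 0%N by have [] := T2 0%N; lra.
  have [m m0 hm] : exists2 m, 0 < m & forall t, 1 <= cabs t <= 1 -> cabs (K (sg 0%N t))^-1 <= m.
    apply: cbounded_annulus => t /andP[t1 t2]; apply: cdiff_ccont; apply: cdiffV.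
      by apply: Kn; [(clear - t2 T1; lra)|rewrite -cabs_gt0; (clear - t1; lra)].
    by have [] := KM 0%N t (le_trans t2 T1).
  exists (1 / (2 * m)); first by rewrite divr_gt0//; lra.
  move=> N t /andP[t4 tT]; rewrite leNgt; apply/negP => h.
  have [t0 t01 e0] : exists2 t0, cabs t0 < 1 & K (sg 0%N t0) - K (sg N t) = 0.
    apply: (@exists_zero _ _ 1 (1 / (2 * m))) => //.
    - move=> s s1; apply: cdiffB; last exact: cdiff_cst.
      by have [] := KM 0%N s (le_trans s1 T1).
    - by rewrite K0 sub0r cabsN.
    - move=> s s1; have := hm s; rewrite s1 lexx => /(_ isT); rewrite cabsV => h1.
      have Ks : 0 < cabs (K (sg 0%N s)).
        by rewrite cabs_gt0; apply: Kn; [(clear - s1 T1; lra)|rewrite -cabs_gt0; (clear - s1; lra)].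
      have : 1 / m <= cabs (K (sg 0%N s)).
        by rewrite ler_pdivrMr// mulrC -ler_pdivrMr// mul1r.
      have := cabs_dist (K (sg 0%N s)) (K (sg N t)).
      have -> : 1 / m = 1 / (2 * m) + 1 / (2 * m) by field; rewrite gt_eqF.
      (clear - h; lra).
  have [t' t'B e1] : exists2 t', cabs t' <= T N & sg 0%N t0 = sg N t'.
    case: N t4 tT h e0 => [|N] t4 tT h e0; first by exists t0 => //; (clear - tT t4 t01; lra).
    have [|t' h1 h2] := nest 0%N N.+1 t0 _ (ltn0Sn N); first (clear - t01 T1; lra).
    by exists t' => //; have [] := T2 N.+1; have := cabs_ge0 t'; (clear - h1; lra).
  have e2 : sg N t' = sg N t.
    by apply: Kinj => //; rewrite -e1; apply/eqP; rewrite -subr_eq0 e0.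
  have := Mlow N t tT; rewrite -e2 -e1; have := Mup t0 (_ : _ <= _); (clear - t01 t4 T1; lra).
(* With [A] the ratio of the slopes at 0, the simple poles of the two reciprocals cancel to leading
   order, so that [t * g N t] tends to 0. *)
pose g N t := (K (sg N t))^-1 - (A * M (sg N t))^-1.
have gd N t : 0 < cabs t <= T N -> cdiff (g N) t.
  move=> /andP[t0 tT]; rewrite cabs_gt0 in t0; have [Kd Md] := KM N t tT.
  apply: cdiffB; apply: cdiffV => //; first exact: Kn.
    by rewrite mulf_neq0// Mn.
  exact: cdiffZ.
have gsing N e : 0 < e -> exists2 d, 0 < d & forall t, 0 < cabs t < d -> cabs (t * g N t) <= e.
  move=> e0; have e2 : 0 < e / 2 by lra.
  have [d1 d10 h1] := lim0 _ e2; have [d2 d20 h2] := loc N _ d10.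
  exists (Num.min d2 (T N)).
    by rewrite lt_min d20; have [] := T2 N; (clear; lra).
  move=> t; rewrite lt_min => /andP[t0 /andP[td /ltW tT]].
  have [t1 t1d e1] := h2 t td; rewrite cabs_gt0 in t0.
  have t10 : t1 != 0.
    by apply: contra_neq (Mn N t tT t0); rewrite e1 => ->; rewrite M0.
  have h3 := ltW (h1 t1 t10 t1d); rewrite -e1 in h3.
  have M1 := Mn N t tT t0; have K1 := Kn N t tT t0.
  have -> : t * g N t = (t / M (sg N t)) * (M (sg N t) / K (sg N t) - A^-1).
    by rewrite /g; field; rewrite A0 M1 K1.
  rewrite cabsM; have : cabs (t / M (sg N t)) <= 2.
    rewrite cabsf ler_pdivrMr ?cabs_gt0//; have := Mlow N t tT; (clear; lra).
  by move=> h4; have := ler_pM (cabs_ge0 _) (cabs_ge0 _) h4 h3; (clear; lra).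
have A1 : 0 < cabs A by rewrite cabs_gt0.
have Mbig N t : cabs t = T N -> cabs (A * M (sg N t))^-1 <= 2 / (cabs A * T N).
  move=> tT; have [T1 _] := T2 N.
  have := Mlow N t; rewrite tT lexx => /(_ isT) h.
  rewrite cabsV cabsM ler_pdivlMr ?mulr_gt0//; last (clear - T1; lra).
  rewrite mulrC ler_pdivrMr ?mulr_gt0//; last (clear - h T1; lra).
  have := ler_wpM2l (ltW A1) h; (clear; lra).
have gbd N t : 4 < T N -> cabs t = T N -> cabs (g N t) <= 1 / r + 1 / cabs A.
  move=> T4 tT; apply: le_trans (cabsB _ _) _; apply: lerD.
    have h : r <= cabs (K (sg N t)) by apply: hr; rewrite tT lexx T4.
    by rewrite cabsV div1r lef_pV2 ?posrE//; (clear - h r0; lra).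
  apply: le_trans (Mbig N t tT) _; rewrite invfM mulrA ler_pdivrMr; last (clear - T4; lra).
  have T22 : 2 <= T N by clear - T4; lra.
  have A1' : 0 <= (cabs A)^-1 by rewrite invr_ge0 ltW.
  by have := ler_wpM2l A1' T22; clear; lra.
have M1 : 0 <= 1 / r + 1 / cabs A by rewrite addr_ge0// divr_ge0// ltW.
have Bbig x : exists N0, forall N, (N0 <= N)%N -> x <= T N /\ 4 < T N.
  by have [N0 h] := Tinf (Num.max x 5); exists N0 => N /h; rewrite ge_max => /andP[]; split => //; (clear - b; lra).
(* In the discs of all higher levels both points have parameters bounded by [B], while [g] is
   bounded on the boundary circles; [liouville_punctured] then gives equality. *)
have gconst N N' t t' : cabs t <= T N -> cabs t' <= T N' -> t != 0 -> t' != 0 -> g N t = g N' t'.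
  move=> tT tT' t0 t0'; apply/eqP; rewrite -subr_eq0 -cabs_eq0 eq_le cabs_ge0 andbT.
  apply/ler_addgt0Pr => e e0; rewrite add0r.
  have [N1 hN1] := Bbig (8 * (1 / r + 1 / cabs A) * (2 * B) / e).
  pose n := maxn N1 (maxn N N').+1.
  have [T1 T4] := hN1 n (leq_maxl _ _).
  have Nn : (N < n)%N by rewrite leq_max ltnS leq_maxl orbT.
  have Nn' : (N' < n)%N by rewrite leq_max ltnS leq_maxr orbT.
  have [p pB pE] := nest N n t tT Nn; have [p' pB' pE'] := nest N' n t' tT' Nn'.
  have p0 : p != 0 by apply: contra_neq (Mn N t tT t0); rewrite pE => ->; rewrite M0.
  have p0' : p' != 0 by apply: contra_neq (Mn N' t' tT' t0'); rewrite pE' => ->; rewrite M0.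
  have -> : g N t - g N' t' = g n p - g n p' by rewrite /g pE pE'.
  have [_ TB] := T2 n.
  have h := @liouville_punctured _ (g n) p p' (T n) (1 / r + 1 / cabs A).
  apply: le_trans (h _ _ _ _ _) _.
  - by rewrite cabs_gt0 p0; (clear - TB pB; lra).
  - by rewrite cabs_gt0 p0'; (clear - TB pB'; lra).
  - exact: gd.
  - exact: gsing.
  - by move=> s sT; exact: gbd.
  rewrite ler_pdivrMr; last (clear - T4; lra).
  rewrite ler_pdivrMr// in T1; apply: le_trans (le_trans _ T1) _; last by rewrite mulrC.
  by rewrite ler_wpM2l ?mulr_ge0//; have := cabsB p p'; (clear - pB' pB; lra).
have one0 : (1 : R[i]) != 0 by exact: oner_neq0.
have T01 : cabs (1 : R[i]) <= T 0%N by rewrite cabs1; have [] := T2 0%N; (clear; lra).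
pose b := g 0%N 1.
have gb N t : cabs t <= T N -> t != 0 -> g N t = b by move=> tT t0; exact: gconst.
(* If the common value [b] were nonzero, [1 / K] would be close to [b] on large circles, so [K]
   would be bounded there by [2 / |b|] and [schwarz] would make it vanish. *)
have b0 : b = 0.
  apply/eqP; apply: contraT => b0; have b1 : 0 < cabs b by rewrite cabs_gt0.
  have K1 := Kn 0%N 1 T01 one0.
  suff : cabs (K (sg 0%N 1)) <= 0 by rewrite leNgt cabs_gt0 K1.
  apply/ler_addgt0Pr => e e0; rewrite add0r.
  have [N1 hN1] := Bbig (Num.max (4 / (cabs A * cabs b)) (16 / cabs b * B / e)).
  have [] := hN1 N1.+1 (leqnSn _); rewrite ge_max => /andP[Tb Te] T4.
  have [_ TB] := T2 N1.+1.
  have [p pB pE] := nest 0%N N1.+1 1 T01 (ltn0Sn _).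
  have Tp : 0 < T N1.+1 by (clear - T4; lra).
  have h := @schwarz _ (fun t => K (sg N1.+1 t)) p 0 (T N1.+1) (2 / cabs b).
  rewrite pE -[K _]subr0 -(K0 N1.+1); apply: le_trans (h _ _ _ _ _) _ => //.
  - (clear - pB TB; lra).
  - by rewrite cabs0; (clear - Tp; lra).
  - by move=> s sT; have [] := KM N1.+1 s sT.
  - move=> s sT; have s0 : s != 0 by rewrite -cabs_gt0 sT.
    have sT' : cabs s <= T N1.+1 by rewrite sT.
    have Ks := Kn _ _ sT' s0.
    have hK : (K (sg N1.+1 s))^-1 = b + (A * M (sg N1.+1 s))^-1 by rewrite -(gb _ _ sT' s0) /g subrK.
    have h1 := Mbig _ _ sT.
    have h2 : 2 / (cabs A * T N1.+1) <= cabs b / 2.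
      rewrite ler_pdivrMr ?mulr_gt0//; move: Tb; rewrite ler_pdivrMr ?mulr_gt0//; (clear; lra).
    have h3 : cabs b / 2 <= cabs (K (sg N1.+1 s))^-1.
      rewrite hK; have := cabs_dist b (- (A * M (sg N1.+1 s))^-1); rewrite opprK cabsN; (clear - h2 h1; lra).
    rewrite cabsV in h3; rewrite ler_pdivlMr//.
    have Kp : 0 < cabs (K (sg N1.+1 s)) by rewrite cabs_gt0.
    have := ler_wpM2r (ltW Kp) h3; rewrite mulVf ?gt_eqF//; (clear; lra).
  rewrite subr0 ler_pdivrMr//; move: Te; rewrite ler_pdivrMr// => Te.
  apply: (le_trans _ (le_trans Te _)); last by rewrite mulrC.
  have -> : 8 * (2 / cabs b) * cabs p = 16 / cabs b * cabs p by ring.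
  by rewrite ler_wpM2l// divr_ge0// ltW.
exists A => N t tT; have [->|t0] := eqVneq t 0; first by rewrite K0 M0 mulr0.
have := gb N t tT t0; rewrite b0 /g => /eqP; rewrite subr_eq0 => /eqP h.
by rewrite -[LHS]invrK h invrK.
Qed.

End Injective.

Section PLip.
Context {R : realType}.
Implicit Types (z w : C2 R).

Definition plip (g : C2 R -> C2 R) z := exists K d, [/\ 0 < K, 0 < d &
  forall w, dst w z < d -> dst (g w) (g z) <= K * dst w z].

Lemma plip_comp g h z : plip g z -> plip h (g z) -> plip (h \o g) z.
Proof.
move=> [K [d [K0 d0 hg]]] [L [e [L0 e0 hh]]]; exists (L * K), (Num.min d (e / K)); split.
- exact: mulr_gt0.
- by rewrite lt_min d0 divr_gt0.
move=> w; rewrite lt_min => /andP[wd we]; have h1 := hg w wd.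
apply: le_trans (hh _ _) _; first by apply: le_lt_trans h1 _; rewrite mulrC -ltr_pdivlMr.
by rewrite -mulrA ler_wpM2l// ltW.
Qed.

Lemma plip_hiterV (q : nat -> {poly R[i]}) a C n z : (forall k, bnd (q k) (a k) C) -> plip (hiterV q a n) z.
Proof.
move=> HB; elim: n z => [|n ih] z; first by exists 1, 1; split => // w _; rewrite mul1r.
apply: (plip_comp (g := hinv q a n)) => //.
have c1 := bC (HB 0%N).
have r1 : 1 <= nrm z + 1 by rewrite lerDr nrm_ge0.
have rd : 1 <= (nrm z + 1) ^+ pdeg (q n) by rewrite exprn_ege1.
exists (C * (C * (nrm z + 1) ^+ pdeg (q n) + 1)), 1; split => //.
  by apply: mulr_gt0; [lra|apply: ltr_wpDl => //; apply: mulr_ge0; lra].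
move=> w wz; apply: (hinv_lip HB n r1); have := nrm_dst w z; lra.
Qed.

End PLip.

Section Generic.
Context {R : realType}.
Implicit Types (z w P : C2 R) (r x y e : R) (n k j N : nat) (s t : R[i]).
Variables (q : nat -> {poly R[i]}) (a : nat -> R[i]) (C : R).
Hypothesis HB : forall k, bnd (q k) (a k) C.
Notation F := (hiter q a).
Notation Fi := (hiterV q a).
Notation G := (gr q a C).
Notation X := (xorb q a).
Notation qs n := (stail n q).
Notation as_ n := (stail n a).

Lemma nearby_gr P Q r : nearby q a P Q r -> G P = G Q.
Proof.
move=> nP; have [N hN] := eventually_good_pt HB Q.
apply: (@gr_uniq _ _ _ _ HB _ (r + cgr C) _ N.+1) => -[|n]// Nn.
have d1 : dst (F n.+1 P) (F n.+1 Q) <= r by rewrite dst_le (nP n) (nP n.+1).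
have := grP HB (hN n.+1 (leq_trans (leqnSn _) Nn)).
have := lg_dst (F n.+1 P) (F n.+1 Q); have := lg_dst (F n.+1 Q) (F n.+1 P); rewrite (dstC (F _ Q)).
rewrite !ler_norml => h1 h2 /andP[h3 h4]; apply/andP; split; lra.
Qed.

Lemma xorbD P n k : X P (n + k) = xorb (qs n) (as_ n) (F n P) k.
Proof. by rewrite /xorb hiterD. Qed.

Lemma rho_ge3 : 3 * C ^+ 2 <= rho C. Proof. by have [*] := Cpow HB; rewrite /rho; lra. Qed.
Lemma rho_ge16 : 16 * C <= rho C. Proof. by have [*] := Cpow HB; rewrite /rho; lra. Qed.

Lemma vplus_tail P n k : vplus (rr C) (F n P) -> (n <= k)%N -> vplus (rr C) (F k P).
Proof. by move=> h nk; exact: (hiter_vplus_from HB (rr_ge HB) nk h). Qed.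

Lemma tauD Q n k : tau q a Q (n + k) = tau q a Q n * tau (qs n) (as_ n) (F n Q) k.
Proof.
elim: k => [|k ih]; first by rewrite addn0 [X in _ = _ * X]/tau big_nil mulr1.
have e : X Q (n + k).+1 = xorb (qs n) (as_ n) (F n Q) k.+1 by rewrite -xorbD addnS.
by rewrite addnS !tauS ih -mulrA /wt e.
Qed.

(** By [tauD] the products [tau] are multiplicative along the orbit, so a later starting level only
    rescales the coordinate by a constant. *)
Lemma dlt_shift P Q j : vplus (rr C) Q ->
  nearby (qs j) (as_ j) (F j P) (F j Q) (rho C) ->
  dlt q a Q P = dlt (qs j) (as_ j) (F j Q) (F j P) / tau q a Q j.
Proof.
move=> VQ nP; have VF : vplus (rr C) (F j Q) by have [] := hiter_vplus HB j (rr_ge HB) VQ.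
have h := dlt_lim (stail_bnd j HB) VF nP.
have h2 : clim \oo (lratio q a Q P Q) (dlt (qs j) (as_ j) (F j Q) (F j P) / tau q a Q j).
  have h3 : clim \oo (fun k => lratio (qs j) (as_ j) (F j Q) (F j P) (F j Q) k / tau q a Q j)
      (dlt (qs j) (as_ j) (F j Q) (F j P) / tau q a Q j).
    by apply: climM => //; exact: clim_cst.
  apply/clim_ooP => e e0; have [N hN] := (clim_ooP _ _).1 h3 e e0.
  exists (j + N)%N => n jn; have := hN (n - j)%N; rewrite leq_subRL ?(leq_trans (leq_addr _ _) jn)// => /(_ jn).
  rewrite /lratio -!xorbD subnKC ?(leq_trans (leq_addr _ _) jn)//.
  have tE : tau q a Q n = tau q a Q j * tau (qs j) (as_ j) (F j Q) (n - j).
    by rewrite -tauD subnKC// (leq_trans (leq_addr _ _) jn).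
  by rewrite tE invfM (mulrC (tau q a Q j)^-1) mulrA.
rewrite {1}/dlt; case: xgetP => [l _ hl|hl]; first exact: (clim_unique _ hl h2).
by exfalso; apply: (hl _ h2).
Qed.

Lemma tau_le1 Q n : vplus (rr C) Q -> cabs (tau q a Q n) <= 2^-1 ^+ n.
Proof.
move=> VQ; have [c1 *] := Cpow HB; elim: n => [|n ih]; first by rewrite /tau big_nil cabs1.
rewrite tauS cabsM exprSr; apply: ler_pM => //.
have w := wt_low2 HB VQ n; have w0 : 0 < cabs (wt q a Q n) by lra.
rewrite cabsf ler_pdivrMr//; have := ba (HB n); lra.
Qed.

End Generic.

(** * Automorphisms along leaves *)

Section Affine.
Context {R : realType}.
Implicit Types (z P : C2 R) (r x e : R) (n k j N : nat) (s t : R[i]).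
Variables (q : nat -> {poly R[i]}) (a : nat -> R[i]) (C : R).
Hypothesis HB : forall k, bnd (q k) (a k) C.
Notation F := (hiter q a).
Notation Fi := (hiterV q a).
Notation G := (gr q a C).
Notation X := (xorb q a).
Notation qs n := (stail n q).
Notation as_ n := (stail n a).

(* A common automorphism of the filled sets [G < c], with inverse [f']. *)
Variables (c : R) (f f' : C2 R -> C2 R).
Hypothesis fh : hol [set z | G z < c] f.
Hypothesis fh' : hol [set z | G z < c] f'.
Hypothesis fG : forall z, G z < c -> G (f z) = G z.
Hypothesis fK : forall z, G z < c -> f' (f z) = z.

Section Base.
Variables (Q : C2 R) (n0 : nat).
Hypothesis VQ : vplus (rr C) Q.
Hypothesis Gc : G Q < c.
Hypothesis Vf : vplus (rr C) (F n0 (f Q)).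

(** The leaf coordinate of [f P] relative to [f Q], taken at a level [n0] where the orbit of [f Q]
    has entered [V+]. *)
Definition Kf P : R[i] := dlt (qs n0) (as_ n0) (F n0 (f Q)) (F n0 (f P)).

Lemma base_tail0 n : vplus (rr C) (F n Q).
Proof. by have [] := hiter_vplus HB n (rr_ge HB) VQ. Qed.

Lemma gr_base_gt0 : 0 < G Q.
Proof.
rewrite lt_neqAle gr_ge0// andbT eq_sym; apply/eqP => g0.
have [B hB] := gr0_bounded HB g0.
have [*] := Cpow HB.
have [M2 hM2] : exists M2 : nat, `|B| < M2%:R by exists (Num.bound `|B|); exact: archi_boundP.
have f4 := far_growth HB VQ M2; have f5 := nrm1 (F M2.+1 Q); have f6 := hB M2.+1.
have f7 : (M2%:R : R) < 2 ^+ M2 by rewrite -natrX ltr_nat ltn_expl.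
have r1 : 1 <= rr C by rewrite /rr; lra.
have f8 : 2 ^+ M2 * 1 <= 2 ^+ M2 * rr C by rewrite ler_wpM2l// exprn_ge0.
have f9 := ler_norm B.
rewrite /xorb in f4; lra.
Qed.

(** Discs exhausting the leaf of [Q]: the graph of [leaf_graph] at level [N], pulled back by
    [F_N]. *)
Lemma sg_exists : exists sg : nat -> R[i] -> C2 R, forall N,
  (forall t, cabs t <= cabs (X Q N.+1) -> (F N (sg N t)).1 = X Q N + t /\
     nearby (qs N) (as_ N) (F N (sg N t)) (F N Q) (3 * C ^+ 2)) /\
  (forall t, cabs t < cabs (X Q N.+1) -> cdiff2 (sg N) t).
Proof.
have /choice[gm hgm] : forall N, exists g : R[i] -> C2 R,
    (forall t, cabs t <= cabs (X Q N.+1) -> (g t).1 = X Q N + t /\ nearby (qs N) (as_ N) (g t) (F N Q) (3 * C ^+ 2)) /\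
    (forall t, cabs t < cabs (X Q N.+1) -> cdiff2 g t).
  by move=> N; have := leaf_graph (stail_bnd N HB) (base_tail0 N).
exists (fun N t => Fi N (gm N t)) => N; have [h1 h2] := hgm N; split => t tQ.
  by rewrite (hiterVK HB); exact: h1.
exact: (cdiff2_hiterV q a N (h2 t tQ)).
Qed.

Lemma sg_uniq N P P' : nearby (qs N) (as_ N) (F N P) (F N Q) (rho C) ->
  nearby (qs N) (as_ N) (F N P') (F N Q) (rho C) -> X P N = X P' N -> P = P'.
Proof.
move=> nP nP' e; have := leaf_eq (stail_bnd N HB) (base_tail0 N) nP nP' e.
by move=> /(congr1 (Fi N)); rewrite !(hiterK HB).
Qed.

Lemma nearby_grN N P r : nearby (qs N) (as_ N) (F N P) (F N Q) r -> G P = G Q.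
Proof.
have D0 := hdegR_gt0 HB N.
by move=> /(nearby_gr (stail_bnd N HB)); rewrite !gr_shift// => /(mulfI (lt0r_neq0 D0)).
Qed.

(** As [f] keeps [G], a disc of the leaf is sent into a level set. [curve_vplus] finds a level where
    the image lies in [V+], and [leaf_disc] puts it in the leaf of [f Q]; up to the factor [l], [Kf]
    is then the leaf coordinate of that level. *)
Lemma Kf_level N (g : R[i] -> C2 R) T : 0 < T -> g 0 = Q ->
  (forall t, cabs t <= T -> cdiff2 g t /\ nearby (qs N) (as_ N) (F N (g t)) (F N Q) (rho C)) ->
  exists j l, [/\ (n0 <= j)%N, l != 0 & forall t, cabs t <= T / 16 ->
    nearby (qs j) (as_ j) (F j (f (g t))) (F j (f Q)) (rho C) /\
    Kf (g t) = dlt (qs j) (as_ j) (F j (f Q)) (F j (f (g t))) / l].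
Proof.
move=> T0 gQ gh.
have gG t : cabs t <= T -> G (g t) = G Q by move=> /gh[_]; exact: nearby_grN.
have fgG t : cabs t <= T -> G (f (g t)) = G Q by move=> tT; rewrite fG gG.
have fgd t : cabs t <= T -> cdiff2 (fun t => f (g t)) t.
  by move=> tT; apply: (hol_curve fh); [have [] := gh t tT|rewrite /= gG].
have [M hM] := @curve_vplus _ _ _ _ HB (fun t => f (g t)) T (rr C)
  (fun t tT => conj (fgd t tT) (eq_ind_r (fun x => 0 < x) gr_base_gt0 (fgG t tT))).
pose j := maxn n0 M.
have n0j : (n0 <= j)%N := leq_maxl _ _.
exists j, (tau (qs n0) (as_ n0) (F n0 (f Q)) (j - n0)); split => //.
  exact: (tau_neq0 (stail_bnd n0 HB) Vf).
move=> t tT.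
have nb : nearby (qs j) (as_ j) (F j (f (g t))) (F j (f Q)) (rho C).
  suff : nearby (qs j) (as_ j) (F j (f (g t))) (F j (f (g 0))) (rho C) by rewrite gQ.
  move=> k; apply: (le_trans _ (rho_ge16 HB)).
  apply: (@leaf_disc _ _ _ C (fun t => F j (f (g t))) T t (stail_bnd j HB)) => // s sT; split.
  - exact: (cdiff2_hiter q a j (fgd s sT)).
  - by apply: hM => //; exact: leq_maxr.
  - by rewrite !gr_shift// !fgG// cabs0 ltW.
split => //; rewrite /Kf.
have ej : (n0 + (j - n0))%N = j by rewrite subnKC.
have st (T' : Type) (u : nat -> T') : stail (j - n0) (stail n0 u) = stail j u.
  by apply/funext => k; rewrite /stail addnA ej.
have := @dlt_shift _ _ _ _ (stail_bnd n0 HB) (F n0 (f (g t))) (F n0 (f Q)) (j - n0) Vf.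
by rewrite !st -!hiterD ej; apply.
Qed.

End Base.
End Affine.

Section Affine2.
Context {R : realType}.
Implicit Types (z P : C2 R) (r x y e : R) (n k j N : nat) (s t : R[i]).
Variables (q : nat -> {poly R[i]}) (a : nat -> R[i]) (C : R).
Hypothesis HB : forall k, bnd (q k) (a k) C.
Notation F := (hiter q a).
Notation Fi := (hiterV q a).
Notation G := (gr q a C).
Notation X := (xorb q a).
Notation qs n := (stail n q).
Notation as_ n := (stail n a).
Variables (c : R) (f f' : C2 R -> C2 R).
Hypothesis fh : hol [set z | G z < c] f.
Hypothesis fh' : hol [set z | G z < c] f'.
Hypothesis fG : forall z, G z < c -> G (f z) = G z.
Hypothesis fK : forall z, G z < c -> f' (f z) = z.

Lemma cdiff_eqon (g h : R[i] -> R[i]) T s : (forall s, cabs s < T -> g s = h s) -> cabs s < T -> cdiff h s -> cdiff g s.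
Proof.
move=> gh sT; apply: cdiff_near; have [e e0 he] := cabs_open_lt sT.
by apply/cnbP; exists e => // s' /he/gh.
Qed.

Section Base.
Variables (Q : C2 R) (n0 : nat).
Hypothesis VQ : vplus (rr C) Q.
Hypothesis Gc : G Q < c.
Hypothesis Vf : vplus (rr C) (F n0 (f Q)).
Notation Kf := (Kf q a f Q n0).

Lemma base_tail n : vplus (rr C) (F n Q).
Proof. by have [] := hiter_vplus HB n (rr_ge HB) VQ. Qed.

Lemma image_tail n : (n0 <= n)%N -> vplus (rr C) (F n (f Q)).
Proof. by move=> h; exact: (vplus_tail HB Vf h). Qed.

Lemma dlt_level N P : nearby (qs N) (as_ N) (F N P) (F N Q) (rho C) ->
  [/\ dlt q a Q P = dlt (qs N) (as_ N) (F N Q) (F N P) / tau q a Q N,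
   cabs (X P N - X Q N) * (3 / 4) <= cabs (tau q a Q N) * cabs (dlt q a Q P) &
   cabs (tau q a Q N) * cabs (dlt q a Q P) <= cabs (X P N - X Q N) * (5 / 4)].
Proof.
move=> nP; have E := dlt_shift HB VQ nP; split => //; rewrite E -cabsM (mulrC (tau _ _ _ _)) divfK ?(tau_neq0 HB VQ)//.
  have := dlt_one (stail_bnd N HB) (base_tail N) nP; rewrite -/(X P N) -/(X Q N).
  have := cabs_dist (X P N - X Q N) (dlt (qs N) (as_ N) (F N Q) (F N P)).
  rewrite (cabsC (X P N - X Q N)); lra.
have := dlt_one (stail_bnd N HB) (base_tail N) nP; rewrite -/(X P N) -/(X Q N).
have := cabs_dist (dlt (qs N) (as_ N) (F N Q) (F N P)) (X P N - X Q N); lra.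
Qed.

Lemma close_levels (g : R[i] -> C2 R) n e : (forall e, 0 < e -> exists2 d, 0 < d & forall t, cabs t < d -> dst (g t) Q < e) ->
  0 < e -> exists2 d, 0 < d & forall t, cabs t < d -> forall k, (k <= n)%N -> dst (F k (g t)) (F k Q) < e.
Proof.
move=> gc e0.
have lev k : exists2 d, 0 < d & forall t, cabs t < d -> dst (F k (g t)) (F k Q) < e.
  have [L L1 hL] := hiter_lip HB k (nrm Q + 1).
  have L0 : 0 < L by lra.
  have [|d d0 hd] := gc (Num.min 1 (e / L)); first by rewrite lt_min ltr01 divr_gt0.
  exists d => // t /hd; rewrite lt_min => /andP[h1 h2].
  apply: le_lt_trans (hL _ _ _ _) _; last by rewrite mulrC -ltr_pdivlMr.
    by have := nrm_dst (g t) Q; lra.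
  by lra.
elim: n => [|n [d d0 hd]].
  by have [d d0 hd] := lev 0%N; exists d => // t /hd h [|k].
have [d1 d10 hd1] := lev n.+1; exists (Num.min d d1); first by rewrite lt_min d0.
move=> t; rewrite lt_min => /andP[/hd h /hd1 h1] k.
by rewrite leq_eqVlt => /orP[/eqP ->//|]; rewrite ltnS; exact: h.
Qed.

(** [leaf_linear] for [Kf] and [dlt]. Injectivity of [Kf] comes from the inverse [f'], and its lower
    bound near [Q] from the pointwise Lipschitz bound of [f' o F_j^-1]. *)
Lemma Kf_affine : exists A, forall N P, nearby (qs N) (as_ N) (F N P) (F N Q) (rho C) ->
  cabs (X P N - X Q N) <= cabs (X Q N.+1) / 64 -> Kf P = A * dlt q a Q P.
Proof.
have [c1 c2 c3 c4 c5] := Cpow HB.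
have [sg hsg] := sg_exists HB VQ.
have XN N : (50 * 40) * C ^+ 5 <= cabs (X Q N.+1) := far HB VQ N.
have XN0 N : 0 < cabs (X Q N.+1) by have := XN N; lra.
have sgn N t : cabs t <= cabs (X Q N.+1) -> nearby (qs N) (as_ N) (F N (sg N t)) (F N Q) (rho C).
  by move=> tX k; have [h _] := hsg N; apply: (le_trans _ (rho_ge3 HB)); exact: (h t tX).2.
have sgX N t : cabs t <= cabs (X Q N.+1) -> X (sg N t) N = X Q N + t by move=> tX; have [h _] := hsg N; exact: (h t tX).1.
have QQ N : nearby (qs N) (as_ N) (F N Q) (F N Q) (rho C) by move=> k; rewrite subrr cabs0 (rho_ge0 HB).
have sgP N P t : cabs t <= cabs (X Q N.+1) -> nearby (qs N) (as_ N) (F N P) (F N Q) (rho C) -> X P N = X Q N + t -> P = sg N t.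
  by move=> tX nP e; apply: (sg_uniq HB VQ nP (sgn N t tX)); rewrite sgX.
have sg0 N : sg N 0 = Q by apply/esym/sgP; rewrite ?cabs0 ?addr0// ltW.
have sgd N t : cabs t < cabs (X Q N.+1) -> cdiff2 (sg N) t by have [_ h] := hsg N; exact: h.
have lev N : exists j l, [/\ (n0 <= j)%N, l != 0 & forall t, cabs t <= cabs (X Q N.+1) / 32 ->
    nearby (qs j) (as_ j) (F j (f (sg N t))) (F j (f Q)) (rho C) /\
    Kf (sg N t) = dlt (qs j) (as_ j) (F j (f Q)) (F j (f (sg N t))) / l].
  have X2 : 0 < cabs (X Q N.+1) / 2 by rewrite divr_gt0.
  have [|j [l [h1 h2 h3]]] := @Kf_level _ _ _ _ HB c f fh fG Q n0 VQ Gc Vf N (sg N) _ X2 (sg0 N).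
    move=> t tX; have tX' : cabs t < cabs (X Q N.+1) by have := XN0 N; lra.
    by split; [exact: sgd|apply: sgn; exact: ltW].
  exists j, l; split => // t tX; apply: h3; lra.
have sgG N t : cabs t <= cabs (X Q N.+1) -> G (sg N t) < c.
  by move=> tX; rewrite (nearby_grN HB (sgn N t tX)).
have sub64 N t : cabs t <= cabs (X Q N.+1) / 64 -> [/\ cabs t < cabs (X Q N.+1) / 32, cabs t <= cabs (X Q N.+1) / 32 & cabs t <= cabs (X Q N.+1)].
  by have := XN0 N; move=> h h1; split; (clear - HB fh fh' fG fK VQ Gc Vf h1 h; lra).
have loc N e : 0 < e -> exists2 d, 0 < d & forall t, cabs t < d -> exists2 t0, cabs t0 < e & sg N t = sg 0%N t0.
  move=> e0; have r0 : 0 < rho C by rewrite /rho; lra.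
  have gc e' : 0 < e' -> exists2 d, 0 < d & forall t, cabs t < d -> dst (sg N t) Q < e'.
    move=> e'0; have [|d d0 hd] := cdiff2_cont (sgd N 0 _) e'0; first by rewrite cabs0.
    by exists d => // t td; have := hd t; rewrite subr0 sg0; apply.
  have m0 : 0 < Num.min e (Num.min (rho C) (cabs (X Q 1))) by rewrite !lt_min e0 r0 XN0.
  have [d d0 hd] := close_levels N gc m0.
  exists (Num.min d (cabs (X Q N.+1))); first by rewrite lt_min d0 XN0.
  move=> t; rewrite lt_min => /andP[/hd h /ltW tX].
  have hk k : (k <= N)%N -> dst (F k (sg N t)) (F k Q) < rho C.
    by move=> /h; rewrite !lt_min => /and3P[].
  have := h 0%N isT; rewrite !lt_min => /and3P[h0 _ h1].
  have d1 := dst1 (F 0 (sg N t)) (F 0 Q).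
  exists (X (sg N t) 0%N - X Q 0%N); first exact: le_lt_trans d1 h0.
  apply: sgP; first exact: le_trans d1 (ltW h1); last by rewrite addrC subrK.
  move=> k; have [kN|Nk] := leqP k.+1 N; first exact: le_trans (dst1 _ _) (ltW (hk _ kN)).
  have := sgn N t tX (k - N)%N; rewrite -!xorbD -subSn ?subnKC//; exact: leqW.
have Mlow N t : cabs t <= cabs (X Q N.+1) / 64 -> cabs t / 2 <= cabs (dlt q a Q (sg N t)).
  move=> /sub64[_ _ tX]; have [_ h1 _] := dlt_level (sgn N t tX).
  rewrite sgX// addrAC subrr add0r in h1.
  have t1 : cabs (tau q a Q N) <= 1.
    apply: le_trans (tau_le1 HB N VQ) _; rewrite exprn_ile1//; lra.
  have := ler_wpM2r (cabs_ge0 (dlt q a Q (sg N t))) t1; have := cabs_ge0 t; lra.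
have Mup t : cabs t <= cabs (X Q 1) / 64 -> cabs (dlt q a Q (sg 0%N t)) <= 2 * cabs t.
  move=> /sub64[_ _ tX]; have [_ _] := dlt_level (sgn 0%N t tX).
  rewrite sgX// addrAC subrr add0r /tau big_nil cabs1; have := cabs_ge0 t; (clear - HB fh fh' fG fK VQ Gc Vf; lra).
have [k0 k00 Klow] : exists2 k0, 0 < k0 & (exists2 d, 0 < d & forall t, cabs t < d -> k0 * cabs t <= cabs (Kf (sg 0%N t))).
  have [j [l [jn l0 hl]]] := lev 0%N.
  have pl : plip (f' \o Fi j) (F j (f Q)).
    apply: plip_comp; first exact: (plip_hiterV j _ HB).
    rewrite (hiterK HB); have [|K [d h]] := hol_lip fh' (z := f Q); first by rewrite /= fG.
    by exists K, d.
  have [K [d [K0 d0 hK]]] := pl.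
  have [d1 d10 hd1] : exists2 d1, 0 < d1 & forall t, cabs t < d1 -> dst (F j (f (sg 0%N t))) (F j (f Q)) < d.
    have z0 : cabs (0 : R[i]) < cabs (X Q 1) by rewrite cabs0.
    have G0 : [set z | G z < c] (sg 0%N 0) by rewrite /= sg0.
    have [d1 d10 hd1] := cdiff2_cont (cdiff2_hiter q a j (hol_curve fh (sgd 0%N 0 z0) G0)) d0.
    by exists d1 => // t td; have := hd1 t; rewrite subr0 sg0; apply.
  exists (1 / (2 * (K * cabs l))).
    by rewrite divr_gt0// !mulr_gt0// cabs_gt0.
  exists (Num.min d1 (cabs (X Q 1) / 64)); first by rewrite lt_min d10 divr_gt0.
  move=> t; rewrite lt_min => /andP[/hd1 td /ltW/sub64[_ t32 tX]].
  have [nb KE] := hl t t32.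
  have h1 := hK _ td; rewrite /= !(hiterK HB) !fK ?sgG// in h1.
  have h2 : cabs t <= dst (sg 0%N t) Q.
    apply: le_trans (dst1 _ _); have := sgX 0%N t tX; rewrite /xorb /= => ->.
    by rewrite addrAC subrr add0r.
  have h3 : dst (F j (f (sg 0%N t))) (F j (f Q)) <= 4 / 3 * cabs (dlt (qs j) (as_ j) (F j (f Q)) (F j (f (sg 0%N t)))).
    have := dlt_one (stail_bnd j HB) (image_tail jn) nb.
    set y := F j (f (sg 0%N t)); set y0 := F j (f Q) => h4.
    have h5 : cabs (y.1 - y0.1) <= 4 / 3 * cabs (dlt (qs j) (as_ j) y0 y).
      have := cabs_dist (y.1 - y0.1) (dlt (qs j) (as_ j) y0 y).
      rewrite (cabsC (y.1 - y0.1)); (clear - HB fh fh' fG fK VQ Gc Vf h4; lra).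
    rewrite dst_le h5 /=; apply: (le_trans _ h5).
    have QQ' : nearby (qs j) (as_ j) y0 y0 (rho C) by move=> k; rewrite subrr cabs0 (rho_ge0 HB).
    have h6 := leaf_small (stail_bnd j HB) (image_tail jn) 0 nb QQ'.
    have h7 := far (stail_bnd j HB) (image_tail jn) 0%N.
    have e0 := cabs_ge0 (y.1 - y0.1); have e1 := cabs_ge0 (y.2 - y0.2).
    have r2 : 2 * C ^+ 2 <= cabs y0.2 by apply: le_trans h7; rewrite /rr; (clear - HB fh fh' fG fK VQ Gc Vf c5 c4 c3 c2 c1; lra).
    have r3 : 0 < 2 * C ^+ 2 by (clear - HB fh fh' fG fK VQ Gc Vf c2 c1; lra).
    rewrite -(ler_pM2l r3); apply: le_trans h6; rewrite mulrC; exact: ler_wpM2l.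
  rewrite KE cabsf.
  set v := cabs (dlt _ _ _ _) in h3 *.
  have l1 : 0 < cabs l by rewrite cabs_gt0.
  rewrite ler_pdivlMr//.
  have -> : 1 / (2 * (K * cabs l)) * cabs t * cabs l = cabs t / (2 * K) by field; rewrite !gt_eqF.
  rewrite ler_pdivrMr ?mulr_gt0//.
  have := ler_wpM2l (ltW K0) h3; have := mulr_ge0 (ltW K0) (cabs_ge0 (dlt (qs j) (as_ j) (F j (f Q)) (F j (f (sg 0%N t))))); rewrite -/v.
  (clear - HB fh fh' fG fK VQ Gc Vf h2 h1; lra).
(* [Kf_level] leaves the radius [|x_(N+1)| / 32], and half of it keeps the closed discs in the
   interior. [3 C^2] is the bound of [leaf_graph] for a point of a lower disc seen at a higher
   level. *)
have [|||||||A hA] := @leaf_linear _ _ sg Kf (dlt q a Q) (fun N => cabs (X Q N.+1) / 64) (3 * C ^+ 2) k0 _ _ _ _ _ _ Mlow Mup _ loc k00 Klow.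
- by move=> N; have := XN N; split; (clear - HB fh fh' fG fK VQ Gc Vf H c5 c4 c3 c2 c1; lra).
- move=> x; exists (Num.bound `|x|) => N hN.
  have := far_growth HB VQ N.
  have : (N%:R : R) < 2 ^+ N by rewrite -natrX ltr_nat ltn_expl.
  have : (Num.bound `|x|)%:R <= N%:R :> R by rewrite ler_nat.
  have : `|x| < (Num.bound `|x|)%:R by exact: archi_boundP.
  have := ler_norm x.
  have r64 : 64 <= rr C by rewrite /rr; (clear - HB fh fh' fG fK VQ Gc Vf c5 c4 c3 c2 c1; lra).
  have : 2 ^+ N * 64 <= 2 ^+ N * rr C by rewrite ler_wpM2l// exprn_ge0.
  (clear - HB fh fh' fG fK VQ Gc Vf; lra).
- move=> N t /sub64[t32 _ tX]; have [j [l [jn l0 hl]]] := lev N; split.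
    apply: (@cdiff_eqon _ (fun t => dlt (qs j) (as_ j) (F j (f Q)) (F j (f (sg N t))) / l) _ _ _ t32).
      by move=> s /ltW/hl[].
    apply: cdiffM; last exact: cdiff_cst.
    apply: (dlt_cdiff (stail_bnd j HB) (image_tail jn) _ t32) => s s32; split; last by have [] := hl s s32.
    have sX : cabs s < cabs (X Q N.+1) by have := XN0 N; (clear - HB fh fh' fG fK VQ Gc Vf s32; lra).
    apply: cdiff2_hiter; apply: (hol_curve fh); first exact: sgd.
    by apply: sgG; exact: ltW.
  apply: (@cdiff_eqon _ (fun t => dlt (qs N) (as_ N) (F N Q) (F N (sg N t)) / tau q a Q N) _ _ _ t32).
    move=> s s32; have sX : cabs s <= cabs (X Q N.+1) by have := XN0 N; (clear - HB fh fh' fG fK VQ Gc Vf s32; lra).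
    by have [] := dlt_level (sgn N s sX).
  apply: cdiffM; last exact: cdiff_cst.
  apply: (dlt_cdiff (stail_bnd N HB) (base_tail N) _ t32) => s s32.
  have sX : cabs s < cabs (X Q N.+1) by have := XN0 N; (clear - HB fh fh' fG fK VQ Gc Vf s32; lra).
  by split; [apply: cdiff2_hiter; exact: sgd|apply: sgn; exact: ltW].
- move=> N; have [j [l [jn l0 hl]]] := lev N; have [|_ ->] := hl 0.
    by rewrite cabs0; have := XN0 N; (clear - HB fh fh' fG fK VQ Gc Vf; lra).
  by rewrite sg0 (dlt_base (stail_bnd j HB) (image_tail jn)) mul0r.
- by move=> N; rewrite sg0 (dlt_base HB VQ).
- move=> N t t' /sub64[_ t32 tX] /sub64[_ t32' tX']; have [j [l [jn l0 hl]]] := lev N.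
  have [n1 ->] := hl t t32; have [n2 ->] := hl t' t32'.
  move=> /(mulIf (invr_neq0 l0)) /(dlt_inj (stail_bnd j HB) (image_tail jn) n1 n2).
  by move=> /(congr1 (Fi j)); rewrite !(hiterK HB) => /(congr1 f'); rewrite !fK ?sgG.
- move=> N N' t /sub64[_ _ tX] NN'.
  have [h _] := hsg N; have [_ nP] := h t tX.
  have e : (N + (N' - N).-1.+1)%N = N' by rewrite prednK ?subn_gt0// subnKC// ltnW.
  have tB : cabs (X (sg N t) N' - X Q N') <= 3 * C ^+ 2 by have := nP (N' - N).-1; rewrite -!xorbD e.
  exists (X (sg N t) N' - X Q N') => //.
  apply: sgP; last by rewrite addrC subrK.
    by apply: le_trans tB _; have := XN N'; (clear - HB fh fh' fG fK VQ Gc Vf c5 c4 c3 c2 c1; lra).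
  move=> k; have := sgn N t tX (N' - N + k)%N; rewrite -!xorbD.
  by rewrite -addnS addnA subnKC// ltnW.
exists A => N P nP tX.
have tX' : cabs (X P N - X Q N) <= cabs (X Q N.+1) by have := XN0 N; (clear - HB fh fh' fG fK VQ Gc Vf tX; lra).
rewrite (sgP N P (X P N - X Q N) tX' nP); last by rewrite addrC subrK.
exact: hA.
Qed.

End Base.
End Affine2.

(** * Orbits with the same value of the Green function *)

Section Compare.
Context {R : realType}.
Implicit Types (z w P Q : C2 R) (r x y e : R) (n k j N : nat) (s t : R[i]).

Lemma wt_cmp (q : nat -> {poly R[i]}) a C P Q k : (forall k, bnd (q k) (a k) C) ->
  vplus (rr C) P -> vplus (rr C) Q -> gr q a C P = gr q a C Q ->
  cabs (wt q a Q k) <= expR (2^-1 ^+ k) * cabs (wt q a P k).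
Proof.
move=> HB VP VQ GPQ; have [c1 c2 c3 c4 c5] := Cpow HB.
have [h0 _] := @half_expn R k.
have fP := far_growth HB VP k; have fQ := far_growth HB VQ k.
have [VFP _] := hiter_vplus HB k (rr_ge HB) VP; have [VFQ _] := hiter_vplus HB k (rr_ge HB) VQ.
have k0 : 0 < 2 ^+ k :> R by rewrite exprn_gt0.
have r0 : 0 < rr C by rewrite /rr; lra.
have m0 : 0 < 2 ^+ k * rr C by rewrite mulr_gt0.
have Cm : C <= 2 ^+ k * rr C.
  have : 1 * rr C <= 2 ^+ k * rr C by rewrite ler_wpM2r ?(ltW r0)// exprn_ege1// ler1n.
  by have := rr_ge HB; lra.
have l1 : `|ln (cabs (xorb q a P k.+1)) - ln (cabs (xorb q a Q k.+1))| <= 2 * C / (2 ^+ k * rr C).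
  by apply: (leaf_ln (stail_bnd k HB) VFP VFQ) => //; rewrite !gr_shift// GPQ.
have le_inv u : 2 ^+ k * rr C <= u -> C / u <= C / (2 ^+ k * rr C).
  by move=> hu; rewrite ler_wpM2l ?lef_pV2 ?posrE//; lra.
have dP := le_trans (bdlog (HB k) (le_trans Cm fP)) (le_inv _ fP).
have dQ := le_trans (bdlog (HB k) (le_trans Cm fQ)) (le_inv _ fQ).
have wP : 0 < cabs (wt q a P k) by rewrite cabs_gt0 (wt_neq0 HB VP).
have wQ : 0 < cabs (wt q a Q k) by rewrite cabs_gt0 (wt_neq0 HB VQ).
have E2 : 2^-1 ^+ k = 1 / 2 ^+ k :> R by rewrite exprVn div1r.
have dC : (pdeg (q k)).-1%:R <= C.
  by apply: le_trans (bdegC (HB k)); rewrite ler_nat leq_pred.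
have [dl dlE] : exists dl, dl = ln (cabs (xorb q a P k.+1)) - ln (cabs (xorb q a Q k.+1)) by eexists.
have l2 : `|(pdeg (q k)).-1%:R * dl| <= C * (2 * C / (2 ^+ k * rr C)).
  by rewrite normrM ger0_norm//; apply: ler_pM => //; rewrite dlE.
have key : ln (cabs (wt q a Q k)) <= 2^-1 ^+ k + ln (cabs (wt q a P k)).
  have tot : 2 * (C / (2 ^+ k * rr C)) + C * (2 * C / (2 ^+ k * rr C)) <= 2^-1 ^+ k.
    have -> : 2 * (C / (2 ^+ k * rr C)) + C * (2 * C / (2 ^+ k * rr C)) = (2 * C + 2 * C ^+ 2) / rr C * (1 / 2 ^+ k).
      by field; rewrite !gt_eqF.
    rewrite E2 ler_piMl ?divr_ge0 ?(ltW k0)// ler_pdivrMr// /rr; (clear - c5 c4 c3 c2 c1; lra).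
  move: dP dQ l2; rewrite -/(wt q a P k) -/(wt q a Q k) !ler_norml => /andP[p1 p2] /andP[q1 q2] /andP[u1 u2].
  have e : (pdeg (q k)).-1%:R * dl = (pdeg (q k)).-1%:R * ln (cabs (xorb q a P k.+1)) - (pdeg (q k)).-1%:R * ln (cabs (xorb q a Q k.+1)).
    by rewrite dlE mulrBr.
  rewrite e in u1 u2; clear - p1 p2 q1 q2 u1 u2 tot; lra.
rewrite -[leLHS]lnK ?posrE//; have -> : cabs (wt q a P k) = expR (ln (cabs (wt q a P k))) by rewrite lnK.
by rewrite -expRD ler_expR.
Qed.

(** The logarithmic errors [2^-k] of [wt_cmp], which come from [leaf_ln], sum to at most 2. So the
    contraction rate of an orbit in [V+] depends only on [G], up to a bounded factor. *)
Lemma tau_cmp (q : nat -> {poly R[i]}) a C P Q n : (forall k, bnd (q k) (a k) C) ->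
  vplus (rr C) P -> vplus (rr C) Q -> gr q a C P = gr q a C Q ->
  cabs (tau q a P n) <= expR 2 * cabs (tau q a Q n).
Proof.
move=> HB VP VQ GPQ.
suff h : cabs (tau q a P n) <= expR (2 * (1 - 2^-1 ^+ n)) * cabs (tau q a Q n).
  apply: le_trans h _; rewrite ler_wpM2r// ler_expR.
  by have [h0 _] := @half_expn R n; lra.
elim: n => [|n ih]; first by rewrite expr0 subrr mulr0 expR0 mul1r /tau !big_nil.
have [h0 h1] := @half_expn R n; rewrite h1 !tauS !cabsM.
have -> : 2 * (1 - 2^-1 ^+ n / 2) = 2 * (1 - 2^-1 ^+ n) + 2^-1 ^+ n :> R by field.
have wP : 0 < cabs (wt q a P n) by rewrite cabs_gt0 (wt_neq0 HB VP).
have wQ : 0 < cabs (wt q a Q n) by rewrite cabs_gt0 (wt_neq0 HB VQ).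
rewrite expRD mulrACA !cabsV; apply: ler_pM => //; first by rewrite divr_ge0.
rewrite ler_pdivrMr//; have := wt_cmp n HB VP VQ GPQ => h2.
have -> : expR (2^-1 ^+ n) * (cabs (a n) / cabs (wt q a Q n)) * cabs (wt q a P n)
   = cabs (a n) * (expR (2^-1 ^+ n) * cabs (wt q a P n) / cabs (wt q a Q n)) by ring.
by rewrite ler_peMr// ler_pdivlMr// mul1r.
Qed.

Lemma modulus_cmp (q : nat -> {poly R[i]}) a C P Q : (forall k, bnd (q k) (a k) C) ->
  vplus (rr C) P -> vplus (rr C) Q -> gr q a C P = gr q a C Q -> cabs P.2 <= 2 * cabs Q.2.
Proof.
move=> HB VP VQ GPQ; have [c1 c2 c3 c4 c5] := Cpow HB.
have r0 : 0 < rr C by rewrite /rr; lra.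
have [p1 _] := VP; have [q1 _] := VQ.
have := leaf_ln HB VP VQ GPQ r0 p1 q1.
have : 2 * C / rr C <= 1 / 2 by rewrite ler_pdivrMr// /rr; lra.
rewrite ler_norml => h1 /andP[_ h2].
have P0 : 0 < cabs P.2 by lra.
have Q0 : 0 < cabs Q.2 by lra.
have e1 : cabs P.2 <= expR (1 / 2) * cabs Q.2.
  have -> : cabs Q.2 = expR (ln (cabs Q.2)) by rewrite lnK.
  by rewrite -expRD -[leLHS]lnK ?posrE// ler_expR; lra.
have := expR_ge1Dx (- (1 / 2) : R); rewrite expRN => e2.
have E0 := expR_gt0 (1 / 2 : R).
have := ler_wpM2r (ltW E0) e2; rewrite mulVf ?gt_eqF// => e3.
have e4 : expR (1 / 2) <= 2 :> R by lra.
by apply: le_trans e1 _; rewrite ler_wpM2r.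
Qed.

End Compare.

Section Transfer.
Context {R : realType}.
Implicit Types (z P : C2 R) (r e : R) (n k j N : nat) (s t : R[i]).
Variables (q : nat -> {poly R[i]}) (a : nat -> R[i]) (C : R).
Hypothesis HB : forall k, bnd (q k) (a k) C.
Notation F := (hiter q a).
Notation Fi := (hiterV q a).
Notation G := (gr q a C).
Notation X := (xorb q a).
Notation qs n := (stail n q).
Notation as_ n := (stail n a).
Variables (c : R) (f f' : C2 R -> C2 R).
Hypothesis fh : hol [set z | G z < c] f.
Hypothesis fG : forall z, G z < c -> G (f z) = G z.
Hypothesis fK : forall z, G z < c -> f' (f z) = z.
Variables (Q : C2 R) (n0 : nat).
Hypothesis VQ : vplus (rr C) Q.
Hypothesis Gc : G Q < c.
Hypothesis Vf : vplus (rr C) (F n0 (f Q)).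
Notation Kf := (Kf q a f Q n0).
Notation tau' n := (tau (qs n0) (as_ n0) (F n0 (f Q)) (n - n0)).

Lemma dlt_image n P : (n0 <= n)%N -> nearby (qs n) (as_ n) (F n P) (F n (f Q)) (rho C) ->
  dlt (qs n) (as_ n) (F n (f Q)) (F n P) = tau' n * dlt (qs n0) (as_ n0) (F n0 (f Q)) (F n0 P).
Proof.
move=> n0n nP.
have e : (n0 + (n - n0))%N = n by rewrite subnKC.
have st (T' : Type) (u : nat -> T') : stail (n - n0) (stail n0 u) = stail n u.
  by apply/funext => k; rewrite /stail addnA e.
have := @dlt_shift _ _ _ _ (stail_bnd n0 HB) (F n0 P) (F n0 (f Q)) (n - n0) Vf.
rewrite !st -!hiterD e => /(_ nP) ->; rewrite mulrCA mulfV ?mulr1//.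
exact: (tau_neq0 (stail_bnd n0 HB) Vf).
Qed.

(** Turns a bound on the leaf coordinate [v] of [f P] into one on its position. [exists_zero]
    produces a point of the image leaf with coordinate [v], and injectivity at a high common level
    identifies it with [F_n (f P)]. *)
Lemma leaf_transfer n P (v : R[i]) : (n0 <= n)%N ->
  nearby (qs n) (as_ n) (F n P) (F n Q) (rho C) ->
  16 * cabs (X P n - X Q n) <= cabs (X Q n.+1) / 4 ->
  v = tau' n * Kf P -> 8 * cabs v <= cabs (X (f Q) n.+1) ->
  nearby (qs n) (as_ n) (F n (f P)) (F n (f Q)) (3 * C ^+ 2) /\
  cabs (X (f P) n - X (f Q) n) <= 4 * cabs v.
Proof.
move=> n0n nP tP vE vb; have [c1 c2 c3 c4 c5] := Cpow HB.
have VF : vplus (rr C) (F n (f Q)) := vplus_tail HB Vf n0n.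
have VFQ : vplus (rr C) (F n Q) by have [] := hiter_vplus HB n (rr_ge HB) VQ.
have X0 : (50 * 40) * C ^+ 5 <= cabs (X (f Q) n.+1) by case: VF.
have XQ0 : (50 * 40) * C ^+ 5 <= cabs (X Q n.+1) by case: VFQ.
have [g [g1 g2]] := leaf_graph (stail_bnd n HB) VF.
have gn t : cabs t <= cabs (X (f Q) n.+1) -> nearby (qs n) (as_ n) (g t) (F n (f Q)) (rho C).
  by move=> tX k; apply: (le_trans _ (rho_ge3 HB)); exact: (g1 t tX).2.
have [t tv dt] : exists2 t, cabs t <= 4 * cabs v & dlt (qs n) (as_ n) (F n (f Q)) (g t) = v.
  have [v0|v0] := eqVneq v 0.
    exists 0; first by rewrite v0 cabs0; lra.
    have z0 : cabs (0 : R[i]) <= cabs (X (f Q) n.+1) by rewrite cabs0.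
    have := dlt_one (stail_bnd n HB) VF (gn 0 z0); have [-> _] := g1 0 z0.
    rewrite addr0 subrr subr0 cabs0 mul0r v0 => h; apply/eqP.
    by rewrite -cabs_eq0 eq_le h cabs_ge0.
  have v1 : 0 < cabs v by rewrite cabs_gt0.
  have T0 : 0 < 4 * cabs v by lra.
  have tX s : cabs s <= 4 * cabs v -> cabs s < cabs (X (f Q) n.+1) by lra.
  have dl s : cabs s <= 4 * cabs v -> cabs (dlt (qs n) (as_ n) (F n (f Q)) (g s) - s) <= cabs s / 4.
    move=> /tX/ltW sX; have := dlt_one (stail_bnd n HB) VF (gn s sX); have [-> _] := g1 s sX.
    by rewrite [_.1 + s]addrC addrK.
  have [|||s s1 s2] := @exists_zero _ (fun s => dlt (qs n) (as_ n) (F n (f Q)) (g s) - v) _ (2 * cabs v) T0.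
  - move=> s s1; apply: cdiffB; last exact: cdiff_cst.
    apply: (@dlt_cdiff _ _ _ _ (stail_bnd n HB) _ VF g (6 * cabs v)); last by lra.
    move=> u u1; have uX : cabs u < cabs (X (f Q) n.+1) by lra.
    by split; [exact: g2|apply: gn; exact: ltW].
  - have z0 : cabs (0 : R[i]) <= 4 * cabs v by rewrite cabs0 ltW.
    have := dl 0 z0; rewrite subr0 cabs0 mul0r => h.
    have := cabsB (dlt (qs n) (as_ n) (F n (f Q)) (g 0)) v; lra.
  - move=> s s1; have := dl s; rewrite s1 lexx => /(_ isT) h.
    have := cabs_dist s (s - dlt (qs n) (as_ n) (F n (f Q)) (g s)).
    rewrite subKr (cabsC s) => h2.
    have := cabs_dist (dlt (qs n) (as_ n) (F n (f Q)) (g s)) v; lra.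
  - by exists s; [exact: ltW|apply/eqP; rewrite -subr_eq0 s2].
have tX : cabs t <= cabs (X (f Q) n.+1) by have := cabs_ge0 v; lra.
have [gt1 gt2] := g1 t tX.
suff e : F n (f P) = g t.
  rewrite e; split => //; rewrite /xorb e gt1 -/(X (f Q) n) addrAC subrr add0r.
  exact: tv.
(* both points have the same coordinate along the image leaf *)
have [sg hsg] := sg_exists HB VQ.
have [hs1 hs2] := hsg n.
have PX : cabs (X P n - X Q n) <= cabs (X Q n.+1) by have := cabs_ge0 (X Q n.+1); lra.
have sgn s : cabs s <= cabs (X Q n.+1) -> nearby (qs n) (as_ n) (F n (sg n s)) (F n Q) (rho C).
  by move=> sX k; apply: (le_trans _ (rho_ge3 HB)); exact: (hs1 s sX).2.
have Pn : nearby (qs n) (as_ n) (F n P) (F n Q) (rho C).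
  exact: nP.
have PE : sg n (X P n - X Q n) = P.
  by apply: (sg_uniq HB VQ (sgn _ PX) Pn); have [h _] := hs1 _ PX; rewrite /xorb h addrC subrK.
have sg0 : sg n 0 = Q.
  have z0 : cabs (0 : R[i]) <= cabs (X Q n.+1) by rewrite cabs0.
  apply: (sg_uniq HB VQ (sgn _ z0)); first by move=> k; rewrite subrr cabs0 (rho_ge0 HB).
  by have [h _] := hs1 _ z0; rewrite /xorb h addr0.
have T0 : 0 < cabs (X Q n.+1) / 2 by lra.
have [|j [l [jn l0 hl]]] := @Kf_level _ _ _ _ HB c f fh fG Q n0 VQ Gc Vf n (sg n) _ T0 sg0.
  move=> s sX; have sX' : cabs s < cabs (X Q n.+1) by lra.
  by split; [exact: hs2|apply: sgn; exact: ltW].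
have [|nj _] := hl (X P n - X Q n); first by (clear - HB fh fG fK VQ Gc Vf T0 tP; lra).
rewrite PE in nj.
pose m := maxn n j.
have nm : (n <= m)%N := leq_maxl _ _.
have jm : (j <= m)%N := leq_maxr _ _.
have n0m : (n0 <= m)%N := leq_trans n0n nm.
have VFm : vplus (rr C) (F m (f Q)) := vplus_tail HB Vf n0m.
have tail N (P1 P2 : C2 R) r : (N <= m)%N -> nearby (qs N) (as_ N) (F N P1) (F N P2) r ->
    nearby (qs m) (as_ m) (F m P1) (F m P2) r.
  move=> Nm h k; have := h (m - N + k)%N; rewrite -!xorbD.
  by rewrite -addnS addnA subnKC.
have nPm := tail _ _ _ _ jm nj.
have gV : g t = F n (Fi n (g t)) by rewrite (hiterVK HB).
have ngt := gn t tX; rewrite gV in ngt.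
have ngm := tail _ _ _ _ nm ngt.
have := dlt_image n0m nPm; rewrite -/(Kf P) => d1.
have := dlt_image n0m ngm => d2.
have := dlt_image n0n ngt; rewrite -gV dt vE => d3.
have t0 : tau' n != 0 := tau_neq0 (stail_bnd n0 HB) Vf _.
have d4 := mulfI t0 d3.
have := dlt_inj (stail_bnd m HB) VFm nPm ngm; rewrite d1 d2 d4 => /(_ erefl).
by move=> /(congr1 (Fi m)); rewrite !(hiterK HB) => ->.
Qed.

End Transfer.

(** * Bounds on the conjugated automorphisms *)

Section StepDown.
Context {R : realType}.
Implicit Types (z P : C2 R) (r x y e : R) (n k N : nat) (s : R[i]).
Variables (q : nat -> {poly R[i]}) (a : nat -> R[i]) (C : R).
Hypothesis HB : forall k, bnd (q k) (a k) C.
Notation F := (hiter q a).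
Notation Fi := (hiterV q a).
Notation D := (hdeg q).
Notation G := (gr q a C).
Notation X := (xorb q a).
Notation qs n := (stail n q).
Notation as_ n := (stail n a).
Notation cg := (cgr C).

(** [12 * expR (C + 1)] is the size of [e^2 y] for which [|s|^2 exp (- C - 1)], a lower bound of
    [|q_n(s)|], reaches [3 y] on the circle [|s| = e y / 2] of [step_down]. *)
Definition rbig : R := 12 * expR (C + 1) + rr C.
(** By [green_large], a point with [G >= gbig] and [|x_n| <= |x_(n+1)|] has
    [|x_(n+1)| >= 10^6 rbig], at whatever level. *)
Definition gbig : R := cg + ln ((40 * 25) * (40 * 25) * rbig) + 1.

Lemma rbig_facts : [/\ rr C <= rbig, 12 * expR (C + 1) <= rbig, 1 <= rbig & 0 <= gbig].
Proof.
have [c1 c2 c3 c4 c5] := Cpow HB; have E0 := expR_gt0 (C + 1).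
have r1 : (50 * 40) <= rr C by rewrite /rr; lra.
have b1 : 1 <= rbig by rewrite /rbig; lra.
have : 0 <= ln ((40 * 25) * (40 * 25) * rbig) by rewrite ln_ge0//; lra.
have := cgr_gt0 HB; rewrite /gbig; split; rewrite ?/rbig; (clear - HB E0 r1 H0 H; lra).
Qed.

Lemma nearby_lev n P P' r : nearby (qs n) (as_ n) (F n P) (F n P') r <->
  forall k, (n < k)%N -> cabs (X P k - X P' k) <= r.
Proof.
split=> h k; last by rewrite -!xorbD addnS; apply: h; rewrite ltnS leq_addr.
by case: k => // k nk; have := h (k - n)%N; rewrite -!xorbD addnS subnKC.
Qed.

Lemma green_large n P x : cabs (X P n) <= cabs (X P n.+1) -> 1 < x ->
  ln x + cg < (D n)%:R * G P -> x <= cabs (X P n.+1).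
Proof.
move=> h x1; rewrite -gr_shift// => h1; have x0 : 0 < x by lra.
have := gr_le (stail_bnd n HB) (F n P) => h2.
have : ln x < lg (F n P) by lra.
rewrite /lg ltr_ln ?posrE ?max1_gt0// lt_max => /orP[|]; first lra.
by rewrite /nrm max_r// => /ltW.
Qed.

(** Slides along the leaf at level [n + 1] to a point [P1] whose term with index [n] vanishes,
    namely a zero of [q_n(s)] minus the second coordinate of the leaf over [s], and then uses level
    [n]. Level [n] is an explicit hypothesis because the last step is taken with a smaller [e] than
    the induction. *)
Lemma step_down n P e :
  (forall P1, cabs (X P1 n) <= cabs (X P1 n.+1) / (40 * 25) -> gbig <= G P1 ->
    exists y0 : R[i], (forall k, (n < k)%N -> cabs (X (0, y0) k - X P1 k) <= 6 * C ^+ 2) /\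
      cabs (X (0, y0) n) <= cabs (X P1 n.+1) / (40 * 25)) ->
  0 < e <= 1 / (40 * 25) -> cabs (X P n.+1) <= cabs (X P n.+2) / (40 * 25) -> gbig <= G P ->
  rbig <= e ^+ 2 * cabs (X P n.+2) ->
  exists y0 : R[i], (forall k, (n.+1 < k)%N -> cabs (X (0, y0) k - X P k) <= 6 * C ^+ 2) /\
    cabs (X (0, y0) n.+1) <= e * cabs (X P n.+2).
Proof.
move=> ih /andP[e0 e1] Pn GP hb; have [c1 c2 c3 c4 c5] := Cpow HB.
have [b1 b2 b3 b4] := rbig_facts.
have rC : rr C = (50 * 40) * C ^+ 5 by [].
set y := cabs (X P n.+2) in Pn hb *.
have y0 : 0 <= y := cabs_ge0 _.
have ey : e ^+ 2 * y <= e * y by rewrite ler_wpM2r// expr2 ler_piMl ?(ltW e0)//; lra.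
have ey2 : e * y <= y / (40 * 25) by have := ler_wpM2r y0 e1; lra.
have VP : vplus (rr C) (F n.+1 P) by split; rewrite -?xorbS -?/(xorb _ _ _ n.+1) -/y; (clear - HB ey2 ey y0 hb b1 Pn; lra).
have [g [g1 g2]] := leaf_graph (stail_bnd n.+1 HB) VP.
rewrite -[(F n.+1 P).2]/(X P n.+2) -[(F n.+1 P).1]/(X P n.+1) -/y in g1 g2.
have T0 : 0 < e * y / 2 by lra.
have in_disc s : cabs s <= e * y / 2 -> cabs (s - X P n.+1) < y.
  by move=> sT; have := cabsB s (X P n.+1); (clear - HB sT T0 ey2 Pn; lra).
have gE s : cabs s <= e * y / 2 -> cabs ((g (s - X P n.+1)).2 - X P n.+2) <= 3 * C ^+ 2.
  by move=> /in_disc/ltW sX; have [_ h] := g1 _ sX; exact: (h 0%N).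
have E1 : expR (C + 1) * expR (- C - 1) = 1 by rewrite -expRD -[RHS]expR0; congr expR; ring.
have [|||s sT s0] := @exists_zero _ (fun s => (q n).[s] - (g (s - X P n.+1)).2) _ (3 / 2 * y) T0.
- move=> s sT; apply: cdiffB; first by apply: cdiff_horner; exact: cdiff_id.
  apply: (@cdiff_comp _ (fun s => s - X P n.+1) (fun s => (g s).2)).
    by apply: cdiffB; [exact: cdiff_id|exact: cdiff_cst].
  by have [] := g2 _ (in_disc s sT).
- have z0 : cabs (0 : R[i]) <= e * y / 2 by rewrite cabs0 ltW.
  have z1 : cabs (0 : R[i]) <= 1 by rewrite cabs0.
  have := bup (HB n) (lexx 1) z1; rewrite expr1n mulr1 => h1.
  have h2 := gE 0 z0; have h3 := cabsB (q n).[0] (g (0 - X P n.+1)).2.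
  have := cabs_dist (g (0 - X P n.+1)).2 (X P n.+2); rewrite -/y; (clear - HB h3 h2 h1 T0 ey2 ey hb rC b1 c5 c4 c3 c2; lra).
- move=> s sT; have sT' : cabs s <= e * y / 2 by rewrite sT.
  have h2 := gE s sT'; have h3 := cabs_dist (q n).[s] (g (s - X P n.+1)).2.
  have h4 := cabs_dist (g (s - X P n.+1)).2 (X P n.+2); rewrite -/y in h4.
  have sC : C <= cabs s by (clear - HB sT T0 ey hb rC b1 c5 c4 c3 c2; lra).
  have s1 : 1 <= cabs s by (clear - HB sC c1; lra).
  have zs : cabs (0 : R[i]) <= cabs s by rewrite cabs0 cabs_ge0.
  have := blog (HB n) sC zs; rewrite mulr0 subr0 => hl.
  have := blead (HB n) => hl2.
  have hl3 : C / cabs s <= 1 by rewrite ler_pdivrMr; lra.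
  have l0 : 0 <= ln (cabs s) by rewrite ln_ge0.
  have d2 : 2 <= (pdeg (q n))%:R :> R by rewrite ler_nat; exact: bdeg (HB n).
  have hl4 := ler_wpM2r l0 d2.
  have hl5 : 2 * ln (cabs s) - C - 1 <= ln (cabs (q n).[s]).
    by move: hl hl2; rewrite !ler_norml => /andP[? _] /andP[? _]; lra.
  have q0 : 0 < cabs (q n).[s].
    have := bpos (HB n) sC zs; rewrite mulr0 subr0; (clear - HB s1; lra).
  have h5 : cabs s ^+ 2 * expR (- C - 1) <= cabs (q n).[s].
    have s0 : 0 < cabs s by (clear - HB s1; lra).
    rewrite -[leRHS]lnK ?posrE//.
    have -> : cabs s ^+ 2 = expR (2 * ln (cabs s)).
      by rewrite -[in LHS](lnK (x := cabs s)) ?posrE// -expRM_natl.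
    by rewrite -expRD ler_expR; (clear - HB hl5; lra).
  have h6 : 3 * y <= cabs s ^+ 2 * expR (- C - 1).
    have -> : cabs s ^+ 2 * expR (- C - 1) = (e ^+ 2 * y) * y / 4 * expR (- C - 1) by rewrite sT; field.
    have h7 : 12 * expR (C + 1) * y <= e ^+ 2 * y * y by rewrite ler_wpM2r//; (clear - HB hb b2; lra).
    have := ler_wpM2r (expR_ge0 (- C - 1)) h7.
    have -> : 12 * expR (C + 1) * y * expR (- C - 1) = 12 * y.
      by transitivity (12 * y * (expR (C + 1) * expR (- C - 1))); [ring|rewrite E1 mulr1].
    lra.
  lra.
have sT' := ltW sT.
pose P1 := Fi n (0, s).
have FP1 : F n P1 = (0, s) by rewrite /P1 (hiterVK HB).
have P1n : X P1 n = 0 by rewrite /xorb FP1.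
have P1s : X P1 n.+1 = s by rewrite xorbS FP1.
have [gx gn] := g1 _ (ltW (in_disc s sT')).
have FP1n : F n.+1 P1 = g (s - X P n.+1).
  have gx' : (g (s - X P n.+1)).1 = s by rewrite gx addrC subrK.
  rewrite /= FP1 /henon /= mulr0 subr0.
  by case: (g _) gx' s0 {gx gn} => u v /= -> /eqP; rewrite subr_eq0 => /eqP ->.
have nP1 : nearby (qs n.+1) (as_ n.+1) (F n.+1 P1) (F n.+1 P) (3 * C ^+ 2) by rewrite FP1n.
have GP1 : G P1 = G P by exact: (nearby_grN HB nP1).
have gb2 : 1 < (40 * 25) * (40 * 25) * rbig by (clear - HB b3; lra).
have s_big : (40 * 25) * (40 * 25) * rbig <= cabs s.
  rewrite -P1s; apply: (@green_large n) => //; first by rewrite P1n cabs0 cabs_ge0.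
  have D1 : 1 <= (D n)%:R :> R by rewrite ler1n (hdeg_gt0 HB).
  have := ler_pM (_ : 0 <= 1) b4 D1 GP; rewrite GP1 mul1r /gbig; (clear - HB; lra).
have GP1' : gbig <= G P1 by rewrite GP1.
have [|y1 [hy1 hy2]] := ih P1 _ GP1'; first by rewrite P1n cabs0 P1s divr_ge0.
have VP1 : vplus (rr C) (F n P1) by rewrite FP1; split => /=; rewrite ?cabs0 ?cabs_ge0//; (clear - HB s_big gb2 b1; lra).
have n6 : nearby (qs n) (as_ n) (F n (0, y1)) (F n P1) (6 * C ^+ 2) by apply/nearby_lev.
have n40 : nearby (qs n) (as_ n) (F n (0, y1)) (F n P1) (rho C).
  by move=> k; apply: le_trans (n6 k) _; rewrite /rho; (clear - HB c2 c1; lra).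
have nn : nearby (qs n) (as_ n) (F n P1) (F n P1) (rho C) by move=> k; rewrite subrr cabs0 (rho_ge0 HB).
exists y1; split; last first.
  have := hy1 n.+1 (ltnSn n); rewrite P1s.
  have := cabs_dist (X (0, y1) n.+1) s; (clear - HB s_big gb2 sT' rC b1 c5 c4 c3; lra).
have nP1' := (nearby_lev _ _ _ _).1 nP1.
move=> k nk; have h1 := nP1' k nk.
apply: le_trans (cabs_triB _ (X P1 k) _) _.
(* Contraction along the leaf reduces the [6 C^2] of level [n] to at most [3 C^2] from index [n + 2]
   on; the displacements of successive levels therefore do not add up. *)
suff : cabs (X (0, y1) k - X P1 k) <= 3 * C ^+ 2 by (clear - HB h1; lra).
have [i kE] : exists i, k = (n + i.+2)%N by exists (k - n.+2)%N; rewrite !addnS -!addSn subnKC.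
clear - HB c1 c2 c3 c4 c5 rC VP1 n40 nn hy1 kE.
have := leaf_small (stail_bnd n HB) VP1 i.+1 n40 nn; rewrite -!xorbD -kE => h2.
have h3 := far (stail_bnd n HB) VP1 i.+1; rewrite -xorbD -kE rC in h3.
have h4 : cabs (X (0, y1) (n + i.+1) - X P1 (n + i.+1)) <= 6 * C ^+ 2 by apply: hy1; rewrite addnS ltnS leq_addr.
have h5 : 2 * C ^+ 2 * cabs (X (0, y1) (n + i.+1) - X P1 (n + i.+1)) <= 2 * C ^+ 2 * (6 * C ^+ 2) by rewrite ler_wpM2l; lra.
have h6 : 2 * C ^+ 2 * (6 * C ^+ 2) <= 12 * C ^+ 5.
  have -> : 2 * C ^+ 2 * (6 * C ^+ 2) = 12 * C ^+ 4 by ring.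
  lra.
have e_0 := cabs_ge0 (X (0, y1) k - X P1 k).
have h7 := ler_wpM2l e_0 h3.
have p5 : 0 < C ^+ 5 by lra.
have : cabs (X (0, y1) k - X P1 k) * (50 * 40) * C ^+ 5 <= 12 * C ^+ 5 by lra.
rewrite ler_pM2r//; lra.
Qed.

(** The leaf is brought to the transversal [{0} x C] one level at a time; at level 0 its graph is
    evaluated at [t = - P.1]. *)
Lemma descend n P : cabs (X P n) <= cabs (X P n.+1) / (40 * 25) -> gbig <= G P ->
  exists y0 : R[i], (forall k, (n < k)%N -> cabs (X (0, y0) k - X P k) <= 6 * C ^+ 2) /\
    cabs (X (0, y0) n) <= cabs (X P n.+1) / (40 * 25).
Proof.
have [c1 c2 c3 c4 c5] := Cpow HB; have [b1 b2 b3 b4] := rbig_facts.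
have gb2 : 1 < (40 * 25) * (40 * 25) * rbig by lra.
have big m P' : cabs (X P' m) <= cabs (X P' m.+1) / (40 * 25) -> gbig <= G P' -> (40 * 25) * (40 * 25) * rbig <= cabs (X P' m.+1).
  move=> h GP; apply: (@green_large m) => //; first by have := cabs_ge0 (X P' m.+1); lra.
  have D1 : 1 <= (D m)%:R :> R by rewrite ler1n (hdeg_gt0 HB).
  have := ler_pM (_ : 0 <= 1) b4 D1 GP; rewrite mul1r /gbig; lra.
elim: n P => [|n ih] P Pn GP; have h := big _ _ Pn GP; last first.
  have [||y0 [h1 h2]] := @step_down n P (1 / (40 * 25)) ih _ Pn GP.
  - by apply/andP; split; (clear - HB; lra).
  - have -> : (1 / (40 * 25)) ^+ 2 = 1 / ((40 * 25) * (40 * 25)) :> R by field.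
    lra.
  by exists y0; split => //; (clear - HB h2; lra).
have VP : vplus (rr C) P by split; [apply: le_trans h; (clear - HB gb2 b1; lra)|apply: le_trans Pn _; rewrite xorbS /=; have := cabs_ge0 P.2; (clear - HB; lra)].
have [g [g1 _]] := leaf_graph HB VP.
have [|e nb] := g1 (- P.1).
  by rewrite cabsN; case: VP.
have gE : g (- P.1) = (0, (g (- P.1)).2) by case: (g _) e => u v /= ->; rewrite subrr.
exists (g (- P.1)).2; rewrite -gE; split => [[//|k] _|].
  by apply: le_trans (nb k) _; lra.
by rewrite /xorb /= gE cabs0 divr_ge0.
Qed.

End StepDown.

(** * Uniform constants over the transversal *)

Section Uniform.
Context {R : realType}.
Implicit Types (z w P Q : C2 R) (r x y e : R) (n k N : nat) (s t : R[i]).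
Variables (q : nat -> {poly R[i]}) (a : nat -> R[i]) (C : R).
Hypothesis HB : forall k, bnd (q k) (a k) C.
Notation F := (hiter q a).
Notation G := (gr q a C).
Notation X := (xorb q a).
Notation qs n := (stail n q).
Notation as_ n := (stail n a).
Notation cg := (cgr C).

Lemma vplus_open r z : 0 < G z -> exists e N, 0 < e /\ forall n w, (N <= n)%N -> dst w z < e -> vplus r (F n w).
Proof.
move=> g0; have c1 := bC (HB 0).
have [r' [rr' r4]] : exists r', r <= r' /\ 4 * C <= r'.
  by exists (Num.max r (4 * C)); rewrite !le_max !lexx orbT.
have Cr : C <= r' by lra.
have [N hN] := gr_gt0_vplus HB (2 * r') g0.
have [L L1 hL] := hiter_lip HB N.+1 (nrm z + 1).
have L0 : 0 < L by lra.
exists (Num.min 1 (1 / L)), N.+1; split; first by rewrite lt_min ltr01 divr_gt0.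
move=> n w Nn; rewrite lt_min => /andP[w1 wL].
have wz := nrm_dst w z.
have d1 : dst (F N.+1 w) (F N.+1 z) < 1.
  apply: le_lt_trans (hL _ _ _ _) _; [lra|lra|].
  by rewrite mulrC -ltr_pdivlMr.
have [v1 v2] := hN N (leqnn _).
have Cv : C <= cabs (F N z).2 by lra.
have h3 := bpos (HB N) Cv v2.
apply: (vplus_mono rr'); apply: (hiter_vplus_from HB Cr Nn).
have y1 : cabs (F N.+1 z).1 = cabs (F N z).2 by [].
have y2 : 2 * cabs (F N z).2 <= cabs (F N.+1 z).2 by [].
have := cabs_dist (F N.+1 w).1 (F N.+1 z).1.
have := cabs_dist (F N.+1 z).2 (F N.+1 w).2; rewrite (cabsC (F N.+1 z).2).
have := dst1 (F N.+1 w) (F N.+1 z); have := dst2 (F N.+1 w) (F N.+1 z).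
by move=> *; split; lra.
Qed.

Lemma tau_inv_bound n R1 R2 : rr C <= R1 -> exists M, forall y : R[i], R1 <= cabs y <= R2 ->
  cabs (tau q a (0, y) n)^-1 <= M.
Proof.
move=> R1r.
have V (y : R[i]) : R1 <= cabs y <= R2 -> vplus (rr C) ((0, y) : C2 R).
  by move=> /andP[h _]; split; rewrite /= ?cabs0 ?cabs_ge0//; exact: le_trans h.
elim: n => [|n [M hM]]; first by exists 1 => y _; rewrite /tau big_nil invr1 cabs1.
have c2 (y : R[i]) k : cdiff (fun y : R[i] => X (0, y) k) y.
  by have [] := cdiff2_hiter q a k (conj (cdiff_cst 0 y) (cdiff_id y) : cdiff2 (fun y : R[i] => (0, y)) y).
have [M1 M10 hM1] : exists2 M1, 0 < M1 & forall y : R[i], R1 <= cabs y <= R2 -> cabs (wt q a (0, y) n / a n) <= M1.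
  apply: cbounded_annulus => y _; apply: cdiff_ccont; apply: cdiffM; last exact: cdiff_cst.
  by apply: cdiff_horner.
exists (M * M1) => y hy; rewrite tauS invfM cabsM invf_div; apply: ler_pM => //; [exact: hM|exact: hM1].
Qed.

Variables (c : R) (f f' : C2 R -> C2 R).
Hypothesis fh : hol [set z | G z < c] f.
Hypothesis fh' : hol [set z | G z < c] f'.
Hypothesis fG : forall z, G z < c -> G (f z) = G z.
Hypothesis fK : forall z, G z < c -> f' (f z) = z.

(** Compactness of the product [A] of a disc and an annulus, which lies in [0 < G < c] and will
    contain the leaf discs of radius 16 over the transversal. The radius 16 leaves the parameter 1
    available after [leaf_disc]. *)
Lemma uniform_image R1 R2 : rr C <= R1 -> expR cg < R1 -> ln R2 + cg < c -> exists n0 M, forall z,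
  cabs z.1 <= 16 -> R1 <= cabs z.2 <= R2 -> [/\ vplus (rr C) (F n0 (f z)) & nrm (F n0 (f z)) <= M].
Proof.
move=> R1r R1e R2c; have [c1 c2 c3 c4 c5] := Cpow HB.
have r16 : 16 <= R1 by apply: (le_trans _ R1r); rewrite /rr; lra.
pose A := [set z : C2 R | cabs z.1 <= 16 /\ R1 <= cabs z.2 <= R2].
have AT z : A z -> nrm z <= Num.max 16 R2.
  by move=> [h1 /andP[_ h2]]; rewrite nrm_le !le_max h1 h2 orbT.
have AG z : A z -> 0 < G z < c.
  move=> [h1 /andP[h2 h3]]; have z12 : cabs z.1 <= cabs z.2 by lra.
  have V1 : vplus R1 z by [].
  rewrite (gr_vplus_gt0 HB R1e V1) /=; last first.
    by apply: (vplus_mono _ V1); apply: le_trans R1r; exact: rr_rgood HB.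
  have := gr_le HB z; have : lg z <= ln R2 by apply: lg_le; [lra|rewrite nrm_le h3 (le_trans z12 h3)].
  lra.
have Aopen z : ~ A z -> exists2 e, 0 < e & forall w, dst w z < e -> ~ A w.
  move=> nA; have [h1|h1] := leP (cabs z.1) 16; last first.
    have [e e0 he] := cabs_open_gt h1; exists e => // w wz [h _].
    by have := he _ (le_lt_trans (dst1 w z) wz); lra.
  have [h2|h2] := leP R1 (cabs z.2); last first.
    have [e e0 he] := cabs_open_lt h2; exists e => // w wz [_ /andP[h _]].
    by have := he _ (le_lt_trans (dst2 w z) wz); lra.
  have [h3|h3] := leP (cabs z.2) R2; first by case: nA; split => //; rewrite h2.
  have [e e0 he] := cabs_open_gt h3; exists e => // w wz [_ /andP[_ h]].
  by have := he _ (le_lt_trans (dst2 w z) wz); lra.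
have [n0 hn0] : exists N, forall n z, (N <= n)%N -> A z -> vplus (rr C) (F n (f z)).
  apply: (ccover2 AT) => z; have [Az|/Aopen[e e0 he]] := pselect (A z); last first.
    by exists e, 0%N; split => // n w _ /he.
  have /andP[g0 gc] := AG z Az.
  have [e [N [e0 he]]] := @vplus_open (rr C) (f z) (eq_ind_r (fun x => 0 < x) g0 (fG gc)).
  have [d d0 hd] := hol_cont fh gc e0.
  by exists d, N; split => // n w Nn /hd/(he n _ Nn).
have [M hM] : exists N, forall n z, (N <= n)%N -> A z -> nrm (F n0 (f z)) <= n%:R.
  apply: (ccover2 AT) => z; have [Az|/Aopen[e e0 he]] := pselect (A z); last first.
    by exists e, 0%N; split => // n w _ /he.
  have /andP[g0 gc] := AG z Az.
  have [L L1 hL] := hiter_lip HB n0 (nrm (f z) + 1).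
  have L0 : 0 < L by lra.
  have m0 : 0 < Num.min 1 (1 / L) by rewrite lt_min ltr01 divr_gt0.
  have [d d0 hd] := hol_cont fh gc m0.
  exists d, (Num.bound (nrm (F n0 (f z)) + 1)); split => // n w Nn /hd; rewrite lt_min => /andP[w1 wL] _.
  have h1 := nrm_dst (f w) (f z).
  have d1 : dst (F n0 (f w)) (F n0 (f z)) <= 1.
    apply: le_trans (hL _ _ _ _) _; [(clear - HB fh fh' fG fK h1 w1; lra)|(clear - HB fh fh' fG fK; lra)|].
    by rewrite mulrC -ler_pdivlMr// ltW.
  have := nrm_dst (F n0 (f w)) (F n0 (f z)).
  have : nrm (F n0 (f z)) + 1 < (Num.bound (nrm (F n0 (f z)) + 1))%:R.
    by apply: archi_boundP; have := nrm_ge0 (F n0 (f z)); (clear - HB fh fh' fG fK; lra).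
  have : (Num.bound (nrm (F n0 (f z)) + 1))%:R <= n%:R :> R by rewrite ler_nat.
  (clear - HB fh fh' fG fK d1; lra).
exists n0, M%:R => z z1 z2; split; [exact: hn0|exact: hM].
Qed.

(** The slope of [Kf_affine] is bounded uniformly in [y] by evaluation at the leaf point with
    parameter 1, whose image is controlled by compactness. [tau_cmp] then replaces the contraction
    of the image orbit by that of the orbit of [(0, y)], which makes the bound independent of
    [n]. *)
Lemma uniform_transfer R1 R2 : rr C <= R1 -> expR cg < R1 -> ln R2 + cg < c -> exists n0 K, 0 <= K /\
  forall y : R[i], R1 + 3 * C ^+ 2 <= cabs y -> cabs y + 3 * C ^+ 2 <= R2 ->
  vplus (rr C) (F n0 (f (0, y))) /\ forall n P, (n0 <= n)%N ->
    nearby (qs n) (as_ n) (F n P) (F n (0, y)) (rho C) ->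
    cabs (X P n - X (0, y) n) <= cabs (X (0, y) n.+1) / 64 ->
    cabs (tau (qs n0) (as_ n0) (F n0 (f (0, y))) (n - n0) * Kf q a f (0, y) n0 P) <= K * cabs (X P n - X (0, y) n).
Proof.
move=> R1r R1e R2c; have [c1 c2 c3 c4 c5] := Cpow HB.
have [n0 [M hM]] := uniform_image R1r R1e R2c.
have [M2 hM2] := tau_inv_bound n0 R2 R1r.
have r16 : (50 * 40) * C ^+ 5 <= R1 by [].
exists n0, (10 * `|M| * expR 2 * `|M2|); split; first by rewrite !mulr_ge0 ?expR_ge0.
move=> y y1 y2; pose Q : C2 R := (0, y).
have yE : R1 <= cabs y <= R2 by apply/andP; split; (clear - HB fh fh' fG fK y1 c2 c1 y2; lra).
have VQ : vplus (rr C) Q by split; rewrite /= ?cabs0 ?cabs_ge0//; lra.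
have GQ : G Q < c.
  have := gr_le HB Q; have : lg Q <= ln R2.
    by apply: lg_le; [(clear - HB fh fh' fG fK yE r16 c5 c4 c3 c2 c1; lra)|rewrite nrm_le /= cabs0; apply/andP; split; (clear - HB fh fh' fG fK yE r16 c5 c4 c3 c2 c1; lra)].
  lra.
have Q16 : cabs Q.1 <= 16 by rewrite /= cabs0.
have [Vf _] := hM Q Q16 yE.
split => // n P n0n nP tP.
have [A hA] := Kf_affine HB fh fh' fG fK VQ GQ Vf.
have [g [g1 g2]] := leaf_graph HB VQ.
have Qb : cabs Q.2 = cabs y by [].
have gE t : cabs t <= 16 -> cabs (g t).1 <= 16 /\ R1 <= cabs (g t).2 <= R2.
  move=> t16; have [|e nb] := g1 t; first by rewrite Qb; lra.
  rewrite e add0r; split => //.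
  have := nb 0%N; rewrite !xorbS /= => h.
  have := cabs_dist (g t).2 y; have := cabs_dist y (g t).2; rewrite (cabsC y).
  by move=> *; apply/andP; split; lra.
have g1X t : cabs t <= 16 -> (g t).1 = t /\ nearby q a (g t) Q (3 * C ^+ 2).
  by move=> t16; have [|-> nb] := g1 t; rewrite ?Qb ?add0r//; (clear - HB fh fh' fG fK t16 yE r16 c5 c4 c3 c2 c1; lra).
have g16 t : cabs t <= 16 -> G (g t) = G Q by move=> /g1X[_]; exact: nearby_gr.
have gQ : g 0 = Q.
  have z0 : cabs (0 : R[i]) <= 16 by rewrite cabs0.
  have [e nb] := g1X 0 z0.
  have nb' : nearby q a (g 0) Q (rho C) by move=> k; apply: le_trans (nb k) (rho_ge3 HB).
  by apply: (leaf_eq HB VQ nb') => //; move=> k; rewrite subrr cabs0 (rho_ge0 HB).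
have o16 : cabs (1 : R[i]) <= 16 by rewrite cabs1; (clear - HB fh fh' fG fK; lra).
have fg1 : nearby (qs n0) (as_ n0) (F n0 (f (g 1))) (F n0 (f Q)) (rho C).
  suff : nearby (qs n0) (as_ n0) (F n0 (f (g 1))) (F n0 (f (g 0))) (rho C) by rewrite gQ.
  move=> k; apply: (le_trans _ (rho_ge16 HB)).
  apply: (@leaf_disc _ _ _ C (fun t => F n0 (f (g t))) 16 1 (stail_bnd n0 HB)) => //; last by rewrite cabs1; (clear - HB fh fh' fG fK; lra).
  move=> s s16; have Gs : G (g s) < c by rewrite g16.
  have z16 : cabs (0 : R[i]) <= 16 by rewrite cabs0.
  split.
  - apply: cdiff2_hiter; apply: (hol_curve fh) => //; apply: g2; rewrite Qb; (clear - HB fh fh' fG fK s16 yE r16 c5 c4 c3 c2 c1; lra).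
  - by have [h1 h2] := gE s s16; have [] := hM _ h1 h2.
  - by rewrite !gr_shift// !fG ?g16.
have [e1 nb1] := g1X 1 o16.
have nb1' : nearby (qs 0) (as_ 0) (F 0 (g 1)) (F 0 Q) (rho C) by move=> k; apply: le_trans (nb1 k) (rho_ge3 HB).
have X1 : X (g 1) 0 - X Q 0 = 1 by rewrite /xorb /= e1 subr0.
have [_ m1 _] := dlt_level HB VQ nb1'.
rewrite X1 cabs1 mul1r /tau big_nil cabs1 mul1r in m1.
have AE : Kf q a f Q n0 (g 1) = A * dlt q a Q (g 1).
  apply: (hA 0%N) => //; rewrite X1 cabs1 -[X Q 1]/y; (clear - HB fh fh' fG fK yE r16 c5 c4 c3 c2 c1; lra).
have K1 : cabs (Kf q a f Q n0 (g 1)) <= 5 / 2 * `|M|.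
  have := dlt_one (stail_bnd n0 HB) Vf fg1; rewrite -/(Kf q a f Q n0 (g 1)).
  set u := (F n0 (f (g 1))).1 - _ => h.
  have : cabs u <= 2 * `|M|.
    have [h1 h2] := gE 1 o16; have [_ h3] := hM _ h1 h2; have [_ h4] := hM Q Q16 yE.
    have := cabsB (F n0 (f (g 1))).1 (F n0 (f Q)).1; rewrite -/u.
    have := nrm1 (F n0 (f (g 1))); have := nrm1 (F n0 (f Q)); have := ler_norm M; (clear - HB fh fh' fG fK h4 h3; lra).
  have := cabs_dist (Kf q a f Q n0 (g 1)) u; (clear - HB fh fh' fG fK h; lra).
have A4 : cabs A <= 4 * `|M|.
  move: K1; rewrite AE cabsM => K1; have := ler_wpM2l (cabs_ge0 A) m1.
  have := normr_ge0 M; (clear - HB fh fh' fG fK K1; lra).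
rewrite (hA n P nP tP) !cabsM.
have [_ _ m2] := dlt_level HB VQ nP.
have VFQ : vplus (rr C) (F n0 Q) by have [] := hiter_vplus HB n0 (rr_ge HB) VQ.
have tc := @tau_cmp _ _ _ C (F n0 (f Q)) (F n0 Q) (n - n0) (stail_bnd n0 HB) Vf VFQ.
have {}tc := tc (_ : _ = _); rewrite !gr_shift// fG// in tc; have {}tc := tc erefl.
have te : tau q a Q n = tau q a Q n0 * tau (qs n0) (as_ n0) (F n0 Q) (n - n0) by rewrite -tauD subnKC.
rewrite te cabsM in m2.
set t1 := cabs (tau q a Q n0) in m2; set t2 := cabs (tau (qs n0) _ (F n0 Q) _) in m2 tc.
set d := cabs (dlt q a Q P) in m2 *; set u := cabs (X P n - X Q n) in m2 *.
have t1p : 0 < t1 by rewrite cabs_gt0 (tau_neq0 HB VQ).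
have t1i : t1^-1 <= `|M2| by have := hM2 y yE; rewrite cabsV -/t1; have := ler_norm M2; (clear - HB fh fh' fG fK; lra).
have d0 : 0 <= d by exact: cabs_ge0.
have u0 : 0 <= u by exact: cabs_ge0.
have h1 : t2 * d <= `|M2| * (u * (5 / 4)).
  have -> : t2 * d = t1^-1 * (t1 * t2 * d) by field; rewrite gt_eqF.
  apply: ler_pM => //; first by rewrite invr_ge0 ltW.
  by rewrite !mulr_ge0 ?cabs_ge0// ltW.
have h2 : cabs (tau (qs n0) (as_ n0) (F n0 (f Q)) (n - n0)) * (cabs A * d) <= (expR 2 * t2) * (4 * `|M| * d).
  by apply: ler_pM => //; [rewrite mulr_ge0|rewrite ler_wpM2r].
apply: le_trans h2 _.
have -> : expR 2 * t2 * (4 * `|M| * d) = 4 * `|M| * expR 2 * (t2 * d) by ring.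
have p0 : 0 <= 4 * `|M| * expR 2 by rewrite !mulr_ge0 ?expR_ge0.
apply: le_trans (ler_wpM2l p0 h1) _.
have : 0 <= `|M| * expR 2 * `|M2| * u by rewrite !mulr_ge0 ?expR_ge0.
(clear - HB fh fh' fG fK; lra).
Qed.

End Uniform.

Section ImageBound.
Context {R : realType}.
Implicit Types (z P Q : C2 R) (r y e : R) (n k N : nat).
Variables (q : nat -> {poly R[i]}) (a : nat -> R[i]) (C : R).
Hypothesis HB : forall k, bnd (q k) (a k) C.
Notation F := (hiter q a).
Notation G := (gr q a C).
Notation X := (xorb q a).
Notation qs n := (stail n q).
Notation as_ n := (stail n a).
Notation cg := (cgr C).

Variables (c : R) (f f' : C2 R -> C2 R).
Hypothesis fh : hol [set z | G z < c] f.
Hypothesis fh' : hol [set z | G z < c] f'.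
Hypothesis fG : forall z, G z < c -> G (f z) = G z.
Hypothesis fK : forall z, G z < c -> f' (f z) = z.

(** Above this level [descend] applies, and the transversal point of the leaf has modulus at least
    [rr C + expR cg + 1 + 3 * C ^+ 2]. *)
Definition gone : R := gbig C + ln (rr C + expR cg + 1 + 3 * C ^+ 2) + cg + 1.

Lemma gone_gt0 : 0 < gone.
Proof.
have [c1 *] := Cpow HB; have [_ _ _ b4] := rbig_facts HB.
have cg0 := cgr_gt0 HB; have E0 := expR_gt0 cg.
have r0 : 0 <= rr C by rewrite /rr; lra.
have : 0 <= ln (rr C + expR cg + 1 + 3 * C ^+ 2) by rewrite ln_ge0//; lra.
rewrite /gone; lra.
Qed.

(** [P] is compared with the point [Q = (0, y1)] of its leaf. Since [f] keeps [G], [modulus_cmp]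
    bounds [F_n (f Q)], and [leaf_transfer] places [F_n (f P)] within [4 |v|] of it along the
    leaf. *)
Lemma image_bound g2 : ln (expR (g2 + cg) + 3 * C ^+ 2) + cg < c ->
  exists e n1, [/\ 0 < e, e <= 1 / (40 * 25) & forall n P, (n1 <= n)%N -> cabs (X P n) <= e * cabs (X P n.+1) ->
   gone <= G P <= g2 -> nrm (F n (f P)) <= 4 * cabs (X P n.+1)].
Proof.
move=> g2c; have [c1 c2 c3 c4 c5] := Cpow HB; have [b1 b2 b3 b4] := rbig_facts HB.
pose R1 := rr C + expR cg + 1.
have [R2 R2E] : exists R2, R2 = expR (g2 + cg) + 3 * C ^+ 2 by eexists.
rewrite -R2E in g2c.
have R21 : 1 <= R2 by rewrite R2E; have := expR_gt0 (g2 + cg); lra.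
have rC : rr C = (50 * 40) * C ^+ 5 by [].
have R1r : rr C <= R1 by rewrite /R1; have := expR_gt0 cg; lra.
have R1e : expR cg < R1 by rewrite /R1; lra.
have [n0 [K [K0 hK]]] := uniform_transfer HB fh fh' fG fK R1r R1e g2c.
have R30 : 1 < R1 + 3 * C ^+ 2 by lra.
have [g1 g1E] : exists g1, g1 = gone by eexists.
have g1D : g1 = gbig C + ln (R1 + 3 * C ^+ 2) + cg + 1 by [].
rewrite -g1E.
have cg0 := cgr_gt0 HB.
have lR : 0 <= ln (R1 + 3 * C ^+ 2) by rewrite ln_ge0// ltW.
have g1p : 0 < g1 by rewrite g1D; lra.
(* Small enough that [|v|], at most [2 K e y], is a small fraction of [y], as [leaf_transfer]
   requires. *)
pose e := 1 / ((40 * 25) * (1 + K)).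
have K1 : 0 < (40 * 25) * (1 + K) by lra.
have e0 : 0 < e by rewrite divr_gt0.
have eK : e * (1 + K) = 1 / (40 * 25) by rewrite /e; field; rewrite gt_eqF//; (clear - HB fh fh' fG fK K1; lra).
have eK0 : 0 <= e * K by rewrite mulr_ge0// ltW.
have e1 : e <= 1 / (40 * 25) by (clear - HB fh fh' fG fK eK0 eK; lra).
have b0 : 1 < (rbig C + 1) / e ^+ 2.
  have e2 : 0 < e ^+ 2 by rewrite exprn_gt0.
  rewrite ltr_pdivlMr// mul1r; have : e ^+ 2 <= 1 by rewrite expr_le1//; (clear - HB fh fh' fG fK e1 e0; lra).
  (clear - HB fh fh' fG fK b3; lra).
have [n1 hn1] := hdeg_large HB ((ln ((rbig C + 1) / e ^+ 2) + cg) / g1).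
exists e, (maxn n0 n1).+1; split => // -[//|n] P; rewrite ltnS geq_max => /andP[n0n n1n] Pn /andP[g1P gP2].
have n0n' : (n0 <= n.+1)%N by exact: leqW.
set y := cabs (X P n.+2) in Pn *.
have y0 : 0 <= y by exact: cabs_ge0.
have ey := ler_wpM2r y0 e1.
have ybig : (rbig C + 1) / e ^+ 2 <= y.
  apply: (@green_large _ _ _ _ HB n.+1) => //; first by rewrite -/y; (clear - HB fh fh' fG fK ey y0 Pn; lra).
  have := hn1 n.+1 (leqW n1n); rewrite ltr_pdivrMr// => h.
  have D0 := hdegR_gt0 HB n.+1; have := ler_wpM2l (ltW D0) g1P; (clear - HB fh fh' fG fK h; lra).
have rb : rbig C <= e ^+ 2 * y.
  by move: ybig; rewrite ler_pdivrMr ?exprn_gt0//; (clear - HB fh fh' fG fK; lra).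
have yb : rbig C <= y.
  have : e ^+ 2 * y <= 1 * y by rewrite ler_wpM2r// expr_le1//; (clear - HB fh fh' fG fK e1 e0; lra).
  (clear - HB fh fh' fG fK rb; lra).
have eyb : rbig C <= e * y.
  have : e ^+ 2 * y <= e * y by rewrite ler_wpM2r// expr2 ler_piMl ?(ltW e0)//; (clear - HB fh fh' fG fK e1; lra).
  (clear - HB fh fh' fG fK rb; lra).
have [|||||y1 [h1 h2]] := @step_down _ _ _ _ HB n P e.
- by move=> P1 hP1 GP1; exact: descend.
- by rewrite e0.
- by rewrite -/y; (clear - HB fh fh' fG fK ey Pn; lra).
- by rewrite g1D in g1P; (clear - HB fh fh' fG fK g1P lR cg0; lra).
- exact: rb.
rewrite -/y in h2; pose Q : C2 R := (0, y1).
have n6 : nearby (qs n.+1) (as_ n.+1) (F n.+1 P) (F n.+1 Q) (6 * C ^+ 2).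
  by apply/nearby_lev => k nk; rewrite cabsC; exact: h1.
have n40 : nearby (qs n.+1) (as_ n.+1) (F n.+1 P) (F n.+1 Q) (rho C).
  by move=> k; apply: le_trans (n6 k) _; rewrite /rho; (clear - HB fh fh' fG fK c2 c1; lra).
have GQ : G Q = G P by rewrite (nearby_grN HB n40).
have y1big : R1 + 3 * C ^+ 2 <= cabs y1.
  apply: (@green_large _ _ _ _ HB 0 Q) => //; first by rewrite /xorb /= cabs0 cabs_ge0.
  by rewrite hdeg0 mul1r GQ; rewrite g1D in g1P; (clear - HB fh fh' fG fK g1P b4; lra).
have VQ : vplus (rr C) Q by split; rewrite /= ?cabs0 ?cabs_ge0//; (clear - HB fh fh' fG fK y1big R1r c2 c1; lra).
have y1le : cabs y1 + 3 * C ^+ 2 <= R2.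
  rewrite R2E lerD2r; apply: le_expR_ln; first (clear - HB fh fh' fG fK y1big R30; lra).
  have := gr_vplus HB (vplus_mono (rr_rgood HB) VQ); rewrite GQ ler_norml /=; (clear - HB fh fh' fG fK gP2; lra).
have [Vf hv] := hK y1 y1big y1le.
have XQ1 := h1 n.+2 (ltnSn _); rewrite -/Q in h1 h2 XQ1 Vf hv.
have XQy : cabs (X Q n.+2) <= y + 6 * C ^+ 2 by have := cabs_dist (X Q n.+2) (X P n.+2); rewrite -/y; (clear - HB fh fh' fG fK XQ1; lra).
have yXQ : y - 6 * C ^+ 2 <= cabs (X Q n.+2).
  by have := cabs_dist (X P n.+2) (X Q n.+2); rewrite (cabsC (X P _)) -/y; (clear - HB fh fh' fG fK XQ1; lra).
have dPQ : cabs (X P n.+1 - X Q n.+1) <= 2 * (e * y) by have := cabsB (X P n.+1) (X Q n.+1); (clear - HB fh fh' fG fK h2 Pn; lra).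
have [v vE] : exists v, v = tau (qs n0) (as_ n0) (F n0 (f Q)) (n.+1 - n0) * Kf q a f Q n0 P by eexists.
have Gc : G Q < c.
  have := gr_le HB Q; have : lg Q <= ln R2.
    by apply: lg_le; [exact: R21|rewrite nrm_le /= cabs0; apply/andP; split; (clear - HB fh fh' fG fK yXQ XQy y1le y1big R30; lra)].
  (clear - HB fh fh' fG fK g2c; lra).
have vb : cabs v <= K * cabs (X P n.+1 - X Q n.+1) by rewrite vE; apply: hv => //; (clear - HB fh fh' fG fK dPQ yXQ XQy eyb ey rC b1 c5 c4 c3; lra).
have vb2 : cabs v <= y / (25 * 20).
  have := ler_wpM2l K0 dPQ.
  have : e * K * y <= (1 / (40 * 25)) * y by rewrite ler_wpM2r//; (clear - HB fh fh' fG fK eK e0; lra).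
  (clear - HB fh fh' fG fK vb; lra).
have VfQ : vplus (rr C) (F n.+1 (f Q)) := vplus_tail HB Vf n0n'.
have VQn : vplus (rr C) (F n.+1 Q) by have [] := hiter_vplus HB n.+1 (rr_ge HB) VQ.
have GG : gr (qs n.+1) (as_ n.+1) C (F n.+1 (f Q)) = gr (qs n.+1) (as_ n.+1) C (F n.+1 Q) by rewrite !gr_shift// fG.
have mc1 := modulus_cmp (stail_bnd n.+1 HB) VfQ VQn GG.
have mc2 := modulus_cmp (stail_bnd n.+1 HB) VQn VfQ (esym GG).
rewrite -!/(xorb _ _ _ n.+2) in mc1 mc2.
have mc1' : cabs (X (f Q) n.+2) <= 2 * cabs (X Q n.+2) := mc1.
have mc2' : cabs (X Q n.+2) <= 2 * cabs (X (f Q) n.+2) := mc2.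
have [||nf df] := leaf_transfer HB fh fG VQ Gc Vf n0n' n40 _ vE.
- (clear - HB fh fh' fG fK mc2' mc1' dPQ yXQ eyb ey rC b1 c5 c4 c3; lra).
- (clear - HB fh fh' fG fK mc2' mc1' vb2 yXQ yb rC b1 c5 c4 c3; lra).
have [_ VfQ2] := VfQ.
have VfQ3 : cabs (X (f Q) n.+1) <= cabs (X (f Q) n.+2) := VfQ2.
rewrite nrm_le; apply/andP; split.
  change (cabs (X (f P) n.+1) <= 4 * y).
  have := cabs_dist (X (f P) n.+1) (X (f Q) n.+1); (clear - HB fh fh' fG fK VfQ3 df mc2' mc1' vb2 XQy yb rC b1 c5 c4 c3; lra).
change (cabs (X (f P) n.+2) <= 4 * y).
have /nearby_lev nf' := nf; have := nf' n.+2 (ltnSn _).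
have := cabs_dist (X (f P) n.+2) (X (f Q) n.+2); (clear - HB fh fh' fG fK mc2' mc1' XQy yb rC b1 c5 c4 c3; lra).
Qed.

End ImageBound.

(** * Affine approximation and exactness *)

Section Interp.
Context {R : realType}.
Implicit Types (x y s p : R[i]) (r T M : R).

(** Interpolation at 0 and 1 replaces the Taylor polynomial, so that no derivatives of [f_n] have to
    be carried along. *)
Lemma interp (g : R[i] -> R[i]) T M p r : 2 <= T -> (forall s, cabs s <= T -> cdiff g s) ->
  (forall s, cabs s = T -> cabs (g s) <= M) -> 1 <= r -> cabs p <= r -> r <= T / 2 ->
  cabs (g p - g 0 - p * (g 1 - g 0)) <= 8 * M * r ^+ 2 / T ^+ 2.
Proof.
move=> T2 gd gM r1 pr rT; have T0 : 0 < T by lra.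
have [l [_ hl]] := taylor2 T0 gd gM.
have M0 : 0 <= M.
  apply: le_trans (gM T%:C _); first exact: cabs_ge0.
  by rewrite cabsR gtr0_norm.
have h1 := hl p (le_trans pr rT).
have o1 : cabs (1 : R[i]) <= T / 2 by rewrite cabs1; lra.
have := hl 1 o1; rewrite cabs1 expr1n mulr1 mulr1 => h2.
have -> : g p - g 0 - p * (g 1 - g 0) = (g p - g 0 - l * p) - p * (g 1 - g 0 - l) by ring.
apply: le_trans (cabsB _ _) _; rewrite cabsM.
have T20 : 0 < T ^+ 2 by rewrite exprn_gt0.
have MT : 0 <= 4 * M / T ^+ 2 by rewrite divr_ge0 ?(ltW T20)// mulr_ge0.
have p0 := cabs_ge0 p.
have pp : cabs p ^+ 2 <= r ^+ 2 by rewrite ler_sqr ?nnegrE//; lra.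
have pr2 : cabs p <= r ^+ 2 by rewrite expr2; apply: le_trans pr _; rewrite ler_peMl//; lra.
have h3 := ler_wpM2l MT pp; have h4 := ler_wpM2l MT pr2; have h5 := ler_wpM2l p0 h2.
have -> : 8 * M * r ^+ 2 / T ^+ 2 = 4 * M / T ^+ 2 * r ^+ 2 + 4 * M / T ^+ 2 * r ^+ 2 by ring.
apply: lerD; first by apply: le_trans h1 _; rewrite mulrAC.
by apply: le_trans h5 _; rewrite mulrC.
Qed.

(** The mixed second difference is absent from the affine interpolant; [schwarz] in each variable
    bounds it. *)
Lemma interp2 (Phi : R[i] -> R[i] -> R[i]) T M x y r : 2 <= T ->
  (forall x y, cabs x <= T -> cabs y <= T -> cdiff (Phi x) y /\ cdiff (fun x => Phi x y) x) ->
  (forall x y, cabs x <= T -> cabs y <= T -> cabs (Phi x y) <= M) ->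
  1 <= r -> cabs x <= r -> cabs y <= r -> r <= T / 2 ->
  cabs (Phi x y - (Phi 0 0 + (Phi 1 0 - Phi 0 0) * x + (Phi 0 1 - Phi 0 0) * y)) <= 80 * M * r ^+ 2 / T ^+ 2.
Proof.
move=> T2 Pd PM r1 xr yr rT; have T0 : 0 < T by lra.
have z0 : cabs (0 : R[i]) <= T by rewrite cabs0 ltW.
have o1 : cabs (1 : R[i]) <= T by rewrite cabs1; lra.
have xT : cabs x <= T by lra.
have M0 : 0 <= M := le_trans (cabs_ge0 _) (PM 0 0 z0 z0).
have h1 := @interp (Phi x) T M y r T2 (fun s sT => (Pd x s xT sT).1) (fun s sT => PM x s xT (eq_ind_r (fun u => u <= T) (lexx T) sT)) r1 yr rT.
have h2 := @interp (fun x => Phi x 0) T M x r T2 (fun s sT => (Pd s 0 sT z0).2) (fun s sT => PM s 0 (eq_ind_r (fun u => u <= T) (lexx T) sT) z0) r1 xr rT.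
have z2 : cabs (0 : R[i]) <= T / 2 by rewrite cabs0; lra.
have o2 : cabs (1 : R[i]) <= T / 2 by rewrite cabs1; lra.
have psi s : cabs s <= T -> cabs (Phi s 1 - Phi s 0) <= 8 * M / T.
  move=> sT; have := @schwarz _ (Phi s) 1 0 T M o2 z2 T0 (fun u uT => (Pd s u sT uT).1) (fun u uT => PM s u sT (eq_ind_r (fun v => v <= T) (lexx T) uT)).
  by rewrite subr0 cabs1 mulr1.
have h3 : cabs ((Phi x 1 - Phi x 0) - (Phi 0 1 - Phi 0 0)) <= 8 * (8 * M / T) * cabs (x - 0) / T.
  apply: (@schwarz _ (fun x => Phi x 1 - Phi x 0)) => //; first lra.
    by move=> s sT; apply: cdiffB; [have [] := Pd s 1 sT o1|have [] := Pd s 0 sT z0].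
  by move=> s sT; apply: psi; rewrite sT.
have h4 : cabs (y * ((Phi x 1 - Phi x 0) - (Phi 0 1 - Phi 0 0))) <= 64 * M * r ^+ 2 / T ^+ 2.
  rewrite cabsM subr0 in h3 *.
  have -> : 64 * M * r ^+ 2 / T ^+ 2 = r * (8 * (8 * M / T) * r / T) by field; rewrite gt_eqF.
  apply: ler_pM => //; apply: le_trans h3 _.
  rewrite ler_pM2r ?invr_gt0//; apply: ler_wpM2l => //.
  by rewrite mulr_ge0// divr_ge0 ?(ltW T0)// mulr_ge0.
have -> : Phi x y - (Phi 0 0 + (Phi 1 0 - Phi 0 0) * x + (Phi 0 1 - Phi 0 0) * y) =
  (Phi x y - Phi x 0 - y * (Phi x 1 - Phi x 0)) + (Phi x 0 - Phi 0 0 - x * (Phi 1 0 - Phi 0 0))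
   + y * ((Phi x 1 - Phi x 0) - (Phi 0 1 - Phi 0 0)) by ring.
have -> : 80 * M * r ^+ 2 / T ^+ 2 = 8 * M * r ^+ 2 / T ^+ 2 + 8 * M * r ^+ 2 / T ^+ 2 + 64 * M * r ^+ 2 / T ^+ 2 by ring.
apply: le_trans (cabsD _ _) _; apply: lerD => //.
by apply: le_trans (cabsD _ _) _; apply: lerD.
Qed.

End Interp.

(** * The conjugates [f_n] on bidiscs *)

Section Box.
Context {R : realType}.
Implicit Types (z P : C2 R) (r S : R) (n k N : nat) (s : R[i]).
Variables (q : nat -> {poly R[i]}) (a : nat -> R[i]) (C : R).
Hypothesis HB : forall k, bnd (q k) (a k) C.
Notation F := (hiter q a).
Notation Fi := (hiterV q a).
Notation D := (hdeg q).
Notation G := (gr q a C).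
Notation X := (xorb q a).
Notation qs n := (stail n q).
Notation as_ n := (stail n a).
Notation cg := (cgr C).
Variables (c : R) (f : C2 R -> C2 R).
Hypothesis fh : hol [set z | G z < c] f.
Hypothesis fG : forall z, G z < c -> G (f z) = G z.
Variables (g1 g2 ep : R) (n1 : nat).
Hypothesis g1r : ln (rr C) <= g1.
Hypothesis g12 : 2 * cg + 1 <= g2 - g1.
Hypothesis g2c : g2 < c.
Hypothesis ep0 : 0 < ep.
Hypothesis ep1 : ep <= 1.
Hypothesis IB : forall n P, (n1 <= n)%N -> cabs (X P n) <= ep * cabs (X P n.+1) ->
   g1 <= G P <= g2 -> nrm (F n (f P)) <= 4 * cabs (X P n.+1).

Definition fl n z := F n (f (Fi n z)).
(** A point of [V+] whose second coordinate has modulus between [Smin] and [Smax] at level [n] comes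
    from a point with [G] between [g1] and [g2]; the terms [cg] are the error of [gr_vplus]. *)
Definition Smin n : R := expR ((D n)%:R * g1 + cg).
Definition Smax n : R := expR ((D n)%:R * g2 - cg).

Lemma fl_gr n z : G (Fi n z) < c -> gr (qs n) (as_ n) C (fl n z) = gr (qs n) (as_ n) C z.
Proof. by move=> h; rewrite /fl gr_shift// fG// -grV_shift. Qed.

Lemma fl_henon n z : fl n.+1 (henon (q n) (a n) z) = henon (q n) (a n) (fl n z).
Proof. by rewrite /fl /= (henonK HB). Qed.

Lemma Sm_order n : Smin n <= Smax n.
Proof.
have h12 := g12; have h2c := g2c; have he0 := ep0; have he1 := ep1; have h1r := g1r.
rewrite ler_expR; have D1 : 1 <= (D n)%:R :> R by rewrite ler1n (hdeg_gt0 HB).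
have cg0 := cgr_gt0 HB.
have : 1 * (g2 - g1) <= (D n)%:R * (g2 - g1) by rewrite ler_wpM2r//; lra.
lra.
Qed.

Lemma Smin_rr n : rr C <= Smin n.
Proof.
have h12 := g12; have h2c := g2c; have he0 := ep0; have he1 := ep1; have h1r := g1r.
have [c1 *] := Cpow HB; have r0 : 0 < rr C by rewrite /rr; lra.
have l0 : 0 <= ln (rr C) by rewrite ln_ge0// /rr; lra.
apply: le_expR_ln => //; have D1 : 1 <= (D n)%:R :> R by rewrite ler1n (hdeg_gt0 HB).
have cg0 := cgr_gt0 HB.
have : 1 * g1 <= (D n)%:R * g1 by rewrite ler_wpM2r//; lra.
lra.
Qed.

Lemma dom_box n z S : nrm z <= S -> Smin n <= S -> S <= Smax n -> G (Fi n z) < c.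
Proof.
have h12 := g12; have h2c := g2c; have he0 := ep0; have he1 := ep1; have h1r := g1r.
move=> zS S1 S2; have D0 := hdegR_gt0 HB n.
have [c1 *] := Cpow HB; have S0 : 1 <= S by have := Smin_rr n; rewrite /rr; lra.
rewrite -(ltr_pM2l D0) -grV_shift//; apply: le_lt_trans (gr_le (stail_bnd n HB) z) _.
have h1 := lg_le S0 zS; have h2 : ln S <= (D n)%:R * g2 - cg.
  by rewrite -[leRHS]expRK ler_ln ?posrE ?expR_gt0//; lra.
have : (D n)%:R * g2 < (D n)%:R * c by rewrite ltr_pM2l.
lra.
Qed.

Lemma fl_cdiff n (g : R[i] -> C2 R) s : cdiff2 g s -> G (Fi n (g s)) < c -> cdiff2 (fun s => fl n (g s)) s.
Proof.
have h12 := g12; have h2c := g2c; have he0 := ep0; have he1 := ep1; have h1r := g1r.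
move=> gd gc; apply: (@cdiff2_hiter _ q a n (fun s => f (Fi n (g s)))).
by apply: (hol_curve fh) => //; exact: cdiff2_hiterV.
Qed.

(** [IB] bounds [f_n] on the circle [|y| = S], where [G] lies between [g1] and [g2]; the maximum
    principle in [y] fills the disc, including points with small [G]. *)
Lemma box n z S : (n1 <= n)%N -> Smin n <= S -> S <= Smax n -> cabs z.1 <= ep * S -> cabs z.2 <= S ->
  nrm (fl n z) <= 4 * S.
Proof.
have h12 := g12; have h2c := g2c; have he0 := ep0; have he1 := ep1; have h1r := g1r.
move=> n1n S1 S2 z1 z2; have D0 := hdegR_gt0 HB n.
have [c1 *] := Cpow HB; have S0 : 1 <= S by have := Smin_rr n; rewrite /rr; lra.
have epS : ep * S <= S by rewrite ler_piMl//; lra.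
have dom y : cabs y <= S -> G (Fi n (z.1, y)) < c.
  move=> yS; apply: (dom_box _ S1 S2); rewrite nrm_le /= yS andbT; lra.
have gd y : cabs y <= S -> cdiff2 (fun y => fl n (z.1, y)) y.
  move=> yS; apply: (@fl_cdiff n (fun y => (z.1, y))); last exact: dom.
  by split => /=; [exact: cdiff_cst|exact: cdiff_id].
have circ y : cabs y = S -> nrm (fl n (z.1, y)) <= 4 * S.
  move=> yS; have FP : F n (Fi n (z.1, y)) = (z.1, y) by rewrite (hiterVK HB).
  have X1 : X (Fi n (z.1, y)) n = z.1 by rewrite /xorb FP.
  have X2 : X (Fi n (z.1, y)) n.+1 = y by rewrite xorbS FP.
  rewrite -yS -{2}X2; apply: IB => //; first by rewrite X1 X2 yS.
  have V : vplus (rgood C) ((z.1, y) : C2 R).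
    split => /=; rewrite yS; last lra.
    by apply: le_trans (rr_rgood HB) _; apply: le_trans (Smin_rr n) S1.
  have := gr_vplus (stail_bnd n HB) V; rewrite /= yS grV_shift// ler_norml => /andP[h1 h2].
  have h3 : (D n)%:R * g1 + cg <= ln S.
    by rewrite -[leLHS]expRK ler_ln ?posrE ?expR_gt0//; lra.
  have h4 : ln S <= (D n)%:R * g2 - cg.
    by rewrite -[leRHS]expRK ler_ln ?posrE ?expR_gt0//; lra.
  by apply/andP; split; rewrite -(ler_pM2l D0); lra.
have [z2S|z2S] := leP S (cabs z.2).
  have := circ z.2; case: z {gd circ dom z1} z2 z2S => u v /= v1 v2; apply.
  by apply/eqP; rewrite eq_le v1.
rewrite -[z]/(z) nrm_le; case: z z1 z2 z2S gd circ {dom} => u v /= z1 z2 z2S gd circ.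
apply/andP; split.
  apply: (@mp_disc _ (fun y => (fl n (u, y)).1) v S) => //; first by move=> s /gd[].
  by move=> s /circ; apply: le_trans; exact: nrm1.
apply: (@mp_disc _ (fun y => (fl n (u, y)).2) v S) => //; first by move=> s /gd[].
by move=> s /circ; apply: le_trans; exact: nrm2.
Qed.

(* The coefficients of the affine map that interpolates [fl n]. *)
Definition ee n := (fl n (0, 0)).1.
Definition al n := (fl n (1, 0)).1 - (fl n (0, 0)).1.
Definition be n := (fl n (0, 1)).1 - (fl n (0, 0)).1.
Definition ee2 n := (fl n (0, 0)).2.
Definition ga n := (fl n (1, 0)).2 - (fl n (0, 0)).2.
Definition ka n := (fl n (0, 1)).2 - (fl n (0, 0)).2.

(** [interp2] on the bidisc of radius [ep * Smax] with the bound [4 Smax] from [box]; the constant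
    is [80 * 4 / ep^2]. *)
Lemma aff1 n z r : (n1 <= n)%N -> 2 <= ep * Smax n -> 1 <= r -> nrm z <= r -> r <= ep * Smax n / 2 ->
  cabs ((fl n z).1 - (ee n + al n * z.1 + be n * z.2)) <= 32 * 10 / ep ^+ 2 * r ^+ 2 / Smax n /\
  cabs ((fl n z).2 - (ee2 n + ga n * z.1 + ka n * z.2)) <= 32 * 10 / ep ^+ 2 * r ^+ 2 / Smax n.
Proof.
have h12 := g12; have h2c := g2c; have he0 := ep0; have he1 := ep1; have h1r := g1r.
move=> n1n T2 r1; rewrite nrm_le => /andP[z1 z2] rT.
have S0 : 0 < Smax n := expR_gt0 _.
have eS : ep * Smax n <= Smax n by rewrite ler_piMl// ltW.
have dom x y : cabs x <= ep * Smax n -> cabs y <= ep * Smax n -> G (Fi n (x, y)) < c.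
  move=> xT yT; apply: (dom_box _ (Sm_order n) (lexx _)).
  by rewrite nrm_le /=; apply/andP; split; lra.
have bd x y : cabs x <= ep * Smax n -> cabs y <= ep * Smax n -> nrm (fl n (x, y)) <= 4 * Smax n.
  move=> xT yT; apply: (box n1n (Sm_order n) (lexx _)) => //=; lra.
have dd x y : cabs x <= ep * Smax n -> cabs y <= ep * Smax n -> cdiff2 (fun y => fl n (x, y)) y /\ cdiff2 (fun x => fl n (x, y)) x.
  move=> xT yT; split.
    by apply: (@fl_cdiff n (fun y => (x, y))); [split => /=; [exact: cdiff_cst|exact: cdiff_id]|exact: dom].
  by apply: (@fl_cdiff n (fun x => (x, y))); [split => /=; [exact: cdiff_id|exact: cdiff_cst]|exact: dom].
have cE : 80 * (4 * Smax n) * r ^+ 2 / (ep * Smax n) ^+ 2 = 32 * 10 / ep ^+ 2 * r ^+ 2 / Smax n.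
  by field; rewrite !gt_eqF.
rewrite -cE; case: z z1 z2 => x y /= z1 z2; split.
  apply: (@interp2 _ (fun x y => (fl n (x, y)).1)) => //.
    by move=> u v uT vT; have [[h1 _] [h2 _]] := dd u v uT vT.
  by move=> u v uT vT; apply: le_trans (nrm1 _) (bd u v uT vT).
apply: (@interp2 _ (fun x y => (fl n (x, y)).2)) => //.
  by move=> u v uT vT; have [[_ h1] [_ h2]] := dd u v uT vT.
by move=> u v uT vT; apply: le_trans (nrm2 _) (bd u v uT vT).
Qed.

Lemma coef_bound n : (n1 <= n)%N -> 2 <= ep * Smax n ->
  [/\ cabs (al n) <= 32 / ep, cabs (ee n) <= 4 * Smin n & cabs (ee2 n) <= 4 * Smin n].
Proof.
have h12 := g12; have h2c := g2c; have he0 := ep0; have he1 := ep1; have h1r := g1r.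
move=> n1n T2; have S0 : 0 < Smax n := expR_gt0 _.
have eS : ep * Smax n <= Smax n by rewrite ler_piMl// ltW.
have T0 : 0 < ep * Smax n by rewrite mulr_gt0.
have Sm0 : 0 < Smin n := expR_gt0 _.
have b0 : nrm (fl n (0, 0)) <= 4 * Smin n.
  by apply: (box n1n (lexx _) (Sm_order n)); rewrite /= cabs0 ?mulr_ge0// ltW.
split.
- have zx (x : R[i]) : cabs x <= ep * Smax n -> nrm ((x, 0) : C2 R) <= Smax n.
    by move=> xT; rewrite nrm_le /= cabs0; apply/andP; split; lra.
  have := @schwarz _ (fun x => (fl n (x, 0)).1) 1 0 (ep * Smax n) (4 * Smax n).
  rewrite subr0 cabs1 cabs0 mulr1 => h.
  have -> : 32 / ep = 8 * (4 * Smax n) / (ep * Smax n) by field; rewrite !gt_eqF.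
  apply: h => //; first lra.
  + lra.
  + move=> x xT; suff [] : cdiff2 (fun x => fl n (x, 0)) x by [].
    apply: (@fl_cdiff n (fun x => (x, 0))); first by split => /=; [exact: cdiff_id|exact: cdiff_cst].
    by apply: (dom_box (zx x xT) (Sm_order n)).
  + move=> x xT; apply: le_trans (nrm1 _) _; apply: (box n1n (Sm_order n)) => //=; rewrite ?xT ?cabs0//; lra.
- exact: le_trans (nrm1 _) b0.
- exact: le_trans (nrm2 _) b0.
Qed.

End Box.

(** * Nearly diagonal affine approximations *)

Section Coefficients.
Context {R : realType}.
Implicit Types (z P : C2 R) (r S : R) (n k N : nat).
Variables (q : nat -> {poly R[i]}) (a : nat -> R[i]) (C : R).
Hypothesis HB : forall k, bnd (q k) (a k) C.
Notation F := (hiter q a).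
Notation Fi := (hiterV q a).
Notation D := (hdeg q).
Notation G := (gr q a C).
Notation X := (xorb q a).
Notation cg := (cgr C).
Notation Cb := (Num.bound C).
Variables (c : R) (f : C2 R -> C2 R).
Hypothesis fh : hol [set z | G z < c] f.
Hypothesis fG : forall z, G z < c -> G (f z) = G z.
Variables (g1 g2 ep : R) (n1 : nat).
Hypothesis g1r : ln (rr C) <= g1.
Hypothesis g12 : 2 * cg + 1 <= g2 - g1.
Hypothesis g2c : g2 < c.
Hypothesis ep0 : 0 < ep.
Hypothesis ep1 : ep <= 1.
Hypothesis IB : forall n P, (n1 <= n)%N -> cabs (X P n) <= ep * cabs (X P n.+1) ->
   g1 <= G P <= g2 -> nrm (F n (f P)) <= 4 * cabs (X P n.+1).
Hypothesis g12C : C * g1 + 1 <= g2.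
Notation fl := (fl q a f).
Notation Smin := (Smin q C g1).
Notation Smax := (Smax q C g2).
Notation ee := (ee q a f).
Notation al := (al q a f).
Notation be := (be q a f).
Notation ee2 := (ee2 q a f).
Notation ga := (ga q a f).
Notation ka := (ka q a f).

Lemma g1_ge0 : 0 <= g1.
Proof.
have [c1 *] := Cpow HB; have h1r := g1r; apply: le_trans h1r.
by rewrite ln_ge0// /rr; lra.
Qed.

Lemma g2_gt0 : 0 < g2.
Proof. by have h := g12; have := g1_ge0; have := cgr_gt0 HB; lra. Qed.

Lemma hdeg_step n : (D n.+1)%:R <= C * (D n)%:R.
Proof. by rewrite hdegS natrM mulrC ler_wpM2r// (bdegC (HB n)). Qed.

Lemma Smax_mono n : Smax n <= Smax n.+1.
Proof.
rewrite ler_expR lerD2r; apply: ler_wpM2r; first exact: ltW g2_gt0.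
by rewrite ler_nat hdegS leq_pmulr// (leq_trans _ (bdeg (HB n))).
Qed.

Lemma Smin_ge1 n : 1 <= Smin n.
Proof.
apply: expR_ge1; rewrite addr_ge0 ?mulr_ge0 ?g1_ge0//; exact: ltW (cgr_gt0 HB).
Qed.

Lemma Smax_large K : exists N, forall n, (N <= n)%N -> K <= Smax n.
Proof.
have [N hN] := hdeg_large HB ((`|K| + cg) / g2); exists N => n /hN.
rewrite ltr_pdivrMr ?g2_gt0// => h; apply: le_trans (ler_norm K) _.
have := expR_ge1Dx ((D n)%:R * g2 - cg); rewrite /Smax; lra.
Qed.

Lemma Smin_Smax K : exists N, forall n, (N <= n)%N -> K * Smin n.+1 <= Smax n.
Proof.
have [N hN] := hdeg_large HB (ln (`|K| + 1) + 2 * cg); exists N => n /hN h.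
have K1 : 0 < `|K| + 1 by rewrite ltr_wpDl.
have k0 : K <= `|K| + 1 by have := ler_norm K; lra.
apply: le_trans (ler_wpM2r (ltW (expR_gt0 _)) k0) _.
have -> : `|K| + 1 = expR (ln (`|K| + 1)) by rewrite lnK.
rewrite -expRD ler_expR.
have h1 := ler_wpM2r g1_ge0 (hdeg_step n); have D0 := hdegR_gt0 HB n.
have := ler_wpM2l (ltW D0) g12C; lra.
Qed.

Lemma horner_box k y r : 1 <= r -> cabs y <= r -> cabs (q k).[y] <= C * r ^+ Cb.
Proof.
move=> r1 yr; have [c1 *] := Cpow HB; apply: le_trans (bup (HB k) r1 yr) _.
by apply: ler_wpM2l; [lra|rewrite ler_weXn2l// (pdeg_bound HB)].
Qed.

(** A common point [Y] at which every [q_k] leaves the chord through its values at 0 and 1. It makes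
    a coefficient of [q_n(y)] visible next to affine terms. *)
Lemma quadratic_growth : exists2 Y, 1 <= Y & forall k,
  1 <= cabs ((q k).[Y%:C] - (q k).[0] - Y%:C * ((q k).[1] - (q k).[0])).
Proof.
have [c1 *] := Cpow HB; have E0 := expR_ge1 (_ : 0 <= C + 1).
have {}E0 : 1 <= expR (C + 1) by apply: E0; lra.
(* Chosen so that [Y^2 exp (- C - 1)], a lower bound of [|q_k(Y)|], equals [Y (4 C + 2)] and
   dominates the chord, which is at most [C + 2 C Y]. *)
exists ((4 * C + 2) * expR (C + 1)).
  by have := ler_wpM2l (_ : 0 <= 4 * C + 2) E0; lra.
move=> k; set Y := (_ + _) * _.
have Y1 : 4 * C + 2 <= Y by have := ler_wpM2l (_ : 0 <= 4 * C + 2) E0; rewrite -/Y; lra.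
have cY : cabs Y%:C = Y by rewrite cabsR ger0_norm//; lra.
have YC : C <= cabs Y%:C by rewrite cY; lra.
have zs : cabs (0 : R[i]) <= cabs Y%:C by rewrite cabs0 cabs_ge0.
have := blog (HB k) YC zs; rewrite mulr0 subr0 cY => hl.
have hl2 := blead (HB k).
have hl3 : C / Y <= 1 by rewrite ler_pdivrMr; lra.
have l0 : 0 <= ln Y by rewrite ln_ge0//; lra.
have d2 : 2 <= (pdeg (q k))%:R :> R by rewrite ler_nat; exact: bdeg (HB k).
have hl4 := ler_wpM2r l0 d2.
have hl5 : 2 * ln Y - C - 1 <= ln (cabs (q k).[Y%:C]).
  by move: hl hl2; rewrite !ler_norml => /andP[? _] /andP[? _]; lra.
have q0 : 0 < cabs (q k).[Y%:C] by have := bpos (HB k) YC zs; rewrite mulr0 subr0 cY; lra.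
have h5 : Y * (4 * C + 2) <= cabs (q k).[Y%:C].
  rewrite -[leRHS]lnK ?posrE//.
  have -> : Y * (4 * C + 2) = expR (2 * ln Y - C - 1); last by rewrite ler_expR.
  have Y0 : 0 < Y by lra.
  have -> : 2 * ln Y - C - 1 = ln Y + ln Y + - (C + 1) by ring.
  rewrite !expRD lnK ?posrE// -mulrA; congr (_ * _).
  by rewrite expRN /Y mulfK// gt_eqF ?expR_gt0.
have b0 := horner_box k (lexx 1) (_ : cabs 0 <= 1).
have {}b0 : cabs (q k).[0] <= C by have := b0; rewrite cabs0 expr1n mulr1; apply.
have b1 := horner_box k (lexx 1) (_ : cabs 1 <= 1).
have {}b1 : cabs (q k).[1] <= C by have := b1; rewrite cabs1 expr1n mulr1; apply.
have := cabs_dist (q k).[Y%:C] ((q k).[0] + Y%:C * ((q k).[1] - (q k).[0])).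
rewrite opprD addrA => h.
have := cabsD (q k).[0] (Y%:C * ((q k).[1] - (q k).[0])); rewrite cabsM cY.
have h6 : cabs ((q k).[1] - (q k).[0]) <= 2 * C by have := cabsB (q k).[1] (q k).[0]; lra.
have := ler_wpM2l (_ : 0 <= Y) h6; have := ler_wpM2r (_ : 0 <= 2 * C) Y1; lra.
Qed.

(** The second coordinate of [f_n z] is the first one of [f_(n+1)] at the next point, so the same
    number has two affine approximations. Comparing them kills the cross terms [be] and [ga] and
    identifies [ee2], [ka] at level [n] with [ee], [al] at level [n + 1], up to [O(1 / Smax)]. *)
Lemma aff2 : exists K N, 1 <= K /\ forall n, (N <= n)%N ->
  [/\ cabs (al n.+1) <= K, cabs (ee n.+1) <= K * Smin n &
    forall z r, 1 <= r -> nrm z <= r -> K * r <= Smax n ->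
      cabs ((fl n z).2 - (ee n.+1 + al n.+1 * z.2)) <= K * r ^+ 2 / Smax n /\
      cabs ((fl n.+1 z).1 - (ee n.+1 + al n.+1 * z.1)) <= K * r ^+ 2 / Smax n].
Proof.
have h0 := ep0; have h1 := ep1.
have [c1 c2 _ _ _] := Cpow HB; have [Y Y1 hY] := quadratic_growth.
have [K0 K0E] : exists K0, K0 = 32 * 10 / ep ^+ 2 by eexists.
have K0p : 0 <= K0 by rewrite K0E divr_ge0// exprn_ge0// ltW.
have [Rb RbE] : exists Rb, Rb = C * Y ^+ Cb + C + Y by eexists.
have Yb : 1 <= Y ^+ Cb by rewrite exprn_ege1.
have CY : C <= C * Y ^+ Cb by rewrite ler_peMr//; lra.
have [dl dlE] : exists dl, dl = 2 * K0 * Rb ^+ 2 by eexists.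
have dl0 : 0 <= dl by rewrite dlE; apply: mulr_ge0; [lra|apply: exprn_ge0; lra].
have CYd : 0 <= C * Y by rewrite mulr_ge0//; lra.
have [B BE] : exists B, B = (2 + 8 * (C * Y)) * dl by eexists.
have B0 : 0 <= B by rewrite BE mulr_ge0//; lra.
have [N1 hN1] := Smax_large (2 * Rb / ep).
pose K := 1 + K0 + 4 * B + 2 / ep + 32 / ep + 4 + 4.
have e2 : 0 <= 2 / ep by rewrite divr_ge0// ltW.
have e32 : 0 <= 32 / ep by rewrite divr_ge0// ltW.
exists K, (maxn n1 N1); split; first by rewrite /K; lra.
move=> n; rewrite geq_max => /andP[n1n /hN1 hS].
have n1n' : (n1 <= n.+1)%N by exact: leqW.
have S0 : 0 < Smax n := expR_gt0 _; have S0' : 0 < Smax n.+1 := expR_gt0 _.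
have SS := Smax_mono n.
have T1 : Rb <= ep * Smax n / 2.
  by move: hS; rewrite ler_pdivrMr//; lra.
have T2 : 2 <= ep * Smax n by lra.
have eSS : ep * Smax n <= ep * Smax n.+1 by rewrite ler_wpM2l// ltW.
have T2' : 2 <= ep * Smax n.+1 by lra.
have Rb1 : 1 <= Rb by (clear - HB fh fG g1r g12 g2c ep0 ep1 IB g12C CY RbE Y1 c1; lra).
have inv : 1 / Smax n.+1 <= 1 / Smax n by rewrite ler_pM2l// lef_pV2 ?posrE.
have A1 m z r := aff1 HB fh g1r g12 g2c ep0 ep1 IB (n := m) (z := z) (r := r).
have id1 x y : cabs x <= 1 -> cabs y <= Y ->
    cabs ((ee n.+1 - ee2 n) + (al n.+1 - ka n) * y + be n.+1 * ((q n).[y] - a n * x) - ga n * x) <= dl / Smax n.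
  move=> x1 y1.
  have zb : nrm ((x, y) : C2 R) <= Rb by rewrite nrm_le /=; apply/andP; split; (clear - HB fh fG g1r g12 g2c ep0 ep1 IB g12C x1 Rb1 y1 CY RbE c1; lra).
  have hb : nrm (henon (q n) (a n) (x, y)) <= Rb.
    rewrite nrm_le /henon /=; apply/andP; split; first (clear - HB fh fG g1r g12 g2c ep0 ep1 IB g12C y1 CY RbE c1; lra).
    have := cabsB (q n).[y] (a n * x); have := horner_box n Y1 y1; rewrite cabsM.
    have := ler_pM (cabs_ge0 _) (cabs_ge0 _) (ba (HB n)) x1; (clear - HB fh fG g1r g12 g2c ep0 ep1 IB g12C RbE Y1; lra).
  have [_ p2] := A1 n _ _ n1n T2 Rb1 zb T1.
  have T1' : Rb <= ep * Smax n.+1 / 2 by (clear - HB fh fG g1r g12 g2c ep0 ep1 IB g12C eSS T1; lra).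
  have [p1 _] := A1 n.+1 _ _ n1n' T2' Rb1 hb T1'.
  rewrite (fl_henon HB) /henon /= in p1 p2.
  rewrite -K0E in p1 p2.
  have p3 : K0 * Rb ^+ 2 / Smax n.+1 <= K0 * Rb ^+ 2 / Smax n.
    apply: ler_wpM2l; last by move: inv; rewrite !mul1r.
    by apply: mulr_ge0 => //; apply: exprn_ge0; (clear - HB fh fG g1r g12 g2c ep0 ep1 IB g12C Rb1; lra).
  set u := (fl n (x, y)).2 in p1 p2.
  have -> : (ee n.+1 - ee2 n) + (al n.+1 - ka n) * y + be n.+1 * ((q n).[y] - a n * x) - ga n * x =
    (u - (ee2 n + ga n * x + ka n * y)) - (u - (ee n.+1 + al n.+1 * y + be n.+1 * ((q n).[y] - a n * x))) by ring.
  apply: le_trans (cabsB _ _) _; rewrite dlE; (clear - HB fh fG g1r g12 g2c ep0 ep1 IB g12C p2 p1 p3; lra).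
have z0 : cabs (0 : R[i]) <= 1 by rewrite cabs0.
have o1 : cabs (1 : R[i]) <= 1 by rewrite cabs1.
have zY : cabs (0 : R[i]) <= Y by rewrite cabs0; (clear - HB fh fG g1r g12 g2c ep0 ep1 IB g12C Y1; lra).
have oY : cabs (1 : R[i]) <= Y by rewrite cabs1.
have YY : cabs Y%:C <= Y by rewrite cabsR ger0_norm//; (clear - HB fh fG g1r g12 g2c ep0 ep1 IB g12C Y1; lra).
have a00 := id1 0 0 z0 zY; have a01 := id1 0 1 z0 oY; have a0Y := id1 0 _ z0 YY; have a10 := id1 1 0 o1 zY.
rewrite !mulr0 !subr0 ?addr0 in a00 a01 a0Y a10.
set A := ee n.+1 - ee2 n in a00 a01 a0Y a10; set B' := al n.+1 - ka n in a01 a0Y.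
set b := be n.+1 in a00 a01 a0Y a10; set d := dl / Smax n in a00 a01 a0Y a10.
have d0 : 0 <= d by rewrite divr_ge0// ltW.
have Yd : d <= Y * d by rewrite ler_peMl.
(* The values at [y = 0], 1 and [Y] with [x = 0] eliminate the affine part and leave [b] times the
   deviation from the chord. *)
have bE : cabs b <= 4 * (Y * d).
  have hq := hY n; set Q := (X in cabs X) in hq.
  have h : cabs (b * Q) <= 4 * (Y * d).
    have -> : b * Q = (A + B' * Y%:C + b * (q n).[Y%:C]) - (A + b * (q n).[0]) -
       Y%:C * ((A + B' * 1 + b * (q n).[1]) - (A + b * (q n).[0])) by rewrite /Q; ring.
    apply: le_trans (cabsB _ _) _; rewrite cabsM cabsR (ger0_norm (_ : 0 <= Y)); last (clear - HB fh fG g1r g12 g2c ep0 ep1 IB g12C Y1; lra).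
    have := cabsB (A + B' * Y%:C + b * (q n).[Y%:C]) (A + b * (q n).[0]).
    have h2 : cabs ((A + B' * 1 + b * (q n).[1]) - (A + b * (q n).[0])) <= 2 * d.
      by apply: le_trans (cabsB _ _) _; (clear - HB fh fG g1r g12 g2c ep0 ep1 IB g12C a01 a00; lra).
    have := ler_wpM2l (_ : 0 <= Y) h2; (clear - HB fh fG g1r g12 g2c ep0 ep1 IB g12C Yd a0Y a00 Y1; lra).
  rewrite cabsM in h; apply: (le_trans _ h); rewrite ler_peMr//.
have q0 : cabs (q n).[0] <= C by have := horner_box n (lexx 1) z0; rewrite expr1n mulr1.
have q1 : cabs (q n).[1] <= C by have := horner_box n (lexx 1) o1; rewrite expr1n mulr1.
have Yd0 : 0 <= 4 * (Y * d) by rewrite mulr_ge0//; (clear - HB fh fG g1r g12 g2c ep0 ep1 IB g12C Yd d0; lra).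
have bq0 : cabs (b * (q n).[0]) <= 4 * (Y * d) * C by rewrite cabsM; apply: ler_pM.
have bq1 : cabs (b * (q n).[1]) <= 4 * (Y * d) * C by rewrite cabsM; apply: ler_pM.
have ban : cabs (b * a n) <= 4 * (Y * d) * C by rewrite cabsM; apply: ler_pM => //; exact: ba (HB n).
have CYd2 : 0 <= C * Y * d by rewrite mulr_ge0.
have YCY : Y * d <= C * Y * d by rewrite -mulrA ler_peMl//; (clear - HB fh fG g1r g12 g2c ep0 ep1 IB g12C Yd0; lra).
have [Bn BnE] : exists Bn, Bn = B / Smax n by eexists.
have BnE2 : Bn = 2 * d + 8 * (C * Y * d) by rewrite BnE BE /d; ring.
have b_le : cabs b <= Bn by (clear - HB fh fG g1r g12 g2c ep0 ep1 IB g12C BnE2 YCY CYd2 bE d0; lra).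
have A_le : cabs A <= Bn.
  have := cabsB (A + b * (q n).[0]) (b * (q n).[0]); rewrite addrK; (clear - HB fh fG g1r g12 g2c ep0 ep1 IB g12C BnE2 CYd2 bq0 d0 a00; lra).
have B_le : cabs B' <= Bn.
  have := cabsB (A + B' * 1 + b * (q n).[1]) (A + b * (q n).[0]).
  set t := _ - _; have e : B' = t - b * (q n).[1] + b * (q n).[0] by rewrite /t; ring.
  have := cabsD (t - b * (q n).[1]) (b * (q n).[0]); rewrite -e; have := cabsB t (b * (q n).[1]); (clear - HB fh fG g1r g12 g2c ep0 ep1 IB g12C BnE2 bq1 bq0 a01 a00; lra).
have g_le : cabs (ga n) <= Bn.
  have := cabsB (A + b * ((q n).[0] - a n * 1) - ga n * 1) (A + b * (q n).[0]).
  set t := _ - (_ + _); have e : ga n = - (t + b * a n) by rewrite /t; ring.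
  have := cabsD t (b * a n); rewrite -cabsN -e; (clear - HB fh fG g1r g12 g2c ep0 ep1 IB g12C BnE2 CYd2 ban a10 a00; lra).
have Bn0 : 0 <= Bn by apply: le_trans (cabs_ge0 b) b_le.
have [m1 m2 m3] := coef_bound HB fh g1r g12 g2c ep0 ep1 IB n1n T2.
have [m1' _ _] := coef_bound HB fh g1r g12 g2c ep0 ep1 IB n1n' T2'.
have Sm1 := Smin_ge1 n.
have BnB : Bn <= B.
  rewrite BnE ler_pdivrMr// ler_peMr//.
  have : ep * Smax n <= Smax n by rewrite ler_piMl// ltW.
  (clear - HB fh fG g1r g12 g2c ep0 ep1 IB g12C T2; lra).
split.
- by rewrite /K; (clear - HB fh fG g1r g12 g2c ep0 ep1 IB g12C BnB m1' Bn0 e32 K0p; lra).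
- have -> : ee n.+1 = A + ee2 n by rewrite /A subrK.
  apply: le_trans (cabsD _ _) _; have : B * 1 <= B * Smin n by rewrite ler_wpM2l.
  have : 0 <= (1 + K0 + 3 * B + 2 / ep + 32 / ep + 4) * Smin n by rewrite mulr_ge0//; (clear - HB fh fG g1r g12 g2c ep0 ep1 IB g12C BnB Bn0 e32 K0p Sm1; lra).
  rewrite /K; (clear - HB fh fG g1r g12 g2c ep0 ep1 IB g12C BnB m3 A_le; lra).
move=> z r r1 zr Kr.
have Kr2 : 2 / ep * r <= Smax n.
  apply: (le_trans _ Kr); rewrite ler_wpM2r// /K; (clear - HB fh fG g1r g12 g2c ep0 ep1 IB g12C r1 BnB Bn0 e32 K0p; lra).
have rT : r <= ep * Smax n / 2.
  by move: Kr2; rewrite mulrAC ler_pdivrMr//; (clear - HB fh fG g1r g12 g2c ep0 ep1 IB g12C; lra).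
have rT' : r <= ep * Smax n.+1 / 2 by (clear - HB fh fG g1r g12 g2c ep0 ep1 IB g12C rT eSS; lra).
have [_ p2] := A1 n _ _ n1n T2 r1 zr rT.
have [p1 _] := A1 n.+1 _ _ n1n' T2' r1 zr rT'.
rewrite -K0E in p1 p2.
have r2 : 1 <= r ^+ 2 by rewrite expr2 -[1]mulr1 ler_pM.
have rr2 : r <= r ^+ 2 by rewrite expr2 ler_peMl//; (clear - HB fh fG g1r g12 g2c ep0 ep1 IB g12C r1; lra).
have z1 := le_trans (nrm1 z) zr; have z2 := le_trans (nrm2 z) zr.
have Br : Bn * r <= Bn * r ^+ 2 by rewrite ler_wpM2l.
have Br1 : Bn * 1 <= Bn * r ^+ 2 by rewrite ler_wpM2l.
have KE : K * r ^+ 2 / Smax n = K0 * r ^+ 2 / Smax n + 4 * (Bn * r ^+ 2) + (K - K0 - 4 * B) * (r ^+ 2 / Smax n).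
  by rewrite BnE; ring.
have rS : 0 <= r ^+ 2 / Smax n by rewrite divr_ge0 ?(ltW S0)//; (clear - HB fh fG g1r g12 g2c ep0 ep1 IB g12C r2; lra).
have rest : 0 <= (K - K0 - 4 * B) * (r ^+ 2 / Smax n) by rewrite mulr_ge0// /K; (clear - HB fh fG g1r g12 g2c ep0 ep1 IB g12C e32; lra).
rewrite KE; split.
  have -> : (fl n z).2 - (ee n.+1 + al n.+1 * z.2) =
    ((fl n z).2 - (ee2 n + ga n * z.1 + ka n * z.2)) - A + ga n * z.1 - B' * z.2 by rewrite /A /B'; ring.
  set t := _ - (_ + _ + _) in p2 *.
  have := cabsB (t - A + ga n * z.1) (B' * z.2); have := cabsD (t - A) (ga n * z.1); have := cabsB t A.
  rewrite !cabsM; have := ler_pM (cabs_ge0 _) (cabs_ge0 _) g_le z1; have := ler_pM (cabs_ge0 _) (cabs_ge0 _) B_le z2.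
  (clear - HB fh fG g1r g12 g2c ep0 ep1 IB g12C p2 rest Br1 Br Bn0 A_le; lra).
have -> : (fl n.+1 z).1 - (ee n.+1 + al n.+1 * z.1) =
  ((fl n.+1 z).1 - (ee n.+1 + al n.+1 * z.1 + b * z.2)) + b * z.2 by rewrite /b; ring.
set t := _ - (_ + _ + _) in p1 *.
have := cabsD t (b * z.2); rewrite cabsM; have := ler_pM (cabs_ge0 _) (cabs_ge0 _) b_le z2.
have p3 : K0 * r ^+ 2 / Smax n.+1 <= K0 * r ^+ 2 / Smax n.
  apply: ler_wpM2l; last by move: inv; rewrite !mul1r.
  by apply: mulr_ge0 => //; (clear - HB fh fG g1r g12 g2c ep0 ep1 IB g12C r2; lra).
(clear - HB fh fG g1r g12 g2c ep0 ep1 IB g12C p3 p1 rest Br1 Br Bn0; lra).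
Qed.

(** As [f] keeps [G], the image of [(0, y)] has norm at least [y / E]. Its first coordinate is close
    to [ee] and small, so the second, about [al * y], must carry the norm. *)
Lemma al_lower : exists K N, 1 <= K /\ forall n, (N <= n)%N -> 1 <= K * cabs (al n).
Proof.
have [K [N [K1 h]]] := aff2; have cg0 := cgr_gt0 HB.
have h0 := ep0; have h1 := ep1.
have [c1 c2 _ _ _] := Cpow HB.
have [E EE] : exists E, E = expR (2 * cg) by eexists.
have E1 : 1 <= E by rewrite EE; apply: expR_ge1; lra.
have [L LE] : exists L, L = 16 * K * E by eexists.
have KE1 : 1 <= K * E by have := ler_pM ler01 ler01 K1 E1; lra.
have [N1 hN1] := Smin_Smax (16 * K * L * E).
have [N2 hN2] := Smin_Smax L.
exists (2 * E), (maxn N (maxn N1 N2)).+2; split; first lra.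
move=> [//|[//|n]]; rewrite !ltnS !geq_max => /and3P[Nn N1n N2n].
have [a1 e1 f1] := h n Nn; have [a2 e2 f2] := h n.+1 (leqW Nn).
have Sm1 := Smin_ge1 n; have Sm2 := Smin_ge1 n.+1.
have q1 := hN1 n N1n; have q2 := hN2 n N2n.
have S0 : 0 < Smax n := expR_gt0 _; have S1 : 0 < Smax n.+1 := expR_gt0 _.
have SS := Smax_mono n.
have Smono : Smin n <= Smin n.+1.
  rewrite ler_expR lerD2r; apply: ler_wpM2r; first exact: g1_ge0.
  by rewrite ler_nat hdegS leq_pmulr// (leq_trans _ (bdeg (HB n))).
(* Large against the translations, which are at most [K * Smin], and small against [Smax], which
   keeps the quadratic errors below [y / (16 E)]. *)
have [y yE] : exists y, y = L * Smin n.+1 by eexists.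
have L16 : 16 <= L by rewrite LE; (clear - HB fh fG g1r g12 g2c ep0 ep1 IB g12C KE1; lra).
have ySm : Smin n.+1 <= y by rewrite yE ler_peMl//; (clear - HB fh fG g1r g12 g2c ep0 ep1 IB g12C Sm2 L16; lra).
have yS : y <= Smax n by rewrite yE.
have yS' : y <= Smax n.+1 by (clear - HB fh fG g1r g12 g2c ep0 ep1 IB g12C yS SS; lra).
pose z : C2 R := (0, y%:C).
have cy : cabs y%:C = y by rewrite cabsR ger0_norm//; (clear - HB fh fG g1r g12 g2c ep0 ep1 IB g12C ySm Sm2; lra).
have nz : nrm z = y by rewrite /nrm /= cabs0 cy max_r//; (clear - HB fh fG g1r g12 g2c ep0 ep1 IB g12C ySm Sm2; lra).
have rg : rgood C <= y.
  by apply: le_trans (rr_rgood HB) _; apply: (le_trans _ ySm); exact: (Smin_rr HB g1r g12 g2c ep0 ep1).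
have V : vplus (rgood C) z by split; rewrite /= cy// cabs0; (clear - HB fh fG g1r g12 g2c ep0 ep1 IB g12C ySm Sm2; lra).
have dz : G (Fi n.+1 z) < c.
  by apply: (dom_box HB g1r g12 g2c ep0 ep1 (_ : nrm z <= y) ySm yS'); rewrite nz.
have gz := gr_vplus (stail_bnd n.+1 HB) V; rewrite /= cy in gz.
have gf := gr_le (stail_bnd n.+1 HB) (fl n.+1 z).
rewrite (fl_gr HB fG dz) in gf.
have lgf : ln y - 2 * cg <= lg (fl n.+1 z) by move: gz; rewrite ler_norml; (clear - HB fh fG g1r g12 g2c ep0 ep1 IB g12C gf; lra).
have y0 : 0 < y by (clear - HB fh fG g1r g12 g2c ep0 ep1 IB g12C ySm Sm2; lra).
have E0 : 0 < E by (clear - HB fh fG g1r g12 g2c ep0 ep1 IB g12C E1; lra).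
have nf : y / E <= nrm (fl n.+1 z).
  have : y / E <= Num.max 1 (nrm (fl n.+1 z)).
    rewrite -[leRHS]lnK ?posrE ?max1_gt0// -/(lg _).
    have -> : y / E = expR (ln y - 2 * cg) by rewrite expRD lnK ?posrE// expRN -EE.
    by rewrite ler_expR.
  have : 16 <= y / E.
    rewrite ler_pdivlMr//; have : L * 1 <= L * Smin n.+1 by rewrite ler_wpM2l//; (clear - HB fh fG g1r g12 g2c ep0 ep1 IB g12C L16; lra).
    have : 16 * 1 * E <= 16 * K * E by rewrite ler_wpM2r//; (clear - HB fh fG g1r g12 g2c ep0 ep1 IB g12C E0 K1; lra).
    rewrite yE LE; (clear - HB fh fG g1r g12 g2c ep0 ep1 IB g12C; lra).
  by rewrite le_max => h2 /orP[|//]; (clear - HB fh fG g1r g12 g2c ep0 ep1 IB g12C h2; lra).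
have y1 : 1 <= y by (clear - HB fh fG g1r g12 g2c ep0 ep1 IB g12C ySm Sm2; lra).
have Ky : K * y <= Smax n.
  apply: (le_trans _ q1); rewrite yE mulrA ler_wpM2r//; first (clear - HB fh fG g1r g12 g2c ep0 ep1 IB g12C Sm2; lra).
  have : 0 <= K * L by rewrite mulr_ge0//; (clear - HB fh fG g1r g12 g2c ep0 ep1 IB g12C K1 L16; lra).
  have : K * L * 1 <= K * L * E by rewrite ler_wpM2l// mulr_ge0//; (clear - HB fh fG g1r g12 g2c ep0 ep1 IB g12C K1 L16; lra).
  (clear - HB fh fG g1r g12 g2c ep0 ep1 IB g12C; lra).
have small : K * y ^+ 2 / Smax n <= y / E / 16.
  rewrite ler_pdivrMr//.
  have -> : y / E / 16 * Smax n = y * (Smax n / (16 * E)) by field; rewrite gt_eqF.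
  have -> : K * y ^+ 2 = y * (K * y) by ring.
  rewrite ler_pM2l// ler_pdivlMr//; last (clear - HB fh fG g1r g12 g2c ep0 ep1 IB g12C E0; lra).
  apply: (le_trans _ q1); rewrite yE; (clear - HB fh fG g1r g12 g2c ep0 ep1 IB g12C; lra).
have small' : K * y ^+ 2 / Smax n.+1 <= y / E / 16.
  apply: (le_trans _ small); rewrite ler_wpM2l ?lef_pV2 ?posrE//.
  by rewrite mulr_ge0 ?exprn_ge0//; (clear - HB fh fG g1r g12 g2c ep0 ep1 IB g12C K1 y1; lra).
have nzy : nrm z <= y by rewrite nz.
have [_ u1] := f1 z y y1 nzy Ky.
have Ky' : K * y <= Smax n.+1 by (clear - HB fh fG g1r g12 g2c ep0 ep1 IB g12C Ky SS; lra).
have [v1 _] := f2 z y y1 nzy Ky'.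
rewrite /= mulr0 addr0 in u1.
have KSm : K * Smin n.+1 = y / E / 16 by rewrite yE LE; field; rewrite gt_eqF.
have KSm2 : K * Smin n <= K * Smin n.+1 by rewrite ler_wpM2l//; (clear - HB fh fG g1r g12 g2c ep0 ep1 IB g12C K1; lra).
have yE0 : 0 < y / E by rewrite divr_gt0.
have ub : cabs (fl n.+1 z).1 <= y / E / 2.
  by have := cabs_dist (fl n.+1 z).1 (ee n.+1); (clear - HB fh fG g1r g12 g2c ep0 ep1 IB g12C yE0 KSm2 KSm u1 small e1; lra).
have vb : y / E <= cabs (fl n.+1 z).2.
  by move: nf; rewrite le_max => /orP[|//]; (clear - HB fh fG g1r g12 g2c ep0 ep1 IB g12C ub yE0; lra).
have av : y / E / 2 <= cabs (al n.+2 * y%:C).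
  have := cabs_dist (fl n.+1 z).2 (ee n.+2 + al n.+2 * z.2); have := cabsD (ee n.+2) (al n.+2 * y%:C); rewrite /=.
  (clear - HB fh fG g1r g12 g2c ep0 ep1 IB g12C vb yE0 KSm v1 small' e2; lra).
rewrite cabsM cy in av.
have : 1 * y <= 2 * E * cabs (al n.+2) * y.
  have := ler_wpM2l (_ : 0 <= 2 * E) av.
  have -> : 2 * E * (y / E / 2) = 1 * y by field; rewrite gt_eqF.
  rewrite mulrA; apply; (clear - HB fh fG g1r g12 g2c ep0 ep1 IB g12C E0; lra).
by rewrite ler_pM2r.
Qed.

End Coefficients.

Section Approximate.
Context {R : realType}.
Implicit Types (z w P : C2 R) (r S : R) (n k N : nat) (s x y : R[i]).
Variables (q : nat -> {poly R[i]}) (a : nat -> R[i]) (C : R).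
Hypothesis HB : forall k, bnd (q k) (a k) C.
Notation F := (hiter q a).
Notation D := (hdeg q).
Notation G := (gr q a C).
Notation X := (xorb q a).
Notation cg := (cgr C).
Notation Cb := (Num.bound C).
Variables (c : R) (f : C2 R -> C2 R).
Hypothesis fh : hol [set z | G z < c] f.
Hypothesis fG : forall z, G z < c -> G (f z) = G z.
Variables (g1 g2 ep : R) (n1 : nat).
Hypothesis g1r : ln (rr C) <= g1.
Hypothesis g12 : 2 * cg + 1 <= g2 - g1.
Hypothesis g2c : g2 < c.
Hypothesis ep0 : 0 < ep.
Hypothesis ep1 : ep <= 1.
Hypothesis IB : forall n P, (n1 <= n)%N -> cabs (X P n) <= ep * cabs (X P n.+1) ->
   g1 <= G P <= g2 -> nrm (F n (f P)) <= 4 * cabs (X P n.+1).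
Hypothesis g12C : C * g1 + 1 <= g2.
Hypothesis g12B : Cb%:R * (C * g1) + 1 <= g2.
Notation fl := (fl q a f).
Notation Smin := (Smin q C g1).
Notation Smax := (Smax q C g2).
Notation ee := (ee q a f).
Notation al := (al q a f).

Definition defect n x y : R[i] := (q n).[ee n.+1 + al n.+1 * y] - a n * (ee n + al n * x)
  - (ee n.+2 + al n.+2 * ((q n).[y] - a n * x)).

(** By [g12B] the power [Cb] of [Smin], which governs the Lipschitz constants of the polynomials, is
    beaten by [Smax] with a factor [exp (- D_k)] to spare. *)
Lemma Smin_pow k : Smin k.+1 ^+ Cb / Smax k <= expR ((Cb%:R + 1) * cg) * expR (- (D k)%:R).
Proof.
have g1p := g1_ge0 HB g1r; have hB := g12B.
rewrite -[Smin k.+1]/(expR ((D k.+1)%:R * g1 + cg)) -[Smax k]/(expR ((D k)%:R * g2 - cg)) -expRM_natl -expRN -!expRD ler_expR.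
have h1 := ler_wpM2r g1p (hdeg_step HB k).
have cb0 : 0 <= Cb%:R :> R by [].
have h2 := ler_wpM2l cb0 h1.
have h3 := ler_wpM2l (ltW (hdegR_gt0 HB k)) hB.
lra.
Qed.

(** The relation between [f_n], [f_(n+1)] and the Henon map is exact. Replacing coordinates by their
    affine approximations costs three errors of order [1 / Smax], one of them amplified by the
    Lipschitz constant of the polynomial. *)
Lemma defect_small (Y : R) : 1 <= Y -> exists K N, 0 <= K /\ forall k, (N <= k)%N -> forall x y, cabs x <= Y -> cabs y <= Y ->
  cabs (defect k.+1 x y) <= K * expR (- (D k)%:R).
Proof.
move=> Y1; have [c1 _ _ _ _] := Cpow HB.
have [K [N [K1 h]]] := aff2 HB fh g1r g12 g2c ep0 ep1 IB.
have Yb : 1 <= Y ^+ Cb by rewrite exprn_ege1.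
have CYb : C <= C * Y ^+ Cb by rewrite ler_peMr//; lra.
have CY0 : C <= C * Y by rewrite ler_peMr//; lra.
have [r rE] : exists r, r = C * Y ^+ Cb + C * Y by eexists.
have r1 : 1 <= r by lra.
have Yr : Y <= r by have : 1 * Y <= C * Y by [rewrite ler_wpM2r//; lra]; lra.
have [N1 hN1] := Smax_large HB g1r g12 (K * r ^+ 2).
have rr2 : r <= r ^+ 2 by rewrite expr2 ler_peMl//; lra.
have YY2 : Y <= Y ^+ 2 by rewrite expr2 ler_peMl//; lra.
have Yr2 : Y ^+ 2 <= r ^+ 2 by rewrite ler_sqr ?nnegrE//; lra.
have r20 : 0 <= r ^+ 2 by apply: exprn_ge0; lra.
have KY1 : 1 <= 3 * K * Y by have := ler_pM ler01 ler01 K1 Y1; lra.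
have KYb : 0 <= (3 * K * Y) ^+ Cb by apply: exprn_ge0; lra.
have [K2 K2E] : exists K2, K2 = K * r ^+ 2 by eexists.
have K20 : 0 <= K2 by rewrite K2E mulr_ge0//; lra.
have CK0 : 0 <= C * (3 * K * Y) ^+ Cb by rewrite mulr_ge0//; lra.
exists ((C * (3 * K * Y) ^+ Cb * K2 + K2 + C * K2) * expR ((Cb%:R + 1) * cg)), (maxn N N1); split.
  by rewrite mulr_ge0 ?expR_ge0// !addr_ge0// mulr_ge0//; lra.
move=> k; rewrite geq_max => /andP[Nk N1k] x y xY yY.
have [_ _ hu] := h k Nk; have [a1 e1 hv] := h k.+1 (leqW Nk); have [_ _ hw] := h k.+2 (leqW (leqW Nk)).
have S0 := hN1 k N1k; have S01 := Smax_mono HB g1r g12 k; have S12 := Smax_mono HB g1r g12 k.+1.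
have Sp : 0 < Smax k := expR_gt0 _.
have zY : nrm ((x, y) : C2 R) <= Y by rewrite nrm_le /= xY.
have hzr : nrm (henon (q k.+1) (a k.+1) (x, y)) <= r.
  rewrite nrm_le /henon /=; apply/andP; split; first (clear - HB fh fG g1r g12 g2c ep0 ep1 IB g12C g12B yY Yr; lra).
  have := cabsB (q k.+1).[y] (a k.+1 * x); have := horner_box HB k.+1 Y1 yY; rewrite cabsM.
  have := ler_pM (cabs_ge0 _) (cabs_ge0 _) (ba (HB k.+1)) xY; (clear - HB fh fG g1r g12 g2c ep0 ep1 IB g12C g12B rE; lra).
have KrS : K * r <= K * r ^+ 2 by rewrite ler_wpM2l//; (clear - HB fh fG g1r g12 g2c ep0 ep1 IB g12C g12B K1; lra).
have KYr : K * Y <= K * r by rewrite ler_wpM2l//; (clear - HB fh fG g1r g12 g2c ep0 ep1 IB g12C g12B K1; lra).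
have [_ u1] := hu (x, y) Y Y1 zY (le_trans KYr (le_trans KrS S0)).
have [v1 _] := hv (x, y) Y Y1 zY (le_trans KYr (le_trans KrS (le_trans S0 S01))).
have [w1 _] := hw _ r r1 hzr (le_trans KrS (le_trans S0 (le_trans S01 S12))).
rewrite (fl_henon HB) /henon /= in u1 v1 w1.
have inv n : Smax k <= Smax n -> K2 / Smax n <= K2 / Smax k.
  by move=> hS; rewrite ler_wpM2l// lef_pV2 ?posrE//; apply: lt_le_trans hS.
have KYK : K * Y ^+ 2 <= K2 by rewrite K2E ler_wpM2l//; (clear - HB fh fG g1r g12 g2c ep0 ep1 IB g12C g12B K1; lra).
have b1 : K * Y ^+ 2 / Smax k <= K2 / Smax k by rewrite ler_wpM2r// invr_ge0 ltW.
have Sp1 : 0 < Smax k.+1 := expR_gt0 _.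
have b2 : K * Y ^+ 2 / Smax k.+1 <= K2 / Smax k.
  by apply: (le_trans _ (inv k.+1 S01)); rewrite ler_wpM2r// invr_ge0 ltW.
have b3 : K * r ^+ 2 / Smax k.+2 <= K2 / Smax k.
  by rewrite -K2E; apply: inv; exact: le_trans S01 S12.
have [T TE] : exists T, T = K2 / Smax k by eexists.
have T1 : T <= 1 by rewrite TE ler_pdivrMr// mul1r K2E.
rewrite -TE in b1 b2 b3.
have T0 : 0 <= T by rewrite TE divr_ge0// ltW.
set u := (fl k.+1 (x, y)).1 in u1 w1; set v := (fl k.+1 (x, y)).2 in v1 w1.
have Sm1 := Smin_ge1 HB g1r k.+1.
have Rb : 1 <= 3 * K * Y * Smin k.+1.
  by have := ler_pM ler01 ler01 KY1 Sm1; (clear - HB fh fG g1r g12 g2c ep0 ep1 IB g12C g12B; lra).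
have vin : cabs (ee k.+2 + al k.+2 * y) <= K * Smin k.+1 + K * Y.
  by apply: le_trans (cabsD _ _) _; rewrite cabsM; apply: lerD => //; apply: ler_pM.
have Sm0 : 0 <= Smin k.+1 by (clear - HB fh fG g1r g12 g2c ep0 ep1 IB g12C g12B Sm1; lra).
have KYS : K * Y * 1 <= K * Y * Smin k.+1 by rewrite ler_wpM2l// mulr_ge0//; (clear - HB fh fG g1r g12 g2c ep0 ep1 IB g12C g12B K1 Y1; lra).
have KS : K * Smin k.+1 * 1 <= K * Smin k.+1 * Y by rewrite ler_wpM2l// mulr_ge0//; (clear - HB fh fG g1r g12 g2c ep0 ep1 IB g12C g12B K1; lra).
have KKK : 1 <= K * Y * Smin k.+1.
  have h1 := ler_pM ler01 ler01 K1 Y1; rewrite mulr1 in h1.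
  by have := ler_pM ler01 ler01 h1 Sm1; (clear - HB fh fG g1r g12 g2c ep0 ep1 IB g12C g12B; lra).
have R1 : cabs (ee k.+2 + al k.+2 * y) <= 3 * K * Y * Smin k.+1 by (clear - HB fh fG g1r g12 g2c ep0 ep1 IB g12C g12B KKK KS KYS vin; lra).
have R2 : cabs v <= 3 * K * Y * Smin k.+1.
  by have := cabs_dist v (ee k.+2 + al k.+2 * y); (clear - HB fh fG g1r g12 g2c ep0 ep1 IB g12C g12B KKK KS KYS vin v1 b2 T1; lra).
have lip : cabs ((q k.+1).[ee k.+2 + al k.+2 * y] - (q k.+1).[v]) <= C * (3 * K * Y * Smin k.+1) ^+ Cb * T.
  apply: le_trans (blip (HB k.+1) Rb R1 R2) _.
  apply: ler_pM => //.
  - by apply: mulr_ge0; [(clear - HB fh fG g1r g12 g2c ep0 ep1 IB g12C g12B c1; lra)|apply: exprn_ge0; (clear - HB fh fG g1r g12 g2c ep0 ep1 IB g12C g12B KKK; lra)].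
  - by apply: ler_wpM2l; [(clear - HB fh fG g1r g12 g2c ep0 ep1 IB g12C g12B c1; lra)|rewrite ler_weXn2l// (pdeg_bound HB)].
  - by rewrite cabsC; (clear - HB fh fG g1r g12 g2c ep0 ep1 IB g12C g12B v1 b2; lra).
have -> : defect k.+1 x y = ((q k.+1).[ee k.+2 + al k.+2 * y] - (q k.+1).[v])
   + ((q k.+1).[v] - a k.+1 * u - (ee k.+3 + al k.+3 * ((q k.+1).[y] - a k.+1 * x)))
   + a k.+1 * (u - (ee k.+1 + al k.+1 * x)) by rewrite /defect; ring.
have au : cabs (a k.+1 * (u - (ee k.+1 + al k.+1 * x))) <= C * T.
  by rewrite cabsM; apply: ler_pM => //; [exact: ba (HB _)|(clear - HB fh fG g1r g12 g2c ep0 ep1 IB g12C g12B u1 b1; lra)].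
have Sb1 : 1 <= Smin k.+1 ^+ Cb by rewrite exprn_ege1.
have tot : C * (3 * K * Y * Smin k.+1) ^+ Cb * T + T + C * T <=
   (C * (3 * K * Y) ^+ Cb * K2 + K2 + C * K2) * (Smin k.+1 ^+ Cb / Smax k).
  have e0 : C * (3 * K * Y * Smin k.+1) ^+ Cb * T = (C * (3 * K * Y) ^+ Cb * K2) * (Smin k.+1 ^+ Cb / Smax k).
    by rewrite exprMn TE; ring.
  have e4 : T <= K2 * (Smin k.+1 ^+ Cb / Smax k).
    by rewrite mulrCA -TE ler_peMl.
  have := ler_wpM2l (_ : 0 <= C) e4; rewrite e0; (clear - HB fh fG g1r g12 g2c ep0 ep1 IB g12C g12B e4 c1; lra).
apply: le_trans (cabsD _ _) _; apply: le_trans (lerD (cabsD _ _) (lexx _)) _.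
apply: le_trans (_ : _ <= C * (3 * K * Y * Smin k.+1) ^+ Cb * T + T + C * T) _; first (clear - HB fh fG g1r g12 g2c ep0 ep1 IB g12C g12B au lip w1 b3; lra).
apply: le_trans tot _; rewrite -[leRHS]mulrA; apply: ler_wpM2l; last exact: Smin_pow.
by rewrite !addr_ge0// mulr_ge0//; (clear - HB fh fG g1r g12 g2c ep0 ep1 IB g12C g12B c1; lra).
Qed.

End Approximate.

(** * Polynomials with small values and affine substitutions *)

Section CoefSmall.
Context {R : realType}.

(** The Vandermonde matrix at the nodes 0, ..., [n] is invertible, so the coefficients are fixed
    linear combinations of the values there. *)
Lemma coef_small n : exists2 L : R, 0 <= L & forall (P : {poly R[i]}) (e : R), (size P <= n.+1)%N ->
  (forall j, (j <= n)%N -> cabs P.[j%:R] <= e) -> forall i, cabs P`_i <= L * e.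
Proof.
pose v : 'rV[R[i]]_n.+1 := \row_j (j : nat)%:R.
pose V := Vandermonde n.+1 v.
have Vu : V \in unitmx.
  rewrite unitmxE det_Vandermonde unitfE; apply/prodf_neq0 => i _; apply/prodf_neq0 => j ij.
  by rewrite !mxE subr_eq0 eqr_nat gtn_eqF.
exists (\sum_(i < n.+1) \sum_(j < n.+1) cabs (invmx V j i)).
  by apply: sumr_ge0 => i _; apply: sumr_ge0 => j _; exact: cabs_ge0.
move=> P e sP Pe i.
have e0 : 0 <= e by apply: le_trans (Pe 0%N _); rewrite ?cabs_ge0.
have [ni|ni] := leqP n.+1 i.
  rewrite nth_default ?(leq_trans sP)// cabs0 mulr_ge0//.
  by apply: sumr_ge0 => k _; apply: sumr_ge0 => j _; exact: cabs_ge0.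
pose cf : 'rV[R[i]]_n.+1 := \row_k P`_k.
have cV : cf *m V = \row_j P.[(j : nat)%:R].
  apply/rowP => j; rewrite !mxE (horner_coef_wide _ sP).
  by apply: eq_bigr => k _; rewrite !mxE.
have -> : P`_i = \sum_(j < n.+1) P.[(j : nat)%:R] * invmx V j (Ordinal ni).
  have : cf = cf *m V *m invmx V by rewrite mulmxK.
  rewrite cV => /rowP/(_ (Ordinal ni)); rewrite !mxE /= => ->.
  by apply: eq_bigr => j _; rewrite !mxE.
have bs (I : Type) (s : seq I) (g : I -> R[i]) : cabs (\sum_(j <- s) g j) <= \sum_(j <- s) cabs (g j).
  elim: s => [|x s ih]; first by rewrite !big_nil cabs0.
  by rewrite !big_cons (le_trans (cabsD _ _))// lerD2l.
apply: le_trans (bs _ _ _) _; rewrite [in leRHS](bigD1 (Ordinal ni))//= mulrDl.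
apply: le_trans (_ : _ <= (\sum_(j < n.+1) cabs (invmx V j (Ordinal ni))) * e) _.
  rewrite mulr_suml; apply: ler_sum => j _; rewrite cabsM mulrC ler_wpM2l ?cabs_ge0//.
  by apply: Pe; rewrite -ltnS.
rewrite lerDl mulr_ge0//; apply: sumr_ge0 => k _; apply: sumr_ge0 => j _; exact: cabs_ge0.
Qed.

(** Only the two top coefficients are recorded: the first relates successive slopes, the second
    determines the translation [e]. *)
Lemma taylor_poly (q : {poly R[i]}) (e al : R[i]) : exists2 T : {poly R[i]},
  (size T <= size q)%N /\ (forall y, T.[y] = q.[e + al * y]) &
  T`_(size q).-1 = q`_(size q).-1 * al ^+ (size q).-1 /\
  ((1 < size q)%N -> T`_(size q).-2 = (q`_(size q).-2 + (q`_(size q).-1 *+ (size q).-1) * e) * al ^+ (size q).-2).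
Proof.
have [s0|s0] := leqP (size q) 0.
  have q0 : q = 0 by apply/eqP; rewrite -size_poly_leq0.
  exists 0; rewrite q0 ?size_poly0 ?coef0 ?mul0r//; split => // y; by rewrite !horner0.
exists (\poly_(i < size q) (q^`N(i).[e] * al ^+ i)).
  split; first exact: size_poly.
  move=> y; rewrite horner_poly nderiv_taylor; last exact: mulrC.
  by apply: eq_bigr => i _; rewrite exprMn mulrA.
split.
  rewrite coef_poly prednK// leqnn; congr (_ * _).
  have -> : q^`N((size q).-1) = (q`_(size q).-1)%:P.
    apply/polyP => i; rewrite coef_nderivn coefC; case: i => [|i] /=.
      by rewrite addn0 binn mulr1n.
    by rewrite nth_default ?mul0rn// addnS -addSn prednK// leq_addr.
  by rewrite hornerC.
move=> s1; rewrite coef_poly -subn2 subn2 /=.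
case sE : (size q) s1 => [|[|d]] // _ /=.
have -> : (d < d.+2)%N by rewrite ltnS leqnSn.
congr (_ * _).
have -> : q^`N(d) = (q`_d)%:P + (q`_d.+1 *+ d.+1) *: 'X.
  apply/polyP => i; rewrite coef_nderivn coefD coefC coefZ coefX; case: i => [|[|i]] /=.
  - by rewrite addn0 binn mulr1n mulr0 addr0.
  - by rewrite addn1 add0r mulr1 binSn.
  - by rewrite nth_default ?mul0rn ?mulr0 ?addr0// sE !addnS !ltnS leq_addr.
by rewrite hornerD hornerC hornerZ hornerX.
Qed.

End CoefSmall.

(** * Limits of the coefficients along periods *)

Section Limits.
Context {R : realType}.
Implicit Types (n k N : nat) (x y : R[i]).
Variables (q : nat -> {poly R[i]}) (a : nat -> R[i]) (C : R).
Hypothesis HB : forall k, bnd (q k) (a k) C.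
Notation D := (hdeg q).
Notation Cb := (Num.bound C).

Definition expm k : R := expR (- (D k)%:R).

Lemma expm_gt0 k : 0 < expm k. Proof. exact: expR_gt0. Qed.

Lemma expm_half k i : expm (k + i) <= expm k * 2^-1 ^+ i.
Proof.
elim: i => [|i ih]; first by rewrite addn0 expr0 mulr1.
rewrite addnS exprSr mulrA.
have h : expm (k + i).+1 <= expm (k + i) / 2.
  have D1 : 1 <= (D (k + i))%:R :> R by rewrite ler1n (hdeg_gt0 HB).
  have D2 : 2 * (D (k + i))%:R <= (D (k + i).+1)%:R :> R.
    by rewrite hdegS natrM mulrC ler_wpM2l// ler_nat (bdeg (HB _)).
  have e1 : expm (k + i).+1 <= expm (k + i) * expR (- 1).
    by rewrite /expm -expRD ler_expR; lra.
  have e2 : expR (- 1) <= 1 / 2 :> R.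
    rewrite expRN div1r lef_pV2 ?posrE ?expR_gt0//.
    by have := expR_ge1Dx (1 : R); lra.
  have := ler_wpM2l (ltW (expm_gt0 (k + i))) e2; lra.
apply: (le_trans h); rewrite ler_wpM2r//.
Qed.

Lemma expm_mono k i : expm (k + i) <= expm k.
Proof.
apply: le_trans (expm_half k i) _; rewrite ler_piMr ?(ltW (expm_gt0 k))//.
by rewrite exprn_ile1//; lra.
Qed.

(** Along each residue class modulo [M] the increments are dominated by a geometric series
    ([expm_half]); the limits are periodic because they are taken along these classes. *)
Lemma seq_limits (s : nat -> R[i]) (M N : nat) (K : R) : (0 < M)%N -> 0 <= K ->
  (forall k, (N <= k)%N -> cabs (s (k.+2 + M)%N - s k.+2) <= K * expm k) ->
  exists L : nat -> R[i], [/\ forall n, L (n + M)%N = L n,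
    forall n, clim \oo (fun j => s (n + M * j)%N) (L n) &
    forall k, (N <= k)%N -> cabs (s k.+2 - L k.+2) <= 2 * K * expm k].
Proof.
move=> M0 K0 h.
have step k i : (N <= k)%N -> cabs (s (k.+2 + M * i)%N - s k.+2) <= 2 * K * expm k * (1 - 2^-1 ^+ i).
  move=> Nk; elim: i => [|i ih]; first by rewrite muln0 addn0 subrr cabs0 expr0 subrr mulr0.
  have h1 := h (k + M * i)%N (leq_trans Nk (leq_addr _ _)).
  have e1 : ((k + M * i).+2 + M = k.+2 + M * i.+1)%N by rewrite mulnS; lia.
  have e2 : ((k + M * i).+2 = k.+2 + M * i)%N by lia.
  rewrite e1 e2 in h1.
  have Mi : (i <= M * i)%N by rewrite leq_pmull.
  have h2 : expm (k + M * i) <= expm k * 2^-1 ^+ i.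
    apply: le_trans (expm_half k (M * i)) _; rewrite ler_wpM2l ?(ltW (expm_gt0 k))//.
    by rewrite -(subnKC Mi) exprD ler_piMr ?exprn_ge0 ?exprn_ile1//; lra.
  have h3 := ler_wpM2l K0 h2; have [_ h4] := @half_expn R i; rewrite h4.
  have := cabs_triB (s (k.+2 + M * i.+1)%N) (s (k.+2 + M * i)%N) (s k.+2).
  lra.
have step2 k i : (N <= k)%N -> cabs (s (k.+2 + M * i)%N - s k.+2) <= 2 * K * expm k.
  move=> Nk; apply: le_trans (step k i Nk) _; apply: ler_piMr; first by apply: mulr_ge0; [lra|exact: ltW (expm_gt0 k)].
  by have [h1 _] := @half_expn R i; lra.
have /choice[L hL] : forall n, exists l, clim \oo (fun j => s (n + M * j)%N) l.
  move=> n.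
  suff [l hl] : exists l, forall e, 0 < e -> exists N, forall j, (N <= j)%N -> cabs (s (n + M * j)%N - l) < e.
    by exists l; apply/clim_ooP.
  apply: ccauchy => e e0.
  have K1 : 0 < 4 * (K + 1) by lra.
  have [N1 hN1] := small_half (divr_gt0 e0 K1).
  pose k := (n + M * (N1 + N).+2).-2.
  have M2 : (2 <= M * (N1 + N).+2)%N by apply: (leq_trans _ (leq_pmull _ M0)).
  have kE : k.+2 = (n + M * (N1 + N).+2)%N by move: M2; rewrite /k; move: (M * _)%N => t t2; lia.
  have kN : (N1 + N <= k)%N.
    rewrite -2!ltnS -addnS -addSn kE; apply: (@leq_trans (M * (N1 + N).+2)); last exact: leq_addl.
    by rewrite !addSn !addnS leq_pmull.
  have Nk : (N <= k)%N by apply: leq_trans kN; exact: leq_addl.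
  have small : 2 * K * expm k < e / 2.
    have : expm k <= 2^-1 ^+ N1.
      have kk : k = (0 + k)%N by [].
      rewrite kk; apply: le_trans (expm_half 0 k) _.
      have e1 : expm 0 <= 1.
        by rewrite /expm -expR0 ler_expR oppr_le0.
      have N1k : (N1 <= k)%N by apply: leq_trans kN; exact: leq_addr.
      have p0 : 0 <= 2^-1 ^+ N1 :> R by rewrite exprn_ge0.
      rewrite -[leRHS]mul1r; apply: ler_pM => //; first exact: ltW (expm_gt0 0).
      by rewrite -(subnKC N1k) exprD ler_piMr ?exprn_ile1//; lra.
    move=> h1; have := hN1 N1 (leqnn _); rewrite ltr_pdivlMr// => h2.
    have h3 := ler_wpM2l K0 h1; have [h4 _] := @half_expn R N1; lra.
  exists (N1 + N).+2 => j1 j2 hj1 hj2.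
  have key j : ((N1 + N).+2 <= j)%N -> cabs (s (n + M * j)%N - s k.+2) < e / 2.
    move=> hj; have := step2 k (j - (N1 + N).+2)%N Nk.
    by rewrite kE -addnA -mulnDr subnKC// -kE => /le_lt_trans; apply.
  have := key _ hj1; have := key _ hj2.
  have := cabs_triB (s (n + M * j1)%N) (s k.+2) (s (n + M * j2)%N); rewrite (cabsC (s k.+2)); lra.
exists L; split => // [n|k Nk].
  apply: (clim_unique _ (hL (n + M)%N)).
  apply/clim_ooP => e e0; have [N1 hN1] := (clim_ooP _ _).1 (hL n) e e0.
  by exists N1 => j Nj; have := hN1 j.+1 (leqW Nj); rewrite mulnS addnA.
rewrite cabsC.
have hl : clim \oo (fun j => s (k.+2 + M * j)%N - s k.+2) (L k.+2 - s k.+2).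
  by apply: climB; [exact: hL|exact: clim_cst].
by apply: (clim_le _ hl); apply: nearW => j; exact: step2.
Qed.

Lemma pow_lip (B : R) x y p : 1 <= B -> cabs x <= B -> cabs y <= B ->
  cabs (x ^+ p - y ^+ p) <= p%:R * B ^+ p * cabs (x - y).
Proof.
move=> B1 xB yB; elim: p => [|p ih]; first by rewrite !expr0 subrr cabs0 !mul0r.
have -> : x ^+ p.+1 - y ^+ p.+1 = x * (x ^+ p - y ^+ p) + y ^+ p * (x - y) by rewrite !exprS; ring.
apply: le_trans (cabsD _ _) _; rewrite !cabsM cabsX.
have B0 : 0 <= B by lra.
have h1 := ler_pM (cabs_ge0 x) (cabs_ge0 _) xB ih.
have yp : cabs y ^+ p <= B ^+ p by apply: lerXn2r; rewrite ?nnegrE ?cabs_ge0.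
have ypp : B ^+ p <= B ^+ p.+1 by rewrite exprS ler_peMl// exprn_ge0.
have h2 := ler_wpM2r (cabs_ge0 (x - y)) (le_trans yp ypp).
rewrite -natr1 mulrDl mulrDl mul1r.
have -> : p%:R * B ^+ p.+1 * cabs (x - y) = B * (p%:R * B ^+ p * cabs (x - y)) by rewrite exprS; ring.
exact: lerD.
Qed.

Variables (m : nat) (al ee : nat -> R[i]).
Hypothesis m0 : (0 < m)%N.
Hypothesis qm : forall k, q (k + m)%N = q k.
Hypothesis am : forall k, a (k + m)%N = a k.

Definition dfc n x y : R[i] := (q n).[ee n.+1 + al n.+1 * y] - a n * (ee n + al n * x)
  - (ee n.+2 + al n.+2 * ((q n).[y] - a n * x)).

Variables (K0 : R) (N0 : nat).
Hypothesis K01 : 1 <= K0.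
Hypothesis alb : forall n, (N0 <= n)%N -> cabs (al n) <= K0 /\ 1 <= K0 * cabs (al n).
Hypothesis dfc_small : forall Y : R, 1 <= Y -> exists K N, 0 <= K /\ forall k, (N <= k)%N ->
  forall x y, cabs x <= Y -> cabs y <= Y -> cabs (dfc k.+1 x y) <= K * expm k.

Lemma q2m k : q (k + m.*2)%N = q k. Proof. by rewrite -addnn addnA !qm. Qed.
Lemma a2m k : a (k + m.*2)%N = a k. Proof. by rewrite -addnn addnA !am. Qed.

(** The difference of the defect between [x = 1] and [x = 0] gives the first estimate; its
    coefficient of degree [deg - 1] in [y], extracted by [coef_small], gives the second. *)
Lemma coef_facts : exists K N, 0 <= K /\ forall k, (N <= k)%N ->
  cabs (al k.+3 - al k.+1) <= K * expm k /\
  cabs (((q k.+1)`_(pdeg (q k.+1)).-1 + (lead_coef (q k.+1) *+ pdeg (q k.+1)) * ee k.+2) * al k.+2 ^+ (pdeg (q k.+1)).-1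
    - al k.+3 * (q k.+1)`_(pdeg (q k.+1)).-1) <= K * expm k.
Proof.
have c1 := bC (HB 0%N).
have Cb1 : 1 <= Cb%:R + 1 :> R by rewrite lerDr.
have [K [N [Kp h]]] := dfc_small Cb1.
have [L L0 hL] := @coef_small R Cb.
have LK : 0 <= L * K by exact: mulr_ge0.
have CK : 0 <= C * K by apply: mulr_ge0 => //; lra.
exists (2 * (C * K) + L * K), N; split; first lra.
move=> k Nk; have hk := h k Nk; have e0 := expm_gt0 k.
have z1 : cabs (0 : R[i]) <= Cb%:R + 1 by rewrite cabs0; lra.
have o1 : cabs (1 : R[i]) <= Cb%:R + 1 by rewrite cabs1.
have LKe : 0 <= L * K * expm k by apply: mulr_ge0 => //; exact: ltW.
have CKe : 0 <= C * K * expm k by apply: mulr_ge0 => //; exact: ltW.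
split.
  have h0 := hk 0 0 z1 z1; have h1 := hk 1 0 o1 z1.
  have : cabs (a k.+1 * (al k.+3 - al k.+1)) <= 2 * (K * expm k).
    have -> : a k.+1 * (al k.+3 - al k.+1) = dfc k.+1 1 0 - dfc k.+1 0 0 by rewrite /dfc; ring.
    by apply: le_trans (cabsB _ _) _; lra.
  rewrite cabsM => h2.
  have h3 := ler_wpM2r (cabs_ge0 (al k.+3 - al k.+1)) (baV (HB k.+1)).
  have C0 : 0 <= C by lra.
  have := ler_wpM2l C0 h2; lra.
have [T [sT TE] [_ T1]] := taylor_poly (q k.+1) (ee k.+2) (al k.+2).
pose P := T - al k.+3 *: q k.+1 - (a k.+1 * ee k.+1 + ee k.+3)%:P.
have d2 := bdeg (HB k.+1).
have sq : size (q k.+1) = (pdeg (q k.+1)).+1 by move: d2; rewrite /pdeg; case: (size (q k.+1)).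
have dC : (pdeg (q k.+1) <= Cb)%N := pdeg_bound HB k.+1.
have sqC : (size (q k.+1) <= Cb.+1)%N by rewrite sq.
have sP : (size P <= Cb.+1)%N.
  rewrite (leq_trans (size_polyD _ _))// size_polyN geq_max; apply/andP; split.
    rewrite (leq_trans (size_polyD _ _))// size_polyN geq_max (leq_trans sT sqC)/=.
    exact: leq_trans (size_scale_leq _ _) sqC.
  exact: leq_trans (size_polyC_leq1 _) _.
have PE j : (j <= Cb)%N -> cabs P.[j%:R] <= K * expm k.
  move=> jC; have jb : cabs (j%:R : R[i]) <= Cb%:R + 1 by rewrite cabs_nat; have : j%:R <= Cb%:R :> R by [rewrite ler_nat]; (clear - HB ee m0 qm am K01 alb dfc_small; lra).
  have := hk 0 j%:R z1 jb; rewrite /dfc /P !hornerE TE.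
  by congr (cabs _ <= _); ring.
have := hL P _ sP PE (pdeg (q k.+1)).-1.
have -> : P`_(pdeg (q k.+1)).-1 = ((q k.+1)`_(pdeg (q k.+1)).-1 + (lead_coef (q k.+1) *+ pdeg (q k.+1)) * ee k.+2) * al k.+2 ^+ (pdeg (q k.+1)).-1
    - al k.+3 * (q k.+1)`_(pdeg (q k.+1)).-1.
  rewrite /P !coefB coefZ coefC.
  have -> : ((pdeg (q k.+1)).-1 == 0)%N = false by move: d2; case: (pdeg _) => [|[|d]].
  by rewrite subr0 /pdeg /lead_coef -T1// sq ltnS (leq_trans _ d2).
(clear - HB ee m0 qm am K01 alb dfc_small CKe; lra).
Qed.

(** [coef_facts] compares slopes whose indices differ by 2; a period of the data is reached after
    [m] such steps, hence [m.*2]. *)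
Lemma al_period : exists K N, 0 <= K /\ forall k, (N <= k)%N -> cabs (al (k.+1 + m.*2)%N - al k.+1) <= K * expm k.
Proof.
have [K [N [Kp h]]] := coef_facts.
exists (m%:R * K), N; split; first exact: mulr_ge0.
move=> k Nk.
suff key i : cabs (al (k.+1 + i.*2)%N - al k.+1) <= i%:R * K * expm k by exact: key.
elim: i => [|i ih]; first by rewrite addn0 subrr cabs0 !mul0r.
have [h1 _] := h (k + i.*2)%N (leq_trans Nk (leq_addr _ _)).
have e1 : ((k + i.*2).+3 = k.+1 + i.+1.*2)%N by rewrite doubleS; lia.
have e2 : ((k + i.*2).+1 = k.+1 + i.*2)%N by lia.
rewrite e1 e2 in h1.
have h2 := ler_wpM2l Kp (expm_mono k i.*2).
have := cabs_triB (al (k.+1 + i.+1.*2)%N) (al (k.+1 + i.*2)%N) (al k.+1).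
rewrite -natr1; lra.
Qed.

(** At [k] and [k + m.*2] the second relation of [coef_facts] has the same polynomial and nearly the
    same slopes. Subtracting, and dividing by a power of the slope and by the leading coefficient,
    both bounded below, compares the translations. *)
Lemma ee_period : exists K N, 0 <= K /\ forall k, (N <= k)%N -> cabs (ee (k.+2 + m.*2)%N - ee k.+2) <= K * expm k.
Proof.
have c1 := bC (HB 0%N); have k01 := K01.
have [K1 [N1 [K1p h1]]] := coef_facts; have [K2 [N2 [K2p h2]]] := al_period.
have [L L0 hL] := @coef_small R Cb.
have b1 : 1 <= Cb%:R + 1 :> R by rewrite lerDr.
have bp : 1 <= (Cb%:R + 1) ^+ Cb :> R by rewrite exprn_ege1.
have [Qc QcE] : exists Qc, Qc = L * (C * (Cb%:R + 1) ^+ Cb) by eexists.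
have Qc0 : 0 <= Qc by rewrite QcE mulr_ge0// mulr_ge0//; lra.
have qc k i : cabs (q k)`_i <= Qc.
  rewrite QcE; apply: hL; first by have := pdeg_bound HB k; rewrite /pdeg; case: (size (q k)).
  move=> j jC; have jb : cabs (j%:R : R[i]) <= Cb%:R + 1 by rewrite cabs_nat ler_wpDr// ler_nat.
  apply: le_trans (bup (HB k) b1 jb) _; apply: ler_wpM2l; first lra.
  by rewrite ler_weXn2l// (pdeg_bound HB).
have [U UE] : exists U, U = K0 ^+ Cb by eexists.
have U1 : 1 <= U by rewrite UE exprn_ege1.
have [W WE] : exists W, W = U * (K0 * Qc + K1) by eexists.
have W0 : 0 <= W by rewrite WE mulr_ge0 ?addr_ge0 ?mulr_ge0//; (clear - HB ee m0 qm am K01 alb dfc_small U1 k01; lra).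
have [Z ZE] : exists Z, Z = Qc * K2 + 2 * K1 + W * (Cb%:R * U * K2) by eexists.
have CU0 : 0 <= Cb%:R * U by rewrite mulr_ge0//; lra.
have Z0 : 0 <= Z.
  by rewrite ZE; have z1 := mulr_ge0 Qc0 K2p; have z2 := mulr_ge0 W0 (mulr_ge0 CU0 K2p); lra.
exists (expR C * (U * Z)), (maxn N1 (maxn N2 N0)); split; first by rewrite !mulr_ge0 ?expR_ge0//; lra.
move=> k; rewrite !geq_max => /and3P[k1 k2 k0].
have e0 := expm_gt0 k.
have [_ f1] := h1 k k1.
have [_ f2] := h1 (k + m.*2)%N (leq_trans k1 (leq_addr _ _)).
rewrite -!addSn q2m in f2.
have g1 := h2 k.+1 (leqW k2); have g2 := h2 k.+2 (leqW (leqW k2)).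
set p := (pdeg (q k.+1)).-1 in f1 f2; set qp := (q k.+1)`_p in f1 f2; set lc := lead_coef (q k.+1) *+ _ in f1 f2.
have d2 := bdeg (HB k.+1).
have pC : (p <= Cb)%N by rewrite (leq_trans (leq_pred _))// (pdeg_bound HB).
have [a1 a2] := alb (leq_trans k0 (leq_trans (leqnSn _) (leqnSn _)) : (N0 <= k.+2)%N).
have [a1' a2'] := alb (leq_trans k0 (leq_trans (leqW (leqnSn _)) (leq_addr _ _)) : (N0 <= k.+2 + m.*2)%N).
have [a3 _] := alb (leq_trans k0 (leqW (leqW (leqnSn _))) : (N0 <= k.+3)%N).
have qpb : cabs qp <= Qc by exact: qc.
have Up : K0 ^+ p <= U by rewrite UE ler_weXn2l.
have low x : 1 <= K0 * cabs x -> 1 <= U * cabs (x ^+ p).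
  move=> hx; rewrite cabsX; have : 1 <= (K0 * cabs x) ^+ p by rewrite exprn_ege1.
  rewrite exprMn => /le_trans; apply; apply: ler_wpM2r => //; exact: exprn_ge0 (cabs_ge0 _).
have l1 := low _ a2; have l2 := low _ a2'.
have em1 : expm k.+1 <= expm k by have := expm_mono k 1; rewrite addn1.
have em2 : expm k.+2 <= expm k by have := expm_mono k 2; rewrite addn2.
have em3 : expm (k + m.*2) <= expm k := expm_mono k _.
have ek1 : expm k <= 1 by rewrite /expm expR_le1 oppr_le0.
set X := qp + lc * ee k.+2 in f1; set X' := qp + lc * ee (k.+2 + m.*2)%N in f2.
set al2 := al k.+2 in f1 a1 a2 l1 g1; set al2' := al (k.+2 + m.*2)%N in f2 a1' a2' l2 g1.
have XW : cabs X <= W.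
  have h3 : cabs (X * al2 ^+ p) <= K0 * Qc + K1.
    have := cabs_dist (X * al2 ^+ p) (al k.+3 * qp); rewrite [cabs (al k.+3 * _)]cabsM.
    have := ler_pM (cabs_ge0 _) (cabs_ge0 _) a3 qpb; have := ler_wpM2l K1p ek1; (clear - HB ee m0 qm am K01 alb dfc_small f1; lra).
  rewrite cabsM in h3; have U0 : 0 <= U by (clear - HB ee m0 qm am K01 alb dfc_small U1; lra).
  have := ler_wpM2l U0 h3; rewrite -WE => h4.
  have := ler_wpM2l (cabs_ge0 X) l1; (clear - HB ee m0 qm am K01 alb dfc_small h4; lra).
have dal3 : cabs (al (k.+3 + m.*2)%N - al k.+3) <= K2 * expm k.
  by apply: le_trans g2 _; exact: ler_wpM2l.
have dal2 : cabs (al2' - al2) <= K2 * expm k by apply: le_trans g1 _; exact: ler_wpM2l.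
have dp : cabs (al2' ^+ p - al2 ^+ p) <= Cb%:R * U * (K2 * expm k).
  apply: le_trans (pow_lip p k01 a1' a1) _; apply: ler_pM => //.
    by rewrite mulr_ge0// exprn_ge0//; (clear - HB ee m0 qm am K01 alb dfc_small k01; lra).
  apply: ler_pM => //; first by rewrite exprn_ge0//; (clear - HB ee m0 qm am K01 alb dfc_small k01; lra).
  by rewrite ler_nat.
have f2' : cabs (X' * al2' ^+ p - al (k.+3 + m.*2)%N * qp) <= K1 * expm k.
  by apply: le_trans f2 _; exact: ler_wpM2l.
have dX : cabs ((X' - X) * al2' ^+ p) <= Z * expm k.
  have -> : (X' - X) * al2' ^+ p = (X' * al2' ^+ p - al (k.+3 + m.*2)%N * qp) - (X * al2 ^+ p - al k.+3 * qp)
     + (al (k.+3 + m.*2)%N - al k.+3) * qp - X * (al2' ^+ p - al2 ^+ p) by ring.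
  apply: le_trans (cabsB _ _) _; apply: le_trans (lerD (cabsD _ _) (lexx _)) _.
  apply: le_trans (lerD (lerD (cabsB _ _) (lexx _)) (lexx _)) _.
  rewrite (cabsM (al _ - _)) (cabsM X).
  have t1 : cabs (al (k.+3 + m.*2)%N - al k.+3) * cabs qp <= K2 * expm k * Qc by apply: ler_pM.
  have t2 : cabs X * cabs (al2' ^+ p - al2 ^+ p) <= W * (Cb%:R * U * (K2 * expm k)) by apply: ler_pM.
  rewrite ZE.
  have -> : (Qc * K2 + 2 * K1 + W * (Cb%:R * U * K2)) * expm k = K1 * expm k + K1 * expm k + K2 * expm k * Qc + W * (Cb%:R * U * (K2 * expm k)) by ring.
  by apply: lerD => //; apply: lerD => //; apply: lerD.
have dX2 : cabs (X' - X) <= U * Z * expm k.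
  rewrite cabsM in dX; have U0 : 0 <= U by (clear - HB ee m0 qm am K01 alb dfc_small U1; lra).
  have := ler_wpM2l U0 dX; have := ler_wpM2l (cabs_ge0 (X' - X)) l2; (clear - HB ee m0 qm am K01 alb dfc_small; lra).
have lcb : expR (- C) <= cabs lc.
  have l0 : lead_coef (q k.+1) != 0.
    by rewrite lead_coef_eq0 -size_poly_gt0; move: d2; rewrite /pdeg; case: (size _).
  have h3 : expR (- C) <= cabs (lead_coef (q k.+1)).
    rewrite -[leRHS]lnK ?posrE ?cabs_gt0// ler_expR.
    by have := blead (HB k.+1); rewrite ler_norml => /andP[].
  apply: le_trans h3 _; rewrite /lc -mulr_natl cabsM cabs_nat ler_peMl ?cabs_ge0// ler1n.
  exact: leq_trans d2.
have dXe : X' - X = lc * (ee (k.+2 + m.*2)%N - ee k.+2) by rewrite /X /X'; ring.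
rewrite dXe cabsM in dX2.
have h5 := ler_wpM2r (cabs_ge0 (ee (k.+2 + m.*2)%N - ee k.+2)) lcb.
have h6 := ler_wpM2l (expR_ge0 C) (le_trans h5 dX2).
by move: h6; rewrite mulrA -expRD subrr expR0 mul1r !mulrA.
Qed.

Lemma limit_maps : exists A E : nat -> R[i],
  [/\ forall n, A (n + m.*2)%N = A n /\ E (n + m.*2)%N = E n,
    forall n, A n != 0,
    forall n x y, (q n).[E n.+1 + A n.+1 * y] - a n * (E n + A n * x) = E n.+2 + A n.+2 * ((q n).[y] - a n * x) &
    exists K N, 0 <= K /\ forall k, (N <= k)%N -> cabs (al k.+2 - A k.+2) <= K * expm k /\ cabs (ee k.+2 - E k.+2) <= K * expm k].
Proof.
have c1 := bC (HB 0%N); have k01 := K01.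
have [K1 [N1 [K1p h1]]] := al_period; have [K2 [N2 [K2p h2]]] := ee_period.
have M0 : (0 < m.*2)%N by rewrite double_gt0.
have [|A [A1 A2 A3]] := @seq_limits al m.*2 N1 K1 M0 K1p.
  move=> k Nk; apply: le_trans (h1 k.+1 (leqW Nk)) _; apply: ler_wpM2l => //.
  by have := expm_mono k 1; rewrite addn1.
have [E [E1 E2 E3]] := seq_limits M0 K2p h2.
have q2mj n j : q (n + m.*2 * j)%N = q n.
  by elim: j => [|j ih]; rewrite ?muln0 ?addn0// mulnS addnCA addnC q2m.
have a2mj n j : a (n + m.*2 * j)%N = a n.
  by elim: j => [|j ih]; rewrite ?muln0 ?addn0// mulnS addnCA addnC a2m.
exists A, E; split => //.
- move=> n; rewrite -cabs_gt0; apply: (@lt_le_trans _ _ (1 / K0)); first by rewrite divr_gt0//; lra.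
  apply/ler_addgt0Pr => e e0; have [N3 hN3] := (clim_ooP _ _).1 (A2 n) e e0.
  have j1 : (N0 <= n + m.*2 * (N3 + N0))%N.
    rewrite (leq_trans _ (leq_addl _ _))// (leq_trans (leq_addl N3 N0))// leq_pmull//.
  have [_ h3] := alb j1; have h4 := hN3 (N3 + N0)%N (leq_addr _ _).
  have h5 : 1 / K0 <= cabs (al (n + m.*2 * (N3 + N0))%N) by rewrite ler_pdivrMr 1?mulrC//; lra.
  have := cabs_dist (al (n + m.*2 * (N3 + N0))%N) (A n); lra.
- move=> n x y.
  have [Y [Y1 xY yY]] : exists Y : R, [/\ 1 <= Y, cabs x <= Y & cabs y <= Y].
    by exists (1 + cabs x + cabs y); have := cabs_ge0 x; have := cabs_ge0 y; split; lra.
  have [K [N [Kp h]]] := dfc_small Y1.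
  have l1 : clim \oo (fun j => dfc (n + m.*2 * j)%N x y)
     ((q n).[E n.+1 + A n.+1 * y] - a n * (E n + A n * x) - (E n.+2 + A n.+2 * ((q n).[y] - a n * x))).
    apply: (@clim_near_eq _ _ _ _ (fun j => (q n).[ee (n.+1 + m.*2 * j)%N + al (n.+1 + m.*2 * j)%N * y]
       - a n * (ee (n + m.*2 * j)%N + al (n + m.*2 * j)%N * x)
       - (ee (n.+2 + m.*2 * j)%N + al (n.+2 + m.*2 * j)%N * ((q n).[y] - a n * x)))).
      by apply: nearW => j; rewrite /dfc q2mj a2mj !addSn.
    apply: climB.
      apply: climB.
        by apply: clim_horner; apply: climD => //; apply: climM => //; exact: clim_cst.
      by apply: climM; [exact: clim_cst|apply: climD => //; apply: climM => //; exact: clim_cst].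
    by apply: climD => //; apply: climM => //; exact: clim_cst.
  have l2 : clim \oo (fun j => dfc (n + m.*2 * j)%N x y) 0.
    apply/clim_ooP => e e0; have K1p' : 0 < K + 1 by lra.
    have [N3 hN3] := small_half (divr_gt0 e0 K1p').
    exists (N3 + N).+1 => j hj; rewrite subr0.
    have hk : (N3 + N <= (n + m.*2 * j).-1)%N.
      have : (j <= m.*2 * j)%N by rewrite leq_pmull.
      by move: hj; clear; lia.
    have kE : ((n + m.*2 * j).-1.+1 = n + m.*2 * j)%N.
      rewrite prednK// (leq_trans _ (leq_addl _ _))// (leq_trans _ (leq_pmull _ M0))//; exact: leq_ltn_trans hj.
    have := h (n + m.*2 * j).-1 (leq_trans (leq_addl _ _) hk) x y xY yY; rewrite kE => /le_lt_trans; apply.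
    set k := (n + m.*2 * j).-1 in hk *.
    have ek : expm k <= 2^-1 ^+ N3.
      have -> : k = (0 + k)%N by [].
      apply: le_trans (expm_half 0 k) _.
      have e1 : expm 0 <= 1 by rewrite /expm expR_le1 oppr_le0.
      have N3k : (N3 <= k)%N by apply: (leq_trans _ hk); exact: leq_addr.
      rewrite -[leRHS]mul1r; apply: (ler_pM (ltW (expm_gt0 0)) _ e1); first by apply: exprn_ge0.
      by rewrite -(subnKC N3k) exprD ler_piMr ?exprn_ge0 ?exprn_ile1//; (clear - HB ee m0 qm am K01 alb dfc_small; lra).
    have := hN3 N3 (leqnn _); rewrite ltr_pdivlMr// => h3.
    have h4 := ler_wpM2l Kp ek; have [h5 _] := @half_expn R N3; lra.
  by apply/eqP; rewrite -subr_eq0; apply/eqP; exact: (clim_unique _ l1 l2).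
- exists (2 * (K1 + K2)), (maxn N1 N2); split; first lra.
  move=> k; rewrite geq_max => /andP[k1 k2]; have e0 := expm_gt0 k.
  have := A3 k k1; have := E3 k k2; have := mulr_ge0 K1p (ltW e0); have := mulr_ge0 K2p (ltW e0).
  by move=> *; split; lra.
Qed.

End Limits.

(** * From approximate to exact equality *)

Section Exact.
Context {R : realType}.
Implicit Types (z w : C2 R) (r : R) (n k N : nat) (s x y : R[i]).

(** The three circles inequality with inner bound 0: the exponent is free, so the bound [M / T ^+ k]
    tends to 0. *)
Lemma zero_continuation (g : R[i] -> R[i]) (r T : R) : 0 < r -> 1 < T ->
  (forall s, cabs s <= T -> cdiff g s) -> (forall s, cabs s <= r -> g s = 0) -> g 1 = 0.
Proof.
move=> r0 T1 gd gz.
have [M M0 hM] := cbounded_disc (fun s sT => cdiff_ccont (gd s sT)).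
have [r1|r1] := leP 1 r; first by apply: gz; rewrite cabs1.
apply/eqP; rewrite -cabs_eq0 eq_le cabs_ge0 andbT.
apply/ler_addgt0Pr => e e0.
have [k hk] : exists k, M <= e * T ^+ k.
  exists (Num.bound (M / (e * (T - 1)))).
  have h0 : 0 < e * (T - 1) by rewrite mulr_gt0// subr_gt0.
  have h1 : M / (e * (T - 1)) < (Num.bound (M / (e * (T - 1))))%:R.
    by rewrite archi_boundP// divr_ge0// ltW.
  set K := Num.bound _ in h1 *; rewrite ltr_pdivrMr// in h1.
  have T10 : 0 <= T - 1 by lra.
  have tt : 1 + (T - 1) = T by lra.
  have := bernoulli_le K T10; rewrite tt => h2.
  have := ler_wpM2l (ltW e0) h2; lra.
have h0 s : cabs s = r -> cabs (g s) <= 0 by move=> sr; rewrite gz ?cabs0// sr.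
have := @hadamard _ g r T 1 0 M k r0; rewrite cabs1 expr1n mul1r => /(_ r1 T1).
move=> /(_ (fun s h => gd s (proj2 (andP h))) h0) /(_ _)/le_trans; apply.
  by move=> s sT; apply: hM; rewrite sT.
rewrite mul0r ge_max; have Tk : 0 < T ^+ k by rewrite exprn_gt0//; lra.
by rewrite add0r ltW// ler_pdivrMr.
Qed.

Variables (q : nat -> {poly R[i]}) (a : nat -> R[i]) (C : R).
Hypothesis HB : forall k, bnd (q k) (a k) C.
Notation F := (hiter q a).
Notation Fi := (hiterV q a).
Notation D := (hdeg q).
Notation G := (gr q a C).
Notation cg := (cgr C).
Notation Cb := (Num.bound C).
Variables (c : R) (f : C2 R -> C2 R).
Hypothesis c0 : 0 < c.
Hypothesis fh : hol [set z | G z < c] f.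
Hypothesis fG : forall z, G z < c -> G (f z) = G z.
Notation fl := (fl q a f).
Variables A E : nat -> R[i].
Hypothesis AE : forall n x y, (q n).[E n.+1 + A n.+1 * y] - a n * (E n + A n * x) =
  E n.+2 + A n.+2 * ((q n).[y] - a n * x).

Definition mmap n z : C2 R := (E n + A n * z.1, E n.+1 + A n.+1 * z.2).

Lemma hiter_mmap n z : F n (mmap 0 z) = mmap n (F n z).
Proof. by elim: n => [|n ih] //=; rewrite ih /henon /mmap /= AE. Qed.

Variable B : R.
Hypothesis B1 : 1 <= B.
Hypothesis AB : forall n, cabs (A n) <= B /\ cabs (E n) <= B.

Lemma nrm_mmap n z r : 1 <= r -> nrm z <= r -> nrm (mmap n z) <= 2 * B * r.
Proof.
move=> r1; rewrite !nrm_le /mmap /= => /andP[z1 z2]; have b1 := B1.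
have Br : B * 1 <= B * r by rewrite ler_wpM2l//; lra.
have h k x : cabs x <= r -> cabs (E k + A k * x) <= 2 * B * r.
  move=> xr; have [ha he] := AB k; apply: le_trans (cabsD _ _) _; rewrite cabsM.
  have := ler_pM (cabs_ge0 _) (cabs_ge0 _) ha xr; lra.
by rewrite !h.
Qed.

Variables (K : R) (N0 : nat).
Hypothesis K1 : 1 <= K.
Hypothesis AP : forall k, (N0 <= k)%N -> forall z r, 1 <= r -> nrm z <= r ->
  K * r <= expR (D k)%:R -> dst (fl k.+2 z) (mmap k.+2 z) <= K * r ^+ 2 * expR (- (D k)%:R).

(** For small [G z] the orbit stays below a multiple of [exp (t D_n)], so an inverse step expands by
    at most [exp (P + Cb t D_(n+1))]. For small [t] the product of these factors cannot make up for
    the error of order [exp (- D_k)] at a late level. *)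
Lemma exact_near : exists2 t, 0 < t & forall z, G z < t -> G z < c -> f z = mmap 0 z.
Proof.
have c1 := bC (HB 0%N); have b1 := B1; have k1 := K1; have cg0 := cgr_gt0 HB.
have [Q QE] : exists Q, Q = (Cb%:R + 1) * C ^+ 2 by eexists.
have cb0 : 0 <= Cb%:R :> R by [].
have CC : 1 <= C ^+ 2 by rewrite exprn_ege1.
have CbC : 0 <= Cb%:R * C ^+ 2 by rewrite mulr_ge0//; lra.
have QE' : Q = Cb%:R * C ^+ 2 + C ^+ 2 by rewrite QE mulrDl mul1r.
have Q0 : 0 < 8 * Q by lra.
(* Makes [2 t C^2 + 2 t Cb C^2] equal to [1 / 4], which leaves more than half of the exponent
   [- D_k]. *)
have [t tE] : exists t, t = 1 / (8 * Q) by eexists.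
have t0 : 0 < t by rewrite tE divr_gt0.
exists t => // z zt zc.
have tQ : t * (8 * Q) = 1 by rewrite tE divfK// gt_eqF.
have u8 : 0 <= t * C ^+ 2 by rewrite mulr_ge0//; lra.
have w8 : 0 <= t * (Cb%:R * C ^+ 2) by rewrite mulr_ge0//; lra.
have uw : 8 * (t * C ^+ 2) + 8 * (t * (Cb%:R * C ^+ 2)) = 1 by rewrite -[RHS]tQ QE'; ring.
have [N1 hN1] := eventually_good_pt HB z; have [N2 hN2] := eventually_good_pt HB (f z).
have [N N1N [N2N N0N]] : exists2 N, (N1 <= N)%N & (N2 <= N)%N /\ (N0 <= N)%N.
  exists (maxn N1 (maxn N2 N0)); rewrite ?leq_maxl//.
  by split; rewrite !leq_max leqnn ?orbT.
pose r n := expR ((D n)%:R * t + cg).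
have r1 n : 1 <= r n by apply: expR_ge1; rewrite addr_ge0 ?mulr_ge0// ltW.
have szv v n : G v < t -> good (rgood C) (F n v) -> nrm (F n v) <= r n.
  move=> vt /(grP HB); rewrite ler_norml => /andP[_ h].
  apply: le_trans (nrm_le_exp _) _; rewrite ler_expR.
  have := ler_wpM2l (ltW (hdegR_gt0 HB n)) (ltW vt); lra.
have az n : (N <= n)%N -> nrm (F n z) <= r n.
  by move=> Nn; apply: szv => //; apply: hN1; exact: leq_trans Nn.
have af n : (N <= n)%N -> nrm (F n (f z)) <= r n.
  by move=> Nn; apply: szv; [rewrite fG|apply: hN2; exact: leq_trans Nn].
have rB n : r n <= 2 * B * r n by rewrite ler_peMl//; [have := r1 n; (clear - HB c0 fh fG AE B1 AB K1 AP; lra)|(clear - HB c0 fh fG AE B1 AB K1 AP b1; lra)].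
pose dl n := dst (F n (f z)) (F n (mmap 0 z)).
have [P PE] : exists P, P = ln (2 * C ^+ 2 * (2 * B) ^+ Cb) + Cb%:R * cg by eexists.
have L0 : 0 < 2 * C ^+ 2 * (2 * B) ^+ Cb by rewrite mulr_gt0 ?exprn_gt0//; (clear - HB c0 fh fG AE B1 AB K1 AP CC b1; lra).
have step n : (N <= n)%N -> dl n <= expR (P + Cb%:R * t * (D n.+1)%:R) * dl n.+1.
  move=> Nn; rewrite /dl.
  have hb : nrm (F n.+1 (mmap 0 z)) <= 2 * B * r n.+1.
    by rewrite hiter_mmap; apply: nrm_mmap => //; exact: az (leqW Nn).
  have ha : nrm (F n.+1 (f z)) <= 2 * B * r n.+1 := le_trans (af _ (leqW Nn)) (rB _).
  have R1 : 1 <= 2 * B * r n.+1 := le_trans (r1 _) (rB _).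
  have := hinv_lip HB n R1 ha hb; rewrite /= !(henonK HB) => /le_trans; apply.
  rewrite ler_wpM2r ?dst_ge0//.
  have e1 : expR (P + Cb%:R * t * (D n.+1)%:R) = 2 * C ^+ 2 * (2 * B * r n.+1) ^+ Cb.
    have -> : P + Cb%:R * t * (D n.+1)%:R =
      ln (2 * C ^+ 2 * (2 * B) ^+ Cb) + Cb%:R * ((D n.+1)%:R * t + cg) by rewrite PE; ring.
    have -> : (2 * B * r n.+1) ^+ Cb = (2 * B) ^+ Cb * r n.+1 ^+ Cb by rewrite exprMn.
    by rewrite expRD (lnK L0) expRM_natl mulrA.
  rewrite e1.
  have e2 : (2 * B * r n.+1) ^+ pdeg (q n) <= (2 * B * r n.+1) ^+ Cb.
    by rewrite ler_weXn2l// (pdeg_bound HB).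
  have e3 : 1 <= (2 * B * r n.+1) ^+ Cb by rewrite exprn_ege1.
  have e4 : 1 <= C * (2 * B * r n.+1) ^+ Cb by have := ler_pM ler01 ler01 c1 e3; (clear - HB c0 fh fG AE B1 AB K1 AP; lra).
  have C0 : 0 <= C by (clear - HB c0 fh fG AE B1 AB K1 AP c1; lra).
  have e5 := ler_wpM2l C0 e2.
  have : C * (C * (2 * B * r n.+1) ^+ pdeg (q n) + 1) <= C * (2 * (C * (2 * B * r n.+1) ^+ Cb)).
    by apply: ler_wpM2l => //; (clear - HB c0 fh fG AE B1 AB K1 AP e5 e4; lra).
  by move=> /le_trans; apply; rewrite expr2 -!mulrA mulrCA.
have Dt n : 2 * (D n)%:R <= (D n.+1)%:R :> R.
  by rewrite hdegS natrM mulrC ler_wpM2l// ler_nat (bdeg (HB _)).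
have tC0 : 0 <= Cb%:R * t by rewrite mulr_ge0// ltW.
have chain j : dl N <= expR (P * j%:R + 2 * (Cb%:R * t * (D (N + j))%:R)) * dl (N + j)%N.
  elim: j => [|j ih].
    rewrite addn0 ler_peMl ?dst_ge0//; apply: expR_ge1; rewrite mulr0 add0r mulr_ge0//.
    exact: mulr_ge0.
  apply: le_trans ih _; apply: le_trans (ler_wpM2l (expR_ge0 _) (step _ (leq_addr _ _))) _.
  rewrite [leLHS]mulrA -expRD addnS ler_wpM2r ?dst_ge0// ler_expR -natr1.
  have := ler_wpM2l tC0 (Dt (N + j)%N); (clear - HB c0 fh fG AE B1 AB K1 AP; lra).
have DC2 k : (D k.+2)%:R <= C ^+ 2 * (D k)%:R :> R.
  have h1 := hdeg_step HB k.+1; have C0 : 0 <= C by (clear - HB c0 fh fG AE B1 AB K1 AP c1; lra).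
  have := ler_wpM2l C0 (hdeg_step HB k); rewrite expr2; (clear - HB c0 fh fG AE B1 AB K1 AP h1; lra).
have [Nb hNb] := hdeg_large HB (2 * (ln K + cg)).
have fin k : (maxn N Nb <= k)%N -> dl k.+2 <= expR (ln K + 2 * (t * C ^+ 2 * (D k)%:R) + 2 * cg - (D k)%:R).
  rewrite geq_max => /andP[Nk Nbk].
  have NkS : (N <= k.+2)%N := leqW (leqW Nk).
  have rk : r k.+2 <= expR (t * C ^+ 2 * (D k)%:R + cg).
    rewrite ler_expR; have := ler_wpM2l (ltW t0) (DC2 k); (clear - HB c0 fh fG AE B1 AB K1 AP; lra).
  have cond : K * expR (t * C ^+ 2 * (D k)%:R + cg) <= expR (D k)%:R.
    rewrite -[K]lnK ?posrE; last (clear - HB c0 fh fG AE B1 AB K1 AP k1; lra).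
    rewrite -expRD ler_expR; have := hNb k Nbk.
    have h8 : t * C ^+ 2 <= 1 / 2 by (clear - HB c0 fh fG AE B1 AB K1 AP uw w8; lra).
    have := ler_wpM2r (ltW (hdegR_gt0 HB k)) h8; (clear - HB c0 fh fG AE B1 AB K1 AP; lra).
  have := AP (leq_trans N0N Nk) (le_trans (r1 _) rk) (le_trans (az _ NkS) rk) cond.
  rewrite -[fl _ _]/(F k.+2 (f (Fi k.+2 (F k.+2 z)))) (hiterK HB) -hiter_mmap => /le_trans; apply.
  rewrite -[X in X * _ ^+ 2]lnK ?posrE; last (clear - HB c0 fh fG AE B1 AB K1 AP k1; lra).
  rewrite -expRM_natl -!expRD ler_expR; (clear - HB c0 fh fG AE B1 AB K1 AP; lra).
suff d0 : dl N <= 0.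
  have : F N (f z) = F N (mmap 0 z).
    have le0 x : cabs x <= 0 -> x = 0.
      by move=> h; apply/eqP; rewrite -cabs_eq0 eq_le h cabs_ge0.
    move: d0; rewrite /dl dst_le => /andP[/le0 /subr0_eq h1 /le0 /subr0_eq h2].
    by rewrite [LHS]surjective_pairing h1 h2 -surjective_pairing.
  by move=> /(congr1 (Fi N)); rewrite !(hiterK HB).
rewrite leNgt; apply/negP => d0.
suff : 1 / 2 <= 0 :> R by (clear - HB c0 fh fG AE B1 AB K1 AP; lra).
(* The constants [P], one for each inverse step, add up to a term linear in [k], which [hdeg_lin]
   allows. *)
apply: (@hdeg_lin _ _ _ _ HB _ _ (ln K + 2 * cg + P * (2 - N%:R) - ln (dl N)) P (maxn N Nb)) => k hk.
have Nk : (N <= k)%N by apply: leq_trans hk; exact: leq_maxl.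
have jE : (N + (k.+2 - N) = k.+2)%N by rewrite subnKC// (leqW (leqW Nk)).
have := chain (k.+2 - N)%N; rewrite jE => h1.
have h2 := le_trans h1 (ler_wpM2l (expR_ge0 _) (fin k hk)).
rewrite -expRD -[X in X <= _]lnK ?posrE// ler_expR natrB ?(leqW (leqW Nk))// in h2.
rewrite -[k.+2]addn2 natrD addn2 in h2.
have h3 := ler_wpM2l tC0 (DC2 k).
have h4 := congr1 (fun v => v * (D k)%:R) uw.
have h5 := mulr_ge0 u8 (ltW (hdegR_gt0 HB k)).
have h6 := mulr_ge0 w8 (ltW (hdegR_gt0 HB k)).
(clear - HB c0 fh fG AE B1 AB K1 AP h6 h5 h4 h3 h2; lra).
Qed.

(** The identity is continued from a neighbourhood of [w] to [z] along the pulled back line of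
    [line_disc], whose disc contains the parameter 1 in its interior for large [n]. *)
Lemma exact_all w z : G w = 0 -> G z < c -> f z = mmap 0 z.
Proof.
move=> w0 zc; have [t t0 ht] := exact_near.
have [K2 [N [K21 hN]]] := line_disc HB w0 zc.
have [N3 hN3] := hdeg_large HB (K2 / (c - G z)).
pose n := maxn N N3.
have [_ hT] := hN n (leq_maxl _ _).
have cz : 0 < c - G z by lra.
have T1 : 1 < expR ((D n)%:R * (c - G z)) / K2.
  rewrite ltr_pdivlMr ?mul1r; last lra.
  have := hN3 n (leq_maxr _ _); rewrite ltr_pdivrMr// => h.
  have := expR_ge1Dx ((D n)%:R * (c - G z)); lra.
move: hT T1; set T := _ / K2 => hT T1.
pose g s := Fi n (line (F n z) (F n w) s).
have gd s : cdiff2 g s by apply: cdiff2_hiterV; exact: cdiff2_line.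
have g1 : g 1 = z by rewrite /g line1 (hiterK HB).
have g0 : g 0 = w by rewrite /g line0 (hiterK HB).
have wm : G w < Num.min t c by rewrite w0 lt_min t0.
have [d d0 hd] := gr_lt_open HB wm.
have [e e0 he] := cdiff2_cont (gd 0) d0.
have near s : cabs s <= e / 2 -> f (g s) = mmap 0 (g s).
  move=> se; have : cabs (s - 0) < e by rewrite subr0; lra.
  by move=> /he; rewrite g0 => /hd; rewrite lt_min => /andP[h1 h2]; exact: ht.
have e20 : 0 < e / 2 by lra.
have fgd s : cabs s <= T -> cdiff2 (fun s => f (g s)) s.
  by move=> /hT h; exact: (hol_curve fh (gd s) h).
have k1 : (f (g 1)).1 - (mmap 0 (g 1)).1 = 0.
  apply: (@zero_continuation (fun s => (f (g s)).1 - (mmap 0 (g s)).1) (e / 2) T) => //.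
    move=> s sT; apply: cdiffB; first exact: (fgd s sT).1.
    by apply: cdiffD; [exact: cdiff_cst|apply: cdiffZ; exact: (gd s).1].
  by move=> s /near->; rewrite subrr.
have k2 : (f (g 1)).2 - (mmap 0 (g 1)).2 = 0.
  apply: (@zero_continuation (fun s => (f (g s)).2 - (mmap 0 (g s)).2) (e / 2) T) => //.
    move=> s sT; apply: cdiffB; first exact: (fgd s sT).2.
    by apply: cdiffD; [exact: cdiff_cst|apply: cdiffZ; exact: (gd s).2].
  by move=> s /near->; rewrite subrr.
rewrite g1 in k1 k2.
rewrite [LHS]surjective_pairing [RHS]surjective_pairing.
by move/eqP: k1; move/eqP: k2; rewrite !subr_eq0 => /eqP-> /eqP->.
Qed.

End Exact.

(** * Automorphisms preserve the Green function *)

Section Invariance.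
Context {R : realType}.
Implicit Types (z w P : C2 R) (r : R) (n k N : nat) (s y : R[i]).
Variables (q : nat -> {poly R[i]}) (a : nat -> R[i]) (C : R).
Hypothesis HB : forall k, bnd (q k) (a k) C.
Notation F := (hiter q a).
Notation Fi := (hiterV q a).
Notation G := (gr q a C).

(** If [G] had no zero, [(F_N (0, y)).2] would vanish nowhere for a suitable [N], while on large
    circles it is at least [|y|] in modulus; this contradicts [exists_zero]. *)
Lemma gr_zero_exists : exists w, G w = 0.
Proof.
apply: contrapT => /forallNP h.
have c1 := bC (HB 0%N).
have pos z : 0 < G z by rewrite lt_neqAle gr_ge0// andbT eq_sym; apply/eqP.
pose g y : C2 R := (0, y).
have gd s : cdiff2 g s by split; [exact: cdiff_cst|exact: cdiff_id].
have [N hN] := curve_vplus HB (T := rgood C) C (fun s _ => conj (gd s) (pos (g s))).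
have Cr : C <= rgood C by rewrite /rgood; lra.
have far y : rgood C <= cabs y -> cabs y <= cabs (F N (g y)).2.
  move=> yr; have gV : vplus C (g y) by split => /=; [exact: le_trans yr|rewrite cabs0].
  have [_ /(le_trans _)] := hiter_vplus HB N (lexx _) gV; apply.
  by apply: ler_peMl; [exact: cabs_ge0|apply: exprn_ege1; lra].
have nz y : 0 < cabs (F N (g y)).2.
  have [yr|yr] := leP (cabs y) (rgood C).
    by have [h1 _] := hN N y (leqnn _) yr; lra.
  by have := far y (ltW yr); lra.
have [T [T0 Tr T1]] : exists T, [/\ 0 < T, rgood C <= T & cabs (F N (g 0)).2 < T].
  have := cabs_ge0 (F N (g 0)).2.
  by exists (rgood C + cabs (F N (g 0)).2); split; lra.
have h1 s : cabs s <= T -> cdiff (fun s => (F N (g s)).2) s.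
  by move=> _; have [] := cdiff2_hiter q a N (gd s).
have h2 s : cabs s = T -> T <= cabs (F N (g s)).2.
  by move=> sT; rewrite -[X in X <= _]sT; apply: far; rewrite sT.
have [s _ s0] := exists_zero T0 h1 T1 h2.
by have := nz s; rewrite s0 cabs0 ltxx.
Qed.

(* Otherwise a small vertical disc at a high level would lie in a single leaf. *)
Lemma gr_not_locally_const P d : 0 < d -> 0 < G P -> exists2 w, dst w P < d & G w <> G P.
Proof.
move=> d0 GP; apply: contrapT => hn.
have cst w : dst w P < d -> G w = G P by move=> wd; apply: contrapT => ne; apply: hn; exists w.
have [c1 c2 c3 c4 c5] := Cpow HB.
have [N hN] := gr_gt0_vplus HB (2 * rr C) GP.
have r1 : 2 <= rr C by rewrite /rr; lra.
have CR : C <= 2 * rr C by have := rr_ge HB; lra.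
have NV := hN N (leqnn _); have [[y1 _] y2] := henon_vplus HB N CR NV.
rewrite -[henon _ _ _]/(F N.+1 P) in y1 y2.
have xE : (F N P).2 = (F N.+1 P).1 by [].
rewrite xE in y2.
set p := F N.+1 P in y1 y2.
pose g s : C2 R := (p.1, p.2 + s).
have gd s : cdiff2 g s.
  by split; [exact: cdiff_cst|apply: cdiffD; [exact: cdiff_cst|exact: cdiff_id]].
have g0 : Fi N.+1 (g 0) = P by rewrite /g addr0 -surjective_pairing (hiterK HB).
have [e e0 he] := cdiff2_cont (cdiff2_hiterV q a N.+1 (gd 0)) d0.
have [T [T0 Te T1]] : exists T, [/\ 0 < T, T < e & T <= 1].
  exists (Num.min (e / 2) 1); rewrite lt_min ge_min lexx orbT; split => //; first by rewrite ltr01 andbT; lra.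
  by rewrite gt_min; apply/orP; left; lra.
have gG s : cabs s <= T -> G (Fi N.+1 (g s)) = G P.
  move=> sT; apply: cst; rewrite -g0; apply: he; rewrite subr0; lra.
have T16 : cabs ((T / 16)%:C : R[i]) = T / 16 by rewrite cabsR ger0_norm//; lra.
have z0 : cabs (0 : R[i]) <= T by rewrite cabs0 ltW.
have near : nearby (stail N.+1 q) (stail N.+1 a) (g (T / 16)%:C) (g 0) (16 * C).
  apply: (leaf_disc (stail_bnd N.+1 HB) T0); last by rewrite T16.
  move=> s sT; split => //.
    have h1 := cabs_dist p.2 (- s); rewrite opprK cabsN in h1.
    have h2 := cabsB (p.2 + s) s; rewrite addrK in h2.
    by split => /=; [lra|have := cabs_ge0 p.1; lra].
  by rewrite !(grV_shift _ _ HB) gG// gG.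
have V0 : vplus (rr C) (g 0) by split; rewrite /= addr0; have := cabs_ge0 p.1; lra.
have rho16 : 16 * C <= rho C by rewrite /rho; lra.
have n1 : nearby (stail N.+1 q) (stail N.+1 a) (g (T / 16)%:C) (g 0) (rho C).
  by move=> k; exact: le_trans (near k) rho16.
have n2 : nearby (stail N.+1 q) (stail N.+1 a) (g 0) (g 0) (rho C).
  by move=> k; rewrite subrr cabs0 /rho; lra.
have := leaf_eq (stail_bnd N.+1 HB) V0 n1 n2 erefl => /(congr1 snd) /=.
move=> /addrI/(congr1 (@cabs R)); rewrite T16 cabs0; lra.
Qed.

Section Aut.
Variables (c : R) (f f' : C2 R -> C2 R).
Hypothesis c0 : 0 < c.
Hypothesis fh : hol [set z | G z < c] f.
Hypothesis fh' : hol [set z | G z < c] f'.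
Hypothesis fc : forall z, G z < c -> G (f z) < c.
Hypothesis fc' : forall z, G z < c -> G (f' z) < c.
Hypothesis fK : forall z, G z < c -> f' (f z) = z.
Hypothesis fK' : forall z, G z < c -> f (f' z) = z.

Lemma hol_sub (W W' : set (C2 R)) (h : C2 R -> C2 R) : W' `<=` W -> hol W h -> hol W' h.
Proof. by move=> s [h1 h2]; split => [g t gt /s|z /s]; [exact: h1|exact: h2]. Qed.

Lemma aut_gr_le z : G z < c -> G (f z) <= G z.
Proof.
move=> zc; have c0' := c0; have [w w0] := gr_zero_exists.
have inK v : G v = 0 -> G v < c by move=> ->.
have fw0 v v' : G v = 0 -> G v' = 0 -> G (f v') <= G (f v).
  move=> h h'; have := green_convex HB fh fc c0 h (inK _ h'); rewrite h' mulr0.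
  by rewrite pmulr_lle0// subr_le0.
have fw0' v v' : G v = 0 -> G v' = 0 -> G (f' v') <= G (f' v).
  move=> h h'; have := green_convex HB fh' fc' c0 h (inK _ h'); rewrite h' mulr0.
  by rewrite pmulr_lle0// subr_le0.
have [k0|k0] := eqVneq (G (f w)) 0.
  by have := green_convex HB fh fc c0 w0 zc; rewrite k0 !subr0 (mulrC c) ler_pM2r.
have kp : 0 < G (f w) by rewrite lt_neqAle eq_sym k0 gr_ge0.
exfalso; have [l0|l0] := eqVneq (G (f' w)) 0.
  have := fw0 _ _ l0 w0; rewrite fK' ?inK// w0; lra.
have lp : 0 < G (f' w) by rewrite lt_neqAle eq_sym l0 gr_ge0.
have lc : G (f' w) < c by apply: fc'; exact: inK.
have sub : [set v | G v < G (f' w)] `<=` [set v | G v < c] by move=> v /= h; exact: lt_trans lc.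
(* If [G (f v)] were 0, then as [v = f' (f v)] the constancy of [G o f'] on the zero set would give
   [G v >= G (f' w)]. So [green_const] applies on this smaller sublevel set. *)
have pos v : G v < G (f' w) -> 0 < G (f v) <= c.
  move=> vl; have vc := sub v vl; rewrite (ltW (fc vc)) andbT lt_neqAle gr_ge0// andbT eq_sym.
  by apply/eqP => v0; have := fw0' _ _ v0 w0; rewrite fK//; lra.
have const v : G v < G (f' w) -> G (f v) = G (f w).
  by move=> vl; exact: (green_const HB (hol_sub sub fh) pos w0 vl).
have wc := inK w w0; have Pc := fc wc.
have [d1 d10 hd1] := gr_lt_open HB Pc.
have wl : G (f' (f w)) < G (f' w) by rewrite fK// w0.
have [d2 d20 hd2] := gr_lt_open HB wl.
have [d3 d30 hd3] := hol_cont fh' Pc d20.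
have dm : 0 < Num.min d1 d3 by rewrite lt_min d10.
(* Points near [f w] are images of points of the smaller sublevel set, so [G] would be constant
   there. *)
have [v vd] := gr_not_locally_const dm kp; apply.
move: vd; rewrite lt_min => /andP[/hd1 vc /hd3/hd2 vl].
by have := const _ vl; rewrite fK'.
Qed.

End Aut.

Lemma aut_gr c f f' : 0 < c -> hol [set z | G z < c] f -> hol [set z | G z < c] f' ->
  (forall z, G z < c -> G (f z) < c) -> (forall z, G z < c -> G (f' z) < c) ->
  (forall z, G z < c -> f' (f z) = z) -> (forall z, G z < c -> f (f' z) = z) ->
  forall z, G z < c -> G (f z) = G z.
Proof.
move=> c0 fh fh' fc fc' fK fK' z zc; apply/eqP; rewrite eq_le.
rewrite (aut_gr_le c0 fh fh' fc fc' fK fK' zc) /=.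
by have := aut_gr_le c0 fh' fh fc' fc fK' fK (fc _ zc); rewrite fK.
Qed.

End Invariance.

(** * Affine form for large levels, then for all levels *)

Section AllLevels.
Context {R : realType}.
Implicit Types (z w : C2 R) (r : R) (n k N : nat) (s x y : R[i]).

Lemma periodic_bounded (u : nat -> R[i]) M : (0 < M)%N -> (forall n, u (n + M)%N = u n) ->
  exists B, forall n, cabs (u n) <= B.
Proof.
move=> M0 uM; exists (\sum_(i < M) cabs (u i)) => n.
have per i j : u (i + j * M)%N = u i.
  by elim: j => [|j ih]; rewrite ?addn0// mulSn addnCA addnC uM.
rewrite (divn_eq n M) addnC per (bigD1 (Ordinal (ltn_pmod n M0)))//= lerDl.
by apply: sumr_ge0 => i _; exact: cabs_ge0.
Qed.

Variables (q : nat -> {poly R[i]}) (a : nat -> R[i]) (C : R) (m : nat).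
Hypothesis HB : forall k, bnd (q k) (a k) C.
Hypothesis m0 : (0 < m)%N.
Hypothesis qm : forall k, q (k + m)%N = q k.
Hypothesis am : forall k, a (k + m)%N = a k.
Notation F := (hiter q a).
Notation Fi := (hiterV q a).
Notation D := (hdeg q).
Notation G := (gr q a C).
Notation cg := (cgr C).
Notation Cb := (Num.bound C).

Record gaut c (f f' : C2 R -> C2 R) : Prop := Gaut {
  gaut_hol : hol [set z | G z < c] f;
  gaut_hol' : hol [set z | G z < c] f';
  gaut_lt : forall z, G z < c -> G (f z) < c;
  gaut_lt' : forall z, G z < c -> G (f' z) < c;
  gaut_K : forall z, G z < c -> f' (f z) = z;
  gaut_K' : forall z, G z < c -> f (f' z) = z }.

Lemma gaut_gr c f f' z : 0 < c -> gaut c f f' -> G z < c -> G (f z) = G z.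
Proof. by move=> c0 [*]; apply: (aut_gr HB c0 (f := f) (f' := f')). Qed.

(** The relation says that the [n]-th Henon map intertwines the diagonal affine maps [mmap A E n]
    and [mmap A E n.+1]. *)
Record affine_symmetry (A E : nat -> R[i]) : Prop := AffineSymmetry {
  asym_A : forall n, A (n + m.*2)%N = A n;
  asym_E : forall n, E (n + m.*2)%N = E n;
  asym_neq0 : forall n, A n != 0;
  asym_rel : forall n x y, (q n).[E n.+1 + A n.+1 * y] - a n * (E n + A n * x) =
    E n.+2 + A n.+2 * ((q n).[y] - a n * x) }.

Lemma large_level : exists2 cb, 0 < cb & forall c f f', cb <= c -> gaut c f f' ->
  exists A E, affine_symmetry A E /\ forall z, G z < c -> f z = mmap A E 0 z.
Proof.
have cg0 := cgr_gt0 HB; have c1 := bC (HB 0%N); have g1p := gone_gt0 HB.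
have [g1 g1E] : exists g1, g1 = gone C by eexists.
rewrite -g1E in g1p.
have C0 : 0 <= C * g1 by rewrite mulr_ge0//; lra.
have CC0 : 0 <= Cb%:R * (C * g1) by rewrite mulr_ge0.
(* The three bracketed terms are what [g12], [g12C] and [g12B] require. The level [c] has to exceed
   this [g2]. *)
have [g2 g2E] : exists g2, g2 = g1 + (2 * cg + 1) + (C * g1 + 1) + (Cb%:R * (C * g1) + 1) by eexists.
have g1r : ln (rr C) <= g1.
  have [b1 b2 b3 b4] := rbig_facts HB; have [c1' c2 c3 c4 c5] := Cpow HB.
  have : ln (rr C) <= ln (rr C + expR cg + 1 + 3 * C ^+ 2).
    by rewrite ler_ln ?posrE; have := expR_gt0 cg; rewrite /rr; (clear - HB m0 qm am c2 c1' c5 c4 c3; lra).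
  rewrite g1E /gone; lra.
have g12 : 2 * cg + 1 <= g2 - g1 by lra.
have g12C : C * g1 + 1 <= g2 by lra.
have g12B : Cb%:R * (C * g1) + 1 <= g2 by lra.
have [cb [cb0 cb1 cb2]] : exists cb, [/\ 0 < cb, g2 < cb & ln (expR (g2 + cg) + 3 * C ^+ 2) + cg < cb].
  exists (Num.max (g2 + 1) (ln (expR (g2 + cg) + 3 * C ^+ 2) + cg + 1)).
  by rewrite !lt_max; split; apply/orP; [left|left|right]; lra.
exists cb => // c f f' cbc fa; have cp := lt_le_trans cb0 cbc.
have fG z := gaut_gr cp fa (z := z); have fh := gaut_hol fa.
have g2c := lt_le_trans cb1 cbc.
have [ep [n1 [ep0 ep1' IB]]] := image_bound HB fh (gaut_hol' fa) fG (gaut_K fa) (lt_le_trans cb2 cbc).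
have ep1 : ep <= 1 by lra.
rewrite -g1E in IB.
have [Ka [Na [Ka1 ha]]] := aff2 HB fh g1r g12 g2c ep0 ep1 IB.
have [Kl [Nl [Kl1 hl]]] := al_lower HB fh fG g1r g12 g2c ep0 ep1 IB g12C.
have K01 : 1 <= Ka + Kl by (clear - HB m0 qm am Kl1 Ka1; lra).
have alb n : (maxn Na.+1 Nl <= n)%N -> cabs (al q a f n) <= Ka + Kl /\ 1 <= (Ka + Kl) * cabs (al q a f n).
  case: n => [|n]; rewrite geq_max => /andP[//]; rewrite ltnS => nNa nNl; have [h1 _ _] := ha n nNa.
  have h2 := hl _ nNl; split; first (clear - HB m0 qm am h1 Kl1; lra).
  have h3 := cabs_ge0 (al q a f n.+1); have Ka0 : 0 <= Ka by (clear - HB m0 qm am h3 h1; lra).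
  by have := mulr_ge0 Ka0 h3; (clear - HB m0 qm am h2; lra).
have ds := defect_small HB fh g1r g12 g2c ep0 ep1 IB g12B.
have [A [E [AEp An0 rel [K2 [N2 [K20 h2]]]]]] := limit_maps HB m0 qm am K01 alb ds.
exists A, E; split; first by split => // n; have [] := AEp n.
have m20 : (0 < m.*2)%N by rewrite double_gt0.
have [B1 hB1] := periodic_bounded m20 (fun n => (AEp n).1).
have [B2 hB2] := periodic_bounded m20 (fun n => (AEp n).2).
have AB n : cabs (A n) <= 1 + B1 + B2 /\ cabs (E n) <= 1 + B1 + B2.
  have := cabs_ge0 (A n); have := cabs_ge0 (E n); have := hB1 n; have := hB2 n.
  by move=> *; split; lra.
have BB : 1 <= 1 + B1 + B2.
  have := cabs_ge0 (A 0%N); have := cabs_ge0 (E 0%N); have := hB1 0%N; have := hB2 0%N; (clear - HB m0 qm am; lra).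
have [w w0] := gr_zero_exists HB.
move=> z; apply: (exact_all HB cp fh fG rel BB AB (K := Ka + 2 * K2) (N0 := maxn Na N2) _ _ w0); first (clear - HB m0 qm am K20 Ka1; lra).
move=> {}k; rewrite geq_max => /andP[kNa kN2] {}z r r1 zr cond.
have Ska : expR (D k)%:R <= Smax q C g2 k.
  rewrite /Smax ler_expR; have D1 : 1 <= (D k)%:R :> R by rewrite ler1n (hdeg_gt0 HB).
  have g2b : 1 + cg <= g2 by (clear - HB m0 qm am g12B g12 CC0 g1p; lra).
  by have := ler_wpM2l (ltW (hdegR_gt0 HB k)) g2b; have := ler_wpM2r (ltW cg0) D1; (clear - HB m0 qm am; lra).
have S01 := Smax_mono HB g1r g12 k; have S12 := Smax_mono HB g1r g12 k.+1.
have Kr : Ka * r <= expR (D k)%:R.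
  have K2r : 0 <= K2 * r by rewrite mulr_ge0//; (clear - HB m0 qm am r1; lra).
  by apply: le_trans cond; (clear - HB m0 qm am K2r; lra).
have [_ _ /(_ z r r1 zr)] := ha k.+1 (leqW kNa).
move=> /(_ (le_trans Kr (le_trans Ska S01)))[_ e1].
have [_ _ /(_ z r r1 zr)] := ha k.+2 (leqW (leqW kNa)).
move=> /(_ (le_trans Kr (le_trans Ska (le_trans S01 S12))))[e2 _].
have r20 : 0 <= Ka * r ^+ 2 by rewrite mulr_ge0 ?exprn_ge0//; (clear - HB m0 qm am Ka1 r1; lra).
have inv n : expR (D k)%:R <= Smax q C g2 n -> Ka * r ^+ 2 / Smax q C g2 n <= Ka * r ^+ 2 * expR (- (D k)%:R).
  move=> hS; rewrite expRN ler_wpM2l// lef_pV2 ?posrE ?expR_gt0//.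
have i1 := inv _ (le_trans Ska S01); have i2 := inv _ (le_trans Ska (le_trans S01 S12)).
have [a1 b1] := h2 k kN2; have [a2 b2] := h2 k.+1 (leqW kN2).
have em : expm q k.+1 <= expm q k by have := expm_mono HB k 1; rewrite addn1.
have em' := ler_wpM2l K20 em.
have rr1 : 1 <= r ^+ 2 by rewrite exprn_ege1.
have rr2 : r <= r ^+ 2 by rewrite expr2 ler_peMl//; (clear - HB m0 qm am r1; lra).
have X0 : 0 <= K2 * expm q k by rewrite mulr_ge0// expR_ge0.
have x1 := ler_wpM2l X0 rr1; have x2 := ler_wpM2l X0 rr2.
have tri (u e1' a1' e2' a2' x : R[i]) (e : R) : cabs (u - (e1' + a1' * x)) <= e ->
  cabs (a1' - a2') <= K2 * expm q k -> cabs (e1' - e2') <= K2 * expm q k -> cabs x <= r ->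
  cabs (u - (e2' + a2' * x)) <= e + K2 * expm q k + K2 * expm q k * r.
  move=> h h' h'' xr.
  have -> : u - (e2' + a2' * x) = (u - (e1' + a1' * x)) + (e1' - e2') + (a1' - a2') * x by ring.
  apply: le_trans (cabsD _ _) _; rewrite cabsM; apply: lerD; last exact: ler_pM.
  by apply: le_trans (cabsD _ _) _; exact: lerD.
move: zr; rewrite nrm_le => /andP[z1 z2].
have q1 := tri _ _ _ _ _ _ _ (le_trans e1 i1) a1 b1 z1.
have q2 := tri _ _ _ _ _ _ _ (le_trans e2 i2) (le_trans a2 em') (le_trans b2 em') z2.
have fin : Ka * r ^+ 2 * expR (- (D k)%:R) + K2 * expm q k + K2 * expm q k * r <=
    (Ka + 2 * K2) * r ^+ 2 * expR (- (D k)%:R).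
  by rewrite /expm in x1 x2 *; (clear - HB m0 qm am x2 x1; lra).
by rewrite dst_le /mmap /=; apply/andP; split; [exact: le_trans q1 fin|exact: le_trans q2 fin].
Qed.

Lemma hiterV_lip n z : exists K d, [/\ 0 < K, 0 < d &
  forall w, dst w z < d -> dst (Fi n w) (Fi n z) <= K * dst w z].
Proof.
have c1 := bC (HB 0%N).
elim: n z => [|n ih] z; first by exists 1, 1; split => // w _; rewrite mul1r.
have [K [d [K0 d0 h]]] := ih (hinv q a n z).
have [r [r1 rE]] : exists r, 1 <= r /\ r = 1 + nrm z by exists (1 + nrm z); rewrite lerDl nrm_ge0.
have [L [L0 hL]] : exists L, 0 < L /\ forall w, dst w z < 1 -> dst (hinv q a n w) (hinv q a n z) <= L * dst w z.
  exists (C * (C * r ^+ pdeg (q n) + 1)); split.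
    have h0 : 0 <= C * r ^+ pdeg (q n) by rewrite mulr_ge0 ?exprn_ge0//; lra.
    by rewrite mulr_gt0//; lra.
  move=> w wz; apply: hinv_lip => //; first by have := nrm_dst w z; lra.
  by rewrite rE; lra.
exists (K * L), (Num.min 1 (d / L)); split; first exact: mulr_gt0.
  by rewrite lt_min ltr01 divr_gt0.
move=> w; rewrite lt_min => /andP[/hL h1]; rewrite ltr_pdivlMr// mulrC => h2.
rewrite /= -mulrA; apply: le_trans (h _ (le_lt_trans h1 h2)) _.
by rewrite ler_pM2l.
Qed.

Lemma hol_conj c n (W : set (C2 R)) f : hol [set z | G z < c] f ->
  (forall z, W z -> G (Fi n z) < c) -> hol W (fun z => F n (f (Fi n z))).
Proof.
move=> fh hW; split => [g s gs /hW Ws|z /hW Wz].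
  apply: cdiff2_hiter; apply: (hol_curve fh (g := fun s => Fi n (g s))) => //.
  exact: cdiff2_hiterV.
have [K1 [d1 [K10 d10 h1]]] := hiterV_lip n z.
have [K2 [d2 [K20 d20 h2]]] := hol_lip fh Wz.
have [L L1 hL] := hiter_lip HB n (nrm (f (Fi n z)) + 1).
have L0 : 0 < L by lra.
exists (L * (K2 * K1)), (Num.min d1 (Num.min (d2 / K1) (1 / (K2 * K1)))); split.
- by rewrite !mulr_gt0.
- by rewrite !lt_min d10 !divr_gt0// mulr_gt0.
move=> w; rewrite !lt_min ltr_pdivlMr// ltr_pdivlMr ?mulr_gt0// => /and3P[wd1 wd2 wd3].
have u1 := h1 w wd1.
have u2 : dst (f (Fi n w)) (f (Fi n z)) <= K2 * K1 * dst w z.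
  apply: le_trans (h2 _ _) _; first by apply: le_lt_trans u1 _; rewrite mulrC.
  by rewrite -mulrA ler_pM2l.
apply: le_trans (hL _ _ _ _) _.
- by have := nrm_dst (f (Fi n w)) (f (Fi n z)); lra.
- by lra.
by rewrite -mulrA ler_pM2l.
Qed.

Lemma stail_period (T : Type) (u : nat -> T) j : (forall k, u (k + m)%N = u k) -> stail (j * m) u = u.
Proof.
move=> um; apply/funext => k; rewrite /stail addnC.
by elim: j => [|j ih]; rewrite ?addn0// mulSn addnCA addnC um.
Qed.

Lemma all_levels c f f' : 0 < c -> gaut c f f' ->
  exists A E, affine_symmetry A E /\ forall z, G z < c -> f z = mmap A E 0 z.
Proof.
move=> c0 fa; have [cb cb0 hcb] := large_level.
have [N hN] := hdeg_large HB (cb / c).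
(* A multiple of [m], so that conjugation by [F_L] keeps the data, and of [m.*2], so that [mmap] has
   the same coefficients at [L] and at 0. The level becomes [D_L c]. *)
pose L := (N.*2 * m)%N.
have NL : (N <= L)%N by rewrite (leq_trans _ (leq_pmulr _ m0))// -addnn leq_addr.
have Dc : cb <= (D L)%:R * c by have := hN L NL; rewrite ltr_pdivrMr// => /ltW.
have D0 := hdegR_gt0 HB L.
have GV z : G z = (D L)%:R * G (Fi L z) by rewrite -(grV_shift _ _ HB) !stail_period.
have GF z : G (F L z) = (D L)%:R * G z by rewrite GV (hiterK HB).
have Wc z : G z < (D L)%:R * c -> G (Fi L z) < c by rewrite GV ltr_pM2l.
have [|A [E [AS hf]]] := hcb _ (fun z => F L (f (Fi L z))) (fun z => F L (f' (Fi L z))) Dc.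
  split => [| |z /Wc zc|z /Wc zc|z /Wc zc|z /Wc zc].
  - exact: hol_conj (gaut_hol fa) Wc.
  - exact: hol_conj (gaut_hol' fa) Wc.
  - by rewrite GF ltr_pM2l// (gaut_lt fa).
  - by rewrite GF ltr_pM2l// (gaut_lt' fa).
  - by rewrite (hiterK HB) (gaut_K fa)// (hiterVK HB).
  - by rewrite (hiterK HB) (gaut_K' fa)// (hiterVK HB).
exists A, E; split => // z zc.
have := hf (F L z); rewrite GF ltr_pM2l// => /(_ zc); rewrite (hiterK HB) => h.
have ML : mmap A E L = mmap A E 0.
  have per (u : nat -> R[i]) i : (forall n, u (n + m.*2)%N = u n) -> u (i + L)%N = u i.
    move=> um; rewrite /L -doubleMl doubleMr.
    by elim: N {hN NL Dc D0 GV GF Wc hf h L} => [|j ih]; rewrite ?addn0// mulSn addnCA addnC um.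
  apply/funext => v; rewrite /mmap -[L]add0n -addSn.
  by rewrite !(per _ _ (asym_A AS)) !(per _ _ (asym_E AS)).
by apply: (can_inj (hiterK HB L)); rewrite h (hiter_mmap (asym_rel AS)) ML.
Qed.

End AllLevels.

(** * Interface with the norms and limits of the library *)

Section Interface.
Context {R : realType}.
Implicit Types (z w : C2 R) (r : R) (n k : nat) (s x y : R[i]).

Lemma norm_nrm z : `|z| = (nrm z)%:C.
Proof.
rewrite prod_normE /nrm -/(cabs z.1) -/(cabs z.2) !cabsE.
have [h|h] := leP (cabs z.1) (cabs z.2); first by rewrite max_r// lecR.
by rewrite max_l// lecR ltW.
Qed.

Lemma rnorm_nrm z : rnorm z = nrm z.
Proof. by rewrite /rnorm norm_nrm. Qed.

Lemma logp_lg z : logp (nrm z) = lg z.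
Proof.
rewrite /logp /lg; have n0 := nrm_ge0 z.
have [h|h] := leP 1 (nrm z); first by rewrite !max_r// ln_ge0.
by rewrite ln1 max_l// ln_le0// ltW.
Qed.

Lemma complex_gt0 (e : R[i]) : 0 < e -> 0 < complex.Re e /\ e = (complex.Re e)%:C.
Proof.
case: e => u v; rewrite ltcE /= => /andP[ve u0]; split => //.
by apply/eqP; rewrite eq_complex /= eqxx.
Qed.

Lemma bounded_nrm (u : nat -> C2 R) : bounded_fun u <-> exists B, forall n, nrm (u n) <= B.
Proof.
split => [[M [Mr hM]]|[B hB]].
  have ME : M = (complex.Re M)%:C by rewrite RRe_real.
  exists (complex.Re M + 1) => n.
  have /hM/(_ n I) : M < (complex.Re M + 1)%:C by rewrite [ltLHS]ME ltcR ltrDl.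
  by rewrite /= norm_nrm lecR.
exists B%:C; split; first by rewrite realE lecR lecR -realE num_real.
move=> M BM n _ /=; rewrite norm_nrm; apply: (le_trans _ (ltW BM)).
by rewrite lecR.
Qed.

Lemma differentiable_eps (g : C2 R -> C2 R) z : differentiable g z ->
  exists l : R[i] * R[i] * (R[i] * R[i]), forall e, 0 < e -> exists2 d, 0 < d & forall w, dst w z < d ->
    cabs ((g w).1 - (g z).1 - (l.1.1 * (w.1 - z.1) + l.1.2 * (w.2 - z.2))) <= e * dst w z /\
    cabs ((g w).2 - (g z).2 - (l.2.1 * (w.1 - z.1) + l.2.2 * (w.2 - z.2))) <= e * dst w z.
Proof.
move=> dg; have /eqaddoP h := diff_locally dg.
pose L := 'd g z.
exists ((L (1, 0)).1, (L (0, 1)).1, ((L (1, 0)).2, (L (0, 1)).2)) => e e0.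
have eC : 0 < e%:C by rewrite ltcR.
have /nbhs_normP[d /= d0 hd] := h _ eC.
have [dr dE] := complex_gt0 d0.
exists (complex.Re d) => // w wz.
have dn : nrm (w - z) = dst w z by [].
have hw : `|0 - (w - z)| < d by rewrite sub0r normrN norm_nrm dE ltcR dn.
have gw : g (w - z + z) = g w by rewrite subrK.
have {}hw : `|g w - (g z + L (w - z))| <= e%:C * `|w - z| by rewrite -gw; exact: (hd _ hw).
move: hw; rewrite !norm_nrm -rmorphM lecR dn.
have LE : L (w - z) = (w.1 - z.1) *: L (1, 0) + (w.2 - z.2) *: L (0, 1).
  rewrite -[X in _ = X + _]linearZ -[X in _ = _ + X]linearZ -linearD; congr (L _).
  change ((w.1 - z.1, w.2 - z.2) = ((w.1 - z.1) * 1 + (w.2 - z.2) * 0, (w.1 - z.1) * 0 + (w.2 - z.2) * 1) :> C2 R).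
  by rewrite !mulr0 !mulr1 addr0 add0r.
rewrite LE nrm_le => /andP[h1 h2]; split.
  move: h1; congr (cabs _ <= _); rewrite /= /GRing.scale /=; ring.
by move: h2; congr (cabs _ <= _); rewrite /= /GRing.scale /=; ring.
Qed.

Lemma cdiff_eps (h : R[i] -> R[i]) (l s : R[i]) :
  (forall e, 0 < e -> exists2 d, 0 < d & forall t, cabs (t - s) < d -> cabs (h t - h s - l * (t - s)) <= e * cabs (t - s)) ->
  cdiff h s.
Proof.
move=> hh; exists l; exists (fun t => if t == s then l else (h t - h s) / (t - s)).
split; first by rewrite eqxx.
- rewrite /ccont eqxx => e e0.
  have e2 : 0 < e / 2 by lra.
  have [d d0 hd] := hh _ e2.
  apply/cnbP; exists d => // t /hd; have [->|ts] := eqVneq t s; first by move=> _; rewrite subrr cabs0.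
  have ts0 : 0 < cabs (t - s) by rewrite cabs_gt0 subr_eq0.
  have -> : (h t - h s) / (t - s) - l = (h t - h s - l * (t - s)) / (t - s).
    by field; rewrite subr_eq0.
  rewrite cabsf => h1; apply: (@le_lt_trans _ _ (e / 2)); last lra.
  by rewrite ler_pdivrMr.
- apply: nearW => t; have [->|ts] := eqVneq t s; first by rewrite subrr mulr0 addr0.
  by rewrite divfK ?subr_eq0// addrC subrK.
Qed.

Lemma cdiff_lip (h : R[i] -> R[i]) s : cdiff h s -> exists K d, [/\ 0 < K, 0 < d &
  forall t, cabs (t - s) < d -> cabs (h t - h s) <= K * cabs (t - s)].
Proof.
move=> [l [phi [pl pc hp]]].
have /cnbP[d d0 hd] : \forall t \near cnb s, h t = h s + phi t * (t - s) /\ cabs (phi t - phi s) < 1.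
  by move: hp (pc 1 ltr01); apply: filterS2.
exists (cabs (phi s) + 1), d; split => //; first by have := cabs_ge0 (phi s); lra.
move=> t /hd[-> hb]; rewrite addrC addKr cabsM ler_wpM2r//.
by have := cabs_dist (phi t) (phi s); lra.
Qed.

Lemma cdiff_linear_approx (g1 g2 h : R[i] -> R[i]) (l1 l2 s : R[i]) : cdiff g1 s -> cdiff g2 s ->
  (forall e, 0 < e -> exists2 d, 0 < d & forall t, cabs (t - s) < d ->
     cabs (h t - h s - (l1 * (g1 t - g1 s) + l2 * (g2 t - g2 s))) <= e * cabs (t - s)) -> cdiff h s.
Proof.
move=> c1 c2 hh.
pose k t := h t - (l1 * g1 t + l2 * g2 t).
have kd : cdiff k s.
  apply: (@cdiff_eps _ 0) => e /hh[d d0 hd]; exists d => // t /hd; congr (cabs _ <= _); rewrite /k; ring.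
have : cdiff (fun t => k t + (l1 * g1 t + l2 * g2 t)) s.
  by apply: cdiffD => //; apply: cdiffD; exact: cdiffZ.
by under eq_fun do rewrite /k subrK.
Qed.

Lemma hol_differentiable (W : set (C2 R)) (g : C2 R -> C2 R) :
  (forall z, W z -> differentiable g z) -> hol W g.
Proof.
move=> dg; split => [u s [u1 u2] /dg /differentiable_eps[l hl]|z /dg/differentiable_eps[l hl]].
  have [K1 [d1 [K10 d10 h1]]] := cdiff_lip u1; have [K2 [d2 [K20 d20 h2]]] := cdiff_lip u2.
  have K0 : 0 < K1 + K2 by lra.
  have key e : 0 < e -> exists2 d, 0 < d & forall t, cabs (t - s) < d ->
     cabs ((g (u t)).1 - (g (u s)).1 - (l.1.1 * ((u t).1 - (u s).1) + l.1.2 * ((u t).2 - (u s).2))) <= e * cabs (t - s) /\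
     cabs ((g (u t)).2 - (g (u s)).2 - (l.2.1 * ((u t).1 - (u s).1) + l.2.2 * ((u t).2 - (u s).2))) <= e * cabs (t - s).
    move=> e0; have [d d0 hd] := hl _ (divr_gt0 e0 K0).
    exists (Num.min (Num.min d1 d2) (d / (K1 + K2))); first by rewrite !lt_min d10 d20 divr_gt0.
    move=> t; rewrite !lt_min => /andP[/andP[td1 td2]]; rewrite ltr_pdivlMr// => td.
    have a1 := h1 t td1; have a2 := h2 t td2; have ts := cabs_ge0 (t - s).
    have b1 := mulr_ge0 (ltW K10) ts; have b2 := mulr_ge0 (ltW K20) ts.
    have dd : dst (u t) (u s) <= (K1 + K2) * cabs (t - s).
      by rewrite dst_le; apply/andP; split; lra.
    have [|r1 r2] := hd (u t); first by apply: (le_lt_trans dd); rewrite mulrC.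
    have ee : e / (K1 + K2) * dst (u t) (u s) <= e * cabs (t - s).
      by rewrite -mulrA ler_pM2l// mulrC ler_pdivrMr// mulrC.
    by split; [exact: le_trans r1 ee|exact: le_trans r2 ee].
  split.
    apply: (@cdiff_linear_approx _ _ _ l.1.1 l.1.2 _ u1 u2) => e /key[d d0 hd].
    by exists d => // t td; have [] := hd t td.
  apply: (@cdiff_linear_approx _ _ _ l.2.1 l.2.2 _ u1 u2) => e /key[d d0 hd].
  by exists d => // t td; have [] := hd t td.
have [d d0 hd] := hl 1 ltr01.
pose K := cabs l.1.1 + cabs l.1.2 + cabs l.2.1 + cabs l.2.2 + 1.
have := cabs_ge0 l.1.1; have := cabs_ge0 l.1.2; have := cabs_ge0 l.2.1; have := cabs_ge0 l.2.2 => p4 p3 p2 p1.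
exists K, d; split => //; first by rewrite /K; lra.
move=> w /hd[h1 h2]; have dz := dst_ge0 w z.
have lin (u v x y e k : R[i]) (r : R) : cabs (u - v - (x * e + y * k)) <= 1 * r -> cabs e <= r -> cabs k <= r ->
    cabs (u - v) <= (cabs x + cabs y + 1) * r.
  move=> q1 q2 q3.
  have := cabs_dist (u - v) (x * e + y * k); have := cabsD (x * e) (y * k); rewrite !cabsM.
  have := ler_wpM2l (cabs_ge0 x) q2; have := ler_wpM2l (cabs_ge0 y) q3; lra.
have r1 := lin _ _ _ _ _ _ _ h1 (dst1 w z) (dst2 w z).
have r2 := lin _ _ _ _ _ _ _ h2 (dst1 w z) (dst2 w z).
have m1 := mulr_ge0 p1 dz; have m2 := mulr_ge0 p2 dz; have m3 := mulr_ge0 p3 dz; have m4 := mulr_ge0 p4 dz.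
by rewrite dst_le /K; apply/andP; split; lra.
Qed.

Variables (q : nat -> {poly R[i]}) (a : nat -> R[i]) (C : R) (m : nat) (p : nat -> {poly R[i]}) (b : nat -> R[i]).
Hypothesis HB : forall k, bnd (q k) (a k) C.
Hypothesis m0 : (0 < m)%N.
Hypothesis qm : forall k, q (k + m)%N = q k.
Hypothesis am : forall k, a (k + m)%N = a k.
Hypothesis qE : forall k, (k < m)%N -> q k = p k.+1.
Hypothesis aE : forall k, (k < m)%N -> a k = b k.+1.
Notation F := (hiter q a).
Notation D := (hdeg q).
Notation G := (gr q a C).
Notation cg := (cgr C).
Notation H := (gen_henon p b m).

Lemma gen_henon_hiter k : (k <= m)%N -> gen_henon p b k = F k.
Proof.
elim: k => [|k ih] km; first by [].
by apply/funext => z; rewrite /= ih ?(ltnW km)// qE// aE.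
Qed.

Lemma henon_degree_hdeg k : (k <= m)%N -> henon_degree p k = D k.
Proof.
move=> km; rewrite /henon_degree /hdeg big_add1 /=; apply: eq_big_nat => i /andP[_ ik].
by rewrite /pdeg qE// (leq_trans ik).
Qed.

Lemma iter_henon n z : iter n H z = F (n * m)%N z.
Proof.
elim: n => [|n ih] //=.
by rewrite ih gen_henon_hiter// mulSn addnC hiterD !stail_period.
Qed.

Lemma hdeg_exp n : D (n * m)%N = (D m ^ n)%N.
Proof.
elim: n => [|n ih]; first by rewrite mul0n hdeg0.
by rewrite mulSn addnC hdegD stail_period// ih expnSr.
Qed.

Lemma hdeg_mul_large (x : R) : exists N, forall n, (N <= n)%N -> x < (D (n * m)%N)%:R.
Proof.
have [N hN] := hdeg_large HB x; exists N => n Nn; apply: hN.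
by rewrite (leq_trans Nn)// leq_pmulr.
Qed.

(** Along the multiples of [m] the defining sequence is [lg (F_(n m) z) / D_(n m)], which [grP]
    keeps within [cgr / D_(n m)] of [G]. *)
Lemma green_gr z : green H (henon_degree p m) z = G z.
Proof.
rewrite /green henon_degree_hdeg//; apply/cvg_lim => //.
have [N hN] := eventually_good_pt HB z.
apply/cvgrPdist_le => e e0.
have [N1 hN1] := hdeg_mul_large (cg / e).
exists (maxn N N1) => // n /=; rewrite geq_max => /andP[Nn N1n].
rewrite iter_henon rnorm_nrm logp_lg -natrX -hdeg_exp.
have D0 := hdegR_gt0 HB (n * m)%N.
have := grP HB (hN _ (leq_trans Nn (leq_pmulr _ m0))).
have := hN1 n N1n; rewrite ltr_pdivrMr// => h1 h2.
have -> : G z - (D (n * m)%N)%:R^-1 * lg (F (n * m)%N z) = - ((lg (F (n * m)%N z) - (D (n * m)%N)%:R * G z) / (D (n * m)%N)%:R).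
  by field; rewrite gt_eqF.
rewrite normrN normrM [X in _ * X]gtr0_norm ?invr_gt0// ler_pdivrMr//.
by apply: (le_trans h2); rewrite mulrC ltW.
Qed.

Lemma sublevel_gr c : sublevel H (henon_degree p m) c = [set z | G z < c].
Proof. by apply/funext => z; rewrite /sublevel /= green_gr. Qed.

Lemma nonescaping_gr z : nonescaping H z <-> G z = 0.
Proof.
apply: (iff_trans (bounded_nrm (fun n => iter n H z))); split => [[B hB]|g0]; last first.
  by have [B hB] := gr0_bounded HB g0; exists B => n; rewrite iter_henon.
apply/eqP; rewrite eq_le gr_ge0// andbT; apply/ler_addgt0Pr => e e0; rewrite add0r.
have [N hN] := eventually_good_pt HB z.
have [N1 hN1] := hdeg_mul_large ((ln (Num.max 1 B) + cg) / e).
pose n := maxn N N1.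
have D0 := hdegR_gt0 HB (n * m)%N.
have := grP HB (hN _ (leq_trans (leq_maxl N N1) (leq_pmulr n m0))).
have h1 := hN1 n (leq_maxr _ _); rewrite ltr_pdivrMr// in h1.
have B1 : 1 <= Num.max 1 B by rewrite le_max lexx.
have h2 : lg (F (n * m)%N z) <= ln (Num.max 1 B).
  by apply: lg_le => //; rewrite -iter_henon le_max hB orbT.
rewrite ler_norml => /andP[h3 _].
rewrite -(ler_pM2l D0); lra.
Qed.

End Interface.

(** * The group of affine symmetries *)

Section Symmetries.
Context {R : realType}.
Implicit Types (z w : C2 R) (n k : nat) (s x : R[i]).
Variables (q : nat -> {poly R[i]}) (a : nat -> R[i]) (C : R) (m : nat).
Hypothesis HB : forall k, bnd (q k) (a k) C.
Hypothesis m0 : (0 < m)%N.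
Hypothesis qm : forall k, q (k + m)%N = q k.
Notation D := (hdeg q).
Notation G := (gr q a C).
Notation asym := (affine_symmetry q a m).

(** The polynomial [P] of the relation at [x = 0] vanishes at all natural numbers, so [coef_small]
    with bound 0 annihilates its coefficients; [taylor_poly] reads off the two top ones. *)
Lemma asym_coef A E n : asym A E -> let p := (pdeg (q n)).-1 in
  A n.+1 ^+ pdeg (q n) = A n.+2 /\
  ((q n)`_p + (lead_coef (q n) *+ pdeg (q n)) * E n.+1) * A n.+1 ^+ p = A n.+2 * (q n)`_p.
Proof.
move=> AS p; have d2 := bdeg (HB n).
have sq : size (q n) = (pdeg (q n)).+1 by move: d2; rewrite /pdeg; case: (size (q n)).
have l0 : lead_coef (q n) != 0 by rewrite lead_coef_eq0 -size_poly_gt0 sq.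
have [T [sT TE] [T0 T1]] := taylor_poly (q n) (E n.+1) (A n.+1).
pose P := T - (A n.+2 *: q n + (a n * E n + E n.+2)%:P).
have sP : (size P <= (size (q n)).+1)%N.
  rewrite (leq_trans (size_polyD _ _))// size_polyN geq_max (leq_trans sT) ?leqnSn//=.
  rewrite (leq_trans (size_polyD _ _))// geq_max (leq_trans (size_scale_leq _ _)) ?leqnSn//=.
  exact: leq_trans (size_polyC_leq1 _) _.
have [L L0 hL] := @coef_small R (size (q n)).
have P0 i : P`_i = 0.
  apply/eqP; rewrite -cabs_eq0 eq_le cabs_ge0 andbT.
  have := hL P 0 sP _ i; rewrite mulr0; apply => j _.
  suff -> : P.[j%:R] = 0 by rewrite cabs0.
  have := asym_rel AS n 0 j%:R; rewrite !mulr0 addr0 subr0 => h.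
  rewrite /P hornerD hornerN hornerD hornerZ hornerC TE.
  by rewrite -[(q n).[_ + _]](subrK (a n * E n)) h; ring.
split.
  have := P0 (pdeg (q n)); rewrite /P !coefB !coefD coefZ coefC /pdeg T0 -lead_coefE.
  have -> : ((size (q n)).-1 == 0)%N = false by move: d2; rewrite /pdeg; case: (_.-1).
  rewrite addr0 => /eqP; rewrite subr_eq0 mulrC => /eqP; exact: (mulIf l0).
have := P0 p; rewrite /P !coefB !coefD coefZ coefC.
have -> : (p == 0)%N = false by move: d2; rewrite /p; case: (pdeg _) => [|[|d]].
rewrite addr0 => /eqP; rewrite subr_eq0 => /eqP <-.
by rewrite /p /pdeg lead_coefE T1// sq ltnS (leq_trans _ d2).
Qed.

Lemma asym_A2 A E n : asym A E -> A n.+2 = A n.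
Proof.
move=> AS; have h0 := asym_rel AS n 0 0; have h1 := asym_rel AS n 1 0.
have : a n * (A n.+2 - A n) = 0.
  transitivity (((q n).[E n.+1 + A n.+1 * 0] - a n * (E n + A n * 1)) - (E n.+2 + A n.+2 * ((q n).[0] - a n * 1))
    - (((q n).[E n.+1 + A n.+1 * 0] - a n * (E n + A n * 0)) - (E n.+2 + A n.+2 * ((q n).[0] - a n * 0)))); first by ring.
  by rewrite h0 h1 !subrr.
by move/eqP; rewrite mulf_eq0 (negbTE (bnd_aneq0 HB n)) /= subr_eq0 => /eqP.
Qed.

Lemma asym_pow A E n : asym A E -> A n.+1 ^+ pdeg (q n) = A n.
Proof. by move=> AS; rewrite (asym_coef n AS).1 (asym_A2 n AS). Qed.

Lemma asym_uniq A E A' E' : asym A E -> asym A' E' -> A 1%N = A' 1%N ->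
  forall n, A n = A' n /\ E n = E' n.
Proof.
move=> AS AS' e1.
have eA n : A n = A' n /\ A n.+1 = A' n.+1.
  elim: n => [|n [h1 h2]]; first by rewrite -(asym_pow 0 AS) -(asym_pow 0 AS') e1.
  by rewrite (asym_A2 n AS) (asym_A2 n AS').
have eE n : E n.+1 = E' n.+1.
  have [_] := asym_coef n AS; have [_] := asym_coef n AS'.
  rewrite -!(proj1 (eA _)) => <- h; have d2 := bdeg (HB n).
  have An : A n.+1 ^+ (pdeg (q n)).-1 != 0 by rewrite expf_neq0// (asym_neq0 AS).
  have l0 : lead_coef (q n) *+ pdeg (q n) != 0.
    rewrite -mulr_natr mulf_neq0//; last by rewrite pnatr_eq0 -lt0n (leq_trans _ d2).
    by rewrite lead_coef_eq0 -size_poly_gt0; move: d2; rewrite /pdeg; case: (size _).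
  by move/(mulIf An)/addrI/(mulfI l0): h.
move=> n; split; first exact: (eA n).1.
rewrite -(asym_E AS) -(asym_E AS').
by have -> : (n + m.*2 = (n + m.*2).-1.+1)%N by rewrite prednK// addn_gt0 double_gt0 m0 orbT.
Qed.

Lemma asym_chain A E n j : asym A E -> A n = A (n + j)%N ^+ hdeg (stail n q) j.
Proof.
move=> AS; elim: j => [|j ih]; first by rewrite addn0 hdeg0 expr1.
by rewrite hdegS addnS {1}ih -(asym_pow (n + j) AS) -exprM mulnC.
Qed.

Lemma asym_even A E n k : asym A E -> A (n + k.*2)%N = A n.
Proof. by move=> AS; elim: k => [|k ih]; rewrite ?addn0// doubleS !addnS (asym_A2 _ AS). Qed.

(** With [d = D m] and [d' = D m.-1]: for even [m], [A_m = A_0] gives [A_0^(d-1) = 1]. For odd [m],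
    [A_m = A_1] gives [A_0^(d^2-1) = 1] and [A_(m-1) = A_0] gives [A_0^(d'-1) = 1]; then [(d + d')
    (d - 1) = (d^2 - 1) + (d' - 1) (d - 1)]. *)
Lemma asym_order A E : asym A E -> A 1%N ^+ ((D m + D m.-1) * (D m - 1)) = 1.
Proof.
move=> AS; have D0 := hdeg_gt0 HB m; have D0' := hdeg_gt0 HB m.-1.
have pred1 x d : x != 0 -> (0 < d)%N -> x = x ^+ d -> x ^+ d.-1 = 1.
  move=> x0; case: d => // d _; rewrite exprS -[X in X = _]mulr1 => /(mulfI x0) <- //.
have ch j := asym_chain 0 j AS.
have s0 : stail 0 q = q by apply/funext.
have A10 : A 1%N = A 0%N ^+ pdeg (q 1%N) by rewrite -(asym_A2 0 AS) (asym_pow 1 AS).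
rewrite A10 -exprM mulnC exprM.
suff -> : A 0%N ^+ ((D m + D m.-1) * (D m - 1)) = 1 by rewrite expr1n.
have [mo|me] := boolP (odd m); last first.
  have h : A 0%N = A 0%N ^+ D m.
    have Am : A m = A 0%N by rewrite -{1}(odd_double_half m) (negbTE me) (asym_even 0 m./2 AS).
    by have := ch m; rewrite s0 add0n Am.
  by rewrite mulnC exprM subn1 (pred1 _ _ (asym_neq0 AS 0) D0 h) expr1n.
have mE : m = (1 + m./2.*2)%N by rewrite -{1}(odd_double_half m) mo.
have m1 : m.-1 = (0 + m./2.*2)%N by rewrite {1}mE.
have Am : A m = A 1%N by rewrite {1}mE (asym_even 1 _ AS).
have Am1 : A m.-1 = A 0%N by rewrite m1 (asym_even 0 _ AS).
have h1 : A 0%N = A 1%N ^+ D m by have := ch m; rewrite s0 add0n Am.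
have h2 : A 1%N = A 0%N ^+ D m.
  have := asym_chain m m AS; have -> : stail m q = q by rewrite -[X in stail X]mul1n stail_period.
  by rewrite Am addnn -[m.*2]add0n (asym_even 0 _ AS).
have h3 : A 0%N = A 0%N ^+ D m.-1.
  by have := ch m.-1; rewrite s0 add0n Am1.
have e1 : A 0%N ^+ (D m * D m).-1 = 1.
  by apply: pred1; rewrite ?muln_gt0 ?D0 ?(asym_neq0 AS)// exprM -h2 -h1.
have e2 : A 0%N ^+ (D m.-1).-1 = 1 by apply: pred1 => //; exact: asym_neq0 AS _.
have -> : ((D m + D m.-1) * (D m - 1) = (D m * D m).-1 + (D m.-1).-1 * (D m).-1)%N.
  by move: (D m) (D m.-1) D0 D0' => [|d] [|d'] // _ _; rewrite subn1 /=; nia.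
by rewrite exprD e1 exprM e2 expr1n mulr1.
Qed.

Lemma asym_pow2 A E k : asym A E -> A 1%N ^+ (pdeg (q k) * pdeg (q k.+1)) = A 1%N.
Proof.
move=> AS; have h1 := asym_pow k AS; have h2 := asym_pow k.+1 AS; rewrite (asym_A2 k AS) in h2.
have [ko|ke] := boolP (odd k).
  have kE : A k = A 1%N by rewrite -(odd_double_half k) ko (asym_even 1 _ AS).
  by rewrite -kE mulnC exprM h2.
have kE : A k.+1 = A 1%N by rewrite -(odd_double_half k) (negbTE ke) -addSn (asym_even 1 _ AS).
by rewrite -kE exprM h1.
Qed.

(** By [asym_pow2] the order divides the product of two successive degrees minus 1, so it is coprime
    to each degree. *)
Lemma asym_coprime A E k : asym A E -> k.-primitive_root (A 1%N) -> coprime k (D m).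
Proof.
move=> AS pk; have k0 := prim_order_gt0 pk.
have cop i : coprime k (pdeg (q i)).
  have h := asym_pow2 i AS; have d1 := bdeg (HB i); have d2 := bdeg (HB i.+1).
  have dd : (0 < pdeg (q i) * pdeg (q i.+1))%N by rewrite muln_gt0 !(leq_trans _ d1) ?(leq_trans _ d2).
  have : (k %| (pdeg (q i) * pdeg (q i.+1)).-1)%N.
    rewrite (prim_order_dvd pk); apply/eqP/(mulfI (asym_neq0 AS 1)).
    by rewrite -exprS prednK// h mulr1.
  move=> /dvdnP[j hj].
  have : coprime (j * k) (pdeg (q i) * pdeg (q i.+1)) by rewrite -hj -{2}(prednK dd) coprimenS.
  by rewrite coprimeMr coprimeMl => /andP[/andP[_ ->]].
by rewrite /hdeg; elim/big_rec: _ => [|i x _ ih]; rewrite ?coprimen1// coprimeMr cop.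
Qed.

Lemma mmap_mul (A E A' E' : nat -> R[i]) n z :
  mmap A E n (mmap A' E' n z) = mmap (fun n => A n * A' n) (fun n => E n + A n * E' n) n z.
Proof. by rewrite /mmap /=; congr (_, _); ring. Qed.

(** Near a zero of [G] the open sublevel set contains a vertical displacement, which isolates the
    slope. *)
Lemma mmap_slope (A E A' E' : nat -> R[i]) c : 0 < c ->
  (forall z, G z < c -> mmap A E 0 z = mmap A' E' 0 z) -> A 1%N = A' 1%N.
Proof.
move=> c0 h; have [w w0] := gr_zero_exists HB.
have wc : G w < c by rewrite w0.
have [d d0 hd] := gr_lt_open HB wc.
have t0 : (d / 2)%:C != 0 :> R[i] by rewrite -cabs_gt0 cabsR gtr0_norm//; lra.
have vc : G (w.1, w.2 + (d / 2)%:C) < c.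
  apply: hd; rewrite dst_lt /= subrr cabs0 d0 /= addrC addKr cabsR gtr0_norm//; lra.
have := congr1 snd (h _ wc); have := congr1 snd (h _ vc) => /= e2 e1.
apply: (mulIf t0).
transitivity ((E 1%N + A 1%N * (w.2 + (d / 2)%:C)) - (E 1%N + A 1%N * w.2)); first by ring.
by rewrite e1 e2; ring.
Qed.

(** The maps [mmap A E n] carry orbits to orbits; their periodic coefficients and the inverses of
    the slopes are bounded, so boundedness is preserved both ways. *)
Lemma mmap_gr0 A E z : asym A E -> G (mmap A E 0 z) = 0 <-> G z = 0.
Proof.
move=> AS; have m20 : (0 < m.*2)%N by rewrite double_gt0.
have [B1 hB1] := periodic_bounded m20 (asym_A AS).
have [B2 hB2] := periodic_bounded m20 (asym_E AS).
have [B3 hB3] := @periodic_bounded _ (fun n => (A n)^-1) _ m20 (fun n => congr1 _ (asym_A AS n)).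
have B10 : 0 <= B1 := le_trans (cabs_ge0 _) (hB1 0%N).
have B30 : 0 <= B3 := le_trans (cabs_ge0 _) (hB3 0%N).
split => /(gr0_bounded HB)[B hB].
  apply: (bounded_gr0 HB (B := (B + B2) * B3)) => n.
  have := hB n; rewrite (hiter_mmap (asym_rel AS)) /mmap !nrm_le /= => /andP[h1 h2].
  have key k x : cabs (E k + A k * x) <= B -> cabs x <= (B + B2) * B3.
    move=> h; have -> : x = (E k + A k * x - E k) / A k.
      by rewrite addrC addKr mulrC mulKf// (asym_neq0 AS).
    rewrite cabsM; apply: ler_pM => //; apply: le_trans (cabsB _ _) _; exact: lerD.
  by rewrite (key _ _ h1) (key _ _ h2).
apply: (bounded_gr0 HB (B := B2 + B1 * B)) => n.
have := hB n; rewrite (hiter_mmap (asym_rel AS)) /mmap !nrm_le /= => /andP[h1 h2].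
have key k x : cabs x <= B -> cabs (E k + A k * x) <= B2 + B1 * B.
  by move=> h; apply: le_trans (cabsD _ _) _; rewrite cabsM; apply: lerD => //; exact: ler_pM.
by rewrite !key.
Qed.

Lemma mmap_surj A E z : asym A E -> exists w, mmap A E 0 w = z.
Proof.
move=> AS; exists ((z.1 - E 0%N) / A 0%N, (z.2 - E 1%N) / A 1%N).
rewrite /mmap /= !(mulrC (A _)) !divfK ?(asym_neq0 AS)// !(addrC (E _)) !subrK.
by rewrite -surjective_pairing.
Qed.

Definition diag_map (al be : R[i]) z : C2 R := (al * z.1, be * z.2).

Lemma diag_map_linear (al be : R[i]) : linear (diag_map al be).
Proof.
move=> t u v; rewrite /diag_map.
change ((al * (t * u.1 + v.1), be * (t * u.2 + v.2)) = (t * (al * u.1) + al * v.1, t * (be * u.2) + be * v.2) :> C2 R).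
by congr (_, _); ring.
Qed.

HB.instance Definition _ (al be : R[i]) :=
  GRing.isLinear.Build R[i] (C2 R) (C2 R) _ (diag_map al be) (diag_map_linear al be).

Lemma mmap_affine (A E : nat -> R[i]) : is_affine (mmap A E 0).
Proof.
exists (diag_map (A 0%N) (A 1%N)), (E 0%N, E 1%N) => z.
by rewrite /mmap; congr (_, _); rewrite addrC.
Qed.

End Symmetries.

(** By its form, [d + d'] is [d0] times a product [P] of primes dividing [d]. As [k] is coprime to
    [P], Gauss's lemma removes it. *)
Lemma dvdn_d0 k d d' : (0 < d)%N -> coprime k d -> (k %| (d + d') * (d - 1))%N -> (k %| d0 d d' * (d - 1))%N.
Proof.
move=> dp kd kk; have [|_ [n hn] _] := @d0P d d'; first by rewrite addn_gt0 dp.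
pose P := (\prod_(q <- primes d) q ^ n q)%N.
have PE : (d0 d d' * P = d + d')%N.
  apply/eqP; rewrite -(eqr_nat rat) natrM hn.
  have PR : P%:R = \prod_(q <- primes d) q%:R ^+ n q :> rat.
    by rewrite /P natr_prod; apply: eq_bigr => i _; rewrite natrX.
  rewrite -PR divfK// pnatr_eq0 -lt0n /P big_seq; apply: prodn_cond_gt0 => i.
  by rewrite mem_primes => /andP[/prime_gt0 i0 _]; rewrite expn_gt0 i0.
have cP : coprime k P.
  rewrite /P big_seq; elim/big_rec: _ => [|i x id ih]; rewrite ?coprimen1// coprimeMr ih andbT.
  rewrite coprimeXr//; move: id; rewrite mem_primes => /and3P[_ _ id].
  exact: coprime_dvdr id kd.
by move: kk; rewrite -PE mulnAC Gauss_dvdl.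
Qed.

Section Cyclic.

(** Finiteness comes first: injectivity bounds the length of duplicate-free lists by the number of
    roots of [X^N - 1]. Then all values are roots of unity whose order divides the group order, and
    a primitive one generates. *)
Lemma cyclic_of_roots (gT : groupType) (K : fieldType) (eta : gT -> K) (N : nat) : (0 < N)%N ->
  {morph eta : x y / (x * y)%g >-> x * y} -> injective eta -> (forall x, eta x ^+ N = 1) ->
  exists g k, [/\ k.-primitive_root (eta g), forall x, exists n, x = (g ^+ n)%g & [set: gT] #= `I_k].
Proof.
move=> N0 etaM etaI etaN.
have eta0 x : eta x != 0.
  by apply/eqP => h; have := etaN x; rewrite h expr0n gtn_eqF// => /eqP; rewrite eq_sym oner_eq0.
have eta1 : eta 1%g = 1.
  by apply: (mulIf (eta0 1%g)); rewrite mul1r -etaM mulg1.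
have etaX x n : eta (x ^+ n)%g = eta x ^+ n.
  by elim: n => [|n ih]; rewrite ?expg0 ?eta1// expgS etaM ih exprS.
have [s us sT] : exists2 s : seq gT, uniq s & forall x, x \in s.
  pose P n := `[< exists s : seq gT, uniq s /\ size s = n >].
  have P0 : exists n, P n by exists 0%N; apply/asboolP; exists [::].
  have PN n : P n -> (n <= N)%N.
    move=> /asboolP[s [us <-]]; rewrite -(size_map eta); apply: max_unity_roots => //.
      by apply/allP => _ /mapP[x _ ->]; rewrite unity_rootE etaN.
    by rewrite map_inj_uniq.
  have [n /asboolP[s [us sn]] nmax] := ex_maxnP P0 PN.
  exists s => // x; apply: contraT => xs.
  have /nmax : P n.+1 by apply/asboolP; exists (x :: s); rewrite /= xs us sn.
  by rewrite ltnn.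
have k0 : (0 < size s)%N by move: (sT 1%g); case: (s).
(* Translation by [x] permutes the elements, so multiplying the product of all values by
   [eta x ^+ size s] leaves it unchanged. *)
have root x : eta x ^+ size s = 1.
  have pe : perm_eq [seq (x * y)%g | y <- s] s.
    apply: uniq_perm => //; first by rewrite map_inj_uniq//; exact: mulgI.
    by move=> y; rewrite sT; apply/mapP; exists (x^-1 * y)%g; rewrite ?sT// mulVKg.
  have nz : \prod_(y <- s) eta y != 0.
    by rewrite prodf_seq_neq0; apply/allP => y _; rewrite eta0.
  have h : \prod_(y <- [seq (x * y)%g | y <- s]) eta y = \prod_(y <- s) eta y by exact: perm_big.
  rewrite big_map in h.
  apply: (mulIf nz); rewrite mul1r -[RHS]h.
  under [RHS]eq_bigr do rewrite etaM.
  by rewrite big_split /= big_const_seq count_predT iter_mulr_1.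
have : has (size s).-primitive_root [seq eta x | x <- s].
  apply: has_prim_root => //; last by rewrite size_map.
    by apply/allP => _ /mapP[x _ ->]; rewrite unity_rootE root.
  by rewrite map_inj_uniq.
move=> /hasP[_ /mapP[g _ ->] pg]; exists g, (size s); split => //.
  move=> x; have [i hi] := prim_rootP pg (root x).
  by exists i; apply: etaI; rewrite hi etaX.
have -> : [set: gT] = [set` [fset x in s]%fset].
  by apply/seteqP; split => x //= _; rewrite inE /= sT.
by apply/card_eq_fsetP; rewrite card_fseq undup_id.
Qed.

End Cyclic.

Theorem corollary1p4 (R : realType) (m : nat)
    (p : nat -> {poly R[i]}) (a : nat -> R[i])
    (hm : (1 <= m)%N)
    (hp : forall i : nat, (1 <= i <= m)%N -> (2 <= (size (p i)).-1)%N)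
    (ha : forall i : nat, (1 <= i <= m)%N -> a i != 0)
    (c : R) (hc : 0 < c) :
  let H := gen_henon p a m in
  let d := henon_degree p m in
  let d' := henon_degree p m.-1 in
  let Omega := sublevel H d c in
  [/\ forall f : holo_aut Omega,
        exists A : C2 R -> C2 R,
          [/\ is_affine A,
              forall w : Omega, val (f w) = A (val w),
              A @` escaping H = escaping H &
              A @` nonescaping H = nonescaping H],
      is_cyclic (holo_aut Omega) &
      exists n : nat,
        [set: holo_aut Omega] #= `I_n /\ (n <= d0 d d' * (d - 1))%N].
Proof.
move=> H d d' Omega.
(* The maps of the statement have indices 1 to [m]; they are extended periodically and indexed from
   0. *)
pose q k := p (k %% m).+1; pose b k := a (k %% m).+1.
have qm k : q (k + m)%N = q k by rewrite /q modnDr.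
have bm k : b (k + m)%N = b k by rewrite /b modnDr.
have ix k : (1 <= (k %% m).+1 <= m)%N by rewrite /= ltn_mod.
have [C HB] := bnd_periodic hm qm bm (fun k => hp _ (ix k)) (fun k => ha _ (ix k)).
have qE k : (k < m)%N -> q k = p k.+1 by move=> km; rewrite /q modn_small.
have bE k : (k < m)%N -> b k = a k.+1 by move=> km; rewrite /b modn_small.
have OE z : Omega z <-> gr q b C z < c.
  by rewrite /Omega /d /H (sublevel_gr HB hm qm bm qE bE).
have NE z : nonescaping H z <-> gr q b C z = 0 := nonescaping_gr HB hm qm bm qE bE z.
have WO (w : Omega) : gr q b C (val w) < c by apply/OE; exact: set_valP.
have OW z : gr q b C z < c -> {w : Omega | val w = z}.
  by move=> /OE zO; exists (SigSub (mem_set zO)).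
have rep (f : holo_aut Omega) : exists AE : (nat -> R[i]) * (nat -> R[i]),
    affine_symmetry q b m AE.1 AE.2 /\ forall w : Omega, val (f w) = mmap AE.1 AE.2 0 (val w).
  have [[g [gE gd]] [h [fh hf [g' [g'E g'd]]]]] := aut_mapP f.
  have [|A [E [AS hAE]]] := @all_levels R q b C m HB hm qm bm c g g' hc.
    split.
    - by apply: hol_differentiable => z /= zc; apply: gd; exact/OE.
    - by apply: hol_differentiable => z /= zc; apply: g'd; exact/OE.
    - by move=> z /OW[w <-]; rewrite gE; exact: WO.
    - by move=> z /OW[w <-]; rewrite g'E; exact: WO.
    - by move=> z /OW[w <-]; rewrite gE g'E fh.
    - by move=> z /OW[w <-]; rewrite g'E gE hf.
  by exists (A, E); split => //= w; rewrite -gE hAE.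
have [AE hAE] := choice rep.
(* The pairs [A], [E] are chosen arbitrarily; [mmap_slope] shows that the slope is determined by the
   automorphism, which yields multiplicativity, and [asym_uniq] yields injectivity. *)
pose eta (f : holo_aut Omega) := (AE f).1 1%N.
have etaM : {morph eta : x y / (x * y)%g >-> x * y}.
  move=> f g; have [ASf hf] := hAE f; have [ASg hg] := hAE g; have [AS hfg] := hAE (f * g)%g.
  apply: (mmap_slope HB (E := (AE (f * g)%g).2) (A' := fun n => (AE f).1 n * (AE g).1 n)
     (E' := fun n => (AE f).2 n + (AE f).1 n * (AE g).2 n) hc) => z /OW[w <-].
  by rewrite -hfg -mmap_mul -hg -hf.
have etaI : injective eta.
  move=> f g fg; have [ASf hf] := hAE f; have [ASg hg] := hAE g.
  apply: holo_autE => w; apply: val_inj; rewrite /= hf hg.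
  have u := asym_uniq HB hm ASf ASg fg.
  by rewrite /mmap !(proj1 (u _)) !(proj2 (u _)).
have dE : d = hdeg q m by exact: (henon_degree_hdeg qE (leqnn m)).
have d'E : d' = hdeg q m.-1 by apply: (henon_degree_hdeg qE); exact: leq_pred.
have d2 : (1 < d)%N.
  rewrite dE -(prednK hm) hdegS; apply: (leq_trans (bdeg (HB m.-1))).
  by rewrite leq_pmull// (hdeg_gt0 HB).
have N0 : (0 < (d + d') * (d - 1))%N by rewrite muln_gt0 addn_gt0 subn_gt0 d2 (ltnW d2).
have etaN f : eta f ^+ ((d + d') * (d - 1)) = 1.
  by rewrite dE d'E (asym_order HB hm qm (hAE f).1).
have [g [k [pg gen card]]] := cyclic_of_roots N0 etaM etaI etaN.
split.
- move=> f; have [AS hf] := hAE f; exists (mmap (AE f).1 (AE f).2 0).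
  have inv z := mmap_gr0 HB hm z AS.
  split; [exact: mmap_affine|exact: hf| |].
    apply/seteqP; split => [_ [z zE <-]|z zE].
      by move=> /NE/inv/NE; exact: zE.
    have [w wz] := mmap_surj z AS; exists w; last exact: wz.
    by move=> /NE/inv; rewrite wz => /NE; exact: zE.
  apply/seteqP; split => [_ [z /NE zE <-]|z /NE zE]; first by apply/NE/inv.
  have [w wz] := mmap_surj z AS; exists w; last exact: wz.
  by apply/NE/inv; rewrite wz.
- by exists g => x; have [n ->] := gen x; exists n; left.
- exists k; split => //.
  (* The order [k] divides [(d + d') (d - 1)] and is coprime to [d], hence divides [d0 (d - 1)];
     positivity turns this into the bound. *)
  apply: dvdn_leq; last first.
    apply: dvdn_d0; first exact: ltnW.
      by rewrite dE; exact: asym_coprime HB _ _ _ (hAE g).1 pg.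
    by rewrite (prim_order_dvd pg) etaN.
  rewrite muln_gt0 subn_gt0 d2 andbT.
  by have [|e0 _ _] := @d0P d d'; rewrite // addn_gt0 (ltnW d2).
Qed.
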